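(* The lax symmetric monoidal functor $$\mathrm{LCH}^{\mathrm{op}}\to\mathrm{Cat},\qquad X\mapsto X\text{-}C^*\mathrm{Alg},\quad f\mapsto f^*,$$ with lax symmetric monoidal structure given by the external products $\boxtimes$, is a three-functor formalism on the Nagata context $(\mathrm{LCH},I,P)$.
   Context: $\mathrm{LCH}$ is the category of locally compact Hausdorff spaces and continuous maps, $I$ the class of open inclusions and $P$ the class of proper maps. $\otimes$ denotes the maximal tensor product of (possibly non-unital) $C^*$-algebras; $I(A)$ is the frame of closed two-sided $*$-ideals of a $C^*$-algebra $A$. For $X\in\mathrm{LCH}$, an object of $X\text{-}C^*\mathrm{Alg}$ is a $C^*$-algebra $A$ with a map $A(-):\mathrm{Open}(X)\to I(A)$ preserving finite meets and all joins; morphisms are $*$-homomorphisms $f:A\to B$ with $f(A(U))\subseteq B(U)$ for all $U$. Equivalently, $A$ is equipped with a surjective $A$-bilinear homomorphism $m:C_0(X)\otimes A\to A$, with $A(U)=m(C_0(U)\otimes A)$. The fibre at $x$ is $A(x):=A/A(X\setminus\{x\})$ with projection $\mathrm{ev}_x$. For $f:X\to Y$ and $A\in Y\text{-}C^*\mathrm{Alg}$, $f^*A$ is the $C^*$-subalgebra of $\prod_{x\in X}A(f(x))$ (bounded families) generated by the sections $x\mapsto\kappa(x)\mathrm{ev}_{f(x)}(a)$, $\kappa\in C_0(X)$, $a\in A$, and $(f^*A)(U)$ is the ideal generated by products with elements of $C_0(U)$. For $A\in X\text{-}C^*\mathrm{Alg}$, $B\in Y\text{-}C^*\mathrm{Alg}$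 with structure maps $m,n$, $A\boxtimes B\in (X\times Y)\text{-}C^*\mathrm{Alg}$ is $A\otimes B$ with structure map $C_0(X\times Y)\otimes(A\otimes B)\cong(C_0(X)\otimes A)\otimes(C_0(Y)\otimes B)\xrightarrow{m\otimes n}A\otimes B$. Since the monoidal structure of $\mathrm{LCH}$ is cartesian, a lax symmetric monoidal functor $D:\mathrm{LCH}^{\mathrm{op}}\to\mathrm{Cat}_\infty$ is the same as a functor $\mathrm{LCH}^{\mathrm{op}}\to\mathrm{CAlg}(\mathrm{Cat}_\infty)$; the tensor product on $D(X)$ is $A\otimes_XB=d^*(A\boxtimes B)$ with $d:X\to X\times X$ the diagonal. A functor $D:\mathrm{LCH}^{\mathrm{op}}\to\mathrm{CAlg}(\mathrm{Cat}_\infty)$, $f\mapsto f^*$, is a three-functor formalism on $(\mathrm{LCH},I,P)$ if the following hold. (I) For every $i:U\to X$ in $I$, $i^*$ has a left adjoint $i_!$; for every cartesian square with $i:U\to X$, $j:V\to Y$ in $I$, $f:X\to Y$ and $g:U\to V$ ($fi=jg$), the canonical map $i_!g^*\to f^*j_!$ is an equivalence; and the canonical map $i_!(A\otimes_Ui^*B)\to i_!(A)\otimes_XB$ is an equivalence for all $A\in D(U)$, $B\in D(X)$. (P) For every $p:X\to Y$ in $P$, $p^*$ has a right adjoint $p_*$; for every cartesian square with $p:X\to Y$, $q:W\to Z$ in $P$, $f:W\to X$, $g:Z\to Y$ ($pf=gq$), the canonical map $g^*p_*\to q_*f^*$ is an equivalence; and the canonical map $p_*(A)\otimes_YB\to p_*(A\otimes_Xp^*B)$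 is an equivalence for all $A\in D(X)$, $B\in D(Y)$. (Mixed Beck–Chevalley) For every cartesian square with $i:W\to X$, $j:Z\to Y$ in $I$ and $p:X\to Y$, $q:W\to Z$ in $P$ ($pi=jq$), the canonical map $j_!q_*\to p_*i_!$ induced from $i_!q^*\simeq p^*j_!$ is an equivalence. *)

(* Defs.v *)
From HB Require Import structures.
From mathcomp Require Import all_boot all_order all_algebra.
From mathcomp Require Import complex.
From mathcomp Require Import all_classical all_reals all_analysis.

Set Implicit Arguments.
Unset Strict Implicit.
Unset Printing Implicit Defensive.

Import Order.TTheory GRing.Theory Num.Theory numFieldNormedType.Exports.
Local Open Scope classical_set_scope.
Local Open Scope ring_scope.
Local Open Scope complex_scope.

Declare Scope cat_scope.
Delimit Scope cat_scope with cat.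

(* [comp] is written in diagrammatic order: [f ;; g] is "first f, then g". *)
Record category := Category {
  ob :> Type ;
  hom : ob -> ob -> Type ;
  idm : forall x, hom x x ;
  comp : forall x y z, hom x y -> hom y z -> hom x z ;
  comp1m : forall x y (f : hom x y), comp (idm x) f = f ;
  compm1 : forall x y (f : hom x y), comp f (idm y) = f ;
  compA : forall x y z w (f : hom x y) (g : hom y z) (h : hom z w),
    comp (comp f g) h = comp f (comp g h) }.

Notation "f ;; g" := (comp f g) (at level 50, left associativity) : cat_scope.
Local Open Scope cat_scope.

Arguments idm {c} x.

Definition inverse_of (C : category) (x y : C) (f : hom x y) (g : hom y x) :=
  f ;; g = idm x /\ g ;; f = idm y.

Definition is_iso (C : category) (x y : C) (f : hom x y) :=
  exists g, inverse_of f g.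

Record iso (C : category) (x y : C) := Iso {
  ihom :> hom x y ;
  iinv : hom y x ;
  isoP : inverse_of ihom iinv }.

Record functor (C D : category) := Functor {
  fob :> C -> D ;
  fmap : forall x y, hom x y -> hom (fob x) (fob y) ;
  fmap1 : forall x, fmap (idm x) = idm (fob x) ;
  fmapD : forall x y z (f : hom x y) (g : hom y z),
    fmap (f ;; g) = fmap f ;; fmap g }.

Arguments fmap {C D} _ {x y} _.

Section IsoOperations.
Variables (C D : category).
Implicit Types x y z : C.

Lemma inverse_of_id x : inverse_of (idm x) (idm x).
Proof. by split; rewrite comp1m. Qed.

Definition iso_id x : iso x x := Iso (inverse_of_id x).

Lemma iso_sym_subproof x y (f : iso x y) : inverse_of (iinv f) f.
Proof. by case: (isoP f). Qed.

Definition iso_sym x y (f : iso x y) : iso y x := Iso (iso_sym_subproof f).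

Lemma iso_comp_subproof x y z (f : iso x y) (g : iso y z) :
  inverse_of (f ;; g) (iinv g ;; iinv f).
Proof.
have [fK Kf] := isoP f; have [gK Kg] := isoP g; split.
  by rewrite compA -(compA g) gK comp1m.
by rewrite compA -(compA (iinv f)) Kf comp1m.
Qed.

Definition iso_comp x y z (f : iso x y) (g : iso y z) : iso x z :=
  Iso (iso_comp_subproof f g).

Lemma iso_fmap_subproof (G : functor C D) x y (f : iso x y) :
  inverse_of (fmap G f) (fmap G (iinv f)).
Proof. by have [fK Kf] := isoP f; split; rewrite -fmapD ?fK ?Kf fmap1. Qed.

Definition iso_fmap (G : functor C D) x y (f : iso x y) : iso (G x) (G y) :=
  Iso (iso_fmap_subproof G f).

End IsoOperations.

Record adjunction (C D : category) (L : functor C D) (G : functor D C) :=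
  Adjunction {
  aunit : forall c, hom c (G (L c)) ;
  acounit : forall d, hom (L (G d)) d ;
  aunit_nat : forall c c' (f : hom c c'),
    f ;; aunit c' = aunit c ;; fmap G (fmap L f) ;
  acounit_nat : forall d d' (f : hom d d'),
    acounit d ;; f = fmap L (fmap G f) ;; acounit d' ;
  triangleL : forall c, fmap L (aunit c) ;; acounit (L c) = idm (L c) ;
  triangleR : forall d, aunit (G d) ;; fmap G (acounit d) = idm (G d) }.

Record left_adjoint (C D : category) (G : functor D C) := LeftAdjoint {
  ladj :> functor C D ; ladjP : adjunction ladj G }.

Record right_adjoint (C D : category) (L : functor C D) := RightAdjoint {
  radj :> functor D C ; radjP : adjunction L radj }.

Definition ltranspose (C D : category) (G : functor D C) (L : left_adjoint G)
    (c : C) (d : D) (u : hom c (G d)) : hom (L c) d :=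
  fmap L u ;; acounit (ladjP L) d.

Definition rtranspose (C D : category) (L : functor C D) (G : right_adjoint L)
    (c : C) (d : D) (v : hom (L c) d) : hom c (G d) :=
  aunit (radjP G) c ;; fmap G v.

(* [W] is the fibre product of [p] and [q], with projections [f] and [g]. *)
Definition cartesian (C : category) (W X Z Y : C) (f : hom W X) (g : hom W Z)
    (p : hom X Y) (q : hom Z Y) :=
  f ;; p = g ;; q /\
  forall (T : C) (u : hom T X) (v : hom T Z), u ;; p = v ;; q ->
    exists! w : hom T W, w ;; f = u /\ w ;; g = v.

Record cartCategory := CartCategory {
  cart_cat :> category ;
  one : cart_cat ;
  term : forall X, hom X one ;
  term_uniq : forall X (f g : hom X one), f = g ;
  prodo : cart_cat -> cart_cat -> cart_cat ;
  pr1 : forall X Y, hom (prodo X Y) X ;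
  pr2 : forall X Y, hom (prodo X Y) Y ;
  pairm : forall T X Y, hom T X -> hom T Y -> hom T (prodo X Y) ;
  pairm1 : forall T X Y (f : hom T X) (g : hom T Y),
    pairm f g ;; pr1 X Y = f ;
  pairm2 : forall T X Y (f : hom T X) (g : hom T Y),
    pairm f g ;; pr2 X Y = g ;
  pairm_uniq : forall T X Y (h k : hom T (prodo X Y)),
    h ;; pr1 X Y = k ;; pr1 X Y -> h ;; pr2 X Y = k ;; pr2 X Y -> h = k }.

Arguments one {c}.
Arguments pr1 {c} X Y.
Arguments pr2 {c} X Y.

Section CartesianMaps.
Variable C : cartCategory.

Definition prodm (X X' Y Y' : C) (f : hom X X') (g : hom Y Y') :
    hom (prodo X Y) (prodo X' Y') :=
  pairm (pr1 X Y ;; f) (pr2 X Y ;; g).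

Definition prodmA (X Y Z : C) :
    hom (prodo (prodo X Y) Z) (prodo X (prodo Y Z)) :=
  pairm (pr1 (prodo X Y) Z ;; pr1 X Y)
        (pairm (pr1 (prodo X Y) Z ;; pr2 X Y) (pr2 (prodo X Y) Z)).

Definition swapm (X Y : C) : hom (prodo X Y) (prodo Y X) :=
  pairm (pr2 X Y) (pr1 X Y).

Definition diagm (X : C) : hom X (prodo X X) := pairm (idm X) (idm X).

Lemma diagm_nat (X Y : C) (f : hom X Y) :
  f ;; diagm Y = diagm X ;; prodm f f.
Proof.
apply: pairm_uniq; rewrite !compA.
  by rewrite !pairm1 -compA pairm1 compm1 comp1m.
by rewrite !pairm2 -compA pairm2 compm1 comp1m.
Qed.

End CartesianMaps.

Arguments prodmA {C} X Y Z.
Arguments swapm {C} X Y.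
Arguments diagm {C} X.

(* The target is the 2-category of categories, so "functor" means pseudofunctor.
   Morphisms of [C] that are equal but not convertible index functors that have
   to be identified by transport. *)
Definition pbeq (C : category) (F : C -> category)
    (pb : forall X Y : C, hom X Y -> functor (F Y) (F X))
    (X Y : C) (f g : hom X Y) (e : f = g) (A : F Y) :
    iso (pb X Y f A) (pb X Y g A) :=
  match e in _ = h return iso (pb X Y f A) (pb X Y h A) with
  | erefl => iso_id _
  end.

Record pseudofunctor (C : category) (F : C -> category) := Pseudofunctor {
  pb : forall X Y : C, hom X Y -> functor (F Y) (F X) ;
  pbid : forall (X : C) (A : F X), iso (pb (idm X) A) A ;
  pbcomp : forall (X Y Z : C) (f : hom X Y) (g : hom Y Z) (A : F Z),
    iso (pb (f ;; g) A) (pb f (pb g A)) ;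
  pbid_nat : forall (X : C) (A B : F X) (u : hom A B),
    fmap (pb (idm X)) u ;; pbid B = pbid A ;; u ;
  pbcomp_nat : forall (X Y Z : C) (f : hom X Y) (g : hom Y Z) (A B : F Z)
      (u : hom A B),
    fmap (pb (f ;; g)) u ;; pbcomp f g B =
    pbcomp f g A ;; fmap (pb f) (fmap (pb g) u) ;
  pbcomp1m : forall (X Y : C) (f : hom X Y) (A : F Y),
    pbcomp (idm X) f A ;; pbid (pb f A) = pbeq pb (comp1m f) A ;
  pbcompm1 : forall (X Y : C) (f : hom X Y) (A : F Y),
    pbcomp f (idm Y) A ;; fmap (pb f) (pbid A) = pbeq pb (compm1 f) A ;
  pbcompA : forall (X Y Z W : C) (f : hom X Y) (g : hom Y Z) (h : hom Z W)
      (A : F W),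
    pbcomp (f ;; g) h A ;; pbcomp f g (pb h A) =
    pbeq pb (compA f g h) A ;; pbcomp f (g ;; h) A
      ;; fmap (pb f) (pbcomp g h A) }.

Arguments pb {C F} p {X Y} f.

(* Morphisms of the Grothendieck construction lying over a morphism of [C];
   the coherence axioms below are equations between such morphisms. *)
Section Over.
Variables (C : category) (F : C -> category) (D : pseudofunctor F).

Definition over (X Y : C) (f : hom X Y) (A : F X) (B : F Y) : Type :=
  hom A (pb D f B).

Definition oid (X : C) (A : F X) : over (idm X) A A := iinv (pbid D A).

Definition ocomp (X Y Z : C) (f : hom X Y) (g : hom Y Z)
    (A : F X) (B : F Y) (E : F Z) (u : over f A B) (v : over g B E) :
    over (f ;; g) A E :=
  u ;; fmap (pb D f) v ;; iinv (pbcomp D f g E).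

Definition osame (X Y : C) (f g : hom X Y) (A : F X) (B : F Y)
    (u : over f A B) (v : over g A B) : Prop :=
  exists e : f = g, u ;; pbeq (@pb _ _ D) e B = v.

End Over.

Arguments oid {C F} D {X} A.

Record extProduct (C : cartCategory) (F : C -> category)
    (D : pseudofunctor F) := ExtProduct {
  box : forall X Y : C, F X -> F Y -> F (prodo X Y) ;
  bmap : forall (X Y : C) (A A' : F X) (B B' : F Y),
    hom A A' -> hom B B' -> hom (box A B) (box A' B') ;
  bmap1 : forall (X Y : C) (A : F X) (B : F Y),
    bmap (idm A) (idm B) = idm (box A B) ;
  bmapD : forall (X Y : C) (A A' A'' : F X) (B B' B'' : F Y)
      (u : hom A A') (u' : hom A' A'') (v : hom B B') (v' : hom B' B''),
    bmap (u ;; u') (v ;; v') = bmap u v ;; bmap u' v' ;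
  boxpb : forall (X X' Y Y' : C) (f : hom X X') (g : hom Y Y')
      (A : F X') (B : F Y'),
    iso (box (pb D f A) (pb D g B)) (pb D (prodm f g) (box A B)) ;
  boxpb_nat : forall (X X' Y Y' : C) (f : hom X X') (g : hom Y Y')
      (A A' : F X') (B B' : F Y') (u : hom A A') (v : hom B B'),
    bmap (fmap (pb D f) u) (fmap (pb D g) v) ;; boxpb f g A' B' =
    boxpb f g A B ;; fmap (pb D (prodm f g)) (bmap u v) }.

Arguments box {C F D} e {X Y} A B.
Arguments bmap {C F D} e {X Y A A' B B'} u v.
Arguments boxpb {C F D} e {X X' Y Y'} f g A B.

Definition obox (C : cartCategory) (F : C -> category) (D : pseudofunctor F)
    (P : extProduct D) (X X' Y Y' : C) (f : hom X X') (g : hom Y Y')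
    (A : F X) (A' : F X') (B : F Y) (B' : F Y')
    (u : over D f A A') (v : over D g B B') :
    over D (prodm f g) (box P A B) (box P A' B') :=
  bmap P u v ;; boxpb P f g A' B'.

Record laxSymMonFunctor (C : cartCategory) (F : C -> category) :=
  LaxSymMonFunctor {
  psf :> pseudofunctor F ;
  ext :> extProduct psf ;
  obox1 : forall (X Y : C) (A : F X) (B : F Y),
    osame (obox ext (oid psf A) (oid psf B)) (oid psf (box ext A B)) ;
  oboxD : forall (X X' X'' Y Y' Y'' : C)
      (f : hom X X') (f' : hom X' X'') (g : hom Y Y') (g' : hom Y' Y'')
      (A : F X) (A' : F X') (A'' : F X'') (B : F Y) (B' : F Y') (B'' : F Y'')
      (u : over psf f A A') (u' : over psf f' A' A'')
      (v : over psf g B B') (v' : over psf g' B' B''),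
    osame (obox ext (ocomp u u') (ocomp v v'))
          (ocomp (obox ext u v) (obox ext u' v')) ;
  lone : F one ;
  lunit : forall (X : C) (A : F X),
    iso (box ext lone A) (pb psf (pr2 one X) A) ;
  runit : forall (X : C) (A : F X),
    iso (box ext A lone) (pb psf (pr1 X one) A) ;
  assoc : forall (X Y Z : C) (A : F X) (B : F Y) (E : F Z),
    iso (box ext (box ext A B) E)
        (pb psf (prodmA X Y Z) (box ext A (box ext B E))) ;
  braid : forall (X Y : C) (A : F X) (B : F Y),
    iso (box ext A B) (pb psf (swapm X Y) (box ext B A)) ;
  lunit_nat : forall (X X' : C) (f : hom X X') (A : F X) (A' : F X')
      (u : over psf f A A'),
    osame (ocomp (obox ext (oid psf lone) u) (ihom (lunit A')))
          (ocomp (ihom (lunit A)) u) ;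
  runit_nat : forall (X X' : C) (f : hom X X') (A : F X) (A' : F X')
      (u : over psf f A A'),
    osame (ocomp (obox ext u (oid psf lone)) (ihom (runit A')))
          (ocomp (ihom (runit A)) u) ;
  assoc_nat : forall (X X' Y Y' Z Z' : C)
      (f : hom X X') (g : hom Y Y') (h : hom Z Z')
      (A : F X) (A' : F X') (B : F Y) (B' : F Y') (E : F Z) (E' : F Z')
      (u : over psf f A A') (v : over psf g B B') (w : over psf h E E'),
    osame (ocomp (obox ext (obox ext u v) w) (ihom (assoc A' B' E')))
          (ocomp (ihom (assoc A B E)) (obox ext u (obox ext v w))) ;
  braid_nat : forall (X X' Y Y' : C) (f : hom X X') (g : hom Y Y')
      (A : F X) (A' : F X') (B : F Y) (B' : F Y')
      (u : over psf f A A') (v : over psf g B B'),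
    osame (ocomp (obox ext u v) (ihom (braid A' B')))
          (ocomp (ihom (braid A B)) (obox ext v u)) ;
  triangle : forall (X Y : C) (A : F X) (B : F Y),
    osame (ocomp (ihom (assoc A lone B))
                 (obox ext (oid psf A) (ihom (lunit B))))
          (obox ext (ihom (runit A)) (oid psf B)) ;
  pentagon : forall (X Y Z W : C) (A : F X) (B : F Y) (E : F Z) (G : F W),
    osame (ocomp (ihom (assoc (box ext A B) E G))
                 (ihom (assoc A B (box ext E G))))
          (ocomp (ocomp (obox ext (ihom (assoc A B E)) (oid psf G))
                        (ihom (assoc A (box ext B E) G)))
                 (obox ext (oid psf A) (ihom (assoc B E G)))) ;
  hexagon : forall (X Y Z : C) (A : F X) (B : F Y) (E : F Z),
    osame (ocomp (ocomp (ihom (assoc A B E))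
                        (ihom (braid A (box ext B E))))
                 (ihom (assoc B E A)))
          (ocomp (ocomp (obox ext (ihom (braid A B)) (oid psf E))
                        (ihom (assoc B A E)))
                 (obox ext (oid psf B) (ihom (braid A E)))) ;
  braidK : forall (X Y : C) (A : F X) (B : F Y),
    osame (ocomp (ihom (braid A B)) (ihom (braid B A)))
          (oid psf (box ext A B)) }.

Section ThreeFunctors.
Variables (C : cartCategory) (F : C -> category) (D : laxSymMonFunctor F).

Local Notation "f ^*" := (pb D f) : cat_scope.

Definition tens (X : C) (A B : F X) : F X := (diagm X)^* (box D A B).

Definition tmap (X : C) (A A' B B' : F X) (u : hom A A') (v : hom B B') :
    hom (tens A B) (tens A' B') :=
  fmap ((diagm X)^*) (bmap D u v).

Definition square (W X Z Y : C) (f : hom W X) (g : hom W Z)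
    (p : hom X Y) (q : hom Z Y) (e : f ;; p = g ;; q) (A : F Y) :
    iso (f^* (p^* A)) (g^* (q^* A)) :=
  iso_comp (iso_sym (pbcomp D f p A))
    (iso_comp (pbeq (@pb _ _ D) e A) (pbcomp D g q A)).

(* f^* is strong monoidal: f^* (A (x)_Y B) ~ f^* A (x)_X f^* B. *)
Definition pbtens (X Y : C) (f : hom X Y) (A B : F Y) :
    iso (f^* (tens A B)) (tens (f^* A) (f^* B)) :=
  iso_comp (square (diagm_nat f) (box D A B))
    (iso_fmap ((diagm X)^*) (iso_sym (boxpb D f f A B))).

(* i_! g^* B -> f^* j_! B, for the square  i ;; f = g ;; j *)
Definition bc_shriek (U X V Y : C) (i : hom U X) (g : hom U V) (f : hom X Y)
    (j : hom V Y) (e : i ;; f = g ;; j)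
    (Li : left_adjoint (i^*)) (Lj : left_adjoint (j^*)) (B : F V) :
    hom (Li (g^* B)) (f^* (Lj B)) :=
  ltranspose Li (fmap (g^*) (aunit (ladjP Lj) B)
                 ;; square (esym e) (Lj B)).

Definition proj_shriek (U X : C) (i : hom U X) (Li : left_adjoint (i^*))
    (A : F U) (B : F X) : hom (Li (tens A (i^* B))) (tens (Li A) B) :=
  ltranspose Li (tmap (aunit (ladjP Li) A) (idm (i^* B))
                 ;; iso_sym (pbtens i (Li A) B)).

(* g^* p_* A -> q_* f^* A, for the square  f ;; p = q ;; g *)
Definition bc_push (W X Z Y : C) (f : hom W X) (q : hom W Z) (p : hom X Y)
    (g : hom Z Y) (e : f ;; p = q ;; g)
    (Rp : right_adjoint (p^*)) (Rq : right_adjoint (q^*)) (A : F X) :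
    hom (g^* (Rp A)) (Rq (f^* A)) :=
  rtranspose Rq (square (esym e) (Rp A)
                 ;; fmap (f^*) (acounit (radjP Rp) A)).

Definition proj_push (X Y : C) (p : hom X Y) (Rp : right_adjoint (p^*))
    (A : F X) (B : F Y) : hom (tens (Rp A) B) (Rp (tens A (p^* B))) :=
  rtranspose Rp (pbtens p (Rp A) B
                 ;; tmap (acounit (radjP Rp) A) (idm (p^* B))).

(* j_! q_* A -> p_* i_! A, from  m : p^* j_! q_* A -> i_! q^* q_* A  *)
Definition mixed (W X Z Y : C) (i : hom W X) (q : hom W Z) (p : hom X Y)
    (j : hom Z Y)
    (Li : left_adjoint (i^*)) (Lj : left_adjoint (j^*))
    (Rp : right_adjoint (p^*)) (Rq : right_adjoint (q^*)) (A : F W)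
    (m : hom (p^* (Lj (Rq A))) (Li (q^* (Rq A)))) :
    hom (Lj (Rq A)) (Rp (Li A)) :=
  rtranspose Rp (m ;; fmap Li (acounit (radjP Rq) A)).

Variables I P : forall X Y : C, hom X Y -> Prop.

Record condition_I : Prop := ConditionI {
  I_adjoint : forall (U X : C) (i : hom U X),
    I i -> inhabited (left_adjoint (i^*)) ;
  I_base_change : forall (U X V Y : C) (i : hom U X) (g : hom U V)
      (f : hom X Y) (j : hom V Y) (sq : cartesian i g f j),
    I i -> I j ->
    forall (Li : left_adjoint (i^*)) (Lj : left_adjoint (j^*)) (B : F V),
    is_iso (bc_shriek (proj1 sq) Li Lj B) ;
  I_projection : forall (U X : C) (i : hom U X), I i ->
    forall (Li : left_adjoint (i^*)) (A : F U) (B : F X),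
    is_iso (proj_shriek Li A B) }.

Record condition_P : Prop := ConditionP {
  P_adjoint : forall (X Y : C) (p : hom X Y),
    P p -> inhabited (right_adjoint (p^*)) ;
  P_base_change : forall (W X Z Y : C) (f : hom W X) (q : hom W Z)
      (p : hom X Y) (g : hom Z Y) (sq : cartesian f q p g),
    P p -> P q ->
    forall (Rp : right_adjoint (p^*)) (Rq : right_adjoint (q^*)) (A : F X),
    is_iso (bc_push (proj1 sq) Rp Rq A) ;
  P_projection : forall (X Y : C) (p : hom X Y), P p ->
    forall (Rp : right_adjoint (p^*)) (A : F X) (B : F Y),
    is_iso (proj_push Rp A B) }.

Definition mixed_beck_chevalley : Prop :=
  forall (W X Z Y : C) (i : hom W X) (q : hom W Z) (p : hom X Y)
    (j : hom Z Y) (sq : cartesian i q p j),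
  I i -> I j -> P p -> P q ->
  forall (Li : left_adjoint (i^*)) (Lj : left_adjoint (j^*))
    (Rp : right_adjoint (p^*)) (Rq : right_adjoint (q^*)) (A : F W)
    (m : hom (p^* (Lj (Rq A))) (Li (q^* (Rq A)))),
  inverse_of (bc_shriek (proj1 sq) Li Lj (Rq A)) m ->
  is_iso (mixed Rp m).

Definition three_functor_formalism : Prop :=
  [/\ condition_I, condition_P & mixed_beck_chevalley].

End ThreeFunctors.

Record lch := Lch {
  lch_space :> topologicalType ;
  lch_hausdorff : hausdorff_space lch_space ;
  lch_locally_compact : locally_compact [set: lch_space] }.

Record cmap (X Y : lch) := Cmap {
  cfun :> X -> Y ;
  cmap_continuous : continuous cfun }.

Lemma cmap_ext (X Y : lch) (f g : cmap X Y) : f =1 g -> f = g.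
Proof.
case: f g => [f cf] [g cg] /= fg.
have {}fg : f = g by exact/funext.
by case: _ / fg cg => cg; congr Cmap; exact: Prop_irrelevance.
Qed.

Definition cmap_id (X : lch) : cmap X X := Cmap (fun x : X => @cvg_id _ (nbhs x)).

Lemma cmap_comp_subproof (X Y Z : lch) (f : cmap X Y) (g : cmap Y Z) :
  continuous (g \o f).
Proof.
by move=> x; apply: continuous_comp; exact: cmap_continuous.
Qed.

Definition cmap_comp (X Y Z : lch) (f : cmap X Y) (g : cmap Y Z) : cmap X Z :=
  Cmap (@cmap_comp_subproof X Y Z f g).

Definition lch_category : category.
Proof.
by refine (@Category lch cmap cmap_id cmap_comp _ _ _) => *; apply: cmap_ext.
Defined.

Lemma lch_one_locally_compact :
  locally_compact [set: discrete_topology unit].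
Proof.
move=> [] _; exists setT; first exact: filterT.
split; last exact: closedT.
have -> : [set: discrete_topology unit] = [set tt] by apply/seteqP; split=> -[].
exact: compact_set1.
Qed.

Definition lch_one : lch :=
  @Lch (discrete_topology unit) discrete_hausdorff lch_one_locally_compact.

Lemma lch_prod_hausdorff (X Y : lch) : hausdorff_space (X * Y)%type.
Proof.
move=> [x y] [x' y'] xy; congr pair.
- apply: (@lch_hausdorff X) => A B xA xB.
  have [||z [zA zB]] := xy (fst @^-1` A) (fst @^-1` B).
  + exact: (@cvg_fst _ _ (nbhs x) (nbhs y) _ A xA).
  + exact: (@cvg_fst _ _ (nbhs x') (nbhs y') _ B xB).
  + by exists z.1.
- apply: (@lch_hausdorff Y) => A B yA yB.
  have [||z [zA zB]] := xy (snd @^-1` A) (snd @^-1` B).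
  + exact: (@cvg_snd _ _ (nbhs x) (nbhs y) _ A yA).
  + exact: (@cvg_snd _ _ (nbhs x') (nbhs y') _ B yB).
  + by exists z.2.
Qed.

Lemma lch_prod_locally_compact (X Y : lch) :
  locally_compact [set: (X * Y)%type].
Proof.
move=> [x y] _.
have [A xA [cA _]] := @lch_locally_compact X x I.
have [B yB [cB _]] := @lch_locally_compact Y y I.
have cAB := compact_setX cA cB.
exists (A `*` B).
  have {}xA : nbhs x A by apply: (@filterS _ (nbhs x) _ _ _ _ xA) => z; apply.
  have {}yB : nbhs y B by apply: (@filterS _ (nbhs y) _ _ _ _ yB) => z; apply.
  by exists (A, B) => // z [zA zB] _.
by split => //; apply: compact_closed => //; exact: lch_prod_hausdorff.
Qed.

Definition lch_prod (X Y : lch) : lch :=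
  @Lch (X * Y)%type (@lch_prod_hausdorff X Y) (@lch_prod_locally_compact X Y).

Definition lch_term (X : lch) : cmap X lch_one :=
  @Cmap X lch_one (fun=> tt) (fun x => cvg_cst _).

Definition lch_pr1 (X Y : lch) : cmap (lch_prod X Y) X :=
  @Cmap (lch_prod X Y) X fst (fun z => cvg_fst).

Definition lch_pr2 (X Y : lch) : cmap (lch_prod X Y) Y :=
  @Cmap (lch_prod X Y) Y snd (fun z => cvg_snd).

Lemma lch_pair_subproof (T X Y : lch) (f : cmap T X) (g : cmap T Y) :
  continuous (fun t => (f t, g t) : lch_prod X Y).
Proof. by move=> t; apply: cvg_pair; exact: cmap_continuous. Qed.

Definition lch_pair (T X Y : lch) (f : cmap T X) (g : cmap T Y) :
  cmap T (lch_prod X Y) := Cmap (@lch_pair_subproof T X Y f g).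

Definition LCH : cartCategory.
Proof.
refine (@CartCategory lch_category lch_one lch_term _ lch_prod
  lch_pr1 lch_pr2 lch_pair _ _ _).
- by move=> X f g; apply: cmap_ext => x; case: (f x) (g x) => -[].
- by move=> *; exact: cmap_ext.
- by move=> *; exact: cmap_ext.
- move=> T X Y h k h1 h2; apply: cmap_ext => t.
  have /= e1 := congr1 (fun u : cmap T X => u t) h1.
  have /= e2 := congr1 (fun u : cmap T Y => u t) h2.
  by rewrite (surjective_pairing (h t)) e1 e2 -surjective_pairing.
Defined.

(* Inclusions of open subsets, up to homeomorphism onto the image. *)
Definition open_inclusion (X Y : LCH) (i : hom X Y) : Prop :=
  injective (i : cmap X Y) /\
  forall U : set (X : lch), open U -> open ((i : cmap X Y) @` U).

Definition proper_map (X Y : LCH) (p : hom X Y) : Prop :=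
  forall K : set (Y : lch), compact K -> compact ((p : cmap X Y) @^-1` K).

Record opens (X : lch) := Opens { oset :> set X ; osetP : open oset }.

Definition opensT (X : lch) : opens X := Opens (@openT X).

Definition opensI (X : lch) (U V : opens X) : opens X :=
  Opens (openI (osetP U) (osetP V)).

Definition opens_bigcup (X : lch) (S : set (opens X)) : opens X :=
  Opens (@bigcup_open X _ S (@oset X) (fun U _ => osetP U)).

Lemma opensC1_subproof (X : lch) (x : X) : open (~` [set x]).
Proof.
rewrite openC; apply: accessible_closed_set1; apply: hausdorff_accessible.
exact: lch_hausdorff.
Qed.

Definition opensC1 (X : lch) (x : X) : opens X := Opens (opensC1_subproof x).

HB.mixin Record CompleteNormedModule_isCStar (R : realType) A
    of CompleteNormedModule R[i] A := {
  cmul : A -> A -> A ;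
  cstar : A -> A ;
  cmulA : associative cmul ;
  cmulDl : left_distributive cmul +%R ;
  cmulDr : right_distributive cmul +%R ;
  cmulZl : forall (k : R[i]) a b, cmul (k *: a) b = k *: cmul a b ;
  cmulZr : forall (k : R[i]) a b, cmul a (k *: b) = k *: cmul a b ;
  cstarK : involutive cstar ;
  cstarD : {morph cstar : a b / a + b} ;
  cstarZ : forall (k : R[i]) a, cstar (k *: a) = conjc k *: cstar a ;
  cstarM : forall a b, cstar (cmul a b) = cmul (cstar b) (cstar a) ;
  cnormM : forall a b, `|cmul a b| <= `|a| * `|b| ;
  cnorm_star : forall a, `|cmul (cstar a) a| = `|a| ^+ 2 }.

#[short(type="cstarType")]
HB.structure Definition CStar (R : realType) :=
  { A of CompleteNormedModule_isCStar R A & CompleteNormedModule R[i] A }.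

Section CStarAlgebras.
Variable R : realType.
Implicit Types A B Q : cstarType R.

Record star_hom A B (f : A -> B) : Prop := StarHom {
  star_hom_linear : linear f ;
  star_homM : forall a b, f (cmul a b) = cmul (f a) (f b) ;
  star_hom_star : forall a, f (cstar a) = cstar (f a) }.

Record closed_subspace A (S : set A) : Prop := ClosedSubspace {
  subspace_closed : closed S ;
  subspace0 : S 0 ;
  subspaceD : forall a b, S a -> S b -> S (a + b) ;
  subspaceZ : forall (k : R[i]) a, S a -> S (k *: a) }.

Record closed_ideal A (J : set A) : Prop := ClosedIdeal {
  ideal_subspace : closed_subspace J ;
  idealMl : forall a b, J b -> J (cmul a b) ;
  idealMr : forall a b, J a -> J (cmul a b) ;
  ideal_star : forall a, J a -> J (cstar a) }.

Definition closed_span A (G : set A) : set A :=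
  \bigcap_(S in [set S | closed_subspace S /\ G `<=` S]) S.

Definition ideal_gen A (G : set A) : set A :=
  \bigcap_(J in [set J | closed_ideal J /\ G `<=` J]) J.

Record is_quotient A (J : set A) Q (pi : A -> Q) : Prop := IsQuotient {
  quotient_hom : star_hom pi ;
  quotient_surj : forall q, exists a, pi a = q ;
  quotient_ker : forall a, pi a = 0 <-> J a ;
  quotient_norm : forall a (r : R[i]),
    `|pi a| < r <-> exists2 b, J b & `|a + b| < r }.

(* A chosen quotient A / J. It exists for every closed ideal J; the value for
   other sets is irrelevant. *)
Definition quotient A (J : set A) : {Q : cstarType R & A -> Q} :=
  match pselect (exists q : {Q : cstarType R & A -> Q},
                   is_quotient J (projT2 q)) with
  | left ex => projT1 (cid ex)
  | right _ => existT _ A idfun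
  end.

(* *-homomorphisms from the algebraic tensor product of A and B. *)
Record bistar_hom A B Q (t : A -> B -> Q) : Prop := BistarHom {
  bistar_linear_l : forall b, linear (t^~ b) ;
  bistar_linear_r : forall a, linear (t a) ;
  bistarM : forall a a' b b',
    t (cmul a a') (cmul b b') = cmul (t a b) (t a' b') ;
  bistar_star : forall a b, t (cstar a) (cstar b) = cstar (t a b) }.

(* Q is the completion of the algebraic tensor product for its largest
   C*-seminorm. *)
Record is_max_tensor A B Q (t : A -> B -> Q) : Prop := IsMaxTensor {
  max_tensor_hom : bistar_hom t ;
  max_tensor_dense : closed_span [set q | exists a b, q = t a b] = setT ;
  max_tensor_norm : forall (Q' : cstarType R) (t' : A -> B -> Q'),
    bistar_hom t' -> forall s : seq (A * B),
    `|\sum_(ab <- s) t' ab.1 ab.2| <= `|\sum_(ab <- s) t ab.1 ab.2| }.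

Definition is_scalars Q (u : R[i]^o -> Q) : Prop :=
  [/\ linear u, bijective u,
      forall z w : R[i], u (z * w) = cmul (u z) (u w),
      forall z : R[i], u (conjc z) = cstar (u z)
    & forall z : R[i], `|u z| = `|z|].

Definition C0 (X : lch) : set (X -> R[i]^o) :=
  [set k | continuous k /\ forall eps : R[i], 0 < eps ->
     exists2 K : set X, compact K & forall x, ~ K x -> `|k x| <= eps].

Definition C0_on (X : lch) (U : opens X) : set (X -> R[i]^o) :=
  [set k | C0 k /\ forall x, ~ oset U x -> k x = 0].

Record xcstar (X : lch) := Xcstar {
  xalg :> cstarType R ;
  xideal : opens X -> set xalg ;
  xidealP : forall U, closed_ideal (xideal U) ;
  xidealT : xideal (opensT X) = setT ;
  xidealI : forall U V, xideal (opensI U V) = xideal U `&` xideal V ;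
  xideal_bigcup : forall S : set (opens X),
    xideal (opens_bigcup S) = ideal_gen (\bigcup_(U in S) xideal U) }.

Arguments xideal {X} x U.

Record xhom (X : lch) (A B : xcstar X) := Xhom {
  xfun :> A -> B ;
  xhom_star : star_hom xfun ;
  xhom_ideal : forall U a, xideal A U a -> xideal B U (xfun a) }.

Lemma xhom_ext (X : lch) (A B : xcstar X) (f g : xhom A B) : f =1 g -> f = g.
Proof.
case: f g => [f f1 f2] [g g1 g2] /= fg.
have {}fg : f = g by exact/funext.
by case: _ / fg g1 g2 => g1 g2; congr Xhom; exact: Prop_irrelevance.
Qed.

Lemma star_hom_id A : star_hom (@id A).
Proof. by []. Qed.

Lemma star_hom_comp A B Q (f : A -> B) (g : B -> Q) :
  star_hom f -> star_hom g -> star_hom (g \o f).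
Proof.
move=> [f1 f2 f3] [g1 g2 g3]; split => /= *.
- by move=> k a b /=; rewrite f1 g1.
- by rewrite f2 g2.
- by rewrite f3 g3.
Qed.

Definition xhom_id (X : lch) (A : xcstar X) : xhom A A :=
  @Xhom X A A id (star_hom_id A) (fun U a => id).

Definition xhom_comp (X : lch) (A B E : xcstar X) (f : xhom A B)
    (g : xhom B E) : xhom A E :=
  @Xhom X A E (g \o f) (star_hom_comp (xhom_star f) (xhom_star g))
    (fun U a aU => xhom_ideal g (xhom_ideal f aU)).

Definition xcstar_category (X : LCH) : category.
Proof.
by refine (@Category (xcstar X) (@xhom X) (@xhom_id X) (@xhom_comp X) _ _ _)
  => *; apply: xhom_ext.
Defined.

Definition fibre (X : lch) (A : xcstar X) (x : X) : cstarType R :=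
  projT1 (quotient (xideal A (opensC1 x))).

Definition ev (X : lch) (A : xcstar X) (x : X) : A -> fibre A x :=
  projT2 (quotient (xideal A (opensC1 x))).

Arguments ev {X} A x _.

Section Pullback.
Variables (X Y : lch) (f : cmap X Y) (A : xcstar Y).

Definition family := forall x : X, fibre A (f x).

Definition basic_sections : set family :=
  [set s | exists k a, C0 k /\ forall x, s x = k x *: ev A (f x) a].

Record family_subalgebra (S : set family) : Prop := FamilySubalgebra {
  family_bounded : forall s, S s -> exists r : R[i], forall x, `|s x| <= r ;
  family0 : S (fun=> 0) ;
  familyD : forall s t, S s -> S t -> S (fun x => s x + t x) ;
  familyZ : forall (c : R[i]) s, S s -> S (fun x => c *: s x) ;
  familyM : forall s t, S s -> S t -> S (fun x => cmul (s x) (t x)) ;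
  family_star : forall s, S s -> S (fun x => cstar (s x)) ;
  family_closed : forall s,
    (forall eps : R[i], 0 < eps ->
       exists2 t, S t & forall x, `|s x - t x| <= eps) -> S s }.

(* [P], with the evaluations [e], is f^* A: a C*-algebra of bounded families
   under the supremum norm. *)
Record is_pullback (P : xcstar X) (e : forall x : X, P -> fibre A (f x)) :
    Prop := IsPullback {
  pullback_hom : forall x, star_hom (e x) ;
  pullback_norm : forall p (r : R[i]), 0 <= r ->
    (`|p| <= r <-> forall x, `|e x p| <= r) ;
  pullback_sections :
    [set s : family | exists p, forall x, e x p = s x] =
    \bigcap_(S in [set S | family_subalgebra S /\ basic_sections `<=` S]) S ;
  pullback_ideal : forall U, xideal P U =
    ideal_gen [set q | exists k p,
      C0_on U k /\ forall x, e x q = k x *: e x p] }.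

End Pullback.

(* A *-homomorphism C_0(X) (x) A -> A, given by its values on elementary
   tensors; only the values at functions in C_0(X) matter. The image of the
   closed ideal C_0(U) (x) A is the closed span of the images of elementary
   tensors. *)
Record is_structure_map (X : lch) (A : xcstar X)
    (m : (X -> R[i]^o) -> A -> A) : Prop := IsStructureMap {
  structure_linear_l : forall (c : R[i]) k l a, C0 k -> C0 l ->
    m (fun x => c *: k x + l x) a = c *: m k a + m l a ;
  structure_linear_r : forall k, C0 k -> linear (m k) ;
  structureM : forall k l a b, C0 k -> C0 l ->
    m (fun x => k x * l x) (cmul a b) = cmul (m k a) (m l b) ;
  structure_star : forall k a, C0 k ->
    m (fun x => conjc (k x)) (cstar a) = cstar (m k a) ;
  structure_bilinear_l : forall k a b, C0 k ->
    m k (cmul a b) = cmul a (m k b) ;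
  structure_bilinear_r : forall k a b, C0 k ->
    m k (cmul a b) = cmul (m k a) b ;
  structure_surj :
    closed_span [set b | exists k a, C0 k /\ b = m k a] = setT ;
  structure_ideal : forall U, xideal A U =
    closed_span [set b | exists k a, C0_on U k /\ b = m k a] }.

Definition is_ext_product (X Y : lch) (A : xcstar X) (B : xcstar Y)
    (E : xcstar (lch_prod X Y)) (t : A -> B -> E) : Prop :=
  is_max_tensor t /\
  exists m n M, [/\ @is_structure_map X A m, @is_structure_map Y B n,
    @is_structure_map (lch_prod X Y) E M &
    forall k l a b, C0 k -> C0 l ->
      M (fun z => k z.1 * l z.2) (t a b) = t (m k a) (n l b)].

Section Formalism.
Variable D : laxSymMonFunctor (C := LCH) xcstar_category.

Definition pbx (X Y : lch) (f : cmap X Y) (A : xcstar Y) : xcstar X :=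
  @pb _ _ D X Y f A.

Definition boxx (X Y : lch) (A : xcstar X) (B : xcstar Y) :
    xcstar (lch_prod X Y) :=
  @box _ _ _ D X Y A B.

Definition onex : xcstar lch_one := lone D.

(* [D] is X |-> X-C*Alg with the pullbacks f^* and external products of
   C*-algebras, given by the evaluations [e], the universal bilinear maps [t]
   and the isomorphism [u] of C with the unit of D(pt). All structure maps of
   [D] are the evident ones: each is determined by its effect on elementary
   tensors and on the values of sections. *)
Record cstar_structure
    (e : forall (X Y : lch) (f : cmap X Y) (A : xcstar Y) (x : X),
       pbx f A -> fibre A (f x))
    (t : forall (X Y : lch) (A : xcstar X) (B : xcstar Y), A -> B -> boxx A B)
    (u : R[i]^o -> onex) : Prop := CStarStructure {
  std_pb : forall (X Y : lch) (f : cmap X Y) (A : xcstar Y),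
    is_pullback (e X Y f A) ;
  std_fmap : forall (X Y : lch) (f : cmap X Y) (A B : xcstar Y)
      (phi : xhom A B) (p : pbx f A) (x : X) (a : A),
    e X Y f A x p = ev A (f x) a ->
    e X Y f B x ((fmap (@pb _ _ D X Y f) phi : xhom (pbx f A) (pbx f B)) p) =
    ev B (f x) (phi a) ;
  std_pbid : forall (X : lch) (A : xcstar X) (p : pbx (cmap_id X) A) (x : X),
    e X X (cmap_id X) A x p =
    ev A x ((ihom (@pbid _ _ D X A) : xhom (pbx (cmap_id X) A) A) p) ;
  std_pbcomp : forall (X Y Z : lch) (f : cmap X Y) (g : cmap Y Z)
      (A : xcstar Z) (p : pbx (cmap_comp f g) A) (x : X) (q : pbx g A),
    e X Y f (pbx g A) x
      ((ihom (@pbcomp _ _ D X Y Z f g A) :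
          xhom (pbx (cmap_comp f g) A) (pbx f (pbx g A))) p) =
    ev (pbx g A) (f x) q ->
    e X Z (cmap_comp f g) A x p = e Y Z g A (f x) q ;
  std_box : forall (X Y : lch) (A : xcstar X) (B : xcstar Y),
    is_ext_product (t X Y A B) ;
  std_bmap : forall (X Y : lch) (A A' : xcstar X) (B B' : xcstar Y)
      (phi : xhom A A') (psi : xhom B B') (a : A) (b : B),
    (@bmap _ _ _ D X Y A A' B B' phi psi : xhom (boxx A B) (boxx A' B'))
      (t X Y A B a b) = t X Y A' B' (phi a) (psi b) ;
  std_boxpb : forall (X X' Y Y' : lch) (f : cmap X X') (g : cmap Y Y')
      (A : xcstar X') (B : xcstar Y') (p : pbx f A) (q : pbx g B)
      (x : X) (y : Y) (a : A) (b : B),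
    e X X' f A x p = ev A (f x) a ->
    e Y Y' g B y q = ev B (g y) b ->
    e _ _ (@prodm LCH X X' Y Y' f g) (boxx A B) (x, y)
      ((ihom (@boxpb _ _ _ D X X' Y Y' f g A B) :
          xhom (boxx (pbx f A) (pbx g B))
               (pbx (@prodm LCH X X' Y Y' f g) (boxx A B)))
         (t X Y (pbx f A) (pbx g B) p q)) =
    ev (boxx A B) (f x, g y) (t X' Y' A B a b) ;
  std_one : is_scalars u ;
  std_lunit : forall (X : lch) (A : xcstar X) (z : R[i]) (a : A)
      (w : lch_prod lch_one X),
    e _ _ (lch_pr2 lch_one X) A w
      ((ihom (@lunit _ _ D X A) :
          xhom (boxx onex A) (pbx (lch_pr2 lch_one X) A))
         (t lch_one X onex A (u z) a)) =
    ev A w.2 (z *: a) ;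
  std_runit : forall (X : lch) (A : xcstar X) (z : R[i]) (a : A)
      (w : lch_prod X lch_one),
    e _ _ (lch_pr1 X lch_one) A w
      ((ihom (@runit _ _ D X A) :
          xhom (boxx A onex) (pbx (lch_pr1 X lch_one) A))
         (t X lch_one A onex a (u z))) =
    ev A w.1 (z *: a) ;
  std_assoc : forall (X Y Z : lch) (A : xcstar X) (B : xcstar Y)
      (E : xcstar Z) (a : A) (b : B) (c : E)
      (w : lch_prod (lch_prod X Y) Z),
    e _ _ (@prodmA LCH X Y Z) (boxx A (boxx B E)) w
      ((ihom (@assoc _ _ D X Y Z A B E) :
          xhom (boxx (boxx A B) E)
               (pbx (@prodmA LCH X Y Z) (boxx A (boxx B E))))
         (t _ Z (boxx A B) E (t X Y A B a b) c)) =
    ev (boxx A (boxx B E)) (w.1.1, (w.1.2, w.2))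
      (t X _ A (boxx B E) a (t Y Z B E b c)) ;
  std_braid : forall (X Y : lch) (A : xcstar X) (B : xcstar Y)
      (a : A) (b : B) (w : lch_prod X Y),
    e _ _ (@swapm LCH X Y) (boxx B A) w
      ((ihom (@braid _ _ D X Y A B) :
          xhom (boxx A B) (pbx (@swapm LCH X Y) (boxx B A)))
         (t X Y A B a b)) =
    ev (boxx B A) (w.2, w.1) (t Y X B A b a) }.

Definition is_cstar_functor : Prop := exists e t u, cstar_structure e t u.

End Formalism.

End CStarAlgebras.

(* Main.v *)
(* An algebra A over X is determined by its fibres A(x): an element is the same
   as its section x |-> ev_x a, whose norm function is upper semicontinuous and
   vanishes at infinity, and a space of sections which is stable under bump
   functions and locally dense is everything (partition of unity).  Hence f^* A
   is the algebra of all continuous sections over X, vanishing at infinity, of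
   the pulled back fibres, and the fibre of the external product at (x, y) is
   the maximal tensor product of A(x) and B(y), by exactness of the maximal
   tensor product.  All coherence isomorphisms are therefore constructed, and
   all coherence equations checked, on fibres.
   Both p_* for proper p and i_! for open i keep the algebra A and change only
   the ideals, (f_* A)(V) = A(f^-1 V); the fibres of i_! A vanish outside U.
   The canonical maps of base change and of the projection formulas are
   isometric, as one checks on fibres (for p_* using the maximal tensor product
   of A with the single algebra B(y), an algebra over X), and have dense range. *)
From HB Require Import structures.
From mathcomp Require Import all_boot all_order all_algebra.
From mathcomp Require Import complex ring lra.
From mathcomp Require Import all_classical all_reals all_analysis.
Require Import Defs.

Set Implicit Arguments.
Unset Strict Implicit.
Unset Printing Implicit Defensive.

Import Order.TTheory GRing.Theory Num.Theory numFieldNormedType.Exports.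
Local Open Scope classical_set_scope.
Local Open Scope ring_scope.
Local Open Scope complex_scope.

(** * C*-algebras *)

(** The basic norm estimates rest on one construction, the square root of [1 - h^2] for a
    self-adjoint [h] of norm below 1. It makes [1 - r + i h] and [1 - r - i h] unitary in the
    unitization; this bounds actions, star homomorphisms and tensors, and it produces the
    approximate units behind C*-norms on quotients. Fibres are chosen quotients and adjoints are
    arbitrary given ones, so neither can be computed with directly. Fibres are replaced by any
    family of surjections with the right kernels ([presents]), adjoints are compared with concrete
    universal arrows, and the axioms are derived from the properties collected in [cstar_structure].
    Without units the factors do not embed in a tensor product, which makes associativity an
    obstacle; multipliers supply the missing maps. Equal maps of [LCH] need not be convertible, so
    coherence equations live over transports. Representatives of values in fibres are insensitive to
    transport, which reduces each equation to a computation on elementary tensors. *)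

Section RealNorm.
Variable R : realType.
Implicit Types (V : normedModType R[i]) (k : R[i]).

(** Norms over [R[i]] take values in [R[i]], whose order is partial; taking the real part moves all
    estimates to the ordered field [R]. *)
Definition nm V (a : V) : R := complex.Re `|a|.

Lemma complex_ge0E k : 0 <= k -> k = (complex.Re k)%:C.
Proof. by case: k => a b; rewrite lecE /= => /andP[/eqP -> _]. Qed.

Lemma nmE V (a : V) : `|a| = (nm a)%:C.
Proof. exact: complex_ge0E. Qed.

Lemma nm_ge0 V (a : V) : 0 <= nm a.
Proof. by have := normr_ge0 a; rewrite nmE lecR. Qed.

Lemma nmD V (a b : V) : nm (a + b) <= nm a + nm b.
Proof. by have := ler_normD a b; rewrite !nmE -rmorphD lecR. Qed.

Lemma nmN V (a : V) : nm (- a) = nm a.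
Proof. by rewrite /nm normrN. Qed.

Lemma nmB V (a b : V) : nm (a - b) <= nm a + nm b.
Proof. by rewrite -(nmN b) nmD. Qed.

Lemma nmC V (a b : V) : nm (a - b) = nm (b - a).
Proof. by rewrite -nmN opprB. Qed.

Definition cabs k : R := complex.Re `|k|.

Lemma cabsE k : `|k| = (cabs k)%:C.
Proof. exact: complex_ge0E. Qed.

Lemma cabs_ge0 k : 0 <= cabs k.
Proof. by have := normr_ge0 k; rewrite cabsE lecR. Qed.

Lemma nmZ V k (a : V) : nm (k *: a) = cabs k * nm a.
Proof.
apply: (@complexI R); rewrite rmorphM /= -nmE -nmE -cabsE; exact: normrZ.
Qed.

Lemma cabs_real (x : R) : cabs x%:C = `|x|.
Proof. by rewrite /cabs normc_def /= expr0n /= addr0 sqrtr_sqr. Qed.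

Lemma cabsM k l : cabs (k * l) = cabs k * cabs l.
Proof. by apply: (@complexI R); rewrite rmorphM /= -!cabsE normrM. Qed.

Lemma cabsD k l : cabs (k + l) <= cabs k + cabs l.
Proof. by have := ler_normD k l; rewrite !cabsE -rmorphD lecR. Qed.

Lemma cabsN k : cabs (- k) = cabs k.
Proof. by rewrite /cabs normrN. Qed.

Lemma cabsi : cabs 'i = 1.
Proof. by rewrite /cabs normc_def /= expr0n add0r expr1n sqrtr1. Qed.

Lemma cabs_conj k : cabs (conjc k) = cabs k.
Proof. by case: k => a b; rewrite /cabs !normc_def /= sqrrN. Qed.

Lemma cabs_eq0 k : cabs k = 0 -> k = 0.
Proof. by move=> k0; apply/eqP; rewrite -normr_eq0 cabsE k0. Qed.

Lemma nmZr V (x : R) (a : V) : 0 <= x -> nm (x%:C *: a) = x * nm a.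
Proof. by move=> x0; rewrite nmZ cabs_real ger0_norm. Qed.

Lemma nm0 V : nm (0 : V) = 0.
Proof. by rewrite /nm normr0. Qed.

Lemma nm_eq0 V (a : V) : nm a = 0 -> a = 0.
Proof. by move=> a0; apply/eqP; rewrite -normr_eq0 nmE a0. Qed.

Lemma nm_le0 V (a : V) : nm a <= 0 -> a = 0.
Proof. by move=> a0; apply: nm_eq0; apply/eqP; rewrite eq_le a0 nm_ge0. Qed.

Lemma nm_small V (a : V) : (forall e : R, 0 < e -> nm a <= e) -> a = 0.
Proof. by move=> ae; apply: nm_le0; apply/ler_addgt0Pr => e /ae; rewrite add0r. Qed.

Lemma nm_tri V (a b c : V) : nm (a - c) <= nm (a - b) + nm (b - c).
Proof. by rewrite (le_trans _ (nmD _ _))// addrA subrK. Qed.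

Lemma nm_le_add V (a b : V) : nm a <= nm b + nm (a - b).
Proof. by rewrite (le_trans _ (nmD _ _))// addrC subrK. Qed.

Lemma nm_sum V (I : Type) (r : seq I) (F : I -> V) :
  nm (\sum_(i <- r) F i) <= \sum_(i <- r) nm (F i).
Proof.
elim: r => [|i r IH]; first by rewrite !big_nil nm0.
by rewrite !big_cons (le_trans (nmD _ _))// lerD2l.
Qed.

Lemma norm_ltE V (a : V) (r : R) : (`|a| < r%:C) = (nm a < r).
Proof. by rewrite nmE ltcR. Qed.

Lemma norm_leE V (a : V) (r : R) : (`|a| <= r%:C) = (nm a <= r).
Proof. by rewrite nmE lecR. Qed.

Lemma closedP V (S : set V) : closed S <->
  (forall a, (forall e : R, 0 < e -> exists2 b, S b & nm (a - b) < e) -> S a).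
Proof.
split=> [cS a aS|S_cl].
  apply: cS => B /nbhs_normP[e /= e0 eB].
  (* A positive element of [R[i]] is real, so the radius of a ball is determined by its real
     part. *)
  have e0' := e0; rewrite ltcE /= in e0'; move: e0' => /andP[/eqP ei er].
  have [b Sb ab] := aS _ er; exists b; split=> //; apply: eB => /=.
  by rewrite nmE (complex_ge0E (ltW e0)) ltcR.
move=> a aS; apply: S_cl => e e0.
have [|b [Sb /=]] := aS [set b | `|a - b| < e%:C].
  by apply/nbhs_normP; exists e%:C => //=; rewrite ltcR.
by rewrite norm_ltE => ab; exists b.
Qed.

Definition cauchy_seq (V : normedModType R[i]) (u : nat -> V) :=
  forall e : R, 0 < e -> exists N, forall m n, (N <= m)%N -> (N <= n)%N ->
    nm (u m - u n) < e.

Definition lim_seq (V : normedModType R[i]) (u : nat -> V) (l : V) :=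
  forall e : R, 0 < e -> exists N, forall n, (N <= n)%N -> nm (u n - l) < e.

Lemma cauchy_seq_cvg (V : completeNormedModType R[i]) (u : nat -> V) :
  cauchy_seq u -> exists l, lim_seq u l.
Proof.
move=> cu; have : cauchy (u @ \oo).
  apply: cauchy_exP => e e0.
  have e0' := e0; rewrite ltcE /= in e0'; move: e0' => /andP[/eqP ei er].
  have [N NP] := cu _ er; exists (u N).
  exists N => // n /= Nn; rewrite -ball_normE /ball_ /= nmE.
  by rewrite (complex_ge0E (ltW e0)) ltcR; exact: NP.
move=> /cauchy_cvg/cvg_ex[/= l ul]; exists l => e e0.
have /cvgrPdist_lt /(_ e%:C) := ul; rewrite ltcR => /(_ e0) [N _ NP].
by exists N => n Nn; rewrite nmC -norm_ltE; exact: NP.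
Qed.

Lemma half_pow_small (e : R) : 0 < e ->
  exists N, forall n, (N <= n)%N -> 2^-1 ^+ n < e.
Proof.
move=> e0; have := @cvg_geometric R 1 2^-1.
rewrite ger0_norm ?invr_ge0 // invf_lt1 // ltr1n => /(_ isT) /cvgrPdist_lt /(_ e e0).
move=> [N _ NP]; exists N => n /NP; rewrite /geometric /= mul1r sub0r normrN.
by rewrite ger0_norm // exprn_ge0 // invr_ge0.
Qed.

Lemma lim_seq_uniq V (u : nat -> V) l l' :
  lim_seq u l -> lim_seq u l' -> l = l'.
Proof.
move=> ul ul'; apply/eqP; rewrite -subr_eq0; apply/eqP/nm_small => e e0.
have e2 : 0 < e / 2 by rewrite divr_gt0.
have [N NP] := ul _ e2; have [N' NP'] := ul' _ e2.
have := NP _ (leq_maxl N N'); have := NP' _ (leq_maxr N N').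
set n := maxn _ _ => h1 h2; apply: (le_trans (nm_tri _ (u n) _)).
by rewrite nmC; lra.
Qed.

Lemma geometric_cvg (V : completeNormedModType R[i]) (u : nat -> V) (C q : R) :
  0 <= q < 1 -> (forall n, nm (u n.+1 - u n) <= C * q ^+ n) ->
  exists l, lim_seq u l.
Proof.
move=> /andP[q0 q1] uC; apply: cauchy_seq_cvg => e e0.
(* Telescoping against the partial geometric sum, in the closed form [(1 - q^k) / (1 - q)]. *)
have tail n (k : nat) : nm (u (n + k)%N - u n) <= C * q ^+ n * ((1 - q ^+ k) / (1 - q)).
  elim: k => [|k IH]; first by rewrite addn0 subrr nm0 expr0 subrr mul0r mulr0.
  apply: (le_trans (nm_tri _ (u (n + k)%N) _)); rewrite addnS.
  apply: (le_trans (lerD (uC _) IH)); rewrite exprD exprS le_eqVlt.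
  apply/orP; left; apply/eqP; field; lra.
have C0 : 0 <= C by have := le_trans (nm_ge0 _) (uC 0%N); rewrite expr0 mulr1.
have tail' n (k : nat) : nm (u (n + k)%N - u n) <= C / (1 - q) * q ^+ n.
  apply: (le_trans (tail n k)).
  have -> : C / (1 - q) * q ^+ n = C * q ^+ n * (1 / (1 - q)) by field; lra.
  apply: ler_wpM2l; first by rewrite mulr_ge0 // exprn_ge0.
  by rewrite ler_wpM2r // ?invr_ge0 ?gerBl ?exprn_ge0 //; lra.
have D0 : 0 <= C / (1 - q) by rewrite divr_ge0 //; lra.
have := @cvg_geometric R (C / (1 - q)) q.
rewrite ger0_norm // => /(_ q1) /cvgrPdist_lt /(_ (e / 2)).
rewrite divr_gt0 // => /(_ isT) [N _ NP].
have {}NP n : (N <= n)%N -> C / (1 - q) * q ^+ n < e / 2.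
  by move=> /NP; rewrite /geometric /= sub0r normrN ger0_norm // mulr_ge0 // exprn_ge0.
exists N => m n Nm Nn; apply: (le_lt_trans (nm_tri _ (u N) _)).
rewrite (nmC (u N)) -(subnKC Nm) -(subnKC Nn).
have := tail' N (m - N)%N; have := tail' N (n - N)%N; have := NP _ (leqnn N).
lra.
Qed.

(** Powers absorb constants: if [y < x], the powers of [x / y] stay below [C] and yet grow by
    Bernoulli's inequality. The exponents are powers of two because the C*-identity squares a norm
    at each use. *)
Lemma exp2_cmp (x y C : R) : 0 <= x -> 0 <= y ->
  (forall n, x ^+ (2 ^ n) <= C * y ^+ (2 ^ n)) -> x <= y.
Proof.
move=> x0 y0 xy; rewrite leNgt; apply/negP => yx.
have [y00|yn0] := eqVneq y 0.
  by have := xy 0%N; rewrite expn0 !expr1 y00 mulr0 leNgt -[X in X < _]y00 yx.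
have yp : 0 < y by rewrite lt_def yn0.
set q := x / y; have q1 : 1 < q by rewrite /q ltr_pdivlMr // mul1r.
have qC n : q ^+ (2 ^ n) <= C.
  by rewrite /q expr_div_n ler_pdivrMr ?exprn_gt0.
have bern n : 1 + n%:R * (q - 1) <= q ^+ n.
  elim: n => [|n IH]; first by rewrite mul0r addr0 expr0.
  rewrite exprS; apply: (@le_trans _ _ (q * (1 + n%:R * (q - 1)))); last first.
    by rewrite ler_wpM2l //; lra.
  rewrite -natr1; have /mulr_ge0 n0 : 0 <= n%:R * (q - 1) by rewrite mulr_ge0 //; lra.
  have : 0 <= q - 1 by lra.
  by move=> /n0; lra.
have [N] : exists N : nat, C < N%:R * (q - 1).
  exists (Num.bound (C / (q - 1))).
  have := archi_boundP (x := `|C / (q - 1)|) (normr_ge0 _).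
  have Cb : C / (q - 1) < (Num.bound (C / (q - 1)))%:R.
    by apply: le_lt_trans (ler_norm _) _; have := archi_boundP (normr_ge0 (C / (q-1))); rewrite /Num.bound normr_id.
  by move=> _; rewrite -ltr_pdivrMr // subr_gt0.
have := qC N; have := bern (2 ^ N)%N.
have : N%:R <= (2 ^ N)%:R :> R by rewrite ler_nat ltnW // ltn_expl.
nra.
Qed.

End RealNorm.
Arguments nm {R V} a.
Arguments cabs {R} k.

Local Notation "a ** b" := (cmul a b) (at level 40, left associativity).

(* [ring] does not decide identities between vectors: they are reflected to an
   equality of coefficients in the scalars. *)
Section LinearExpressions.
Variables (K : comNzRingType) (V : lmodType K).

Inductive lexp := LVar of nat | LZero | LAdd of lexp & lexp | LOpp of lexp
  | LScale of K & lexp.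

Fixpoint ldenote (env : seq V) (e : lexp) : V :=
  match e with
  | LVar i => nth 0 env i
  | LZero => 0
  | LAdd e1 e2 => ldenote env e1 + ldenote env e2
  | LOpp e1 => - ldenote env e1
  | LScale k e1 => k *: ldenote env e1
  end.

Fixpoint lcoef (e : lexp) (i : nat) : K :=
  match e with
  | LVar j => if PeanoNat.Nat.eqb i j then 1 else 0
  | LZero => 0
  | LAdd e1 e2 => lcoef e1 i + lcoef e2 i
  | LOpp e1 => - lcoef e1 i
  | LScale k e1 => k * lcoef e1 i
  end.

Fixpoint leqs (n : nat) (e1 e2 : lexp) : Prop :=
  match n with
  | 0%N => True
  | S m => lcoef e1 m = lcoef e2 m /\ leqs m e1 e2
  end.

Lemma ldenoteE env e :
  ldenote env e = \sum_(i < size env) lcoef e i *: nth 0 env i.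
Proof.
elim: e => /= [j||e1 -> e2 ->|e1 ->|k e1 ->].
- have eqE i : PeanoNat.Nat.eqb i j = (i == j).
    by apply/idP/eqP => /PeanoNat.Nat.eqb_eq.
  have [jn|jn] := ltnP j (size env).
    rewrite (bigD1 (Ordinal jn)) //= eqE eqxx scale1r big1 ?addr0 // => i ij.
    by rewrite eqE ifN ?scale0r //; apply: contra ij => /eqP ij; apply/eqP/val_inj.
  rewrite nth_default // big1 // => i _; rewrite eqE ifN ?scale0r //.
  by rewrite ltn_eqF // (leq_trans (ltn_ord i)).
- by rewrite big1 // => i _; rewrite scale0r.
- by rewrite -big_split; apply: eq_bigr => i _; rewrite /= scalerDl.
- by rewrite -sumrN; apply: eq_bigr => i _; rewrite scaleNr.
- by rewrite scaler_sumr; apply: eq_bigr => i _; rewrite scalerA.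
Qed.

Lemma lmod_eq env e1 e2 :
  leqs (size env) e1 e2 -> ldenote env e1 = ldenote env e2.
Proof.
move=> e12; rewrite !ldenoteE; apply: eq_bigr => i _; congr (_ *: _).
case: i => i /=; elim: (size env) e12 => //= n IH [en e12].
by rewrite ltnS leq_eqVlt => /predU1P[->|/IH ->].
Qed.

End LinearExpressions.

Ltac lmod_mem a l :=
  lazymatch l with
  | nil => constr:(false)
  | a :: _ => constr:(true)
  | _ :: ?l' => lmod_mem a l'
  end.

Ltac lmod_atoms t l :=
  lazymatch t with
  | ?a + ?b => let l1 := lmod_atoms a l in lmod_atoms b l1
  | - ?a => lmod_atoms a l
  | ?k *: ?a => lmod_atoms a l
  | 0 => l
  | ?a => lazymatch lmod_mem a l with true => l | false => constr:(a :: l) end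
  end.

Ltac lmod_index a l :=
  lazymatch l with
  | a :: _ => constr:(0%N)
  | _ :: ?l' => let i := lmod_index a l' in constr:(S i)
  end.

Ltac lmod_reify K t l :=
  lazymatch t with
  | ?a + ?b => let x := lmod_reify K a l in let y := lmod_reify K b l in
      constr:(LAdd x y)
  | - ?a => let x := lmod_reify K a l in constr:(LOpp x)
  | ?k *: ?a => let x := lmod_reify K a l in constr:(LScale (k : K) x)
  | 0 => constr:(LZero K)
  | ?a => let i := lmod_index a l in constr:(LVar K i)
  end.

Ltac lmod_with K :=
  lazymatch goal with
  | |- @eq ?T ?a ?b =>
    let l := lmod_atoms a (@nil T) in
    let l := lmod_atoms b l in
    let x := lmod_reify K a l in
    let y := lmod_reify K b l in
    change (ldenote l x = ldenote l y);
    apply: lmod_eq; rewrite /=; do ?[split]; rewrite ?mulr1 ?mulr0 //; try ring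
  end.

Section CStarBasics.
Variable R : realType.
Ltac lmod := lmod_with (R[i]).
Implicit Types A B D Q : cstarType R.

Lemma cmul0l A (a : A) : 0 ** a = 0.
Proof. by have := cmulZl 0 (0 : A) a; rewrite !scale0r. Qed.

Lemma cmul0r A (a : A) : a ** 0 = 0.
Proof. by have := cmulZr 0 a (0 : A); rewrite !scale0r. Qed.

Lemma cmulNl A (a b : A) : (- a) ** b = - (a ** b).
Proof. by rewrite -scaleN1r cmulZl scaleN1r. Qed.

Lemma cmulNr A (a b : A) : a ** (- b) = - (a ** b).
Proof. by rewrite -scaleN1r cmulZr scaleN1r. Qed.

Lemma cmulBl A (a b c : A) : (a - b) ** c = a ** c - b ** c.
Proof. by rewrite cmulDl cmulNl. Qed.

Lemma cmulBr A (a b c : A) : a ** (b - c) = a ** b - a ** c.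
Proof. by rewrite cmulDr cmulNr. Qed.

Lemma cstar0 A : cstar (0 : A) = 0.
Proof. by have := cstarZ 0 (0 : A); rewrite scale0r conjc0 scale0r. Qed.

Lemma cstarN A (a : A) : cstar (- a) = - cstar a.
Proof. by rewrite -scaleN1r cstarZ rmorphN rmorph1 scaleN1r. Qed.

Lemma cstarB A (a b : A) : cstar (a - b) = cstar a - cstar b.
Proof. by rewrite cstarD cstarN. Qed.

Lemma nmM A (a b : A) : nm (a ** b) <= nm a * nm b.
Proof. by have := cnormM a b; rewrite !nmE -rmorphM /= lecR. Qed.

Lemma nm_star_mul A (a : A) : nm (cstar a ** a) = nm a ^+ 2.
Proof. by apply: (@complexI R); rewrite rmorphXn /= -!nmE cnorm_star. Qed.

Lemma nm_star A (a : A) : nm (cstar a) = nm a.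
Proof.
have le (b : A) : nm b <= nm (cstar b).
  have [b0|b0] := eqVneq (nm b) 0; first by rewrite b0 nm_ge0.
  have bp : 0 < nm b by rewrite lt_def b0 nm_ge0.
  by have := nmM (cstar b) b; rewrite nm_star_mul expr2 ler_pM2r.
by apply/eqP; rewrite eq_le le -{2}(cstarK a) le.
Qed.

Lemma nm_mul_star A (a : A) : nm (a ** cstar a) = nm a ^+ 2.
Proof. by rewrite -{1}(cstarK a) nm_star_mul nm_star. Qed.

Lemma cmul_star_eq0 A (a : A) : cstar a ** a = 0 -> a = 0.
Proof.
move=> aa; apply: nm_eq0; apply/eqP; rewrite -sqrf_eq0 -nm_star_mul aa.
by rewrite nm0.
Qed.

Lemma cmul_eq0 A (a : A) : (forall b, a ** b = 0) -> a = 0.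
Proof.
by move=> a0; rewrite -[a]cstarK (@cmul_star_eq0 _ (cstar a)) ?cstar0 // cstarK a0.
Qed.

Lemma lim_seq_closed A (S : set A) u l :
  closed S -> (forall n, S (u n)) -> lim_seq u l -> S l.
Proof.
move=> /closedP Sc Su ul; apply: Sc => e /ul[N NP]; exists (u N) => //.
by rewrite nmC NP.
Qed.

(* [1 - r] is the square root of [1 - h^2]; [r] is a limit of polynomials in
   [h^2] without constant term, so it stays in any closed ideal containing [h]. *)
Lemma sqrt_iteration A (J : set A) (h : A) : closed_ideal J -> J h ->
  cstar h = h -> nm h < 1 ->
  exists r, [/\ J r, cstar r = r, h ** r = r ** h & r + r - r ** r = h ** h].
Proof.
move=> Ji Jh sh h1; have [[Jc J0 JD JZ] JMl JMr JS] := Ji.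
set q := nm h; set x := h ** h.
have q0 : 0 <= q by exact: nm_ge0.
have x2 : nm x <= q ^+ 2 by rewrite expr2 nmM.
(* A fixed point of [T] solves the equation for [r]. On the ball of radius [q] the map [T] has
   Lipschitz constant [q < 1] and stays inside, so the iteration from 0 converges geometrically. *)
pose T (r : A) := ((2^-1)%:C : R[i]) *: (x + r ** r).
have half (a : A) : a + a = (2%:C : R[i]) *: a.
  by rewrite (_ : 2%:C = 2) ?rmorph_nat // scaler_nat mulr2n.
have xs : cstar x = x by rewrite cstarM sh.
have Jx : J x by exact: JMl.
pose u n := iter n T 0.
have u_nm n : nm (u n) <= q.
  elim: n => [|n IH] /=; first by rewrite nm0.
  rewrite nmZr ?invr_ge0 //; apply: (@le_trans _ _ (2^-1 * (q ^+ 2 + q ^+ 2))).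
    rewrite ler_wpM2l ?invr_ge0 // (le_trans (nmD _ _)) // lerD //.
    rewrite (le_trans (nmM _ _)) // -expr2 ler_pXn2r // nnegrE ?nm_ge0 //.
  by rewrite -/q; nra.
have u_step n : nm (u n.+1 - u n) <= q ^+ 2 * q ^+ n.
  elim: n => [|n IH].
    rewrite /= subr0 mulr1 /T cmul0l addr0 nmZr ?invr_ge0 //.
    by have := nm_ge0 x; lra.
  have -> : u n.+2 - u n.+1 = (2^-1)%:C *: (u n.+1 ** (u n.+1 - u n) +
      (u n.+1 - u n) ** u n).
    rewrite -[u n.+2]/(T (u n.+1)) {2}(erefl : u n.+1 = T (u n)) /T -scalerBr.
    by congr (_ *: _); rewrite cmulBr cmulBl; lmod.
  rewrite nmZr ?invr_ge0 //.
  have := nmD (u n.+1 ** (u n.+1 - u n)) ((u n.+1 - u n) ** u n).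
  have := nmM (u n.+1) (u n.+1 - u n); have := nmM (u n.+1 - u n) (u n).
  have := u_nm n; have := u_nm n.+1; have := nm_ge0 (u n.+1 - u n).
  rewrite (exprS _ n).
  move: (nm (u n.+1 - u n)) IH => d IH d0 un1 un m1 m2 m3.
  have : d * nm (u n) <= d * q by rewrite ler_wpM2l.
  have : nm (u n.+1) * d <= q * d by rewrite ler_wpM2r.
  have : q * d <= q * (q ^+ 2 * q ^+ n) by rewrite ler_wpM2l.
  lra.
have [|r ur] := geometric_cvg _ u_step; first by rewrite q0.
pose S := [set a : A | [/\ J a, cstar a = a & h ** a = a ** h]].
have Su n : S (u n).
  elim: n => [|n [IH1 IH2 IH3]] /=; first by split; rewrite ?cstar0 ?cmul0r ?cmul0l.
  split; first by apply/JZ/JD => //; exact: JMl.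
    by rewrite cstarZ cstarD cstarM IH2 xs conjc_real.
  rewrite cmulZl cmulZr cmulDl cmulDr; congr (_ *: (_ + _)).
    by rewrite /x !cmulA.
  by rewrite cmulA IH3 -cmulA IH3 cmulA.
have Sc : closed S.
  apply/closedP => a aS; split.
  - by move/closedP: Jc; apply => e /aS[b [Jb _ _] ab]; exists b.
  - apply/eqP; rewrite -subr_eq0; apply/eqP/nm_small => e e0.
    have [|b [_ sb _] ab] := aS (e / 2); first by rewrite divr_gt0.
    have := nm_tri (cstar a) b a; rewrite -{1}sb -cstarB nm_star (nmC b); lra.
  - apply/eqP; rewrite -subr_eq0; apply/eqP/nm_small => e e0.
    have [|b [_ _ hb] ab] := aS (e / 2); first by rewrite divr_gt0.
    have := nm_tri (h ** a) (h ** b) (a ** h).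
    rewrite {2}hb -cmulBr -cmulBl.
    have := nmM h (a - b); have := nmM (b - a) h.
    rewrite (nmC b) -/q; have := nm_ge0 (a - b); nra.
have [Jr sr hr] := lim_seq_closed Sc Su ur.
exists r; split=> //; apply/eqP; rewrite -subr_eq0; apply/eqP/nm_small => e e0.
have e8 : 0 < e / 8 by rewrite divr_gt0.
have [N NP] := ur _ e8.
have := NP _ (leqnn N); have := NP _ (leqnSn N).
have uN : u N.+1 + u N.+1 = x + u N ** u N.
  by rewrite half /= scalerA -rmorphM /= mulfV // scale1r.
have rq : nm r <= q.
  apply/ler_addgt0Pr => d /ur[M /(_ M (leqnn M))].
  by have := nm_le_add r (u M); have := u_nm M; rewrite (nmC r); lra.
(* The defect of [r] is written through its distances to two consecutive iterates, both below
   [e / 8]. *)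
have -> : r + r - r ** r - x = (r - u N.+1) + (r - u N.+1)
    + ((u N - r) ** u N + r ** (u N - r)).
  rewrite cmulBr cmulBl.
  have -> : x = u N.+1 + u N.+1 - u N ** u N by rewrite uN; lmod.
  by lmod.
move=> h2 h3; apply: (le_trans (nmD _ _)).
have := nmD (r - u N.+1) (r - u N.+1).
have := nmD ((u N - r) ** u N) (r ** (u N - r)).
have := nmM (u N - r) (u N); have := nmM r (u N - r); have := u_nm N.
have := nm_ge0 (u N - r); have := nm_ge0 r; have := nm_ge0 (u N).
rewrite (nmC r); move: (nm (u N - r)) h3 => d h3 n1 n2 n3 n4 n5 n6.
have : nm r * d <= 1 * d by rewrite ler_wpM2r // (le_trans rq) // ltW.
have : d * nm (u N) <= d * 1 by rewrite ler_wpM2l // (le_trans n4) // ltW.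
lra.
Qed.

Ltac cexpand := rewrite ?(cmulDl, cmulDr, cmulNl, cmulNr, cmulZl, cmulZr).

Lemma ideal_setT A : closed_ideal [set: A].
Proof. by split=> //; split=> //; exact: closedT. Qed.

(** * Norm bounds for actions by an algebra *)

Section ActionBound.
Variables (D Q : cstarType R) (e0 : Q) (E : D -> Q).
Hypothesis El : linear E.
Hypothesis EE : forall d d', cstar (E d) ** E d' = cstar e0 ** E (cstar d ** d').
Hypothesis Ee0 : forall d, cstar (E d) ** e0 = cstar e0 ** E (cstar d).

Let ED a b : E (a + b) = E a + E b.
Proof. by have := El 1 a b; rewrite !scale1r. Qed.
Let E0 : E 0 = 0.
Proof. by apply: (addrI (E 0)); rewrite -ED !addr0. Qed.
Let EZ k a : E (k *: a) = k *: E a.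
Proof. by have := El k a 0; rewrite E0 !addr0. Qed.
Let EN a : E (- a) = - E a.
Proof. by rewrite -scaleN1r EZ scaleN1r. Qed.

(** [E d] plays the part of [d] acting on [e0]. The hypothesis on [d] says that [1 + d] is an
    isometry in the unitization, and then [(1 + d) e0] has the norm of [e0]. *)
Lemma action_unitary d : d + cstar d + cstar d ** d = 0 -> nm (e0 + E d) = nm e0.
Proof.
move=> d0; apply/eqP; rewrite -(@eqrXn2 _ 2) ?nm_ge0 // -!nm_star_mul.
rewrite cstarD cmulDl !cmulDr Ee0 EE.
rewrite (_ : _ + _ = cstar e0 ** e0 + cstar e0 ** E (d + cstar d + cstar d ** d)).
  by rewrite d0 E0 cmul0r addr0.
by rewrite !ED !cmulDr; lmod.
Qed.

(** The equation for [r] says [h^2 + (1 - r)^2 = 1], so [1 - r + i h] and [1 - r - i h] are unitary.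
    Half their difference is [i h] and half their sum is [1 - r], which gives the two bounds. *)
Lemma action_sqrt h r : cstar h = h -> cstar r = r -> h ** r = r ** h ->
  r + r - r ** r = h ** h ->
  nm (E h) <= nm e0 /\ nm (e0 - E r) <= nm e0.
Proof.
move=> sh sr hr rh.
pose d := 'i%C *: h - r; pose d' := - 'i%C *: h - r.
have ci : conjc 'i%C = - 'i%C :> R[i] by apply/eqP; rewrite eq_complex /= oppr0 !eqxx.
have sd : cstar d = d' by rewrite cstarB cstarZ sh sr ci.
have sd' : cstar d' = d by rewrite -sd cstarK.
have ii : 'i%C * 'i%C = -1 :> R[i] by rewrite -expr2 sqr_i.
have u1 : nm (e0 + E d) = nm e0.
  apply: action_unitary; rewrite sd /d /d'; cexpand; rewrite hr !scalerA.
  by rewrite mulNr ii opprK scale1r -rh; lmod.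
have u2 : nm (e0 + E d') = nm e0.
  apply: action_unitary; rewrite sd' /d /d'; cexpand; rewrite hr !scalerA.
  by rewrite mulrN ii opprK scale1r -rh; lmod.
have E2 : nm ((2%:C : R[i]) *: E h) <= 2 * nm e0.
  have -> : (2%:C : R[i]) *: E h = - 'i%C *: ((e0 + E d) - (e0 + E d')).
    rewrite /d /d' !ED !EN !EZ.
    rewrite [RHS](_ : _ = - (2 * ('i%C * 'i%C)) *: E h); last by lmod.
    by rewrite ii mulrN1 opprK rmorph_nat.
  rewrite nmZ cabsN cabsi mul1r (le_trans (nmB _ _)) // u1 u2; lra.
have E3 : nm ((2%:C : R[i]) *: (e0 - E r)) <= 2 * nm e0.
  have -> : (2%:C : R[i]) *: (e0 - E r) = (e0 + E d) + (e0 + E d').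
    by rewrite /d /d' !ED !EN !EZ rmorph_nat; lmod.
  by rewrite (le_trans (nmD _ _)) // u1 u2; lra.
by move: E2 E3; rewrite !nmZr //; lra.
Qed.

(** A self-adjoint [h] is scaled below norm 1 and handled by [action_sqrt]. For general [d], the
    square of the norm of [E d] is the norm of [cstar e0 ** E (cstar d ** d)], where the
    self-adjoint case applies. *)
Lemma action_bound d : nm (E d) <= nm d * nm e0.
Proof.
have sa h : cstar h = h -> nm (E h) <= nm h * nm e0.
  move=> sh; apply/ler_addgt0Pr => e e_gt0.
  (* The margin [s] brings the norm of [h / (nm h + s)] below 1 and costs at most [e] in the
     bound. *)
  pose s := e / (nm e0 + 1).
  have n1 : 0 < nm e0 + 1 by have := nm_ge0 e0; lra.
  have s0 : 0 < s by rewrite divr_gt0.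
  have hs : 0 < nm h + s by have := nm_ge0 h; lra.
  pose h' := ((nm h + s)^-1)%:C *: h.
  have sh' : cstar h' = h' by rewrite cstarZ sh conjc_real.
  have nh' : nm h' < 1.
    by rewrite nmZr ?invr_ge0 ?ltW // mulrC ltr_pdivrMr // mul1r; lra.
  have [r [_ sr hr rh]] := sqrt_iteration (ideal_setT D) I sh' nh'.
  have [] := action_sqrt sh' sr hr rh.
  rewrite /h' EZ nmZr ?invr_ge0 ?(ltW hs) // ler_pdivrMl // mulrC => le1 _.
  apply: (le_trans le1); rewrite mulrC mulrDl lerD2l //.
  by rewrite /s mulrAC ler_pdivrMr // ler_wpM2l //; lra.
rewrite -(@ler_pXn2r _ 2) ?nnegrE ?mulr_ge0 ?nm_ge0 // -nm_star_mul EE.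
apply: (le_trans (nmM _ _)); rewrite nm_star.
apply: (@le_trans _ _ (nm e0 * (nm (cstar d ** d) * nm e0))).
  by rewrite ler_wpM2l ?nm_ge0 // sa // cstarM cstarK.
by rewrite nm_star_mul exprMn !expr2; lra.
Qed.

End ActionBound.

Section StarHom.
Variables (A B : cstarType R) (f : A -> B).
Hypothesis fh : star_hom f.

Lemma star_homD a b : f (a + b) = f a + f b.
Proof. by have := star_hom_linear fh 1 a b; rewrite !scale1r. Qed.
Lemma star_hom0 : f 0 = 0.
Proof. by apply: (addrI (f 0)); rewrite -star_homD !addr0. Qed.
Lemma star_homZ k a : f (k *: a) = k *: f a.
Proof. by have := star_hom_linear fh k a 0; rewrite star_hom0 !addr0. Qed.
Lemma star_homN a : f (- a) = - f a.
Proof. by rewrite -scaleN1r star_homZ scaleN1r. Qed.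
Lemma star_homB a b : f (a - b) = f a - f b.
Proof. by rewrite star_homD star_homN. Qed.

(** [b |-> f (b ** c)] is an action on [f c], hence bounded by [nm b]. At [b = cstar a] and [c = a]
    the C*-identity turns this into the claim, after one factor [nm (f a)] is cancelled. *)
Lemma star_hom_le a : nm (f a) <= nm a.
Proof.
have le1 b c : nm (f (b ** c)) <= nm b * nm (f c).
  apply: (@action_bound A B (f c) (fun d => f (d ** c))) => [k x y|d d'|d].
  - by rewrite cmulDl cmulZl star_homD star_homZ.
  - by rewrite !(star_homM fh) cstarM !(star_hom_star fh) !cmulA.
  - by rewrite !(star_homM fh) cstarM !(star_hom_star fh) !cmulA.
have := le1 (cstar a) a; rewrite (star_homM fh) (star_hom_star fh).
rewrite nm_star_mul nm_star expr2.
have [->|fa] := eqVneq (nm (f a)) 0; first by rewrite nm_ge0.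
by rewrite ler_pM2r // lt_def fa nm_ge0.
Qed.

End StarHom.

Lemma star_iso_nm A B (f : A -> B) : star_hom f -> bijective f ->
  forall a, nm (f a) = nm a.
Proof.
move=> fh [g fK gK] a; apply/eqP; rewrite eq_le star_hom_le //=.
have gh : star_hom g.
  have inj := can_inj gK; split.
  - by move=> k x y; rewrite -{1}(gK x) -{1}(gK y) -(star_hom_linear fh) fK.
  - by move=> x y; rewrite -{1}(gK x) -{1}(gK y) -(star_homM fh) fK.
  - by move=> x; rewrite -{1}(gK x) -(star_hom_star fh) fK.
by rewrite -{1}(fK a) star_hom_le.
Qed.

Section Bistar.
Variables (A B Q : cstarType R) (t : A -> B -> Q).
Hypothesis th : bistar_hom t.

Lemma bistarDl a a' b : t (a + a') b = t a b + t a' b.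
Proof. by have := bistar_linear_l th b 1 a a'; rewrite !scale1r. Qed.
Lemma bistarDr a b b' : t a (b + b') = t a b + t a b'.
Proof. by have := bistar_linear_r th a 1 b b'; rewrite !scale1r. Qed.
Lemma bistar0l b : t 0 b = 0.
Proof. by apply: (addrI (t 0 b)); rewrite -bistarDl !addr0. Qed.
Lemma bistar0r a : t a 0 = 0.
Proof. by apply: (addrI (t a 0)); rewrite -bistarDr !addr0. Qed.
Lemma bistarZl k a b : t (k *: a) b = k *: t a b.
Proof. by have := bistar_linear_l th b k a 0; rewrite bistar0l !addr0. Qed.
Lemma bistarZr k a b : t a (k *: b) = k *: t a b.
Proof. by have := bistar_linear_r th a k b 0; rewrite bistar0r !addr0. Qed.
Lemma bistarNl a b : t (- a) b = - t a b.
Proof. by rewrite -scaleN1r bistarZl scaleN1r. Qed.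
Lemma bistarNr a b : t a (- b) = - t a b.
Proof. by rewrite -scaleN1r bistarZr scaleN1r. Qed.
Lemma bistarBl a a' b : t (a - a') b = t a b - t a' b.
Proof. by rewrite bistarDl bistarNl. Qed.
Lemma bistarBr a b b' : t a (b - b') = t a b - t a b'.
Proof. by rewrite bistarDr bistarNr. Qed.

(** The bound is first proved on [t (a1 ** a2) (b1 ** b2)], where each outer factor acts on what
    remains. As in [star_hom_le], the C*-identity brings it back to single elements. *)
Lemma bistar_le a b : nm (t a b) <= nm a * nm b.
Proof.
have le1 a1 a2 b1 b2 : nm (t (a1 ** a2) (b1 ** b2)) <=
    nm a1 * (nm b1 * nm (t a2 b2)).
  apply: (@le_trans _ _ (nm a1 * nm (t a2 (b1 ** b2)))).
    apply: (@action_bound A Q _ (fun d => t (d ** a2) (b1 ** b2))) => [k x y|d d'|d].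
    + by rewrite cmulDl cmulZl bistarDl bistarZl.
    + by rewrite -!(bistar_star th) -!(bistarM th) !cstarM !cmulA.
    + by rewrite -!(bistar_star th) -!(bistarM th) !cstarM !cmulA.
  rewrite ler_wpM2l ?nm_ge0 //.
  apply: (@action_bound B Q _ (fun d => t a2 (d ** b2))) => [k x y|d d'|d].
  + by rewrite cmulDl cmulZl bistarDr bistarZr.
  + by rewrite -!(bistar_star th) -!(bistarM th) !cstarM !cmulA.
  + by rewrite -!(bistar_star th) -!(bistarM th) !cstarM !cmulA.
have := le1 (cstar a) a (cstar b) b; rewrite (bistarM th) (bistar_star th).
rewrite nm_star_mul !nm_star expr2 mulrA.
have [->|fa] := eqVneq (nm (t a b)) 0; first by rewrite mulr_ge0 ?nm_ge0.
by rewrite ler_pM2r // lt_def fa nm_ge0.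
Qed.

End Bistar.

Lemma cmul_sumr A (I : Type) (r : seq I) (F : I -> A) x :
  (\sum_(i <- r) F i) ** x = \sum_(i <- r) F i ** x.
Proof.
by elim: r => [|i r IH]; rewrite ?big_nil ?cmul0l // !big_cons cmulDl IH.
Qed.

(** With [T x] for [x - f ** x], the element [T z ** cstar (T z)] is [T] applied to the adjoint of
    [T (z ** cstar z)], and contractivity discards the outer [T]. Smallness on [z ** cstar z] thus
    passes to [z]. *)
Lemma contraction_sqr A (f : A) : (forall x, nm (x - f ** x) <= nm x) ->
  forall z, nm (z - f ** z) ^+ 2 <= nm (z ** cstar z - f ** (z ** cstar z)).
Proof.
move=> fc z; rewrite -nm_mul_star.
set w := _ - _ ** (z ** _); have -> : (z - f ** z) ** cstar (z - f ** z) =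
    cstar (cstar w - f ** cstar w).
  rewrite /w !(cstarB, cstarM, cstarK) !(cmulBl, cmulBr, cmulA).
  by lmod.
by rewrite nm_star (le_trans (fc _)) // nm_star.
Qed.

(** A mean ergodic argument. The operator [1 - r] attached to [h] is a contraction, and the averages
    of its powers tend to 0 on multiples of [r], because the sum telescopes. Smallness on [r ** r]
    then passes to [r], to [h ** h = r + r - r ** r], and by [contraction_sqr] to [h] and to
    [b']. *)
Lemma approx_unit A (J : set A) (b : A) (e : R) : closed_ideal J -> J b -> 0 < e ->
  exists f, [/\ J f, nm (b - f ** b) < e & forall x, nm (x - f ** x) <= nm x].
Proof.
move=> Ji Jb e0; have [[Jc J0 JD JZ] JMl JMr JS] := Ji.
have b1 : 0 < nm b + 1 by have := nm_ge0 b; lra.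
pose b' := ((nm b + 1)^-1)%:C *: b; pose h := b' ** cstar b'.
have Jh : J h by apply/JMr/JZ.
have sh : cstar h = h by rewrite cstarM cstarK.
have nb' : nm b' < 1.
  by rewrite nmZr ?invr_ge0 ?(ltW b1) // ltr_pdivrMl // mulr1; lra.
have nh : nm h < 1.
  by rewrite nm_mul_star expr2; have := nm_ge0 b'; nra.
have [r [Jr sr hr rh]] := sqrt_iteration Ji Jh sh nh.
have rc x : nm (x - r ** x) <= nm x.
  have [|d d'|d|] := @action_sqrt A A x (fun d => d ** x) _ _ _ h r sh sr hr rh.
  - by move=> k c d; rewrite cmulDl cmulZl.
  - by rewrite !cstarM !cmulA.
  - by rewrite !cstarM !cmulA.
  by [].
(* [1 - p n] is the [n]-th power of [1 - r]; without constant term, [p n] stays in [J]. *)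
pose p n := iter n (fun q => q + r - q ** r) 0.
have Jp n : J (p n).
  elim: n => //= n IH; apply: (JD); first exact: (JD).
  by rewrite -scaleN1r; apply/JZ/JMr.
have pc n x : nm (x - p n ** x) <= nm x.
  elim: n x => [|n IH] x /=; first by rewrite cmul0l subr0.
  apply: le_trans (rc x); apply: le_trans (IH (x - r ** x)).
  by rewrite (_ : x - _ = x - r ** x - p n ** (x - r ** x)) //; cexpand;
    rewrite cmulA; lmod.
pose f n := ((n.+1%:R)^-1)%:C *: \sum_(j < n.+1) p j.
have n1 n : 0 < n.+1%:R :> R by [].
have fE n x : x - f n ** x = ((n.+1%:R)^-1)%:C *: \sum_(j < n.+1) (x - p j ** x).
  rewrite big_split /= sumrN scalerBr sumr_const card_ord.
  have -> : x *+ n.+1 = (n.+1%:R)%:C *: x by rewrite rmorph_nat scaler_nat.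
  rewrite scalerA -rmorphM /= mulVf // scale1r.
  by rewrite /f cmulZl cmul_sumr.
have fc n x : nm (x - f n ** x) <= nm x.
  rewrite fE nmZr ?invr_ge0 // ler_pdivrMl //.
  apply: (le_trans (nm_sum _ _)).
  apply: (@le_trans _ _ (\sum_(j < n.+1) nm x)).
    by apply: ler_sum => i _; exact: pc.
  by rewrite sumr_const card_ord mulr_natl.
have fr n y : nm (r ** y - f n ** (r ** y)) <= 2 / n.+1%:R * nm y.
  rewrite fE (_ : \sum_(j < _) _ = p n.+1 ** y).
    rewrite nmZr ?invr_ge0 // mulrAC mulrC ler_wpM2r ?invr_ge0 //.
    by have := pc n.+1 y; have := nm_le_add (p n.+1 ** y) y; rewrite nmC; lra.
  elim: n.+1 => [|m IH]; first by rewrite big_ord0 cmul0l.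
  by rewrite big_ord_recr /= IH; cexpand; rewrite cmulA; lmod.
have Jf n : J (f n).
  by apply: JZ; elim/big_ind: _ => // *; exact: JD.
pose eta := Num.min 1 (e / (nm b + 1)).
have eta0 : 0 < eta by rewrite lt_min ltr01 divr_gt0.
have eta1 : eta <= 1 by rewrite ge_min lexx.
(* The fourth power comes from two squarings, from [b'] to [h] and from [h] to [h ** h]; the factor
   4 covers the error [k + k + k^2] of [r + r - r ** r]. *)
pose k := eta ^+ 4 / 4.
have k0 : 0 < k by rewrite divr_gt0 // exprn_gt0.
have k1 : k < 1 by rewrite ltr_pdivrMr // mul1r (le_lt_trans (exprn_ile1 4 (ltW eta0) eta1)) //; lra.
have [n nP] : exists n : nat, 2 / n.+1%:R * (nm r + 1) < k ^+ 2.
  exists (Num.bound (2 * (nm r + 1) / k ^+ 2)).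
  have rr := nm_ge0 r.
  have D0 : 0 <= 2 * (nm r + 1) / k ^+ 2.
    by apply: divr_ge0; [lra | rewrite exprn_ge0 // ltW].
  have := archi_boundP D0; set N := Num.bound _ => NP.
  have k2 : 0 < k ^+ 2 by rewrite exprn_gt0.
  by rewrite mulrAC ltr_pdivrMr // -natr1; move: NP; rewrite ltr_pdivrMr //; lra.
exists (f n); split => //.
have rr := nm_ge0 r.
have n2 : 0 <= 2 / n.+1%:R :> R by rewrite divr_ge0.
have frr : nm (r ** r - f n ** (r ** r)) < k ^+ 2.
  by apply: le_lt_trans nP; apply: (le_trans (fr _ _)); rewrite ler_wpM2l //; lra.
have kk : k ^+ 2 < k by rewrite expr2; nra.
have fr1 : nm (r - f n ** r) < k.
  rewrite -(@ltr_pXn2r _ 2) ?nnegrE ?nm_ge0 ?(ltW k0) //.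
  by apply: le_lt_trans frr; have := contraction_sqr (fc n) r; rewrite sr.
have fhh : nm (h ** h - f n ** (h ** h)) < 4 * k.
  rewrite -rh (_ : _ - _ = (r - f n ** r) + (r - f n ** r)
      - (r ** r - f n ** (r ** r))); last by cexpand; lmod.
  have := nmB ((r - f n ** r) + (r - f n ** r)) (r ** r - f n ** (r ** r)).
  have := nmD (r - f n ** r) (r - f n ** r); lra.
have fb : nm (b' - f n ** b') < eta.
  rewrite -(@ltr_pXn2r _ 4) ?nnegrE ?nm_ge0 ?(ltW eta0) //.
  have -> : eta ^+ 4 = 4 * k by rewrite /k; lra.
  apply: le_lt_trans fhh; have := contraction_sqr (fc n) h; rewrite sh.
  apply: le_trans; rewrite (exprM _ 2 2) ler_pXn2r ?nnegrE ?exprn_ge0 ?nm_ge0 //.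
  exact: contraction_sqr.
have -> : b - f n ** b = (nm b + 1)%:C *: (b' - f n ** b').
  by rewrite /b' cmulZr -scalerBr scalerA -rmorphM /= mulfV ?scale1r // gt_eqF.
rewrite nmZr ?(ltW b1) // -ltr_pdivlMl // mulrC (lt_le_trans fb) //.
by rewrite ge_min lexx orbT.
Qed.

Lemma closed_ideal_sub A (J : set A) a b : closed_ideal J -> J a -> J b -> J (a - b).
Proof. by case=> -[_ _ JD JZ] _ _ _ Ja Jb; rewrite -scaleN1r; exact/JD/JZ. Qed.

Lemma closed_idealI A (J L : set A) :
  closed_ideal J -> closed_ideal L -> closed_ideal (J `&` L).
Proof.
move=> [[Jc J0 JD JZ] JMl JMr JS] [[Lc L0 LD LZ] LMl LMr LS].
split; first split.
- exact: closedI.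
- by [].
- by move=> a b [? ?] [? ?]; split; [exact: JD|exact: LD].
- by move=> k a [? ?]; split; [exact: JZ|exact: LZ].
- by move=> a b [? ?]; split; [exact: JMl|exact: LMl].
- by move=> a b [? ?]; split; [exact: JMr|exact: LMr].
- by move=> a [? ?]; split; [exact: JS|exact: LS].
Qed.

Lemma closed_ideal_bigcap A (F : set (set A)) :
  (forall J, F J -> closed_ideal J) -> closed_ideal (\bigcap_(J in F) J).
Proof.
move=> Fi; split; first split.
- apply/closedP => a aF J FJ; have /closedP := subspace_closed (ideal_subspace (Fi _ FJ)).
  by apply => e /aF[b bF ab]; exists b => //; exact: bF.
- by move=> J /Fi/ideal_subspace/subspace0.
- by move=> a b aF bF J FJ; apply: (subspaceD (ideal_subspace (Fi _ FJ))); [exact: aF|exact: bF].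
- by move=> k a aF J FJ; apply: (subspaceZ (ideal_subspace (Fi _ FJ))); exact: aF.
- by move=> a b bF J FJ; apply: (idealMl (Fi _ FJ)); exact: bF.
- by move=> a b bF J FJ; apply: (idealMr (Fi _ FJ)); exact: bF.
- by move=> a aF J FJ; apply: (ideal_star (Fi _ FJ)); exact: aF.
Qed.

Lemma ideal_gen_ideal A (G : set A) : closed_ideal (ideal_gen G).
Proof. by apply: closed_ideal_bigcap => J []. Qed.

Lemma sub_ideal_gen A (G : set A) : G `<=` ideal_gen G.
Proof. by move=> a Ga J [_]; apply. Qed.

Lemma ideal_gen_sub A (G J : set A) : closed_ideal J -> G `<=` J -> ideal_gen G `<=` J.
Proof. by move=> Ji GJ a; apply. Qed.

Lemma closed_span_subspace A (G : set A) : closed_subspace (closed_span G).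
Proof.
split.
- apply/closedP => a aF J [FJ GJ]; have /closedP := subspace_closed FJ.
  by apply => e /aF[b bF ab]; exists b => //; apply: bF.
- by move=> J [/subspace0].
- by move=> a b aF bF J FJ; apply: (subspaceD (proj1 FJ)); [exact: aF|exact: bF].
- by move=> k a aF J FJ; apply: (subspaceZ (proj1 FJ)); exact: aF.
Qed.

Lemma sub_closed_span A (G : set A) : G `<=` closed_span G.
Proof. by move=> a Ga J [_]; apply. Qed.

Lemma closed_span_sub A (G J : set A) :
  closed_subspace J -> G `<=` J -> closed_span G `<=` J.
Proof. by move=> Ji GJ a; apply. Qed.

Definition aclosure A (S : set A) : set A :=
  [set a | forall e : R, 0 < e -> exists2 b, S b & nm (a - b) < e].

Lemma sub_aclosure A (S : set A) : S `<=` aclosure S.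
Proof. by move=> a Sa e e0; exists a => //; rewrite subrr nm0. Qed.

Lemma aclosure_closed A (S : set A) : closed (aclosure S).
Proof.
apply/closedP => a aS e e0; have e2 : 0 < e / 2 by rewrite divr_gt0.
have [b bS ab] := aS _ e2; have [c cS bc] := bS _ e2; exists c => //.
by have := nm_tri a b c; lra.
Qed.

Lemma aclosure_subspace A (S : set A) : S 0 ->
  (forall a b, S a -> S b -> S (a + b)) ->
  (forall (k : R[i]) a, S a -> S (k *: a)) -> closed_subspace (aclosure S).
Proof.
move=> S0 SD SZ; split => [||a b aS bS e e0|k a aS e e0].
- exact: aclosure_closed.
- exact: sub_aclosure.
- have e2 : 0 < e / 2 by rewrite divr_gt0.
  have [a' a'S aa'] := aS _ e2; have [b' b'S bb'] := bS _ e2.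
  exists (a' + b'); first exact: SD.
  by have := nmD (a - a') (b - b'); rewrite opprD addrACA; lra.
- have k0 : 0 < cabs k + 1 by have := cabs_ge0 k; lra.
  have ek : 0 < e / (cabs k + 1) by rewrite divr_gt0.
  have [b bS ab] := aS _ ek; exists (k *: b); first exact: SZ.
  rewrite -scalerBr nmZ; have := nm_ge0 (a - b).
  by move: ab; rewrite ltr_pdivlMr //; nra.
Qed.

Lemma aclosure_ideal A (S : set A) : S 0 ->
  (forall a b, S a -> S b -> S (a + b)) ->
  (forall (k : R[i]) a, S a -> S (k *: a)) ->
  (forall a b, S b -> S (a ** b)) -> (forall a b, S a -> S (a ** b)) ->
  (forall a, S a -> S (cstar a)) -> closed_ideal (aclosure S).
Proof.
move=> S0 SD SZ SMl SMr SS; split; first exact: aclosure_subspace.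
- move=> a b bS e e0.
  have k0 : 0 < nm a + 1 by have := nm_ge0 a; lra.
  have [|c cS bc] := bS (e / (nm a + 1)); first by rewrite divr_gt0.
  exists (a ** c); first exact: SMl.
  rewrite -cmulBr; have := nmM a (b - c); have := nm_ge0 (b - c).
  by move: bc; rewrite ltr_pdivlMr //; nra.
- move=> b a bS e e0.
  have k0 : 0 < nm a + 1 by have := nm_ge0 a; lra.
  have [|c cS bc] := bS (e / (nm a + 1)); first by rewrite divr_gt0.
  exists (c ** a); first exact: SMr.
  rewrite -cmulBl; have := nmM (b - c) a; have := nm_ge0 (b - c).
  by move: bc; rewrite ltr_pdivlMr //; nra.
- move=> a aS e /aS[b bS ab]; exists (cstar b); first exact: SS.
  by rewrite -cstarB nm_star.
Qed.

Definition dist A (J : set A) (a : A) : R := inf [set nm (a + j) | j in J].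

Section Dist.
Variables (A : cstarType R) (J : set A).
Hypothesis Ji : closed_ideal J.

Let J0 : J 0. Proof. by case: Ji => -[]. Qed.

Lemma dist_has_inf a : has_inf [set nm (a + j) | j in J].
Proof.
split; first by exists (nm (a + 0)), 0.
by exists 0 => _ [j Jj <-]; exact: nm_ge0.
Qed.

Lemma dist_le a j : J j -> dist J a <= nm (a + j).
Proof.
move=> Jj; apply: ge_inf; last by exists j.
by case: (dist_has_inf a).
Qed.

Lemma dist_lt a r : dist J a < r -> exists2 j, J j & nm (a + j) < r.
Proof.
move=> ar; have ra : 0 < r - dist J a by rewrite subr_gt0.
have [_ [j Jj <-]] := inf_adherent ra (dist_has_inf a).
by move=> aj; exists j => //; move: aj; rewrite -/(dist J a); lra.
Qed.

Lemma dist_ge0 a : 0 <= dist J a.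
Proof.
apply: lb_le_inf; first by case: (dist_has_inf a).
by move=> _ [j _ <-]; exact: nm_ge0.
Qed.

Lemma dist_leP a r : (forall e, 0 < e -> exists2 j, J j & nm (a + j) < r + e) ->
  dist J a <= r.
Proof.
move=> h; apply/ler_addgt0Pr => e /h[j Jj ar].
by rewrite (le_trans (dist_le a Jj)) // ltW.
Qed.

Lemma dist_eq0 a : dist J a <= 0 <-> J a.
Proof.
split=> [a0|Ja]; last first.
  have JNa : J (- a) by rewrite -scaleN1r; case: Ji => -[_ _ _ JZ] *; exact: JZ.
  by have := dist_le a JNa; rewrite subrr nm0.
have /closedP := subspace_closed (ideal_subspace Ji); apply => e e0.
have [j Jj aj] := dist_lt (le_lt_trans a0 e0).
exists (- j); last by rewrite opprK.
by rewrite -scaleN1r; case: Ji => -[_ _ _ JZ] *; exact: JZ.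
Qed.

Lemma distD a b : dist J (a + b) <= dist J a + dist J b.
Proof.
apply: dist_leP => e e0; have e2 : 0 < e / 2 by rewrite divr_gt0.
have [|j Jj aj] := @dist_lt a (dist J a + e / 2); first by rewrite ltrDl.
have [|l Jl bl] := @dist_lt b (dist J b + e / 2); first by rewrite ltrDl.
exists (j + l); first by case: Ji => -[_ _ JD _] *; exact: JD.
by rewrite addrACA; have := nmD (a + j) (b + l); lra.
Qed.

Lemma distZ k a : dist J (k *: a) = cabs k * dist J a.
Proof.
have JZ : forall (k : R[i]) a, J a -> J (k *: a) by case: Ji => -[].
have le l b : dist J (l *: b) <= cabs l * dist J b.
  apply: dist_leP => e e0.
  have l0 : 0 < cabs l + 1 by have := cabs_ge0 l; lra.
  have [|j Jj bj] := @dist_lt b (dist J b + e / (cabs l + 1)).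
    by rewrite ltrDl divr_gt0.
  exists (l *: j); first exact: JZ.
  rewrite -scalerDr nmZ; have := cabs_ge0 l; move: bj.
  rewrite -ltrBlDl ltr_pdivlMr // => bj l0'.
  have := nm_ge0 (b + j); have := dist_le b Jj; nra.
apply/eqP; rewrite eq_le le /=.
have [->|k0] := eqVneq k 0.
  by rewrite /cabs normr0 mul0r scale0r dist_ge0.
have := le k^-1 (k *: a); rewrite scalerA mulVf // scale1r.
have kk : cabs k^-1 = (cabs k)^-1.
  by apply: (@complexI R); rewrite -cabsE normfV cabsE fmorphV.
have ck : 0 < cabs k by rewrite lt_def cabs_ge0 andbT; apply: contra k0 => /eqP/cabs_eq0 ->.
by rewrite kk mulrC ler_pdivlMr // mulrC.
Qed.

Lemma distM a b : dist J (a ** b) <= dist J a * dist J b.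
Proof.
apply: dist_leP => e e0.
pose M := dist J a + dist J b + 1.
have [a0 b0] := (dist_ge0 a, dist_ge0 b).
pose d := Num.min 1 (e / (M + 1)).
have M0 : 0 < M + 1 by rewrite /M; lra.
have d0 : 0 < d by rewrite lt_min ltr01 divr_gt0.
have d1 : d <= 1 by rewrite ge_min lexx.
have de : d * (M + 1) <= e by rewrite -ler_pdivlMr // ge_min lexx orbT.
have [|j Jj aj] := @dist_lt a (dist J a + d); first by rewrite ltrDl.
have [|l Jl bl] := @dist_lt b (dist J b + d); first by rewrite ltrDl.
exists (a ** l + j ** (b + l)).
  by case: Ji => -[_ _ JD _] JMl JMr _; apply: JD; [exact: JMl|exact: JMr].
have -> : a ** b + (a ** l + j ** (b + l)) = (a + j) ** (b + l).
  by cexpand; lmod.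
apply: (le_lt_trans (nmM _ _)).
have := nm_ge0 (a + j); have := nm_ge0 (b + l); rewrite /M in de *; nra.
Qed.

Lemma dist_star a : dist J (cstar a) = dist J a.
Proof.
have le b : dist J (cstar b) <= dist J b.
  apply: dist_leP => e e0.
  have [|j Jj bj] := @dist_lt b (dist J b + e); first by rewrite ltrDl.
  exists (cstar j); first exact: (ideal_star Ji).
  by rewrite -cstarD nm_star.
by apply/eqP; rewrite eq_le le -{1}(cstarK a) le.
Qed.

(** This C*-identity is what makes the quotient a C*-algebra. For an approximate unit [f] of [J],
    the element [a - a ** cstar f] represents the class of [a]. By [contraction_sqr] its squared
    norm is at most that of [h - f ** h], and [1 - f] nearly kills the correction [j] added to
    [h]. *)
Lemma dist_star_mul a : dist J (cstar a ** a) = dist J a ^+ 2.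
Proof.
apply/eqP; rewrite eq_le; apply/andP; split.
  by rewrite (le_trans (distM _ _)) // dist_star expr2.
apply/ler_addgt0Pr => e e0; have e2 : 0 < e / 2 by rewrite divr_gt0.
set h := cstar a ** a.
have [|j Jj hj] := @dist_lt h (dist J h + e / 2); first by rewrite ltrDl.
have [f [Jf jf fc]] := approx_unit Ji Jj e2.
have Jaf : J (- (a ** cstar f)).
  rewrite -scaleN1r; apply: (subspaceZ (ideal_subspace Ji)).
  exact/(idealMl Ji)/(ideal_star Ji).
apply: (@le_trans _ _ (nm (a - a ** cstar f) ^+ 2)).
  by rewrite ler_pXn2r ?nnegrE ?nm_ge0 ?dist_ge0 ?dist_le.
have -> : nm (a - a ** cstar f) = nm (cstar a - f ** cstar a).
  by rewrite -nm_star cstarB cstarM cstarK.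
apply: (le_trans (contraction_sqr fc _)); rewrite cstarK -/h.
have -> : h - f ** h = (h + j - f ** (h + j)) - (j - f ** j).
  by cexpand; lmod.
have := nmB (h + j - f ** (h + j)) (j - f ** j); have := fc (h + j); lra.
Qed.

End Dist.

(** Iterating [a |-> cstar a ** a] raises the seminorms to the powers [2^n] while the constant
    stays, so [exp2_cmp] removes it. *)
Lemma seminorm_cmp A (p q : A -> R) (C : R) :
  (forall a, 0 <= p a) -> (forall a, 0 <= q a) ->
  (forall a, p (cstar a ** a) = p a ^+ 2) ->
  (forall a, q (cstar a ** a) <= q a ^+ 2) ->
  (forall a, p a <= C * q a) -> forall a, p a <= q a.
Proof.
move=> p0 q0 pS qS pq a; have C0 n : exists b,
    p b = p a ^+ (2 ^ n) /\ q b <= q a ^+ (2 ^ n).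
  elim: n => [|n [b [pb qb]]]; first by exists a.
  exists (cstar b ** b); rewrite pS pb -exprM mulnC -expnS; split => //.
  rewrite (le_trans (qS _)) // expnS mulnC exprM ler_pXn2r // nnegrE //.
  by rewrite exprn_ge0.
apply: (@exp2_cmp _ _ _ `|C|) => // n; have [b [<- qb]] := C0 n.
apply: (le_trans (pq b)); apply: (@le_trans _ _ (`|C| * q b)).
  by rewrite ler_wpM2r // ler_norm.
by rewrite ler_wpM2l.
Qed.

(** A correction in both ideals is [f ** l], with [l] nearly optimal for [L] and [f] in [J] an
    approximate unit for a nearly optimal [j]. This yields the bound with constant 3, one for
    [1 - f] and two for [f], and [seminorm_cmp] reduces 3 to 1. *)
Lemma dist_meet A (J L : set A) a : closed_ideal J -> closed_ideal L ->
  dist (J `&` L) a <= Num.max (dist J a) (dist L a).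
Proof.
move=> Ji Li; have JLi := closed_idealI Ji Li.
apply: (@seminorm_cmp _ (dist (J `&` L))
   (fun a => Num.max (dist J a) (dist L a)) 3) => {}a.
- exact: dist_ge0.
- by rewrite le_max dist_ge0.
- exact: dist_star_mul.
- by rewrite !dist_star_mul // ge_max !ler_pXn2r ?nnegrE ?dist_ge0 ?le_max ?dist_ge0 ?lexx ?orbT.
set m := Num.max _ _; apply: dist_leP => // e e0.
have e4 : 0 < e / 4 by rewrite divr_gt0.
have Jm : dist J a <= m by rewrite le_max lexx.
have Lm : dist L a <= m by rewrite le_max lexx orbT.
have [|j Jj aj] := @dist_lt _ _ Ji a (dist J a + e / 4); first by rewrite ltrDl.
have [|l Ll al] := @dist_lt _ _ Li a (dist L a + e / 4); first by rewrite ltrDl.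
have [f [Jf jf fc]] := approx_unit Ji Jj e4.
exists (f ** l); first by split; [exact: (idealMr Ji)|exact: (idealMl Li)].
have -> : a + f ** l = (a + j - f ** (a + j)) - (j - f ** j) + f ** (a + l).
  by cexpand; lmod.
have := nmD ((a + j - f ** (a + j)) - (j - f ** j)) (f ** (a + l)).
have := nmB (a + j - f ** (a + j)) (j - f ** j).
have := fc (a + j); have := fc (a + l).
by have := nm_le_add (f ** (a + l)) (a + l); rewrite nmC; lra.
Qed.

End CStarBasics.

(** * C*-algebras from carriers with a seminorm *)

Section Builder.
Variable R : realType.

(* A C*-algebra presented up to an equivalence [peq]: a carrier on which the
   axioms hold modulo [peq], complete for the seminorm [pnorm]. *)
Record precstar := PreCStar {
  pcar : Type ;
  peq : pcar -> pcar -> Prop ;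
  pzero : pcar ;
  padd : pcar -> pcar -> pcar ;
  pscale : R[i] -> pcar -> pcar ;
  pmul : pcar -> pcar -> pcar ;
  pstar : pcar -> pcar ;
  pnorm : pcar -> R ;
  peq_refl : forall u, peq u u ;
  peq_sym : forall u v, peq u v -> peq v u ;
  peq_trans : forall u v w, peq u v -> peq v w -> peq u w ;
  padd_eq : forall u u' v v', peq u u' -> peq v v' -> peq (padd u v) (padd u' v') ;
  pscale_eq : forall k u u', peq u u' -> peq (pscale k u) (pscale k u') ;
  pmul_eq : forall u u' v v', peq u u' -> peq v v' -> peq (pmul u v) (pmul u' v') ;
  pstar_eq : forall u u', peq u u' -> peq (pstar u) (pstar u') ;
  pnorm_eq : forall u u', peq u u' -> pnorm u = pnorm u' ;
  paddA : forall u v w, peq (padd u (padd v w)) (padd (padd u v) w) ;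
  paddC : forall u v, peq (padd u v) (padd v u) ;
  padd0 : forall u, peq (padd pzero u) u ;
  paddN : forall u, peq (padd (pscale (-1) u) u) pzero ;
  pscaleA : forall k l u, peq (pscale k (pscale l u)) (pscale (k * l) u) ;
  pscale1 : forall u, peq (pscale 1 u) u ;
  pscaleDr : forall k u v, peq (pscale k (padd u v)) (padd (pscale k u) (pscale k v)) ;
  pscaleDl : forall u k l, peq (pscale (k + l) u) (padd (pscale k u) (pscale l u)) ;
  pmulA : forall u v w, peq (pmul u (pmul v w)) (pmul (pmul u v) w) ;
  pmulDl : forall u v w, peq (pmul (padd u v) w) (padd (pmul u w) (pmul v w)) ;
  pmulDr : forall u v w, peq (pmul u (padd v w)) (padd (pmul u v) (pmul u w)) ;
  pmulZl : forall k u v, peq (pmul (pscale k u) v) (pscale k (pmul u v)) ;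
  pmulZr : forall k u v, peq (pmul u (pscale k v)) (pscale k (pmul u v)) ;
  pstarK : forall u, peq (pstar (pstar u)) u ;
  pstarD : forall u v, peq (pstar (padd u v)) (padd (pstar u) (pstar v)) ;
  pstarZ : forall k u, peq (pstar (pscale k u)) (pscale (conjc k) (pstar u)) ;
  pstarM : forall u v, peq (pstar (pmul u v)) (pmul (pstar v) (pstar u)) ;
  pnorm_ge0 : forall u, 0 <= pnorm u ;
  pnormD : forall u v, pnorm (padd u v) <= pnorm u + pnorm v ;
  pnormZ : forall k u, pnorm (pscale k u) = cabs k * pnorm u ;
  pnorm0 : forall u, pnorm u = 0 -> peq u pzero ;
  pnormM : forall u v, pnorm (pmul u v) <= pnorm u * pnorm v ;
  pnorm_star : forall u, pnorm (pmul (pstar u) u) = pnorm u ^+ 2 ;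
  pcomplete : forall u : nat -> pcar,
    (forall e : R, 0 < e -> exists N, forall m n, (N <= m)%N -> (N <= n)%N ->
       pnorm (padd (u m) (pscale (-1) (u n))) < e) ->
    exists l, forall e : R, 0 < e -> exists N, forall n, (N <= n)%N ->
       pnorm (padd (u n) (pscale (-1) l)) < e }.

Section Quotient.
Variable P : precstar.

Definition pquot : Type := {S : set (pcar P) | exists v, S = @peq P v}.

Definition pclass (v : pcar P) : pquot := exist _ (@peq P v) (ex_intro _ v erefl).

Definition prepr (S : pquot) : pcar P := sval (cid (svalP S)).

Lemma pclass_eq u v : peq u v -> pclass u = pclass v.
Proof.
move=> uv; have e : @peq P u = @peq P v.
  apply/seteqP; split => w; first exact: peq_trans (peq_sym uv).
  exact: peq_trans.
by apply: eq_sig_hprop => [S ? ?|//]; exact: Prop_irrelevance.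
Qed.

Lemma preprK S : pclass (prepr S) = S.
Proof.
apply: eq_sig_hprop => [T ? ?|]; first exact: Prop_irrelevance.
by rewrite /prepr; case: cid => /= v ->.
Qed.

Lemma pclass_inj u v : pclass u = pclass v -> peq u v.
Proof. by move=> /(congr1 sval) /= ->; exact: peq_refl. Qed.

Lemma prepr_class v : peq (prepr (pclass v)) v.
Proof. by apply: pclass_inj; rewrite preprK. Qed.

HB.instance Definition _ := gen_eqMixin pquot.
HB.instance Definition _ := gen_choiceMixin pquot.

Let qadd S T := pclass (padd (prepr S) (prepr T)).
Let qopp S := pclass (pscale (-1) (prepr S)).
Let qscale k S := pclass (pscale k (prepr S)).

Let qaddE u v : qadd (pclass u) (pclass v) = pclass (padd u v).
Proof. by apply/pclass_eq/padd_eq; exact: prepr_class. Qed.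
Let qscaleE k u : qscale k (pclass u) = pclass (pscale k u).
Proof. by apply/pclass_eq/pscale_eq; exact: prepr_class. Qed.

Let qaddA : associative qadd.
Proof.
move=> S T U; rewrite -(preprK S) -(preprK T) -(preprK U) !qaddE.
by apply: pclass_eq; exact: paddA.
Qed.
Let qaddC : commutative qadd.
Proof. by move=> S T; apply: pclass_eq; exact: paddC. Qed.
Let qadd0 : left_id (pclass (@pzero P)) qadd.
Proof.
by move=> S; rewrite -(preprK S) qaddE; apply: pclass_eq; exact: padd0.
Qed.
Let qaddN : left_inverse (pclass (@pzero P)) qopp qadd.
Proof.
move=> S; rewrite /qopp -{2}(preprK S) qaddE.
by apply: pclass_eq; exact: paddN.
Qed.

HB.instance Definition _ := GRing.isZmodule.Build pquot qaddA qaddC qadd0 qaddN.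

Lemma pclassD u v : pclass (padd u v) = pclass u + pclass v.
Proof. by rewrite -qaddE. Qed.

Let qscaleA k l S : qscale k (qscale l S) = qscale (k * l) S.
Proof. by rewrite -(preprK S) !qscaleE; apply: pclass_eq; exact: pscaleA. Qed.
Let qscale1 : left_id 1 qscale.
Proof. by move=> S; rewrite -(preprK S) qscaleE; apply: pclass_eq; exact: pscale1. Qed.
Let qscaleDr : right_distributive qscale +%R.
Proof.
move=> k S T; rewrite -(preprK S) -(preprK T) -pclassD !qscaleE -pclassD.
by apply: pclass_eq; exact: pscaleDr.
Qed.
Let qscaleDl S : {morph qscale^~ S : k l / k + l}.
Proof.
move=> k l; rewrite -(preprK S) !qscaleE -pclassD.
by apply: pclass_eq; exact: pscaleDl.
Qed.

HB.instance Definition _ := GRing.Zmodule_isLmodule.Build R[i] pquot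
  qscaleA qscale1 qscaleDr qscaleDl.

Lemma pclassZ k u : pclass (pscale k u) = k *: pclass u.
Proof. by rewrite -qscaleE. Qed.

Let qnorm S : R[i] := (pnorm (prepr S))%:C.
Let qnormE u : qnorm (pclass u) = (pnorm u)%:C.
Proof. by rewrite /qnorm (pnorm_eq (prepr_class u)). Qed.
Let qnormD S T : qnorm (S + T) <= qnorm S + qnorm T.
Proof.
rewrite -(preprK S) -(preprK T) -pclassD !qnormE -rmorphD lecR.
exact: pnormD.
Qed.
Let qnormZ k S : qnorm (k *: S) = `|k| * qnorm S.
Proof.
by rewrite -(preprK S) -pclassZ !qnormE pnormZ rmorphM /= -cabsE.
Qed.
Let qnorm0 S : qnorm S = 0 -> S = 0.
Proof.
rewrite -(preprK S) qnormE => /complexI S0; apply: pclass_eq; exact: pnorm0.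
Qed.

HB.instance Definition _ := Lmodule_isNormed.Build R[i] pquot qnormD qnormZ qnorm0.

Lemma pclass_nm u : nm (pclass u) = pnorm u.
Proof. by rewrite /nm (_ : `|_| = (pnorm u)%:C) // -qnormE. Qed.

Lemma pclassB u v : pclass (padd u (pscale (-1) v)) = pclass u - pclass v.
Proof. by rewrite pclassD pclassZ scaleN1r. Qed.

(** A Cauchy filter contains a ball of radius [2^-n] for each [n]; the centres form a Cauchy
    sequence, and the filter converges to its limit. *)
Lemma seq_complete (V : normedModType R[i]) :
  (forall u : nat -> V, cauchy_seq u -> exists l, lim_seq u l) ->
  forall F : set_system V, ProperFilter F -> cauchy F -> cvg F.
Proof.
move=> Vc F FF /cauchyP Fc.
have p2 n : 0 < (2^-1 ^+ n : R)%:C :> R[i] by rewrite ltcR exprn_gt0 // invr_gt0.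
have [u uF] := choice (fun n => Fc _ (p2 n)).
have near x e y : ball (x : V) (e%:C) y -> nm (x - y) < e.
  by rewrite -ball_normE /ball_ /= norm_ltE.
have [e e0|l ul] := Vc u.
  have [N NP] := half_pow_small (divr_gt0 e0 (ltr0Sn R 1)).
  exists N => m n Nm Nn.
  have [x [/near xm /near xn]] := filter_ex (filterI (uF m) (uF n)).
  have := NP _ Nm; have := NP _ Nn; have := nm_tri (u m) x (u n).
  by rewrite (nmC x); lra.
apply/cvg_ex; exists l; apply/cvgrPdist_lt => e.
rewrite ltcE /= => /andP[/eqP ei e0].
have e2 : 0 < complex.Re e / 2 by rewrite divr_gt0.
have [N NP] := half_pow_small e2; have [M MP] := ul _ e2.
pose n := maxn N M; apply: filterS (uF n) => x /near xn.
rewrite nmE (_ : e = (complex.Re e)%:C) ?ltcR; last by case: (e) ei => ? ? /= ->.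
have := NP n (leq_maxl _ _); have := MP n (leq_maxr _ _).
by have := nm_tri l (u n) x; rewrite (nmC l (u n)); lra.
Qed.

Let qcomplete (F : set_system pquot) : ProperFilter F -> cauchy F -> cvg F.
Proof.
apply: seq_complete => u cu.
have [|l ul] := @pcomplete P (fun n => prepr (u n)).
  move=> e /cu[N NP]; exists N => m n Nm Nn.
  by rewrite -pclass_nm pclassB !preprK; exact: NP.
exists (pclass l) => e /ul[N NP]; exists N => n /NP.
by rewrite -pclass_nm pclassB preprK.
Qed.

HB.instance Definition _ := Uniform_isComplete.Build pquot qcomplete.

Let qmul S T := pclass (pmul (prepr S) (prepr T)).
Let qstar S := pclass (pstar (prepr S)).
Let qmulE u v : qmul (pclass u) (pclass v) = pclass (pmul u v).
Proof. by apply/pclass_eq/pmul_eq; exact: prepr_class. Qed.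
Let qstarE u : qstar (pclass u) = pclass (pstar u).
Proof. by apply/pclass_eq/pstar_eq; exact: prepr_class. Qed.

Let qmulA : associative qmul.
Proof.
move=> S T U; rewrite -(preprK S) -(preprK T) -(preprK U) !qmulE.
by apply: pclass_eq; exact: pmulA.
Qed.
Let qmulDl : left_distributive qmul +%R.
Proof.
move=> S T U; rewrite -(preprK S) -(preprK T) -(preprK U) -pclassD !qmulE -pclassD.
by apply: pclass_eq; exact: pmulDl.
Qed.
Let qmulDr : right_distributive qmul +%R.
Proof.
move=> S T U; rewrite -(preprK S) -(preprK T) -(preprK U) -pclassD !qmulE -pclassD.
by apply: pclass_eq; exact: pmulDr.
Qed.
Let qmulZl k S T : qmul (k *: S) T = k *: qmul S T.
Proof.
rewrite -(preprK S) -(preprK T) -pclassZ !qmulE -pclassZ.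
by apply: pclass_eq; exact: pmulZl.
Qed.
Let qmulZr k S T : qmul S (k *: T) = k *: qmul S T.
Proof.
rewrite -(preprK S) -(preprK T) -pclassZ !qmulE -pclassZ.
by apply: pclass_eq; exact: pmulZr.
Qed.
Let qstarK : involutive qstar.
Proof. by move=> S; rewrite -(preprK S) !qstarE; apply: pclass_eq; exact: pstarK. Qed.
Let qstarD : {morph qstar : S T / S + T}.
Proof.
move=> S T; rewrite -(preprK S) -(preprK T) -pclassD !qstarE -pclassD.
by apply: pclass_eq; exact: pstarD.
Qed.
Let qstarZ k S : qstar (k *: S) = conjc k *: qstar S.
Proof.
rewrite -(preprK S) -pclassZ !qstarE -pclassZ.
by apply: pclass_eq; exact: pstarZ.
Qed.
Let qstarM S T : qstar (qmul S T) = qmul (qstar T) (qstar S).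
Proof.
rewrite -(preprK S) -(preprK T) qmulE !qstarE qmulE.
by apply: pclass_eq; exact: pstarM.
Qed.
Let qnormM S T : `|qmul S T| <= `|S| * `|T|.
Proof.
rewrite -(preprK S) -(preprK T) qmulE !nmE -rmorphM lecR !pclass_nm.
exact: pnormM.
Qed.
Let qnorm_star S : `|qmul (qstar S) S| = `|S| ^+ 2.
Proof.
by rewrite -(preprK S) qstarE qmulE !nmE -rmorphXn /= !pclass_nm pnorm_star.
Qed.

HB.instance Definition _ := CompleteNormedModule_isCStar.Build R pquot
  qmulA qmulDl qmulDr qmulZl qmulZr qstarK qstarD qstarZ qstarM qnormM qnorm_star.

Definition cstar_of : cstarType R := pquot.

Lemma pclassM u v : pclass (pmul u v) = (pclass u : cstar_of) ** pclass v.
Proof. by rewrite -qmulE. Qed.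

Lemma pclass_star u : pclass (pstar u) = cstar (pclass u : cstar_of).
Proof. by rewrite -qstarE. Qed.

End Quotient.
End Builder.

(** * C*-algebras of bounded families *)

Section Evaluations.
Variables (R : realType) (V I : Type) (Qf : I -> cstarType R).

(* V is a set of codes for bounded families in the [Qf i]; codes with the same
   evaluations are identified in the resulting C*-algebra. *)
Record evalgebra := EvAlgebra {
  evl : forall i, V -> Qf i ;
  vzero : V ;
  vadd : V -> V -> V ;
  vscale : R[i] -> V -> V ;
  vmul : V -> V -> V ;
  vstar : V -> V ;
  ev_zero : forall i, evl i vzero = 0 ;
  ev_add : forall i u v, evl i (vadd u v) = evl i u + evl i v ;
  ev_scale : forall i k u, evl i (vscale k u) = k *: evl i u ;
  ev_mul : forall i u v, evl i (vmul u v) = evl i u ** evl i v ;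
  ev_star : forall i u, evl i (vstar u) = cstar (evl i u) ;
  ev_bounded : forall u, exists C, forall i, nm (evl i u) <= C ;
  ev_complete : forall u : nat -> V,
    (forall e : R, 0 < e -> exists N, forall m n, (N <= m)%N -> (N <= n)%N ->
       forall i, nm (evl i (u m) - evl i (u n)) <= e) ->
    exists l, forall e : R, 0 < e -> exists N, forall n, (N <= n)%N ->
       forall i, nm (evl i (u n) - evl i l) <= e }.

Variable T : evalgebra.

Let eq u v := forall i, evl T i u = evl T i v.

(** The value 0 is put into the set so that the supremum makes sense for an empty index type. *)
Let norm u : R := sup [set r | r = 0 \/ exists i, r = nm (evl T i u)].

Let norm_has_sup u : has_sup [set r | r = 0 \/ exists i, r = nm (evl T i u)].
Proof.
split; first by exists 0; left.
have [C uC] := ev_bounded T u; exists (Num.max 0 C) => r [->|[i ->]].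
  by rewrite le_max lexx.
by rewrite le_max uC orbT.
Qed.

Let norm_ge u i : nm (evl T i u) <= norm u.
Proof. by apply: sup_upper_bound => //; right; exists i. Qed.
Let norm_ge0 u : 0 <= norm u.
Proof. by apply: sup_upper_bound => //; left. Qed.
Let norm_le u r : 0 <= r -> (forall i, nm (evl T i u) <= r) -> norm u <= r.
Proof.
by move=> r0 ur; apply: ge_sup => [|_ [->|[i ->]]] //; case: (norm_has_sup u).
Qed.
Let norm_approx u e : 0 < e -> norm u <= e \/ exists i, norm u < nm (evl T i u) + e.
Proof.
move=> e0; have [_ [->|[i ->]]] := sup_adherent e0 (norm_has_sup u).
  by rewrite -/(norm u) ltrBlDl addr0 => /ltW; left.
by rewrite -/(norm u) ltrBlDr; right; exists i.
Qed.

Ltac evl_tac := rewrite !(ev_add, ev_scale, ev_mul, ev_star, ev_zero).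

Lemma ev_precstar_subproof (u : nat -> V) :
  (forall e : R, 0 < e -> exists N, forall m n, (N <= m)%N -> (N <= n)%N ->
     norm (vadd T (u m) (vscale T (-1) (u n))) < e) ->
  exists l, forall e : R, 0 < e -> exists N, forall n, (N <= n)%N ->
     norm (vadd T (u n) (vscale T (-1) l)) < e.
Proof.
move=> cu; have [|l ul] := ev_complete (e := T) (u := u).
  move=> e /cu[N NP]; exists N => m n Nm Nn i.
  apply: ltW; apply: le_lt_trans (NP _ _ Nm Nn); apply: le_trans (norm_ge _ i).
  by evl_tac; rewrite scaleN1r.
exists l => e e0; have [|N NP] := ul (e / 2); first by rewrite divr_gt0.
exists N => n Nn; apply: (@le_lt_trans _ _ (e / 2)); last by lra.
apply: norm_le => [|i]; first by lra.
by evl_tac; rewrite scaleN1r NP.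
Qed.

Definition ev_precstar : precstar R.
Proof.
refine (@PreCStar R V eq (vzero T) (vadd T) (vscale T) (vmul T) (vstar T) norm
  _ _ _ _ _ _ _ _ _ _ _ _ _ _ _ _ _ _ _ _ _ _ _ _ _ _ _ _ _ _ _
  ev_precstar_subproof).
all: try by move=> * i; evl_tac; rewrite ?(addrA, scalerA, scale1r, scalerDr,
  scalerDl, cmulA, cmulDl, cmulDr, cmulZl, cmulZr, cstarK, cstarD, cstarZ,
  cstarM, add0r) // addrC.
- by [].
- by move=> u v uv i.
- by move=> u v w uv vw i; rewrite uv.
- by move=> u u' v v' uu vv i; rewrite !ev_add uu vv.
- by move=> k u u' uu i; rewrite !ev_scale uu.
- by move=> u u' v v' uu vv i; rewrite !ev_mul uu vv.
- by move=> u u' uu i; rewrite !ev_star uu.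
- move=> u u' uu; rewrite /norm; congr sup; apply/seteqP.
  by split=> r [->|[i ->]]; [left|right; exists i; rewrite uu|left|right; exists i; rewrite uu].
- by move=> u i; evl_tac; rewrite scaleN1r addNr.
- exact: norm_ge0.
- move=> u v; apply: norm_le => [|i]; first by rewrite addr_ge0.
  by rewrite ev_add (le_trans (nmD _ _)) // lerD.
- move=> k u; apply/eqP; rewrite eq_le; apply/andP; split.
    apply: norm_le => [|i]; first by rewrite mulr_ge0 ?cabs_ge0.
    by rewrite ev_scale nmZ ler_wpM2l ?cabs_ge0.
  apply/ler_addgt0Pr => e e0.
  have k1 : 0 < cabs k + 1 by have := cabs_ge0 k; lra.
  have d0 : 0 < e / (cabs k + 1) by rewrite divr_gt0.
  have ed : cabs k * (e / (cabs k + 1)) <= e.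
    by rewrite mulrA ler_pdivrMr // mulrC ler_wpM2l ?ltW //; lra.
  have [u0|[i ui]] := norm_approx u d0.
    apply: (@le_trans _ _ (cabs k * (e / (cabs k + 1)))).
      by rewrite ler_wpM2l ?cabs_ge0.
    by rewrite (le_trans ed) // ler_wpDl.
  apply: (@le_trans _ _ (cabs k * (nm (evl T i u) + e / (cabs k + 1)))).
    by rewrite ler_wpM2l ?cabs_ge0 // ltW.
  rewrite mulrDr lerD // -nmZ -ev_scale; exact: norm_ge.
- move=> u u0 i; rewrite ev_zero; apply: nm_le0; rewrite -u0; exact: norm_ge.
- move=> u v; apply: norm_le => [|i]; first by rewrite mulr_ge0.
  by rewrite ev_mul (le_trans (nmM _ _)) // ler_pM ?nm_ge0.
- move=> u; apply/eqP; rewrite eq_le; apply/andP; split.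
    apply: norm_le => [|i]; first by rewrite exprn_ge0.
    by rewrite ev_mul ev_star nm_star_mul ler_pXn2r ?nnegrE ?nm_ge0.
  (* The C*-identity at each index bounds every value by the square root of the norm of the product,
     hence also the supremum. *)
  rewrite -[leRHS]sqr_sqrtr ?norm_ge0 // ler_pXn2r ?nnegrE ?sqrtr_ge0 //.
  apply: norm_le => [|i]; first exact: sqrtr_ge0.
  rewrite -(ler_pXn2r (n := 2)) ?nnegrE ?sqrtr_ge0 ?nm_ge0 // sqr_sqrtr //.
  by rewrite -nm_star_mul -ev_star -ev_mul.
Defined.

Definition ev_cstar : cstarType R := cstar_of ev_precstar.
Definition ev_class (v : V) : ev_cstar := pclass (P := ev_precstar) v.
Definition ev_at i (x : ev_cstar) : Qf i := evl T i (prepr x).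

Lemma ev_at_class i v : ev_at i (ev_class v) = evl T i v.
Proof. by rewrite /ev_at (@prepr_class _ ev_precstar v i). Qed.

Lemma ev_classK x : exists v, x = ev_class v.
Proof. by exists (prepr x); rewrite /ev_class preprK. Qed.

Lemma ev_at_hom i : star_hom (ev_at i).
Proof.
split.
- move=> k x y; have [u ->] := ev_classK x; have [v ->] := ev_classK y.
  have -> : k *: ev_class u + ev_class v = ev_class (vadd T (vscale T k u) v).
    by rewrite /ev_class (pclassD (P := ev_precstar)) (pclassZ (P := ev_precstar)).
  by rewrite !ev_at_class ev_add ev_scale.
- move=> x y; have [u ->] := ev_classK x; have [v ->] := ev_classK y.
  have -> : ev_class u ** ev_class v = ev_class (vmul T u v) by rewrite /ev_class pclassM.
  by rewrite !ev_at_class ev_mul.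
- move=> x; have [u ->] := ev_classK x.
  have -> : cstar (ev_class u) = ev_class (vstar T u) by rewrite /ev_class pclass_star.
  by rewrite !ev_at_class ev_star.
Qed.

Lemma ev_nm_le (x : ev_cstar) r : 0 <= r -> nm x <= r <-> forall i, nm (ev_at i x) <= r.
Proof.
move=> r0; have [u ->] := ev_classK x; rewrite pclass_nm; split=> [xr i|xr].
  by rewrite ev_at_class (le_trans _ xr) //; exact: norm_ge.
by apply: norm_le => // i; rewrite -ev_at_class.
Qed.

Lemma ev_at_ext (x y : ev_cstar) : (forall i, ev_at i x = ev_at i y) -> x = y.
Proof.
move=> xy; apply/eqP; rewrite -subr_eq0; apply/eqP/nm_le0.
by apply/ev_nm_le => // i; rewrite (star_homB (ev_at_hom i)) xy subrr nm0.
Qed.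

End Evaluations.

Lemma norm_ltP (R : realType) (V : normedModType R[i]) (a : V) (r : R[i]) :
  (`|a| < r) = (complex.Im r == 0) && (nm a < complex.Re r).
Proof. by case: r => x y; rewrite nmE ltcE /= eq_sym. Qed.

Lemma norm_leP (R : realType) (V : normedModType R[i]) (a : V) (r : R[i]) :
  (`|a| <= r) = (complex.Im r == 0) && (nm a <= complex.Re r).
Proof. by case: r => x y; rewrite nmE lecE /= eq_sym. Qed.

(** * Quotients by closed ideals *)

Section QuotientExists.
Variables (R : realType) (A : cstarType R) (J : set A).
Hypothesis Ji : closed_ideal J.

Let JD : forall a b, J a -> J b -> J (a + b). Proof. by case: Ji => -[]. Qed.
Let JZ : forall (k : R[i]) a, J a -> J (k *: a). Proof. by case: Ji => -[]. Qed.
Let J0 : J 0. Proof. by case: Ji => -[]. Qed.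
Let JN a : J a -> J (- a). Proof. by move=> /(JZ (-1)); rewrite scaleN1r. Qed.

(** A subsequence with quotient steps below [2^-k] is lifted step by step, each lift being corrected
    by an element of [J], to a sequence [w] that is Cauchy in [A] itself. Its limit there is a limit
    in the quotient. *)
Lemma quot_complete (u : nat -> A) :
  (forall e : R, 0 < e -> exists N, forall m n, (N <= m)%N -> (N <= n)%N ->
     dist J (u m + (-1) *: u n) < e) ->
  exists l, forall e : R, 0 < e -> exists N, forall n, (N <= n)%N ->
     dist J (u n + (-1) *: l) < e.
Proof.
move=> cu; have p2 n : 0 < 2^-1 ^+ n :> R by rewrite exprn_gt0 // invr_gt0.
have [N NP] := choice (fun k => cu _ (p2 k)).
(* Summing makes the indices increase while [M k] still dominates the threshold [N k]. *)
pose M k := (\sum_(j < k.+1) N j)%N.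
have NM k : (N k <= M k)%N by rewrite /M big_ord_recr /= leq_addl.
have MM k : (M k <= M k.+1)%N by rewrite {2}/M big_ord_recr /= leq_addr.
have step k : exists2 j, J j & nm (u (M k.+1) - u (M k) + j) < 2^-1 ^+ k.
  apply: dist_lt => //; rewrite -(scaleN1r (u (M k))); apply: NP => //.
  exact: leq_trans (MM k).
have [j jP] := choice (fun k => let: ex_intro2 x y z := step k in ex_intro _ x (conj y z)).
pose w := fix w k := if k is k'.+1 then w k' + (u (M k'.+1) - u (M k') + j k')
  else u (M 0%N).
have wu k : J (w k - u (M k)).
  elim: k => [|k IH] /=; first by rewrite subrr.
  have -> : w k + (u (M k.+1) - u (M k) + j k) - u (M k.+1) = (w k - u (M k)) + j k.
    by lmod_with R[i].
  by apply: JD => //; case: (jP k).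
have [||l wl] := @geometric_cvg R A w 1 2^-1; first by apply/andP; split; lra.
  move=> n; rewrite mul1r /= [w n + _]addrC addrK; apply: ltW; by case: (jP n).
exists l => e e0; have e4 : 0 < e / 4 by rewrite divr_gt0.
have [K KP] := wl _ e4.
have [K' K'P] := half_pow_small e4; pose k := maxn K K'.
have {}K'P : 2^-1 ^+ k < e / 4 by exact/K'P/leq_maxr.
exists (N k) => n Nn; have := NP k n (M k) Nn (NM k); have := KP k (leq_maxl _ _).
have := distD Ji (u n + (-1) *: u (M k)) (u (M k) - l).
have -> : u n + (-1) *: u (M k) + (u (M k) - l) = u n + (-1) *: l.
  by lmod_with R[i].
have := dist_le Ji (u (M k) - l) (wu k).
have -> : u (M k) - l + (w k - u (M k)) = w k - l by lmod_with R[i].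
lra.
Qed.

Definition quot_precstar : precstar R.
Proof.
refine (@PreCStar R A (fun a b => J (a - b)) 0 +%R ( *:%R) (@cmul R A) (@cstar R A)
  (dist J) _ _ _ _ _ _ _ _ _ _ _ _ _ _ _ _ _ _ _ _ _ _ _ _ _ _ _ _ _ _ _
  quot_complete).
all: try by move=> *; rewrite ?(addrA, scalerA, scale1r, scalerDr,
  scalerDl, cmulA, cmulDl, cmulDr, cmulZl, cmulZr, cstarK, cstarD, cstarZ,
  cstarM, add0r, scaleN1r, addNr) subrr.
- by move=> u v /JN; rewrite opprB.
- by move=> u v w uv vw; rewrite -(subrK v u) -addrA; exact: JD.
- by move=> u u' v v' uu vv; rewrite opprD addrACA; exact: JD.
- by move=> k u u' uu; rewrite -scalerBr; exact: JZ.
- move=> u u' v v' uu vv.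
  have -> : u ** v - u' ** v' = (u - u') ** v + u' ** (v - v').
    by rewrite cmulBl cmulBr; lmod_with R[i].
  by apply: JD; [exact: (idealMr Ji)|exact: (idealMl Ji)].
- by move=> u u' uu; rewrite -cstarB; exact: (ideal_star Ji).
- have le u v : J (u - v) -> dist J u <= dist J v.
    move=> uv; have := distD Ji v (u - v); rewrite subrKC.
    have : dist J (u - v) <= 0 by apply/dist_eq0.
    lra.
  move=> u v uv; apply/eqP; rewrite eq_le !le // -opprB; exact: JN.
- by move=> u v; rewrite [v + u]addrC subrr.
- by move=> u; rewrite scaleN1r addNr subrr.
- exact: dist_ge0.
- exact: distD.
- exact: distZ.
- by move=> u u0; rewrite subr0; apply/(dist_eq0 Ji); rewrite u0.
- exact: distM.
- exact: dist_star_mul.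
Defined.

Lemma quotient_exists : exists q : {Q : cstarType R & A -> Q},
  is_quotient J (projT2 q).
Proof.
exists (existT (fun Q : cstarType R => A -> Q) (cstar_of quot_precstar)
  (fun a => pclass (P := quot_precstar) a)); split => /=.
- split=> [k a b|a b|a].
  + by rewrite -(pclassZ (P := quot_precstar)) -(pclassD (P := quot_precstar)).
  + by rewrite -pclassM.
  + by rewrite -pclass_star.
- by move=> q; exists (prepr q); rewrite preprK.
- move=> a; split=> [a0|Ja].
    by rewrite -(subr0 a); exact: (@pclass_inj _ quot_precstar a 0 a0).
  by apply: (@pclass_eq _ quot_precstar a 0); rewrite /= subr0.
- move=> a r; rewrite norm_ltP (@pclass_nm _ quot_precstar) /=; split.
    by move=> /andP[ri /(dist_lt Ji)[j Jj aj]]; exists j => //; rewrite norm_ltP ri.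
  move=> [j Jj]; rewrite norm_ltP => /andP[-> /=]; apply: le_lt_trans.
  exact: dist_le.
Qed.

Lemma quotientP : is_quotient J (projT2 (quotient J)).
Proof.
rewrite /quotient; case: pselect => [ex|]; last by case; exact: quotient_exists.
by case: cid.
Qed.

End QuotientExists.

Lemma quotient_nm (R : realType) (A Q : cstarType R) (J : set A) (pi : A -> Q) :
  closed_ideal J -> is_quotient J pi -> forall a, nm (pi a) = dist J a.
Proof.
move=> Ji [_ _ _ nP] a; apply/eqP; rewrite eq_le; apply/andP; split.
  apply/ler_addgt0Pr => e e0; rewrite -norm_leE; apply: ltW; apply/nP.
  have [|j Jj aj] := @dist_lt _ _ _ Ji a (dist J a + e); first by rewrite ltrDl.
  by exists j; rewrite ?norm_ltE.
apply: dist_leP => // e e0.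
have /nP[j Jj aj] : `|pi a| < (nm (pi a) + e)%:C by rewrite norm_ltE ltrDl.
by exists j => //; rewrite -norm_ltE.
Qed.

(** * Maximal tensor products *)

Section Scalars.
Variable R : realType.

Lemma real_cauchy (u : nat -> R) :
  (forall e : R, 0 < e -> exists N, forall m n, (N <= m)%N -> (N <= n)%N ->
     `|u m - u n| < e) ->
  exists l, forall e : R, 0 < e -> exists N, forall n, (N <= n)%N -> `|u n - l| < e.
Proof.
move=> cu; have : cauchy (u @ \oo).
  apply: cauchy_exP => e e0; have [N NP] := cu _ e0; exists (u N).
  by exists N => // n /= Nn; rewrite -ball_normE /ball_ /=; exact: NP.
move=> /cauchy_cvg/cvg_ex[/= l ul]; exists l => e e0.
have /cvgrPdist_lt /(_ _ e0) [N _ NP] := ul.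
by exists N => n Nn; rewrite distrC; exact: NP.
Qed.

Lemma cabs_ge_Re (z : R[i]) : `|complex.Re z| <= cabs z.
Proof. by case: z => x y; rewrite /cabs normc_def /= -sqrtr_sqr ler_wsqrtr // lerDl sqr_ge0. Qed.

Lemma cabs_ge_Im (z : R[i]) : `|complex.Im z| <= cabs z.
Proof. by case: z => x y; rewrite /cabs normc_def /= -sqrtr_sqr ler_wsqrtr // lerDr sqr_ge0. Qed.

Lemma cabs_le_ReIm (z : R[i]) : cabs z <= `|complex.Re z| + `|complex.Im z|.
Proof.
case: z => x y; rewrite /cabs normc_def /=.
rewrite -(ler_pXn2r (n := 2)) ?nnegrE ?sqrtr_ge0 ?addr_ge0 //.
rewrite sqr_sqrtr ?addr_ge0 ?sqr_ge0 // sqrrD -!normrX.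
rewrite (ger0_norm (sqr_ge0 x)) (ger0_norm (sqr_ge0 y)) -addrA [leRHS]addrCA -subr_ge0.
by rewrite addrK mulrn_wge0 // mulr_ge0.
Qed.

Lemma scalar_complete (u : nat -> R[i]) :
  (forall e : R, 0 < e -> exists N, forall m n, (N <= m)%N -> (N <= n)%N ->
     cabs (u m + (-1) * u n) < e) ->
  exists l, forall e : R, 0 < e -> exists N, forall n, (N <= n)%N ->
     cabs (u n + (-1) * l) < e.
Proof.
move=> cu.
have ReB x y : complex.Re (x - y : R[i]) = complex.Re x - complex.Re y by case: x y => ? ? [].
have ImB x y : complex.Im (x - y : R[i]) = complex.Im x - complex.Im y by case: x y => ? ? [].
have [|a ua] := @real_cauchy (fun n => complex.Re (u n)).
  move=> e /cu[N NP]; exists N => m n /NP /[apply]; apply: le_lt_trans.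
  by rewrite mulN1r -ReB cabs_ge_Re.
have [|b ub] := @real_cauchy (fun n => complex.Im (u n)).
  move=> e /cu[N NP]; exists N => m n /NP /[apply]; apply: le_lt_trans.
  by rewrite mulN1r -ImB cabs_ge_Im.
exists (a +i* b) => e e0; have e2 : 0 < e / 2 by rewrite divr_gt0.
have [N NP] := ua _ e2; have [M MP] := ub _ e2.
exists (maxn N M) => n; rewrite geq_max => /andP[/NP h1 /MP h2].
apply: (le_lt_trans (cabs_le_ReIm _)); rewrite mulN1r ReB ImB /=; lra.
Qed.

Definition scalar_precstar : precstar R.
Proof.
refine (@PreCStar R R[i] eq 0 +%R *%R *%R conjc cabs
  _ _ _ _ _ _ _ _ _ _ _ _ _ _ _ _ _ _ _ _ _ _ _ _ _ _ _ _ _ _ _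
  scalar_complete) => //.
all: try by move=> *; ring.
all: try by move=> *; rewrite ?(rmorphD, rmorphM) ?conjcK // mulrC.
- by move=> u v w -> ->.
- by move=> u u' v v' -> ->.
- by move=> k u u' ->.
- by move=> u u' v v' -> ->.
- by move=> u u' ->.
- by move=> u u' ->.
- exact: cabs_ge0.
- exact: cabsD.
- exact: cabsM.
- exact: cabs_eq0.
- by move=> u v; rewrite cabsM.
- by move=> u; rewrite cabsM cabs_conj expr2.
Defined.

Definition scalars : cstarType R := cstar_of scalar_precstar.
Definition to_scalars (z : R[i]^o) : scalars := pclass (P := scalar_precstar) z.

Lemma to_scalarsP : is_scalars to_scalars.
Proof.
split.
- move=> k z w; rewrite /to_scalars.
  by rewrite -(pclassZ (P := scalar_precstar)) -(pclassD (P := scalar_precstar)).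
- exists (@prepr _ scalar_precstar) => z; last exact: preprK.
  exact: (@prepr_class _ scalar_precstar).
- by move=> z w; rewrite /to_scalars -pclassM.
- by move=> z; rewrite /to_scalars -pclass_star.
- by move=> z; rewrite nmE pclass_nm /= -cabsE.
Qed.

End Scalars.

Section LimSeq.
Variables (R : realType) (A : cstarType R).
Implicit Types u v : nat -> A.

Lemma lim_seqD u v a b : lim_seq u a -> lim_seq v b ->
  lim_seq (fun n => u n + v n) (a + b).
Proof.
move=> ua vb e e0; have e2 : 0 < e / 2 by rewrite divr_gt0.
have [N NP] := ua _ e2; have [M MP] := vb _ e2.
exists (maxn N M) => n; rewrite geq_max => /andP[/NP h1 /MP h2].
by rewrite opprD addrACA; have := nmD (u n - a) (v n - b); lra.
Qed.

Lemma lim_seqZ (k : R[i]) u a : lim_seq u a -> lim_seq (fun n => k *: u n) (k *: a).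
Proof.
move=> ua e e0; have k1 : 0 < cabs k + 1 by have := cabs_ge0 k; lra.
have [|N NP] := ua (e / (cabs k + 1)); first by rewrite divr_gt0.
exists N => n /NP; rewrite ltr_pdivlMr // -scalerBr nmZ.
by have := cabs_ge0 k; have := nm_ge0 (u n - a); nra.
Qed.

Lemma lim_seq_star u a : lim_seq u a -> lim_seq (fun n => cstar (u n)) (cstar a).
Proof.
by move=> ua e /ua[N NP]; exists N => n /NP; rewrite -cstarB nm_star.
Qed.

Lemma lim_seqM u v a b : lim_seq u a -> lim_seq v b ->
  lim_seq (fun n => u n ** v n) (a ** b).
Proof.
move=> ua vb e e0; pose C := nm a + nm b + 1.
have [a0 b0] := (nm_ge0 a, nm_ge0 b).
have C0 : 0 < C + 1 by rewrite /C; lra.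
pose d := Num.min 1 (e / (C + 1)).
have d0 : 0 < d by rewrite lt_min ltr01 divr_gt0.
have d1 : d <= 1 by rewrite ge_min lexx.
have de : d * (C + 1) <= e by rewrite -ler_pdivlMr // ge_min lexx orbT.
have [N NP] := ua _ d0; have [M MP] := vb _ d0.
exists (maxn N M) => n; rewrite geq_max => /andP[/NP h1 /MP h2].
have -> : u n ** v n - a ** b = (u n - a) ** v n + a ** (v n - b).
  by rewrite cmulBl cmulBr; lmod_with R[i].
have := nmD ((u n - a) ** v n) (a ** (v n - b)).
have := nmM (u n - a) (v n); have := nmM a (v n - b).
have := nm_le_add (v n) b; have := nm_ge0 (u n - a); have := nm_ge0 (v n - b).
have := nm_ge0 (v n); rewrite /C in de; nra.
Qed.

Lemma lim_seq_cst (a : A) : lim_seq (fun _ : nat => a) a.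
Proof. by move=> e e0; exists 0%N => n _; rewrite subrr nm0. Qed.

Lemma lim_seq_le u a (r : R) : lim_seq u a ->
  (exists N, forall n, (N <= n)%N -> nm (u n) <= r) -> nm a <= r.
Proof.
move=> ua [N NP]; apply/ler_addgt0Pr => e /ua[M MP].
have := NP _ (leq_maxl N M); have := MP _ (leq_maxr N M).
by have := nm_le_add a (u (maxn N M)); rewrite (nmC a); lra.
Qed.

End LimSeq.

Section JointlyInjective.
Variable R : realType.

Lemma bistar_joint I (A B Q : cstarType R) (Qf : I -> cstarType R) (p : forall i, Q -> Qf i)
    (b : forall i, A -> B -> Qf i) (t : A -> B -> Q) :
  (forall i, star_hom (p i)) -> (forall x y, (forall i, p i x = p i y) -> x = y) ->
  (forall i, bistar_hom (b i)) -> (forall i x y, p i (t x y) = b i x y) -> bistar_hom t.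
Proof.
move=> ph inj bh tb; split=> [y k u v|x k u v|x x' y y'|x y]; apply: inj => i.
- by rewrite (star_hom_linear (ph i)) !tb (bistar_linear_l (bh i)).
- by rewrite (star_hom_linear (ph i)) !tb (bistar_linear_r (bh i)).
- by rewrite (star_homM (ph i)) !tb (bistarM (bh i)).
- by rewrite (star_hom_star (ph i)) !tb (bistar_star (bh i)).
Qed.

Lemma commuting_bistar (A B Q : cstarType R) (f : A -> Q) (g : B -> Q) :
  star_hom f -> star_hom g -> (forall a b, f a ** g b = g b ** f a) ->
  bistar_hom (fun a b => f a ** g b).
Proof.
move=> fh gh fg; split=> [b k x y|a k x y|a a' b b'|a b].
- by rewrite (star_hom_linear fh) cmulDl cmulZl.
- by rewrite (star_hom_linear gh) cmulDr cmulZr.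
- by rewrite (star_homM fh) (star_homM gh) -!cmulA (cmulA (f a')) fg !cmulA.
- by rewrite (star_hom_star fh) (star_hom_star gh) fg -cstarM.
Qed.

End JointlyInjective.

Section MaxTensor.
Variables (R : realType) (A B : cstarType R).

Definition evs (Q : cstarType R) (t : A -> B -> Q) (s : seq (A * B)) : Q :=
  \sum_(ab <- s) t ab.1 ab.2.

Section Evs.
Variables (Q : cstarType R) (t : A -> B -> Q).
Hypothesis th : bistar_hom t.
Implicit Types s : seq (A * B).

Lemma evs_cat s s' : evs t (s ++ s') = evs t s + evs t s'.
Proof. by rewrite /evs big_cat. Qed.

Definition tscale (k : R[i]) s := [seq (k *: ab.1, ab.2) | ab <- s].
Definition tmul s s' := [seq (x.1 ** y.1, x.2 ** y.2) | x <- s, y <- s'].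
Definition tstar s := [seq (cstar ab.1, cstar ab.2) | ab <- s].

Lemma evs_scale k s : evs t (tscale k s) = k *: evs t s.
Proof.
by rewrite /evs big_map scaler_sumr; apply: eq_bigr => ab _; rewrite /= bistarZl.
Qed.

Lemma evs_star s : evs t (tstar s) = cstar (evs t s).
Proof.
rewrite /evs big_map; elim: s => [|ab s IH]; first by rewrite !big_nil cstar0.
by rewrite !big_cons IH cstarD -(bistar_star th).
Qed.

Lemma evs_mul s s' : evs t (tmul s s') = evs t s ** evs t s'.
Proof.
rewrite /evs /tmul big_allpairs_dep; elim: s => [|ab s IH].
  by rewrite !big_nil cmul0l.
rewrite !big_cons IH cmulDl; congr (_ + _); elim: s' {IH} => [|cd s' IH].
  by rewrite !big_nil cmul0r.
by rewrite !big_cons IH cmulDr -(bistarM th).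
Qed.

Lemma evs_bound s : nm (evs t s) <= \sum_(ab <- s) nm ab.1 * nm ab.2.
Proof.
rewrite (le_trans (nm_sum _ _)) //; elim: s => [|ab s IH]; first by rewrite !big_nil.
by rewrite !big_cons lerD // (bistar_le th).
Qed.

End Evs.

(** The maximal C*-seminorm of a finite sum is the supremum of its norms in all these targets;
    [bistar_le] keeps it finite. *)
Definition bistar_to := {Q : cstarType R & {t : A -> B -> Q | bistar_hom t}}.
Definition btgt (i : bistar_to) : cstarType R := projT1 i.
Definition bmp (i : bistar_to) : A -> B -> btgt i := sval (projT2 i).
Lemma bmpP i : bistar_hom (bmp i). Proof. exact: (svalP (projT2 i)). Qed.

Definition tcauchy (u : nat -> seq (A * B)) := forall e : R, 0 < e ->
  exists N, forall m n, (N <= m)%N -> (N <= n)%N ->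
    forall i, nm (evs (bmp i) (u m) - evs (bmp i) (u n)) <= e.

(** The completion is coded by uniformly Cauchy sequences of finite sums. The quantification over
    all targets occurs only inside the proposition [tcauchy], so the carrier does not grow with the
    collection of targets. *)
Definition tseq := {u : nat -> seq (A * B) | tcauchy u}.

Lemma tseq_cauchy (u : tseq) i : cauchy_seq (fun n => evs (bmp i) (sval u n)).
Proof.
move=> e e0; have [|N NP] := svalP u (e / 2); first by rewrite divr_gt0.
by exists N => m n Nm Nn; have := NP m n Nm Nn i; lra.
Qed.

Definition tlim (i : bistar_to) (u : tseq) : btgt i :=
  sval (cid (cauchy_seq_cvg (tseq_cauchy u i))).

Lemma tlimP i u : lim_seq (fun n => evs (bmp i) (sval u n)) (tlim i u).
Proof. by rewrite /tlim; case: cid. Qed.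

Lemma tseq_bounded (u : tseq) : exists2 C, 0 <= C &
  exists N, forall n, (N <= n)%N -> forall i, nm (evs (bmp i) (sval u n)) <= C.
Proof.
have [N NP] := svalP u _ ltr01.
exists (1 + \sum_(ab <- sval u N) nm ab.1 * nm ab.2).
  by rewrite addr_ge0 // sumr_ge0 // => ab _; rewrite mulr_ge0 ?nm_ge0.
exists N => n Nn i; have := NP n N Nn (leqnn N) i.
have := evs_bound (bmpP i) (sval u N).
by have := nm_le_add (evs (bmp i) (sval u n)) (evs (bmp i) (sval u N)); lra.
Qed.

Lemma tcauchy_cst s : tcauchy (fun=> s).
Proof. by move=> e e0; exists 0%N => m n _ _ i; rewrite subrr nm0 ltW. Qed.

Lemma tcauchy_cat (u v : tseq) : tcauchy (fun n => sval u n ++ sval v n).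
Proof.
move=> e e0; have e2 : 0 < e / 2 by rewrite divr_gt0.
have [N NP] := svalP u _ e2; have [M MP] := svalP v _ e2.
exists (maxn N M) => m n; rewrite !geq_max => /andP[Nm Mm] /andP[Nn Mn] i.
rewrite !evs_cat opprD addrACA (le_trans (nmD _ _)) //.
by have := NP _ _ Nm Nn i; have := MP _ _ Mm Mn i; lra.
Qed.

Lemma tcauchy_scale k (u : tseq) : tcauchy (fun n => tscale k (sval u n)).
Proof.
move=> e e0; have k1 : 0 < cabs k + 1 by have := cabs_ge0 k; lra.
have [|N NP] := svalP u (e / (cabs k + 1)); first by rewrite divr_gt0.
exists N => m n Nm Nn i; have := NP _ _ Nm Nn i.
rewrite !(evs_scale (bmpP i)) -scalerBr nmZ ler_pdivlMr //.
have := cabs_ge0 k; have := nm_ge0 (evs (bmp i) (sval u m) - evs (bmp i) (sval u n)).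
nra.
Qed.

Lemma tcauchy_star (u : tseq) : tcauchy (fun n => tstar (sval u n)).
Proof.
move=> e /(svalP u)[N NP]; exists N => m n Nm Nn i.
by rewrite !(evs_star (bmpP i)) -cstarB nm_star NP.
Qed.

Lemma tcauchy_mul (u v : tseq) : tcauchy (fun n => tmul (sval u n) (sval v n)).
Proof.
have [C C0 [K uC]] := tseq_bounded u; have [D D0 [L vD]] := tseq_bounded v.
move=> e e0; have CD : 0 < C + D + 1 by lra.
have d0 : 0 < e / (C + D + 1) by rewrite divr_gt0.
have [N NP] := svalP u _ d0; have [M MP] := svalP v _ d0.
exists (maxn (maxn N M) (maxn K L)) => m n.
rewrite !geq_max => /andP[/andP[Nm Mm] /andP[Km Lm]] /andP[/andP[Nn Mn] /andP[Kn Ln]] i.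
rewrite !(evs_mul (bmpP i)).
have := NP _ _ Nm Nn i; have := MP _ _ Mm Mn i; have := uC n Kn i; have := vD m Lm i.
set a := evs _ (sval u m); set b := evs _ (sval v m).
set a' := evs _ (sval u n); set b' := evs _ (sval v n).
rewrite !ler_pdivlMr // => h1 h2 h3 h4.
have -> : a ** b - a' ** b' = (a - a') ** b + a' ** (b - b').
  by rewrite cmulBl cmulBr; lmod_with R[i].
have := nmD ((a - a') ** b) (a' ** (b - b')).
have := nmM (a - a') b; have := nmM a' (b - b').
have := nm_ge0 (a - a'); have := nm_ge0 (b - b').
have : nm (a - a') * nm b <= nm (a - a') * D by rewrite ler_wpM2l ?nm_ge0.
have : nm a' * nm (b - b') <= C * nm (b - b') by rewrite ler_wpM2r ?nm_ge0.
move: (nm (a - a')) (nm (b - b')) h3 h4 => x y h3 h4 h5 h6 y0 x0 h7 h8 h9.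
have : x * D + C * y <= e; last by lra.
rewrite -(ler_pM2r CD); nra.
Qed.

(** Each [u m] is within [2^-m] of a finite sum [s m], uniformly over the targets. The sums form a
    uniformly Cauchy sequence, which is a code for the limit. *)
Lemma tlim_complete (u : nat -> tseq) :
  (forall e : R, 0 < e -> exists N, forall m n, (N <= m)%N -> (N <= n)%N ->
     forall i, nm (tlim i (u m) - tlim i (u n)) <= e) ->
  exists l, forall e : R, 0 < e -> exists N, forall n, (N <= n)%N ->
     forall i, nm (tlim i (u n) - tlim i l) <= e.
Proof.
move=> cu.
have near m : exists s, forall i, nm (tlim i (u m) - evs (bmp i) s) <= 2^-1 ^+ m.
  have [|N NP] := svalP (u m) (2^-1 ^+ m); first by rewrite exprn_gt0 // invr_gt0.
  exists (sval (u m) N) => i.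
  have := lim_seqD (tlimP i (u m)) (lim_seq_cst (- evs (bmp i) (sval (u m) N))).
  by move=> /lim_seq_le; apply; exists N => n Nn; exact: NP.
have [s sP] := choice near.
have sc : tcauchy s.
  move=> e e0; have e3 : 0 < e / 3 by rewrite divr_gt0.
  have [N NP] := cu _ e3; have [M MP] := half_pow_small e3.
  exists (maxn N M) => m n; rewrite !geq_max => /andP[Nm Mm] /andP[Nn Mn] i.
  have := nm_tri (evs (bmp i) (s m)) (tlim i (u m)) (evs (bmp i) (s n)).
  have := nm_tri (tlim i (u m)) (tlim i (u n)) (evs (bmp i) (s n)).
  have := sP m i; have := sP n i; have := MP _ Mm; have := MP _ Mn.
  by have := NP _ _ Nm Nn i; rewrite (nmC (evs _ (s m)) (tlim i (u m))); lra.
exists (exist _ s sc) => e e0; have e3 : 0 < e / 3 by rewrite divr_gt0.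
have [N NP] := sc _ e3; have [M MP] := half_pow_small e3.
exists (maxn N M) => n; rewrite !geq_max => /andP[Nn Mn] i.
have h : nm (evs (bmp i) (s n) - tlim i (exist _ s sc)) <= e / 3.
  rewrite nmC.
  have := lim_seqD (tlimP i (exist _ s sc)) (lim_seq_cst (- evs (bmp i) (s n))).
  move=> /lim_seq_le; apply; exists N => k Nk; exact: NP.
have := nm_tri (tlim i (u n)) (evs (bmp i) (s n)) (tlim i (exist _ s sc)).
by have := sP n i; have := MP _ Mn; lra.
Qed.

Definition tensor_evalgebra : evalgebra tseq btgt.
Proof.
refine (@EvAlgebra R tseq bistar_to btgt tlim
  (exist _ _ (tcauchy_cst [::]))
  (fun u v => exist _ _ (tcauchy_cat u v))
  (fun k u => exist _ _ (tcauchy_scale k u))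
  (fun u v => exist _ _ (tcauchy_mul u v))
  (fun u => exist _ _ (tcauchy_star u)) _ _ _ _ _ _ tlim_complete).
- move=> i; apply: lim_seq_uniq (tlimP _ _) _ => /=.
  by rewrite /evs big_nil; exact: lim_seq_cst.
- move=> i u v; apply: lim_seq_uniq (tlimP _ _) _ => /=.
  under eq_fun do rewrite evs_cat; apply: lim_seqD; exact: tlimP.
- move=> i k u; apply: lim_seq_uniq (tlimP _ _) _ => /=.
  under eq_fun do rewrite (evs_scale (bmpP i)); apply: lim_seqZ; exact: tlimP.
- move=> i u v; apply: lim_seq_uniq (tlimP _ _) _ => /=.
  under eq_fun do rewrite (evs_mul (bmpP i)); apply: lim_seqM; exact: tlimP.
- move=> i u; apply: lim_seq_uniq (tlimP _ _) _ => /=.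
  under eq_fun do rewrite (evs_star (bmpP i)); apply: lim_seq_star; exact: tlimP.
- move=> u; have [C _ [N uC]] := tseq_bounded u.
  by exists C => i; apply: lim_seq_le (tlimP i u) _; exists N => n /uC; apply.
Defined.

Definition max_tensor : cstarType R := ev_cstar tensor_evalgebra.
Definition mtens_seq s : max_tensor :=
  ev_class tensor_evalgebra (exist _ _ (tcauchy_cst s)).
Definition mtens (a : A) (b : B) : max_tensor := mtens_seq [:: (a, b)].

Lemma ev_mtens_seq i s : ev_at (T := tensor_evalgebra) i (mtens_seq s) = evs (bmp i) s.
Proof.
by rewrite ev_at_class; apply: lim_seq_uniq (tlimP _ _) _; exact: (lim_seq_cst (evs (bmp i) s)).
Qed.

Lemma ev_mtens i a b : ev_at (T := tensor_evalgebra) i (mtens a b) = bmp i a b.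
Proof. by rewrite ev_mtens_seq /evs big_seq1. Qed.

Lemma mtens_seqE s : mtens_seq s = \sum_(ab <- s) mtens ab.1 ab.2.
Proof.
apply: ev_at_ext => i; rewrite ev_mtens_seq /evs.
elim: s => [|ab s IH]; first by rewrite !big_nil (star_hom0 (ev_at_hom _ i)).
by rewrite !big_cons (star_homD (ev_at_hom _ i)) ev_mtens IH.
Qed.

Lemma mtens_hom : bistar_hom mtens.
Proof.
exact: bistar_joint (ev_at_hom tensor_evalgebra) (@ev_at_ext _ _ _ _ tensor_evalgebra) bmpP ev_mtens.
Qed.

Lemma max_tensorP : is_max_tensor mtens.
Proof.
split; first exact: mtens_hom.
  apply/seteqP; split => // x _; have [u ->] := ev_classK x.
  have [G0 GD GZ Gc] := closed_span_subspace [set q | exists a b, q = mtens a b].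
  move/closedP: G0; apply => e e0.
  have [|N NP] := svalP u (e / 2); first by rewrite divr_gt0.
  exists (mtens_seq (sval u N)).
    rewrite mtens_seqE; elim/big_ind: _ => // ab _.
    by apply: sub_closed_span; exists ab.1, ab.2.
  apply: (@le_lt_trans _ _ (e / 2)); last by lra.
  apply/ev_nm_le => [|i]; first by lra.
  rewrite (star_homB (ev_at_hom _ i)) ev_mtens_seq ev_at_class.
  have := lim_seqD (tlimP i u) (lim_seq_cst (- evs (bmp i) (sval u N))).
  by move=> /lim_seq_le; apply; exists N => n Nn; exact: NP.
move=> Q t th s.
(* The given target is one of the indices, and evaluation at an index is contractive. *)
pose i : bistar_to := existT _ Q (exist _ t th).
rewrite -mtens_seqE !nmE lecR -[X in nm X <= _]/(evs (bmp i) s) -ev_mtens_seq.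
exact: star_hom_le (ev_at_hom _ i) _.
Qed.

End MaxTensor.

(** * Extension of maps from generators *)

Section Extension.
Variable R : realType.
Implicit Types A B E Q : cstarType R.

Definition comb Q (G : Type) (tau : G -> Q) (s : seq (R[i] * G)) : Q :=
  \sum_(cg <- s) cg.1 *: tau cg.2.

Lemma comb_cat Q G (tau : G -> Q) s s' : comb tau (s ++ s') = comb tau s + comb tau s'.
Proof. by rewrite /comb big_cat. Qed.

Lemma comb_scale Q G (tau : G -> Q) k s :
  comb tau [seq (k * cg.1, cg.2) | cg <- s] = k *: comb tau s.
Proof.
by rewrite /comb big_map scaler_sumr; apply: eq_bigr => cg _; rewrite scalerA.
Qed.

Lemma comb1 Q G (tau : G -> Q) g : comb tau [:: (1, g)] = tau g.
Proof. by rewrite /comb big_seq1 scale1r. Qed.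

Lemma closed_span_approx Q G (tau : G -> Q) x (e : R) : 0 < e ->
  closed_span [set q | exists g, q = tau g] x -> exists s, nm (x - comb tau s) < e.
Proof.
move=> e0 xG; have : aclosure [set q | exists s, q = comb tau s] x.
  apply: xG; split; last first.
    by move=> _ [g ->]; apply: sub_aclosure; exists [:: (1, g)]; rewrite comb1.
  apply: aclosure_subspace.
  - by exists [::]; rewrite /comb big_nil.
  - by move=> _ _ [s ->] [s' ->]; exists (s ++ s'); rewrite comb_cat.
  - by move=> k _ [s ->]; exists [seq (k * cg.1, cg.2) | cg <- s]; rewrite comb_scale.
by move=> /(_ e e0)[_ [s ->] xs]; exists s.
Qed.

Lemma linear_of A B (f : A -> B) : (forall a b, f (a + b) = f a + f b) ->
  (forall k a, f (k *: a) = k *: f a) -> linear f.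
Proof. by move=> fD fZ k a b; rewrite fD fZ. Qed.

Section Linear.
Variables (A B : cstarType R) (f : A -> B).
Hypothesis fl : linear f.
Lemma linD a b : f (a + b) = f a + f b.
Proof. by have := fl 1 a b; rewrite !scale1r. Qed.
Lemma lin0 : f 0 = 0.
Proof. by apply: (addrI (f 0)); rewrite -linD !addr0. Qed.
Lemma linZ k a : f (k *: a) = k *: f a.
Proof. by have := fl k a 0; rewrite lin0 !addr0. Qed.
Lemma linB a b : f (a - b) = f a - f b.
Proof. by rewrite linD -scaleN1r linZ scaleN1r. Qed.
Lemma lin_comb G (tau : G -> A) s : f (comb tau s) = comb (f \o tau) s.
Proof.
rewrite /comb; elim: s => [|cg s IH]; first by rewrite !big_nil lin0.
by rewrite !big_cons linD linZ IH.
Qed.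
End Linear.

Lemma zero_subspace Q : closed_subspace [set 0 : Q].
Proof.
split=> [|//|a b /= -> ->|k a /= ->]; rewrite ?addr0 ?scaler0 //.
by apply/closedP => a h; apply: nm_small => r /h[_ ->]; rewrite subr0 => /ltW.
Qed.

Lemma preim_subspace A B (f : A -> B) (M : R) (S : set B) :
  linear f -> (forall x, nm (f x) <= M * nm x) -> closed_subspace S ->
  closed_subspace [set x | S (f x)].
Proof.
move=> fl fM [Sc S0 SD SZ]; split.
- apply/closedP => a aS; have /closedP := Sc; apply => r r0.
  have M1 : 0 < `|M| + 1 by have := normr_ge0 M; lra.
  have [b Sb ab] := aS _ (divr_gt0 r0 M1); exists (f b) => //.
  rewrite -(linB fl); apply: (le_lt_trans (fM _)).
  apply: (@le_lt_trans _ _ ((`|M| + 1) * nm (a - b))).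
    by rewrite ler_wpM2r ?nm_ge0 //; have := ler_norm M; lra.
  by rewrite mulrC -ltr_pdivlMr.
- by rewrite /= (lin0 fl).
- by move=> a b /= Sa Sb; rewrite (linD fl); exact: SD.
- by move=> k a /= Sa; rewrite (linZ fl); exact: SZ.
Qed.

Lemma closed_span_map A B (f : A -> B) (M : R)
    (G : set A) (S : set B) : linear f -> (forall x, nm (f x) <= M * nm x) ->
  closed_subspace S -> (forall g, G g -> S (f g)) -> forall x, closed_span G x -> S (f x).
Proof. by move=> fl fM SS GS; exact: (closed_span_sub (preim_subspace fl fM SS)). Qed.

Lemma star_subspace A (S : set A) : closed_subspace S ->
  closed_subspace [set x | S (cstar x)].
Proof.
move=> [Sc S0 SD SZ]; split.
- apply/closedP => a aS; have /closedP := Sc; apply => r r0.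
  by have [b Sb ab] := aS _ r0; exists (cstar b) => //; rewrite -cstarB nm_star.
- by rewrite /= cstar0.
- by move=> a b /= Sa Sb; rewrite cstarD; exact: SD.
- by move=> k a /= Sa; rewrite cstarZ; exact: SZ.
Qed.

Lemma bistar_linear_bound_l A B Q (t : A -> B -> Q) b :
  bistar_hom t -> forall a, nm (t a b) <= nm b * nm a.
Proof. by move=> th a; rewrite mulrC bistar_le. Qed.

Lemma bistar_comp A B A' B' Q (t : A -> B -> Q) (f : A' -> A) (g : B' -> B) :
  bistar_hom t -> star_hom f -> star_hom g -> bistar_hom (fun a b => t (f a) (g b)).
Proof.
move=> th fh gh; split=> [b k a a'|a k b b'|a a' b b'|a b].
- by rewrite (star_homD fh) (star_homZ fh) (bistar_linear_l th).
- by rewrite (star_homD gh) (star_homZ gh) (bistar_linear_r th).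
- by rewrite (star_homM fh) (star_homM gh) (bistarM th).
- by rewrite (star_hom_star fh) (star_hom_star gh) (bistar_star th).
Qed.

Lemma bistar_post A B Q Q' (t : A -> B -> Q) (f : Q -> Q') :
  bistar_hom t -> star_hom f -> bistar_hom (fun a b => f (t a b)).
Proof.
move=> th fh; split=> [b k a a'|a k b b'|a a' b b'|a b].
- by rewrite (bistar_linear_l th) (star_homD fh) (star_homZ fh).
- by rewrite (bistar_linear_r th) (star_homD fh) (star_homZ fh).
- by rewrite (bistarM th) (star_homM fh).
- by rewrite (bistar_star th) (star_hom_star fh).
Qed.

(** Extension by continuity from combinations of generators. The graph of the extension is the
    closure of the given one, and the single estimate [uniq] on that closure yields independence of
    choices, linearity and the norm bound. *)
Lemma span_extend E Q G (tau : G -> E) (sigma : G -> Q) (C : R) :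
  (forall s, nm (comb sigma s) <= C * nm (comb tau s)) ->
  closed_span [set q | exists g, q = tau g] = setT ->
  exists f : E -> Q, [/\ linear f, forall g, f (tau g) = sigma g &
    forall x, nm (f x) <= C * nm x].
Proof.
move=> sC dense.
have bnd s s' : nm (comb sigma s - comb sigma s') <= C * nm (comb tau s - comb tau s').
  have e (V : cstarType R) (r : G -> V) :
      comb r s - comb r s' = comb r (s ++ [seq (-1 * cg.1, cg.2) | cg <- s']).
    by rewrite comb_cat comb_scale scaleN1r.
  by rewrite !e.
have C0 : 0 <= `|C| + 1 by rewrite addr_ge0.
have C1 : 0 < `|C| + 1 by have := normr_ge0 C; lra.
have bnd' s s' : nm (comb sigma s - comb sigma s') <=
    (`|C| + 1) * nm (comb tau s - comb tau s').
  rewrite (le_trans (bnd _ _)) // ler_wpM2r ?nm_ge0 //.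
  by have := ler_norm C; lra.
have app x n : exists s, nm (x - comb tau s) < 2^-1 ^+ n.
  apply: closed_span_approx; first by rewrite exprn_gt0 // invr_gt0.
  by rewrite dense.
have val x : exists y, forall e : R, 0 < e -> exists2 s,
    nm (x - comb tau s) < e & nm (y - comb sigma s) < e.
  have [s sP] := choice (app x).
  have [|y yP] := @cauchy_seq_cvg _ Q (fun n => comb sigma (s n)).
    move=> e e0; have d0 : 0 < e / (2 * (`|C| + 1)) by rewrite divr_gt0 // mulr_gt0.
    have [N NP] := half_pow_small d0; exists N => m n Nm Nn.
    apply: (le_lt_trans (bnd' _ _)).
    have := nm_tri (comb tau (s m)) x (comb tau (s n)).
    have := sP m; have := sP n; have := NP _ Nm; have := NP _ Nn.
    rewrite (nmC (comb _ (s m)) x) !ltr_pdivlMr ?mulr_gt0 // => h1 h2 h3 h4 h5.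
    have h6 : nm (comb tau (s m) - comb tau (s n)) <= 2^-1 ^+ m + 2^-1 ^+ n by lra.
    have := ler_wpM2l C0 h6; lra.
  exists y => e e0; have [N NP] := half_pow_small e0; have [M MP] := yP _ e0.
  exists (s (maxn N M)); first exact: lt_trans (sP _) (NP _ (leq_maxl _ _)).
  by rewrite nmC MP // leq_maxr.
have uniq x x' y y' : (forall e : R, 0 < e -> exists2 s,
      nm (x - comb tau s) < e & nm (y - comb sigma s) < e) ->
    (forall e : R, 0 < e -> exists2 s,
      nm (x' - comb tau s) < e & nm (y' - comb sigma s) < e) ->
    nm (y - y') <= C * nm (x - x').
  move=> xy xy'; apply/ler_addgt0Pr => e e0.
  have d0 : 0 < e / (2 * (`|C| + 1)) by rewrite divr_gt0 // mulr_gt0.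
  have [s sx sy] := xy _ d0; have [s' sx' sy'] := xy' _ d0.
  set d := e / _ in d0 sx sx' sy sy'.
  have de : d * (2 * (`|C| + 1)) = e by rewrite /d divfK // mulf_neq0 // gt_eqF.
  have := nm_tri y (comb sigma s) y'; have := nm_tri (comb sigma s) (comb sigma s') y'.
  rewrite (nmC (comb sigma s') y') => h1 h2; have := bnd s s'.
  have cc : `|nm (comb tau s - comb tau s') - nm (x - x')| <= 2 * d.
    rewrite ler_norml; apply/andP; split.
      have := nm_tri x (comb tau s) x'; have := nm_tri (comb tau s) (comb tau s') x'.
      by rewrite (nmC (comb tau s') x'); lra.
    have := nm_tri (comb tau s) x (comb tau s'); have := nm_tri x x' (comb tau s').
    by rewrite (nmC (comb tau s) x); lra.
  have : C * (nm (comb tau s - comb tau s') - nm (x - x')) <= `|C| * (2 * d).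
    by rewrite (le_trans (ler_norm _)) // normrM ler_wpM2l.
  have : 2 * d <= e - `|C| * (2 * d) by lra.
  lra.
have [f fP] := choice val.
have eq0 y y' x : nm (y - y') <= C * nm (x - x : E) -> y = y' :> Q.
  by rewrite subrr nm0 mulr0 => /nm_le0/eqP; rewrite subr_eq0 => /eqP.
have cf s e : 0 < e -> exists2 s', nm (comb tau s - comb tau s') < e &
    nm (comb sigma s - comb sigma s') < e.
  by move=> e0; exists s; rewrite subrr nm0.
exists f; split.
- apply: linear_of => [x x'|k x].
    apply: (eq0 _ _ (x + x')); apply: uniq (fP _) _ => e e0.
    have e2 : 0 < e / 2 by rewrite divr_gt0.
    have [s sx sy] := fP x _ e2; have [s' sx' sy'] := fP x' _ e2.
    exists (s ++ s'); rewrite comb_cat opprD addrACA (le_lt_trans (nmD _ _)) //; lra.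
  apply: (eq0 _ _ (k *: x)); apply: uniq (fP _) _ => e e0.
  have k1 : 0 < cabs k + 1 by have := cabs_ge0 k; lra.
  have [|s sx sy] := fP x (e / (cabs k + 1)); first by rewrite divr_gt0.
  exists [seq (k * cg.1, cg.2) | cg <- s]; rewrite comb_scale -scalerBr nmZ.
    have := nm_ge0 (x - comb tau s); move: sx; rewrite ltr_pdivlMr //.
    by have := cabs_ge0 k; nra.
  have := nm_ge0 (f x - comb sigma s); move: sy; rewrite ltr_pdivlMr //.
  by have := cabs_ge0 k; nra.
- move=> g; rewrite -(comb1 sigma g) -(comb1 tau g).
  by apply: (eq0 _ _ (comb tau [:: (1, g)])); apply: uniq (fP _) (cf _).
- move=> x; rewrite -[f x]subr0 -[X in _ * nm X]subr0; apply: uniq (fP _) _ => e e0.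
  by exists [::]; rewrite /comb big_nil subrr nm0.
Qed.

Lemma equalizer_subspace A B (f g : A -> B) (C D : R) : linear f -> linear g ->
  (forall x, nm (f x) <= C * nm x) -> (forall x, nm (g x) <= D * nm x) ->
  closed_subspace [set x | f x = g x].
Proof.
move=> fl gl fC gD.
have dl : linear (fun x => f x - g x).
  by move=> k x y; rewrite fl gl; lmod_with R[i].
have db x : nm (f x - g x) <= (C + D) * nm x.
  by rewrite mulrDl (le_trans (nmB _ _)) // lerD.
have := preim_subspace dl db (zero_subspace B); congr closed_subspace.
by apply/seteqP; split=> x /=; [move/eqP; rewrite subr_eq0 => /eqP|move=> ->; rewrite subrr].
Qed.

Lemma bounded_eq_span A B (f g : A -> B) (C D : R) (G : set A) : linear f -> linear g ->
  (forall x, nm (f x) <= C * nm x) -> (forall x, nm (g x) <= D * nm x) ->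
  closed_span G = setT -> (forall x, G x -> f x = g x) -> f =1 g.
Proof.
move=> fl gl fC gD dense fg x; have : setT x by [].
by rewrite -dense; apply: closed_span_sub (equalizer_subspace fl gl fC gD) fg _.
Qed.

Lemma star_hom_bound A B (f : A -> B) : star_hom f -> forall x, nm (f x) <= 1 * nm x.
Proof. by move=> fh x; rewrite mul1r star_hom_le. Qed.

Lemma star_hom_eq_span A B (f g : A -> B) (G : set A) : star_hom f -> star_hom g ->
  closed_span G = setT -> (forall x, G x -> f x = g x) -> f =1 g.
Proof.
move=> fh gh; apply: bounded_eq_span (star_hom_bound fh) (star_hom_bound gh).
  exact: star_hom_linear fh.
exact: star_hom_linear gh.
Qed.

Lemma mull_linear A (a : A) : linear (fun x => x ** a).
Proof. by move=> k x y; rewrite cmulDl cmulZl. Qed.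
Lemma mulr_linear A (a : A) : linear (cmul a).
Proof. by move=> k x y; rewrite cmulDr cmulZr. Qed.
Lemma mull_bound A (a x : A) : nm (x ** a) <= nm a * nm x.
Proof. by rewrite mulrC nmM. Qed.

Lemma range_closed A B (f : A -> B) : star_hom f -> (forall x, nm (f x) = nm x) ->
  closed [set y | exists x, y = f x].
Proof.
move=> fh fi; apply/closedP => y yS.
have p2 n : 0 < 2^-1 ^+ n :> R by rewrite exprn_gt0 // invr_gt0.
have app n : exists x, nm (y - f x) < 2^-1 ^+ n.
  by have [_ [x ->] yx] := yS _ (p2 n); exists x.
have [u uP] := choice app.
have [|l ul] := @cauchy_seq_cvg _ A u.
  move=> e e0; have [N NP] := half_pow_small (divr_gt0 e0 (ltr0Sn R 1)).
  exists N => m n Nm Nn; rewrite -fi (star_homB fh).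
  have := nm_tri (f (u m)) y (f (u n)); rewrite (nmC (f (u m)) y).
  have := uP m; have := uP n; have := NP _ Nm; have := NP _ Nn; lra.
exists l; apply/eqP; rewrite -subr_eq0; apply/eqP/nm_small => e e0.
have e2 := divr_gt0 e0 (ltr0Sn R 1).
have [N NP] := half_pow_small e2; have [M MP] := ul _ e2.
have := NP _ (leq_maxl N M); have := MP _ (leq_maxr N M); have := uP (maxn N M).
have := nm_tri y (f (u (maxn N M))) (f l).
by rewrite -(star_homB fh) fi; lra.
Qed.

Lemma range_subspace A B (f : A -> B) : star_hom f -> (forall x, nm (f x) = nm x) ->
  closed_subspace [set y | exists x, y = f x].
Proof.
move=> fh fi; split; first exact: range_closed.
- by exists 0; rewrite (star_hom0 fh).
- by move=> _ _ [a ->] [b ->]; exists (a + b); rewrite (star_homD fh).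
- by move=> k _ [a ->]; exists (k *: a); rewrite (star_homZ fh).
Qed.

Lemma tensor_span A B E (t : A -> B -> E) : is_max_tensor t ->
  closed_span [set q | exists g : A * B, q = t g.1 g.2] = setT.
Proof.
move=> /max_tensor_dense <-; congr closed_span; apply/seteqP.
by split=> [_ [[a b] ->]|_ [a [b ->]]]; [exists a, b|exists (a, b)].
Qed.

Lemma tensor_span_l A B Q (t : A -> B -> Q) (S : set A) (H : set Q) : is_max_tensor t ->
  closed_span S = setT -> (forall a b, S a -> H (t a b)) -> closed_span H = setT.
Proof.
move=> tm ST SH; have th := max_tensor_hom tm; apply/seteqP; split => // q _.
have HH := closed_span_subspace H; have : setT q by [].
rewrite -(max_tensor_dense tm); apply: (closed_span_sub HH) => _ [a [b ->]].
have : setT a by []; rewrite -ST.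
apply: (closed_span_map (bistar_linear_l th b) (bistar_linear_bound_l b th) HH) => g Sg.
by apply: sub_closed_span; exact: SH.
Qed.

Lemma tensor_span_r A B Q (t : A -> B -> Q) (S : set B) (H : set Q) : is_max_tensor t ->
  closed_span S = setT -> (forall a b, S b -> H (t a b)) -> closed_span H = setT.
Proof.
move=> tm ST SH; have th := max_tensor_hom tm; apply/seteqP; split => // q _.
have HH := closed_span_subspace H; have : setT q by [].
rewrite -(max_tensor_dense tm); apply: (closed_span_sub HH) => _ [a [b ->]].
have : setT b by []; rewrite -ST.
apply: (closed_span_map (bistar_linear_r th a) (bistar_le th a) HH) => g Sg.
by apply: sub_closed_span; exact: SH.
Qed.

(** The norm condition of [is_max_tensor] is the bound that [span_extend] asks for, with constant 1.
    Multiplicativity follows by density, in one argument at a time. *)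
Lemma max_tensor_univ A B E Q (t : A -> B -> E) (t' : A -> B -> Q) :
  is_max_tensor t -> bistar_hom t' ->
  exists f : E -> Q, star_hom f /\ forall a b, f (t a b) = t' a b.
Proof.
move=> tm t'h; have th := max_tensor_hom tm.
have cE (P : cstarType R) (r : A -> B -> P) : bistar_hom r -> forall s,
    comb (fun g : A * B => r g.1 g.2) s =
    \sum_(ab <- [seq (cg.1 *: cg.2.1, cg.2.2) | cg <- s]) r ab.1 ab.2.
  by move=> rh s; rewrite /comb big_map; apply: eq_bigr => cg _; rewrite /= bistarZl.
have [f [fl fg fn]] : exists f : E -> Q, [/\ linear f,
    forall g : A * B, f (t g.1 g.2) = t' g.1 g.2 & forall x, nm (f x) <= 1 * nm x].
  apply: (span_extend _ (tensor_span tm)) => s; rewrite mul1r !cE //.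
  by have := max_tensor_norm tm t'h [seq (cg.1 *: cg.2.1, cg.2.2) | cg <- s]; rewrite !nmE lecR.
exists f; split=> [|a b]; last exact: (fg (a, b)).
have fb x : nm (f x) <= nm x by rewrite -[leRHS]mul1r.
split=> // [x y|x].
- suff : (fun x => f (x ** y)) =1 (fun x => f x ** f y) by apply.
  apply: (bounded_eq_span (C := nm y) (D := nm (f y)) _ _ _ _ (tensor_span tm)).
  + by move=> k u v /=; rewrite cmulDl cmulZl (linD fl) (linZ fl).
  + by move=> k u v /=; rewrite (linD fl) (linZ fl) cmulDl cmulZl.
  + by move=> u; rewrite (le_trans (fb _)) // mull_bound.
  + by move=> u; rewrite (le_trans (mull_bound _ _)) // ler_wpM2l ?nm_ge0.
  move=> _ [[a b] ->] /=.
  apply: (bounded_eq_span (f := fun y => f (t a b ** y)) (g := fun y => f (t a b) ** f y)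
    (C := nm (t a b)) (D := nm (f (t a b))) _ _ _ _ (tensor_span tm)).
  + by move=> k u v /=; rewrite cmulDr cmulZr (linD fl) (linZ fl).
  + by move=> k u v /=; rewrite (linD fl) (linZ fl) cmulDr cmulZr.
  + by move=> u; rewrite (le_trans (fb _)) // nmM.
  + by move=> u; rewrite (le_trans (nmM _ _)) // ler_wpM2l ?nm_ge0.
  move=> _ [[a' b'] ->] /=.
  by rewrite -(bistarM th) (fg (a, b)) (fg (a', b')) (fg (a ** a', b ** b')) /= (bistarM t'h).
- apply: (can_inj (@cstarK _ _)); rewrite cstarK.
  suff : (fun x => cstar (f (cstar x))) =1 f by apply.
  apply: (bounded_eq_span (C := 1) (D := 1) _ fl _ _ (tensor_span tm)).
  + move=> k u v /=; rewrite cstarD cstarZ (linD fl) (linZ fl) cstarD cstarZ.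
    by rewrite conjcK.
  + by move=> u; rewrite nm_star mul1r (le_trans (fb _)) // nm_star.
  + by move=> u; rewrite mul1r fb.
  move=> _ [[a b] ->] /=; rewrite -(bistar_star th) (fg (cstar a, cstar b)) /=.
  by rewrite (bistar_star t'h) cstarK (fg (a, b)).
Qed.

Lemma bistar_flip A B Q (t : A -> B -> Q) : bistar_hom t -> bistar_hom (fun b a => t a b).
Proof.
by case=> l r m s; split => // *; exact: m.
Qed.

Lemma max_tensor_flip A B E (t : A -> B -> E) : is_max_tensor t ->
  is_max_tensor (fun b a => t a b).
Proof.
move=> [th td tn]; split; first exact: bistar_flip.
  by rewrite -td; congr closed_span; apply/seteqP; split=> _ [a [b ->]]; exists b, a.
move=> Q t' t'h s; have := tn _ _ (bistar_flip t'h) [seq (x.2, x.1) | x <- s].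
by rewrite !big_map.
Qed.

End Extension.

(* Multipliers of Q as pairs (operator on Q, adjoint). *)
Section Multipliers.
Variables (R : realType) (Q : cstarType R).

(** [cstar x ** y] is the inner product of [Q] as a Hilbert module over itself; multipliers are its
    adjointable operators. *)
Definition adjointable (L : (Q -> Q) * (Q -> Q)) :=
  (forall x y, cstar (L.1 x) ** y = cstar x ** L.2 y) /\
  exists2 C, 0 <= C & forall x, nm (L.1 x) <= C * nm x.

Definition adj := {L | adjointable L}.
Implicit Types L M : adj.

Lemma adjE L x y : cstar ((sval L).1 x) ** y = cstar x ** (sval L).2 y.
Proof. by case: L => L []. Qed.

Lemma adjE' L x y : cstar ((sval L).2 x) ** y = cstar x ** (sval L).1 y.
Proof. by apply: (can_inj (@cstarK _ _)); rewrite !cstarM !cstarK -adjE. Qed.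

Lemma cmul_sub_eq (x y : Q) : (forall z, cstar x ** z = cstar y ** z) -> x = y.
Proof.
move=> xy; apply: (can_inj (@cstarK _ _)); apply/eqP; rewrite -subr_eq0; apply/eqP.
by apply: cmul_eq0 => z; rewrite cmulBl xy subrr.
Qed.

Lemma adj_swap L : adjointable ((sval L).2, (sval L).1).
Proof.
split=> [x y|/=]; first exact: adjE'.
have [_ [C C0 LC]] := svalP L; exists C => // x.
have [->|x0] := eqVneq (nm ((sval L).2 x)) 0; first by rewrite mulr_ge0 ?nm_ge0.
have xp : 0 < nm ((sval L).2 x) by rewrite lt_def x0 nm_ge0.
rewrite -(ler_pM2r xp) -expr2 -nm_star_mul adjE'.
rewrite (le_trans (nmM _ _)) // nm_star; have := LC ((sval L).2 x).
by have := nm_ge0 x; nra.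
Qed.

Lemma adj_id0 : adjointable (fun=> 0, fun=> 0).
Proof.
split=> [x y|] /=; first by rewrite cstar0 cmul0l cmul0r.
by exists 0 => // x; rewrite nm0 mul0r.
Qed.

Lemma adj_add L M : adjointable (fun x => (sval L).1 x + (sval M).1 x,
  fun x => (sval L).2 x + (sval M).2 x).
Proof.
split=> [x y|] /=; first by rewrite cstarD cmulDl cmulDr !adjE.
have [_ [C C0 LC]] := svalP L; have [_ [D D0 MD]] := svalP M.
by exists (C + D) => [|x]; rewrite ?addr_ge0 // mulrDl (le_trans (nmD _ _)) ?lerD.
Qed.

Lemma adj_scale k L : adjointable (fun x => k *: (sval L).1 x,
  fun x => conjc k *: (sval L).2 x).
Proof.
split=> [x y|] /=; first by rewrite cstarZ cmulZl cmulZr adjE.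
have [_ [C C0 LC]] := svalP L.
exists (cabs k * C) => [|x]; first by rewrite mulr_ge0 ?cabs_ge0.
by rewrite nmZ -mulrA ler_wpM2l ?cabs_ge0.
Qed.

Lemma adj_mul L M : adjointable (fun x => (sval L).1 ((sval M).1 x),
  fun x => (sval M).2 ((sval L).2 x)).
Proof.
split=> [x y|] /=; first by rewrite !adjE.
have [_ [C C0 LC]] := svalP L; have [_ [D D0 MD]] := svalP M.
exists (C * D) => [|x]; first by rewrite mulr_ge0.
by rewrite (le_trans (LC _)) // -mulrA ler_wpM2l.
Qed.

Let zero : adj := exist _ _ adj_id0.
Let add L M : adj := exist _ _ (adj_add L M).
Let scale k L : adj := exist _ _ (adj_scale k L).
Let mul L M : adj := exist _ _ (adj_mul L M).
Let star L : adj := exist _ _ (adj_swap L).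
(** The adjoint is determined by the operator, so operators alone are compared. *)
Let eq L M := forall x, (sval L).1 x = (sval M).1 x.

Let norm L : R := sup [set r | exists2 x, nm x <= 1 & r = nm ((sval L).1 x)].

(** Linearity is a consequence of having an adjoint: the products [cstar x ** z] separate the
    elements [x]. *)
Lemma adj_linear L : linear (sval L).1.
Proof.
move=> k x y; apply: cmul_sub_eq => z.
by rewrite adjE !cstarD !cstarZ !cmulDl !cmulZl !adjE.
Qed.

Let norm_has_sup L : has_sup [set r | exists2 x, nm x <= 1 & r = nm ((sval L).1 x)].
Proof.
split; first by exists (nm ((sval L).1 0)), 0; rewrite ?nm0.
have [_ [C C0 LC]] := svalP L; exists C => _ [x x1 ->].
by rewrite (le_trans (LC x)) // ler_piMr.
Qed.

Let norm_ge0 L : 0 <= norm L.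
Proof.
apply: (@le_trans _ _ (nm ((sval L).1 0))); first exact: nm_ge0.
by apply: sup_upper_bound => //; exists 0; rewrite ?nm0.
Qed.

Let norm_ge L x : nm ((sval L).1 x) <= norm L * nm x.
Proof.
have [x0|x0] := eqVneq (nm x) 0.
  have -> : x = 0 by exact: nm_eq0.
  by rewrite (lin0 (adj_linear L)) nm0 mulr0.
have xp : 0 < nm x by rewrite lt_def x0 nm_ge0.
rewrite -ler_pdivrMr // mulrC -nmZr ?invr_ge0 ?nm_ge0 // -(linZ (adj_linear L)).
apply: sup_upper_bound => //; exists ((nm x)^-1%:C *: x) => //.
by rewrite nmZr ?invr_ge0 ?nm_ge0 // mulVf.
Qed.

Let norm_le L C : 0 <= C -> (forall x, nm ((sval L).1 x) <= C * nm x) -> norm L <= C.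
Proof.
move=> C0 LC; apply: ge_sup => [|_ [x x1 ->]]; first by case: (norm_has_sup L).
by rewrite (le_trans (LC x)) // ler_piMr.
Qed.

(** Passing to the adjoint does not increase the norm, so the operators and their adjoints converge
    together, and the two limits are adjoint to each other. *)
Lemma adj_complete (u : nat -> adj) :
  (forall e : R, 0 < e -> exists N, forall m n, (N <= m)%N -> (N <= n)%N ->
     norm (add (u m) (scale (-1) (u n))) < e) ->
  exists l, forall e : R, 0 < e -> exists N, forall n, (N <= n)%N ->
     norm (add (u n) (scale (-1) l)) < e.
Proof.
move=> cu.
have cb1 e : 0 < e -> exists N, forall m n, (N <= m)%N -> (N <= n)%N ->
    forall x, nm ((sval (u m)).1 x - (sval (u n)).1 x) <= e * nm x.
  move=> /cu[N NP]; exists N => m n Nm Nn x; rewrite -scaleN1r.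
  apply: le_trans (norm_ge (add (u m) (scale (-1) (u n))) x) _.
  by rewrite ler_wpM2r ?nm_ge0 // ltW // NP.
have nstar L : norm (star L) <= norm L.
  apply: norm_le => // x.
  have [->|x0] := eqVneq (nm ((sval L).2 x)) 0; first by rewrite mulr_ge0 ?nm_ge0.
  have xp : 0 < nm ((sval L).2 x) by rewrite lt_def x0 nm_ge0.
  rewrite -(ler_pM2r xp) -expr2 -nm_star_mul adjE'.
  rewrite (le_trans (nmM _ _)) // nm_star; have := norm_ge L ((sval L).2 x).
  by have := nm_ge0 x; nra.
have cb2 e : 0 < e -> exists N, forall m n, (N <= m)%N -> (N <= n)%N ->
    forall x, nm ((sval (u m)).2 x - (sval (u n)).2 x) <= e * nm x.
  move=> /cu[N NP]; exists N => m n Nm Nn x.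
  have -> : (sval (u m)).2 x - (sval (u n)).2 x =
      (sval (star (add (u m) (scale (-1) (u n))))).1 x.
    rewrite -[RHS]/((sval (u m)).2 x + conjc (-1) *: (sval (u n)).2 x).
    by rewrite rmorphN rmorph1 scaleN1r.
  apply: le_trans (norm_ge _ _) _.
  by rewrite ler_wpM2r ?nm_ge0 // (le_trans (nstar _)) // ltW // NP.
have pt (f : nat -> Q -> Q) : (forall e : R, 0 < e -> exists N, forall m n,
      (N <= m)%N -> (N <= n)%N -> forall x, nm (f m x - f n x) <= e * nm x) ->
    exists g, forall x, lim_seq (f^~ x) (g x).
  move=> cf; have cv x : exists l, lim_seq (f^~ x) l.
    apply: cauchy_seq_cvg => e e0; have x1 : 0 < nm x + 1 by have := nm_ge0 x; lra.
    have [|N NP] := cf (e / (nm x + 1)); first by rewrite divr_gt0.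
    exists N => m n Nm Nn; apply: (le_lt_trans (NP _ _ Nm Nn x)).
    by rewrite mulrAC ltr_pdivrMr // ltr_pM2l //; lra.
  by have [g gP] := choice cv; exists g.
have [g gP] := pt _ cb1; have [h hP] := pt _ cb2.
have gb e : 0 < e -> exists N, forall n, (N <= n)%N ->
    forall x, nm ((sval (u n)).1 x - g x) <= e * nm x.
  move=> /cb1[N NP]; exists N => n Nn x; rewrite nmC.
  have := lim_seqD (gP x) (lim_seq_cst (- (sval (u n)).1 x)).
  by move=> /lim_seq_le; apply; exists N => m Nm; exact: NP.
have Ladj : adjointable (g, h).
  split=> [x y|] /=.
    have := lim_seqM (lim_seq_star (gP x)) (lim_seq_cst y).
    under eq_fun do rewrite adjE.
    by move/lim_seq_uniq; apply; apply: lim_seqM (hP y); exact: lim_seq_cst.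
  have [N /(_ N (leqnn N)) NP] := gb _ ltr01.
  have [_ [C C0 LC]] := svalP (u N).
  exists (1 + C) => [|x]; first by rewrite addr_ge0.
  have := NP x; have := LC x; have := nm_le_add (g x) ((sval (u N)).1 x).
  by rewrite (nmC (g x) ((sval (u N)).1 x)); lra.
exists (exist _ _ Ladj) => e e0; have e2 := divr_gt0 e0 (ltr0Sn R 1).
have [N NP] := gb _ e2; exists N => n Nn.
apply: (@le_lt_trans _ _ (e / 2)); last by lra.
by apply: norm_le => [|x /=]; [rewrite ltW|rewrite scaleN1r NP].
Qed.

Definition mult_precstar : precstar R.
Proof.
refine (@PreCStar R adj eq zero add scale mul star norm
  _ _ _ _ _ _ _ _ _ _ _ _ _ _ _ _ _ _ _ _ _ _ _ _ _ _ _ _ _ _ _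
  adj_complete).
all: try by move=> * x; rewrite /= ?(addrA, scalerA, scale1r, scalerDr,
  scalerDl, add0r, scaleN1r, addNr, linD (adj_linear _), linZ (adj_linear _)) // addrC.
all: try by move=> * x; rewrite /= addrC.
- by move=> u v w uv vw x; rewrite uv.
- by move=> u u' v v' uu vv x; rewrite /= uu vv.
- by move=> k u u' uu x; rewrite /= uu.
- by move=> u u' v v' uu vv x; rewrite /= uu vv.
- by move=> u u' uu x; apply: cmul_sub_eq => y; rewrite /= !adjE' uu.
- move=> u u' uu; rewrite /norm; congr sup; apply/seteqP.
  by split=> r [x x1 ->]; exists x; rewrite ?uu.
- exact: norm_ge0.
- move=> u v; apply: norm_le => [|x]; first by rewrite addr_ge0.
  by rewrite /= mulrDl (le_trans (nmD _ _)) // lerD.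
- have le k u : norm (scale k u) <= cabs k * norm u.
    apply: norm_le => [|x /=]; first by rewrite mulr_ge0 ?cabs_ge0.
    by rewrite nmZ -mulrA ler_wpM2l ?cabs_ge0.
  move=> k u; apply/eqP; rewrite eq_le le /=.
  have [->|k0] := eqVneq k 0; first by rewrite /cabs normr0 mul0r.
  have kp : 0 < cabs k by rewrite lt_def cabs_ge0 andbT; apply: contra k0 => /eqP/cabs_eq0 ->.
  rewrite mulrC -ler_pdivlMr //; apply: norm_le => [|x].
    by rewrite divr_ge0 // ltW.
  rewrite mulrAC ler_pdivlMr // mulrC -nmZ; exact: (norm_ge (scale k u)).
- by move=> u u0 x; apply: nm_le0; rewrite -(mul0r (nm x)) -u0.
- move=> u v; apply: norm_le => [|x /=]; first by rewrite mulr_ge0.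
  by rewrite (le_trans (norm_ge _ _)) // -mulrA ler_wpM2l.
- move=> u; apply/eqP; rewrite eq_le; apply/andP; split.
    apply: norm_le => [|x /=]; first by rewrite exprn_ge0.
    have nstar L x' : nm ((sval L).2 x') <= norm L * nm x'.
      have [->|x0] := eqVneq (nm ((sval L).2 x')) 0; first by rewrite mulr_ge0 ?nm_ge0.
      have xp : 0 < nm ((sval L).2 x') by rewrite lt_def x0 nm_ge0.
      rewrite -(ler_pM2r xp) -expr2 -nm_star_mul adjE'.
      rewrite (le_trans (nmM _ _)) // nm_star; have := norm_ge L ((sval L).2 x').
      by have := nm_ge0 x'; nra.
    by rewrite (le_trans (nstar _ _)) // expr2 -mulrA ler_wpM2l.
  rewrite -[leRHS]sqr_sqrtr // ler_pXn2r ?nnegrE ?sqrtr_ge0 //.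
  apply: norm_le => [|x]; first exact: sqrtr_ge0.
  rewrite -(ler_pXn2r (n := 2)) ?nnegrE ?nm_ge0 ?mulr_ge0 ?sqrtr_ge0 ?nm_ge0 //.
  rewrite exprMn sqr_sqrtr // -nm_star_mul adjE (le_trans (nmM _ _)) // nm_star.
  by have := norm_ge (mul (star u) u) x; have := nm_ge0 x; rewrite /= expr2; nra.
Defined.

Definition multipliers : cstarType R := cstar_of mult_precstar.

Definition mapp (m : multipliers) : Q -> Q := (sval (prepr m : adj)).1.

Definition mk_mult (L : adj) : multipliers := pclass (P := mult_precstar) L.

Lemma mappE L x : mapp (mk_mult L) x = (sval L).1 x.
Proof. exact: (@prepr_class _ mult_precstar L x). Qed.

Lemma mk_multP m : exists L, m = mk_mult L.
Proof. by exists (prepr m); rewrite /mk_mult preprK. Qed.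

Lemma mult_ext (m n : multipliers) : (forall x, mapp m x = mapp n x) -> m = n.
Proof.
have [L ->] := mk_multP m; have [M ->] := mk_multP n => mn.
by apply: (@pclass_eq _ mult_precstar) => x; rewrite -!mappE.
Qed.

Lemma mapp_linear m : linear (mapp m).
Proof. exact: adj_linear. Qed.

Lemma mapp_bound m x : nm (mapp m x) <= nm m * nm x.
Proof.
have [L ->] := mk_multP m; rewrite mappE (@pclass_nm _ mult_precstar L).
exact: norm_ge.
Qed.

Lemma mappD m n x : mapp (m + n) x = mapp m x + mapp n x.
Proof.
have [L ->] := mk_multP m; have [M ->] := mk_multP n.
by rewrite -[_ + _](pclassD (P := mult_precstar)) !mappE.
Qed.

Lemma mappZ k m x : mapp (k *: m) x = k *: mapp m x.
Proof.
have [L ->] := mk_multP m.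
by rewrite -[_ *: mk_mult _](pclassZ (P := mult_precstar)) !mappE.
Qed.

Lemma mappM m n x : mapp (m ** n) x = mapp m (mapp n x).
Proof.
have [L ->] := mk_multP m; have [M ->] := mk_multP n.
by rewrite -[_ ** _](pclassM (P := mult_precstar)) !mappE.
Qed.

Lemma mapp_star m x y : cstar (mapp m x) ** y = cstar x ** mapp (cstar m) y.
Proof.
have [L ->] := mk_multP m.
by rewrite -[cstar (mk_mult _)](pclass_star (P := mult_precstar)) !mappE adjE.
Qed.

Lemma adj_incl q : adjointable (cmul q, cmul (cstar q)).
Proof.
split=> [x y|] /=; first by rewrite cstarM cmulA.
by exists (nm q) => [|x]; rewrite ?nm_ge0 // nmM.
Qed.

Definition mincl q : multipliers := mk_mult (exist _ _ (adj_incl q)).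

Lemma mapp_incl q x : mapp (mincl q) x = q ** x.
Proof. by rewrite mappE. Qed.

Lemma mincl_hom : star_hom mincl.
Proof.
split=> [k x y|x y|x]; apply: mult_ext => z.
- by rewrite mappD mappZ !mapp_incl cmulDl cmulZl.
- by rewrite mappM !mapp_incl cmulA.
- apply: cmul_sub_eq => y; rewrite mapp_incl cstarM cstarK.
  by rewrite mapp_star cstarK mapp_incl cmulA.
Qed.

(** Tested on [cstar q], left multiplication by [q] attains the norm of [q]. *)
Lemma mincl_nm q : nm (mincl q) = nm q.
Proof.
apply/eqP; rewrite eq_le star_hom_le /=; last exact: mincl_hom.
have [->|q0] := eqVneq (nm q) 0; first exact: nm_ge0.
have qp : 0 < nm (cstar q) by rewrite nm_star lt_def q0 nm_ge0.
rewrite -(ler_pM2r qp) nm_star -expr2 -nm_mul_star -mapp_incl.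
by rewrite -[X in _ <= _ * X](nm_star q) mapp_bound.
Qed.

End Multipliers.

(** * Associativity of the maximal tensor product *)

Section TripleTensor.
Variable R : realType.
Implicit Types A B C D E Q S : cstarType R.

(* A tensor factor does not map to the algebra Q generated by the elementary
   tensors, but it acts on Q by multipliers. *)
Lemma action_multipliers D Q (G : Type) (tau : G -> Q) (act : D -> G -> G) :
  (forall d g g', cstar (tau (act d g)) ** tau g' =
     cstar (tau g) ** tau (act (cstar d) g')) ->
  (forall g, linear (fun d => tau (act d g))) ->
  (forall d d' g, tau (act (d ** d') g) = tau (act d (act d' g))) ->
  closed_span [set q | exists g, q = tau g] = setT ->
  exists rho : D -> multipliers Q, star_hom rho /\
    forall d g, mapp (rho d) (tau g) = tau (act d g).
Proof.
move=> actS actL actM dense.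
have comb_mul (F F' H H' : G -> Q) s s' :
    (forall g g', cstar (F g) ** F' g' = cstar (H g) ** H' g') ->
    cstar (comb F s) ** comb F' s' = cstar (comb H s) ** comb H' s'.
  move=> FH; rewrite /comb; elim: s => [|cg s IH]; first by rewrite !big_nil !cstar0 !cmul0l.
  rewrite !big_cons !cstarD !cmulDl IH; congr (_ + _) => {IH}.
  elim: s' => [|dg s' IH]; first by rewrite !big_nil !cmul0r.
  by rewrite !big_cons !cmulDr IH !cstarZ !cmulZl !cmulZr FH.
have bnd d s : nm (comb (fun g => tau (act d g)) s) <= nm d * nm (comb tau s).
  apply: (@action_bound R D Q (comb tau s) (fun d => comb (fun g => tau (act d g)) s)).
  - move=> k x y; rewrite /comb scaler_sumr -big_split; apply: eq_bigr => cg _ /=.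
    by rewrite (actL cg.2 k x y) scalerDr !scalerA mulrC.
  - by move=> x y; apply: comb_mul => g g'; rewrite actS actM.
  - by move=> x; apply: comb_mul => g g'; rewrite actS.
have [f fP] := choice (fun d => span_extend (bnd d) dense).
have fl d : linear (f d) by case: (fP d).
have ft d g : f d (tau g) = tau (act d g) by case: (fP d).
have fb d x : nm (f d x) <= nm d * nm x by case: (fP d).
have fS d x y : cstar (f d x) ** y = cstar x ** f (cstar d) y.
  have cl (A B : cstarType R) (h : A -> B) : linear h -> linear (fun x => cstar (h (cstar x))).
    by move=> hl k u v; rewrite cstarD cstarZ (linD hl) (linZ hl) cstarD cstarZ conjcK.
  have gen g : cstar (f d x) ** tau g = cstar x ** f (cstar d) (tau g).
    apply: (can_inj (@cstarK _ _)); rewrite !cstarM !cstarK.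
    apply: (bounded_eq_span (f := fun x => cstar (tau g) ** f d x)
      (g := fun x => cstar (f (cstar d) (tau g)) ** x)
      (C := nm (tau g) * nm d) (D := nm (f (cstar d) (tau g))) _ _ _ _ dense).
    + by move=> k u v /=; rewrite (linD (fl d)) (linZ (fl d)) cmulDr cmulZr.
    + exact: mulr_linear.
    + move=> u; rewrite (le_trans (nmM _ _)) // nm_star -mulrA.
      by rewrite ler_wpM2l ?nm_ge0.
    + by move=> u; rewrite -(nm_star (f _ _)) nmM.
    by move=> _ [g' ->] /=; rewrite !ft actS cstarK.
  apply: (bounded_eq_span (f := fun y => cstar (f d x) ** y)
      (g := fun y => cstar x ** f (cstar d) y)
      (C := nm (f d x)) (D := nm x * nm d) _ _ _ _ dense).
  - exact: mulr_linear.
  - by move=> k u v /=; rewrite (linD (fl _)) (linZ (fl _)) cmulDr cmulZr.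
  - by move=> u; rewrite -(nm_star (f d x)) nmM.
  - move=> u; rewrite (le_trans (nmM _ _)) // nm_star -mulrA.
    by rewrite ler_wpM2l ?nm_ge0 // -(nm_star d).
  by move=> _ [g ->].
have fadj d : adjointable (f d, f (cstar d)).
  by split=> [x y|] /=; [exact: fS|exists (nm d); rewrite ?nm_ge0].
pose rho d := mk_mult (exist _ _ (fadj d)).
have rhoE d x : mapp (rho d) x = f d x by rewrite mappE.
exists rho; split=> [|d g]; last by rewrite rhoE ft.
have ext (m n : multipliers Q) : (forall g, mapp m (tau g) = mapp n (tau g)) -> m = n.
  move=> mn; apply: mult_ext.
  apply: (bounded_eq_span (mapp_linear m) (mapp_linear n) (mapp_bound m) (mapp_bound n) dense).
  by move=> _ [g ->].
split=> [k x y|x y|x].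
- by apply: ext => g; rewrite mappD mappZ !rhoE !ft (actL g k x y).
- by apply: ext => g; rewrite mappM !rhoE !ft actM.
- apply: mult_ext => z; apply: cmul_sub_eq => y.
  by rewrite rhoE fS cstarK mapp_star cstarK rhoE.
Qed.

(** The three algebras act on [Q] by commuting multipliers, so both tensor products map to the
    multiplier algebra by their universal properties. The values lie in [Q], which is closed there,
    because they do on elementary tensors. *)
Lemma triple_tensor A B C S E Q (t1 : A -> B -> S) (t2 : S -> C -> E)
    (tau : A -> B -> C -> Q) :
  is_max_tensor t1 -> is_max_tensor t2 ->
  (forall b c, linear (fun a => tau a b c)) ->
  (forall a c, linear (fun b => tau a b c)) ->
  (forall a b, linear (tau a b)) ->
  (forall a a' b b' c c', tau (a ** a') (b ** b') (c ** c') =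
     tau a b c ** tau a' b' c') ->
  (forall a b c, tau (cstar a) (cstar b) (cstar c) = cstar (tau a b c)) ->
  closed_span [set q | exists g : A * B * C, q = tau g.1.1 g.1.2 g.2] = setT ->
  exists f : E -> Q, star_hom f /\ forall a b c, f (t2 (t1 a b) c) = tau a b c.
Proof.
move=> m1 m2 lA lB lC tM tS dense.
pose T (g : A * B * C) := tau g.1.1 g.1.2 g.2.
have [rA [rAh rAT]] : exists rho : A -> multipliers Q, star_hom rho /\
    forall a g, mapp (rho a) (T g) = T (a ** g.1.1, g.1.2, g.2).
  apply: action_multipliers dense => [a g g'|g|a a' g]; rewrite /T /=.
  - by rewrite -!tS -!tM cstarM cmulA.
  - by move=> k x y; rewrite cmulDl cmulZl lA.
  - by rewrite cmulA.
have [rB [rBh rBT]] : exists rho : B -> multipliers Q, star_hom rho /\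
    forall b g, mapp (rho b) (T g) = T (g.1.1, b ** g.1.2, g.2).
  apply: action_multipliers dense => [a g g'|g|a a' g]; rewrite /T /=.
  - by rewrite -!tS -!tM cstarM cmulA.
  - by move=> k x y; rewrite cmulDl cmulZl lB.
  - by rewrite cmulA.
have [rC [rCh rCT]] : exists rho : C -> multipliers Q, star_hom rho /\
    forall c g, mapp (rho c) (T g) = T (g.1.1, g.1.2, c ** g.2).
  apply: action_multipliers dense => [a g g'|g|a a' g]; rewrite /T /=.
  - by rewrite -!tS -!tM cstarM cmulA.
  - by move=> k x y; rewrite cmulDl cmulZl lC.
  - by rewrite cmulA.
have ext (m n : multipliers Q) : (forall g, mapp m (T g) = mapp n (T g)) -> m = n.
  move=> mn; apply: mult_ext.
  apply: (bounded_eq_span (mapp_linear m) (mapp_linear n) (mapp_bound m) (mapp_bound n) dense).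
  by move=> _ [g ->]; exact: mn.
have AB a b : rA a ** rB b = rB b ** rA a.
  by apply: ext => g; rewrite !mappM rAT !rBT rAT.
have AC a c : rA a ** rC c = rC c ** rA a.
  by apply: ext => g; rewrite !mappM rAT !rCT rAT.
have BC b c : rB b ** rC c = rC c ** rB b.
  by apply: ext => g; rewrite !mappM rBT !rCT rBT.
have [p [ph pE]] := max_tensor_univ m1 (commuting_bistar rAh rBh AB).
have pC s c : p s ** rC c = rC c ** p s.
  apply: (bounded_eq_span (f := fun s => p s ** rC c) (g := fun s => rC c ** p s)
    (C := nm (rC c)) (D := nm (rC c)) _ _ _ _ (tensor_span m1)).
  - by move=> k u v /=; rewrite (star_hom_linear ph) cmulDl cmulZl.
  - by move=> k u v /=; rewrite (star_hom_linear ph) cmulDr cmulZr.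
  - by move=> u; rewrite (le_trans (mull_bound _ _)) // ler_wpM2l ?nm_ge0 // star_hom_le.
  - by move=> u; rewrite (le_trans (nmM _ _)) // ler_wpM2l ?nm_ge0 // star_hom_le.
  by move=> _ [[a b] ->]; rewrite pE -cmulA BC cmulA AC -cmulA.
have incl_inj x y : mincl x = mincl y -> x = y.
  move=> xy; apply/eqP; rewrite -subr_eq0; apply/eqP/nm_eq0.
  by rewrite -mincl_nm (star_homB (mincl_hom _)) xy subrr nm0.
(* The two factors are only multipliers, but their product lies in [Q]: for [s = t1 a b] it is
   [tau a b c], and the range of [mincl] is closed. *)
have val s c : exists q, mincl q = p s ** rC c.
  pose V := [set s | exists q, p s ** rC c = mincl q].
  have Vs : closed_subspace V.
    apply: (preim_subspace (M := nm (rC c)) (S := [set y | exists q, y = mincl q]) (f := fun s => p s ** rC c)).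
    - by move=> k x y; rewrite (star_hom_linear ph) cmulDl cmulZl.
    - by move=> x; rewrite mulrC (le_trans (nmM _ _)) // ler_wpM2r ?nm_ge0 // star_hom_le.
    - exact: range_subspace (mincl_hom Q) (@mincl_nm _ Q).
  have : setT s by [].
  rewrite -(tensor_span m1) => sp; have [|q ->] := closed_span_sub Vs _ sp; last by exists q.
  move=> _ [[a b] ->] /=; exists (tau a b c); rewrite pE; apply: ext => g.
  by rewrite !mappM rCT rBT rAT /T /= mapp_incl tM.
have [t tP] := choice (fun sc : S * C => val sc.1 sc.2).
have tE s c : mincl (t (s, c)) = p s ** rC c by exact: tP.
have th : bistar_hom (fun s c => t (s, c)).
  apply: (@bistar_joint R unit S C Q (fun=> multipliers Q) (fun=> @mincl _ Q)
    (fun _ s c => p s ** rC c)) => [_|x y xy|_|_ s c]; last exact: tE.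
  - exact: mincl_hom.
  - exact: incl_inj (xy tt).
  - exact: commuting_bistar.
have [f [fh fE]] := max_tensor_univ m2 th.
exists f; split => // a b c; rewrite fE; apply: incl_inj; rewrite tE pE; apply: ext => g.
by rewrite !mappM rCT rBT rAT /T /= mapp_incl tM.
Qed.

End TripleTensor.

(** * Algebras over a space and their fibres *)

Arguments xideal {R X} x U _.
Arguments ev {R X} A x _.

(** * Locally compact spaces and bump functions *)

Section Topology.
Variable R : realType.
Implicit Types X Y : lch.

(** Compactness as an induction principle. If [P K] failed, the sets whose complement in [K]
    satisfies [P] would form a proper filter, and its cluster point in [K] would contradict the
    local hypothesis. *)
Lemma compact_ind (X : topologicalType) (K : set X) (P : set X -> Prop) :
  compact K -> P set0 -> (forall A B, P A -> P B -> P (A `|` B)) ->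
  (forall A B, A `<=` B -> P B -> P A) ->
  (forall x, K x -> exists2 U, nbhs x U & P U) -> P K.
Proof.
move=> Kc P0 PU PS Ploc; apply: contrapT => nPK.
pose F := [set A : set X | P (K `\` A)].
have FF : ProperFilter F.
  split=> [|]; first by rewrite /F /= setD0.
  split=> [|A B|A B AB]; rewrite /F /=.
  - by rewrite setDT.
  - by move=> PA PB; rewrite setDIr; exact: PU.
  - by move=> PA; apply: PS PA; exact: setDS.
have FK : F K by rewrite /F /= setDv.
have [x [Kx xF]] := Kc F FF FK; have [U xU PUU] := Ploc x Kx.
have FU : F (~` U) by rewrite /F /=; apply: PS PUU => y [_]; exact: contrapT.
by have [y []] := xF _ _ FU xU.
Qed.

Lemma lch_nbhs_compact X (x : X) : exists K, [/\ nbhs x K, compact K & closed K].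
Proof.
have [K xK [cK clK]] := @lch_locally_compact X x I; exists K; split => //.
by apply: (@filterS _ (nbhs x) _ _ _ _ xK) => z; apply.
Qed.

Lemma lch_compact_closed X (K : set X) : compact K -> closed K.
Proof. by apply: compact_closed; exact: lch_hausdorff. Qed.

Lemma lch_separate X (x y : X) : x <> y ->
  exists U V, [/\ open U, open V, U x, V y & U `&` V = set0].
Proof.
have := @lch_hausdorff X; rewrite open_hausdorff => h.
move=> /eqP /h[[U V] /= [Ux Vy] [oU oV UV]].
by exists U, V; split => //; [exact: set_mem|exact: set_mem|exact/eqP].
Qed.

Definition clamp (t : R) : R := if t <= 0 then 0 else if 1 <= t then 1 else t.

Lemma clamp01 t : 0 <= clamp t <= 1.
Proof.
rewrite /clamp; case: (leP t 0) => h0; first by rewrite lexx ler01.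
by case: (leP 1 t) => h1; lra.
Qed.

Lemma clamp_lip s t : `|clamp s - clamp t| <= `|s - t|.
Proof.
wlog st : s t / s <= t => [h|].
  by have [/h//|/ltW/h] := leP s t; rewrite distrC (distrC t).
rewrite !(distrC s) !(distrC (clamp s)) !ger0_norm ?subr_ge0 //; rewrite /clamp;
  case: (leP s 0) => s0; case: (leP t 0) => t0; case: (leP 1 s) => s1;
  case: (leP 1 t) => t1; lra.
Qed.

Lemma clamp_eq1 t : 1 <= t -> clamp t = 1.
Proof. by rewrite /clamp; case: (leP t 0) => t0 t1; [lra|rewrite t1]. Qed.

Lemma clamp_eq0 t : t <= 0 -> clamp t = 0.
Proof. by rewrite /clamp => ->. Qed.

Lemma clamp_continuous (T : topologicalType) (g : T -> R) :
  continuous g -> continuous (clamp \o g).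
Proof.
move=> gc x; apply/cvgrPdist_lt => e e0; have /cvgrPdist_lt /(_ e e0) := gc x.
by apply: filterS => y; apply: le_lt_trans; exact: clamp_lip.
Qed.

Record bump X (x : X) (U : set X) (phi : X -> R) : Prop := Bump {
  bump_cont : continuous phi ;
  bump_01 : forall y, 0 <= phi y <= 1 ;
  bump_near : nbhs x [set y | phi y = 1] ;
  bump_supp : exists2 K, compact K & K `<=` U /\ forall y, ~ K y -> phi y = 0 }.

Lemma bump_out X (x : X) U phi : bump x U phi -> forall y, ~ U y -> phi y = 0.
Proof. by move=> [_ _ _ [K _ [KU Kphi]]] y nU; apply: Kphi => /KU. Qed.

Lemma bump_exists X (x : X) (U : set X) : nbhs x U -> exists phi, bump x U phi.
Proof.
move=> xU; have [K [xK cK clK]] := lch_nbhs_compact x.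
have [V [oV Vx VUK]] : exists V, [/\ open V, V x & V `<=` U `&` K].
  exists (interior (U `&` K)); split; [exact: open_interior | | exact: interior_subset].
  exact: (@filterI _ (nbhs x)).
have cr := @locally_compact_completely_regular X R
  (@lch_locally_compact X) (@lch_hausdorff X).
have nVx : ~ (~` V) x by apply.
have /(@uniform_separatorP _ R) [f [cf f01 fx fV]] := cr x _ (open_closedC oV) nVx.
have {}fx : f x = 0 by apply: fx; exists x.
have {}fV y : ~ V y -> f y = 1 by move=> ?; apply: fV; exists y.
have {}f01 y : 0 <= f y <= 1 by have := f01 (f y); rewrite /= in_itv /=; apply; exists y.
(* [f] vanishes at [x] and is 1 off [V]. The affine function is at least 1 where [f <= 1/3] and at
   most 0 where [f >= 2/3], so [phi] is 1 near [x] and supported where [f <= 2/3], a closed set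
   inside [V]. *)
pose phi y := clamp (2 - 3 * f y).
have small (r : R) : closed [set y | f y <= r].
  by apply: (@closed_comp _ _ f [set t | t <= r]); [move=> y _; exact: cf|exact: closed_le].
exists phi; split.
- have c1 : continuous (fun y => 2 - 3 * f y).
    by move=> y; apply: cvgB; [exact: cvg_cst|apply: cvgM; [exact: cvg_cst|exact: cf]].
  exact: clamp_continuous.
- by move=> y; exact: clamp01.
- have : nbhs x [set y | f y < 1 / 3].
    have := cf x; rewrite /continuous_at fx => /(_ [set t | t < 1 / 3]); apply.
    by apply: open_nbhs_nbhs; split; [exact: open_lt|rewrite /=; lra].
  by apply: filterS => y /= fy; apply: clamp_eq1; lra.
- exists [set y | f y <= 2 / 3].
    apply: (subclosed_compact _ cK) => // y /= fy.
    apply: contrapT => nKy; have : ~ V y by move=> /VUK[].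
    by move=> /fV; lra.
  split=> [y /= fy|y /negP].
    apply: contrapT => nUy; have : ~ V y by move=> /VUK[].
    by move=> /fV; lra.
  by rewrite -ltNge => fy; apply: clamp_eq0; lra.
Qed.

Lemma continuousP X (k : X -> R[i]^o) : continuous k <->
  forall x (e : R), 0 < e -> nbhs x [set y | cabs (k y - k x) < e].
Proof.
split=> [kc x e e0|kc x].
  have /cvgrPdist_lt /(_ e%:C) := kc x; rewrite ltcR => /(_ e0).
  apply: filterS => y /=; rewrite -(opprB (k y)) normrN.
  by rewrite (_ : `|_| = (cabs (k y - k x))%:C) ?ltcR // -cabsE.
apply/cvgrPdist_lt => e; rewrite ltcE /= => /andP[/eqP ei e0].
have := kc x _ e0; apply: filterS => y /= h.
rewrite -normrN opprB (_ : `|_| = (cabs (k y - k x))%:C); last by rewrite -cabsE.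
by rewrite (_ : e = (complex.Re e)%:C) ?ltcR //; case: (e) ei => ? ? /= ->.
Qed.

Definition rc X (phi : X -> R) : X -> R[i]^o := fun x => (phi x)%:C.

Lemma rc_continuous X (phi : X -> R) : continuous phi -> continuous (rc phi).
Proof.
move=> pc; apply/continuousP => x e e0.
have /cvgrPdist_lt /(_ e e0) := pc x; apply: filterS => y /=.
by rewrite distrC -cabs_real rmorphB.
Qed.

Lemma real_continuousP X (k : X -> R) : continuous k <->
  forall x (e : R), 0 < e -> nbhs x [set y | `|k y - k x| < e].
Proof.
split=> kc x; first by move=> e e0; have /cvgrPdist_lt /(_ e e0) := kc x;
  apply: filterS => y /=; rewrite distrC.
by apply/cvgrPdist_lt => e e0; have := kc x e e0; apply: filterS => y /=; rewrite distrC.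
Qed.

Lemma cont_bounded_on X (k : X -> R[i]^o) K : continuous k -> compact K ->
  exists2 M : R, 0 <= M & forall x, K x -> cabs (k x) <= M.
Proof.
move=> /continuousP kc cK.
apply: (compact_ind (P := fun A => exists2 M, 0 <= M & forall x, A x -> cabs (k x) <= M) cK).
- by exists 0.
- move=> A B [M M0 AM] [N N0 BN]; exists (M + N); first by rewrite addr_ge0.
  by move=> x [/AM|/BN]; lra.
- by move=> A B AB [M M0 BM]; exists M => // x /AB/BM.
- move=> x _; exists [set y | cabs (k y - k x) < 1]; first exact: kc.
  exists (1 + cabs (k x)); first by rewrite addr_ge0 // cabs_ge0.
  move=> y /= yx; have := cabsD (k y - k x) (k x); rewrite subrK.
  by lra.
Qed.

Lemma C0P X (k : X -> R[i]^o) : C0 k <-> continuous k /\ forall e : R, 0 < e ->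
  exists2 K : set X, compact K & forall x, ~ K x -> cabs (k x) <= e.
Proof.
have e1 (x : X) (e : R) : (`|k x| <= e%:C) = (cabs (k x) <= e).
  by rewrite (_ : `|_| = (cabs (k x))%:C) ?lecR // -cabsE.
split=> -[kc ks]; split=> // e.
  by move=> e0; have [|K cK Kk] := ks e%:C; rewrite ?ltcR //; exists K => // x /Kk; rewrite e1.
rewrite ltcE /= => /andP[/eqP ei e0]; have [K cK Kk] := ks _ e0; exists K => // x /Kk.
by rewrite -e1 (_ : (complex.Re e)%:C = e) //; case: (e) ei => ? ? /= ->.
Qed.

Lemma C0_bounded X (k : X -> R[i]^o) : C0 k -> exists2 M : R, 0 <= M &
  forall x, cabs (k x) <= M.
Proof.
move=> /C0P[kc /(_ _ ltr01)[K cK Kk]]; have [M M0 KM] := cont_bounded_on kc cK.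
exists (1 + M) => [|x]; first by rewrite addr_ge0.
by have [/KM|/Kk] := pselect (K x); lra.
Qed.

Lemma C0M X (k l : X -> R[i]^o) : C0 k -> C0 l -> C0 (fun x => k x * l x : R[i]^o).
Proof.
move=> k0 l0; have [M M0 kM] := C0_bounded k0.
apply/C0P; move/C0P: (k0) => [kc _]; move/C0P: (l0) => [lc lv]; split.
  by move=> x; apply: cvgM; [exact: kc|exact: lc].
move=> e e0; have M1 : 0 < M + 1 by lra.
have [|L cL Ll] := lv (e / (M + 1)); first by rewrite divr_gt0.
exists L => // x /Ll; rewrite ler_pdivlMr // cabsM.
by have := kM x; have := cabs_ge0 (k x); have := cabs_ge0 (l x); nra.
Qed.

Lemma bump_C0 X (x : X) U phi : bump x U phi -> C0 (rc phi).
Proof.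
move=> [pc p01 pn [K cK [KU Kp]]]; apply/C0P; split; first exact: rc_continuous.
by move=> e e0; exists K => // y /Kp; rewrite /rc => ->; rewrite /cabs normr0 ltW.
Qed.

Lemma bump_C0_on X (x : X) (U : opens X) phi : bump x U phi -> C0_on U (rc phi).
Proof.
move=> b; split=> [|y nU]; first exact: bump_C0 b.
by rewrite /rc (bump_out b).
Qed.

Lemma opens_ext X (U V : opens X) : oset U = oset V -> U = V.
Proof.
case: U V => U oU [V oV] /= e; case: _ / e oV => oV; congr Opens.
exact: Prop_irrelevance.
Qed.

End Topology.

(** * Fields of C*-algebras over a space *)

Section Fields.
Variables (R : realType) (X : lch) (E : cstarType R) (F : X -> cstarType R).
Variable q : forall z, E -> F z.

(* The fibre norms of a section are upper semicontinuous, in general not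
   continuous. *)
Record is_field : Prop := IsField {
  fld_hom : forall z, star_hom (@q z) ;
  fld_norm : forall e (r : R), 0 <= r -> (forall z, nm (q z e) <= r) -> nm e <= r ;
  fld_usc : forall e z (r : R), nm (q z e) < r -> nbhs z [set z' | nm (q z' e) < r] ;
  fld_van : forall e (r : R), 0 < r ->
    exists2 K : set X, compact K & forall z, ~ K z -> nm (q z e) <= r }.

Hypothesis qf : is_field.

Lemma fld_ext e e' : (forall z, q z e = q z e') -> e = e'.
Proof.
move=> ee; apply/eqP; rewrite -subr_eq0; apply/eqP/nm_le0.
apply: (fld_norm qf) => // z.
by rewrite (star_homB (fld_hom qf z)) ee subrr nm0.
Qed.

Definition mulby (k : X -> R[i]) (e e' : E) := forall z, q z e' = k z *: q z e.

(* The partition of unity [phi_1, (1 - phi_1) phi_2, ...] avoids divisions, so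
   stability under the bump functions themselves is enough. *)
Lemma fld_density (S : set E) (Phi : set (X -> R)) (e : E) :
  closed_subspace S ->
  (forall phi, Phi phi -> forall z, 0 <= phi z <= 1) ->
  (forall (z : X) (U : set X), nbhs z U -> exists2 phi, Phi phi &
     nbhs z [set y | phi y = 1] /\ forall y, ~ U y -> phi y = 0) ->
  (forall s phi, S s -> Phi phi -> exists2 s', S s' & mulby (fun z => (phi z)%:C) s s') ->
  (forall z (r : R), 0 < r -> exists2 s, S s & nm (q z (e - s)) < r) -> S e.
Proof.
move=> [Sc S0 SD SZ] Phi01 Philoc SPhi Sloc.
have hom := fld_hom qf.
have SB s t : S s -> S t -> S (s - t).
  by move=> Ss St; rewrite -scaleN1r; apply: SD => //; exact: SZ.
move/closedP: Sc; apply => r r0; have r2 := divr_gt0 r0 (ltr0Sn R 1).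
have [K cK Ke] := fld_van qf e r2.
pose stab (sg : X -> R) := forall s, S s -> exists2 s', S s' &
  mulby (fun z => (sg z)%:C) s s'.
(* [sg] is the part of the partition of unity built so far, and [s] approximates [sg] times [e]. An
   error proportional to [sg] survives the union step, where the new weight is multiplied by
   [1 - f]. *)
pose P := fun C : set X => exists s sg, [/\ S s, stab sg, forall z, 0 <= sg z <= 1,
  forall z, C z -> sg z = 1 &
  forall z, nm (q z s - (sg z)%:C *: q z e) <= r / 2 * sg z].
have : P K.
  apply: compact_ind => //.
  - exists 0, (fun=> 0); split => //.
    + by move=> s Ss; exists 0 => // z; rewrite (star_hom0 (hom z)) scale0r.
    + by move=> z; rewrite lexx ler01.
    + by move=> z; rewrite (star_hom0 (hom z)) scale0r subr0 nm0 mulr0.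
  - move=> A B [s [f [Ss fst f01 fA fs]]] [t [g [St gst g01 gB gt]]].
    have [t' St' tt'] := fst t St.
    exists (s + (t - t')), (fun z => f z + (1 - f z) * g z); split.
    + by apply: SD => //; exact: SB.
    + move=> u Su; have [u1 Su1 uu1] := fst u Su; have [u2 Su2 uu2] := gst u Su.
      have [u3 Su3 uu3] := fst u2 Su2; exists (u1 + (u2 - u3)).
        by apply: SD => //; exact: SB.
      move=> z; rewrite (star_homD (hom z)) (star_homB (hom z)) uu1 uu3 uu2.
      rewrite rmorphD rmorphM rmorphB rmorph1 /= scalerDl; congr (_ + _).
      by rewrite -scalerA scalerBl scale1r.
    + move=> z; have := f01 z; have := g01 z; move=> /andP[? ?] /andP[? ?].
      by apply/andP; split; nra.
    + by move=> z [/fA ->|/gB ->]; ring.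
    + move=> z; have := fs z; have := gt z; have /andP[f0 f1] := f01 z.
      have h : 0 <= 1 - f z by lra.
      rewrite (star_homD (hom z)) (star_homB (hom z)) tt'.
      have -> : q z s + (q z t - (f z)%:C *: q z t) - (f z + (1 - f z) * g z)%:C *: q z e
          = (q z s - (f z)%:C *: q z e) + (1 - f z)%:C *: (q z t - (g z)%:C *: q z e).
        rewrite rmorphD rmorphM rmorphB rmorph1 /=.
        by lmod_with R[i].
      have := nmD (q z s - (f z)%:C *: q z e) ((1 - f z)%:C *: (q z t - (g z)%:C *: q z e)).
      rewrite (nmZr _ h); nra.
  - by move=> A B AB [s [f [Ss fst f01 fA fs]]]; exists s, f; split => // z /AB/fA.
  - move=> z _; have [s Ss zs] := Sloc z _ r2.
    have [phi Pphi [phi1 phi0]] := Philoc _ _ (fld_usc qf zs).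
    exists [set y | phi y = 1] => //.
    have [s' Ss' ss'] := SPhi s phi Ss Pphi.
    exists s', phi; split => //; first by move=> t St; exact: SPhi.
      exact: Phi01.
    move=> y; rewrite ss' -scalerBr; have /andP[p0 _] := Phi01 _ Pphi y.
    rewrite nmZr // mulrC; have [Uy|nUy] := pselect (nm (q y (e - s)) < r / 2).
      by rewrite ler_wpM2r // nmC -(star_homB (hom y)) ltW.
    by rewrite phi0 // !mulr0.
move=> [s [f [Ss fst f01 fK fs]]]; exists s => //.
apply: (@le_lt_trans _ _ (r / 2)); last by lra.
apply: (fld_norm qf) => [|z]; first exact: ltW.
rewrite (star_homB (hom z)) nmC; have := fs z; have /andP[f0 f1] := f01 z.
have [/fK f1'|/Ke ze] := pselect (K z); first by rewrite f1' rmorph1 scale1r mulr1.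
have -> : q z s - q z e = (q z s - (f z)%:C *: q z e) - (1 - f z)%:C *: q z e.
  by rewrite rmorphB rmorph1 /=; lmod_with R[i].
have h : 0 <= 1 - f z by lra.
have := nmB (q z s - (f z)%:C *: q z e) ((1 - f z)%:C *: q z e).
rewrite (nmZr _ h); nra.
Qed.

End Fields.

Section XAlgebra.
Variables (R : realType) (X : lch) (A : xcstar R X).
Implicit Types (U V W : opens X) (x : X) (a b : A).

Lemma evP x : is_quotient (xideal A (opensC1 x)) (ev A x).
Proof. exact/quotientP/xidealP. Qed.

Lemma ev_hom x : star_hom (ev A x).
Proof. by case: (evP x). Qed.

Lemma ev_surj x (w : fibre A x) : exists a, ev A x a = w.
Proof. by case: (evP x). Qed.

Lemma ev_eq0 x a : ev A x a = 0 <-> xideal A (opensC1 x) a.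
Proof. by case: (evP x). Qed.

Lemma ev_nm x a : nm (ev A x a) = dist (xideal A (opensC1 x)) a.
Proof. exact: quotient_nm (xidealP _ _) (evP x) a. Qed.

Lemma xideal_sub U V : oset U `<=` oset V -> xideal A U `<=` xideal A V.
Proof.
move=> UV; have -> : U = opensI U V by apply: opens_ext; rewrite /= (setIidl UV).
by rewrite xidealI => a [].
Qed.

Lemma xideal_cover W (S : set (opens X)) (J : set A) : closed_ideal J ->
  oset W `<=` \bigcup_(U in S) oset U -> (forall U, S U -> xideal A U `<=` J) ->
  xideal A W `<=` J.
Proof.
move=> Ji WS SJ; apply: (@subset_trans _ (xideal A (opens_bigcup S))).
  exact: xideal_sub.
rewrite xideal_bigcup; apply: ideal_gen_sub => // a [U SU]; exact: SJ.
Qed.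

(** Binary joins of ideals are closures of sums: the closure of the elements [b + c] is already a
    closed ideal containing both. *)
Lemma xideal_binary W U V a : oset W `<=` oset U `|` oset V -> xideal A W a ->
  forall r : R, 0 < r -> exists b c,
    [/\ xideal A U b, xideal A V c & nm (a - (b + c)) < r].
Proof.
move=> WUV Wa r r0.
pose S := [set a : A | exists b c, [/\ xideal A U b, xideal A V c & a = b + c]].
have [UI VI] := (xidealP A U, xidealP A V).
have [[_ U0 UD UZ] UMl UMr US] := UI; have [[_ V0 VD VZ] VMl VMr VS] := VI.
have Si : closed_ideal (aclosure S).
  apply: aclosure_ideal.
  - by exists 0, 0; rewrite addr0.
  - move=> _ _ [b [c [bU cV ->]]] [b' [c' [bU' cV' ->]]].
    by exists (b + b'), (c + c'); rewrite addrACA; split => //; [exact: UD|exact: VD].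
  - move=> k _ [b [c [bU cV ->]]]; exists (k *: b), (k *: c).
    by rewrite scalerDr; split => //; [exact: UZ|exact: VZ].
  - move=> d _ [b [c [bU cV ->]]]; exists (d ** b), (d ** c).
    by rewrite cmulDr; split => //; [exact: UMl|exact: VMl].
  - move=> _ d [b [c [bU cV ->]]]; exists (b ** d), (c ** d).
    by rewrite cmulDl; split => //; [exact: UMr|exact: VMr].
  - move=> _ [b [c [bU cV ->]]]; exists (cstar b), (cstar c).
    by rewrite cstarD; split => //; [exact: US|exact: VS].
have : aclosure S a.
  apply: (xideal_cover (W := W) (S := [set U' | U' = U \/ U' = V]) Si) => //.
    by move=> x /WUV[Ux|Vx]; [exists U => //; left|exists V => //; right].
  move=> _ [->|->] b Ub; apply: sub_aclosure.
    by exists b, 0; rewrite addr0.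
  by exists 0, b; rewrite add0r.
by move=> /(_ r r0)[_ [b [c [bU cV ->]]] abc]; exists b, c.
Qed.

(** For a directed family the union of the ideals is stable under addition, so the join is merely
    its closure. *)
Lemma xideal_directed W (S : set (opens X)) a : oset W `<=` \bigcup_(U in S) oset U ->
  (exists U, S U) ->
  (forall U V, S U -> S V -> exists W', [/\ S W', oset U `<=` oset W' & oset V `<=` oset W']) ->
  xideal A W a -> forall r : R, 0 < r -> exists U b, [/\ S U, xideal A U b & nm (a - b) < r].
Proof.
move=> WS [U0 SU0] dir Wa r r0.
pose T := [set a : A | exists2 U, S U & xideal A U a].
have Ti : closed_ideal (aclosure T).
  apply: aclosure_ideal.
  - by exists U0 => //; exact: (subspace0 (ideal_subspace (xidealP A U0))).
  - move=> b c [U SU Ub] [V SV Vc]; have [W' [SW' UW VW]] := dir _ _ SU SV.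
    exists W' => //; apply: (subspaceD (ideal_subspace (xidealP A W'))).
      exact: (xideal_sub UW).
    exact: (xideal_sub VW).
  - move=> k b [U SU Ub]; exists U => //.
    exact: (subspaceZ (ideal_subspace (xidealP A U))).
  - by move=> d b [U SU Ub]; exists U => //; exact: (idealMl (xidealP A U)).
  - by move=> b d [U SU Ub]; exists U => //; exact: (idealMr (xidealP A U)).
  - by move=> b [U SU Ub]; exists U => //; exact: (ideal_star (xidealP A U)).
have : aclosure T a.
  apply: (xideal_cover (W := W) Ti WS) => // U SU b Ub.
  by apply: sub_aclosure; exists U.
by move=> /(_ r r0)[b [U SU Ub] ab]; exists U, b.
Qed.

Definition opensU U V : opens X := Opens (openU (osetP U) (osetP V)).

(* An open set maximal among those V with [dist (xideal A V) a >= r] is the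
   complement of a point. *)
Lemma xideal_norm U a (r : R) : 0 <= r -> (forall x, ~ oset U x -> nm (ev A x a) <= r) ->
  dist (xideal A U) a <= r.
Proof.
move=> r0 Ur; rewrite leNgt; apply/negP => rU.
set D := dist _ _ in rU; have D0 : 0 < D by lra.
pose P (V : set X) := exists oV : open V, D <= dist (xideal A (opensU (Opens oV) U)) a.
have [B [[oB PB] Bmax]] : exists B, P B /\ forall C, B `<` C -> ~ P C.
  apply: Zorn_bigcup => F FP Ftot.
  have oF : open (\bigcup_(V in F) V) by apply: bigcup_open => V /FP[].
  (* A better correction [j] for the union of the chain would be approximated by an element of the
     ideal of one member, because a chain is directed. *)
  exists oF; rewrite leNgt; apply/negP => /(dist_lt (xidealP _ _))[j Wj aj].
  have [||||U' [b [SU' U'b jb]]] := xideal_directed (S := [set W | W = U \/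
      exists2 V, F V & oset W = V `|` oset U]) (r := D - nm (a + j)) _ _ _ Wj.
  - move=> x [[V FV Vx]|Ux]; last by exists U => //; left.
    have [oV _] := FP _ FV.
    by exists (opensU (Opens oV) U); [right; exists V|left].
  - by exists U; left.
  - move=> V V' [->|[C FC VC]] [->|[C' FC' VC']].
    + by exists U; split => //; left.
    + exists V'; split => //; first by right; exists C'.
      by rewrite VC'; exact: subsetUr.
    + exists V; split => //; first by right; exists C.
      by rewrite VC; exact: subsetUr.
    + have [CC|CC] := Ftot _ _ FC FC'.
        exists V'; split => //; first by right; exists C'.
        by rewrite VC VC'; exact: setSU.
      exists V; split => //; first by right; exists C.
      by rewrite VC VC'; exact: setSU.
  - by rewrite subr_gt0.
  have ab : nm (a + b) < D.
    have := nmD (a + j) (b - j); rewrite (nmC b).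
    by rewrite addrACA [j - j]subrr addr0 => ?; lra.
  have : D <= dist (xideal A U') a.
    case: SU' => [->|[V FV VU]]; first exact: lexx.
    have [oV VP] := FP _ FV; suff -> : U' = opensU (Opens oV) U by [].
    exact: opens_ext.
  by have := dist_le (xidealP A U') a U'b; lra.
set W := opensU _ U in PB.
have [x Wx] : exists x, ~ oset W x.
  apply: contrapT => nW; have WT : W = opensT X.
    by apply: opens_ext; apply/seteqP; split => // x _; apply: contrapT => Wx; apply: nW; exists x.
  suff : dist (xideal A W) a <= 0 by lra.
  by apply/(dist_eq0 (xidealP _ _)); rewrite WT xidealT.
have Wmax (V : opens X) : D <= dist (xideal A (opensU V W)) a -> oset V `<=` oset W.
  move=> DV y Vy; apply: contrapT => Wy.
  apply: (Bmax (oset W `|` oset V)); first split.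
  - by move=> z Bz; left; left.
  - by move=> h; apply: Wy; left; apply: h; right.
  exists (openU (osetP W) (osetP V)); set W' := opensU _ _.
  suff -> : W' = opensU V W by [].
  apply: opens_ext => /=; apply/seteqP; split=> z /=; tauto.
(* For another point [y] outside [W], disjoint neighbourhoods of [x] and [y], each joined with [W],
   meet in [W]. By [dist_meet] one of the two joins keeps the distance at least [D], against the
   maximality of [W]. *)
have WE : W = opensC1 x.
  apply: opens_ext; apply/seteqP; split=> y /=; first by move=> Wy yx; apply: Wx; rewrite -yx.
  move=> yx; apply: contrapT => Wy.
  have [Vy [Vx [oy ox Vyy Vxx VV]]] := lch_separate yx.
  have := dist_meet a (xidealP A (opensU (Opens oy) W)) (xidealP A (opensU (Opens ox) W)).
  rewrite -xidealI (_ : opensI _ _ = W); last first.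
    apply: opens_ext => /=; apply/seteqP; split => z /=; last by tauto.
    move=> [[zy|//] [zx|//]]; exfalso.
    by have : (Vy `&` Vx) z by []; rewrite VV.
  rewrite le_max => /orP[h|h].
    by apply: Wy; apply: (Wmax (Opens oy)) => //; apply: le_trans h.
  by apply: Wx; apply: (Wmax (Opens ox)) => //; apply: le_trans h.
have Ux : ~ oset U x by move=> Ux; apply: Wx; right.
by have := Ur x Ux; rewrite ev_nm -WE; lra.
Qed.

(** The case of distance 0 in [xideal_norm]; from here on, membership in an ideal is tested fibre by
    fibre. *)
Lemma xideal_evP U a : xideal A U a <-> forall x, ~ oset U x -> ev A x a = 0.
Proof.
split=> [Ua x Ux|aU].
  by apply/ev_eq0; apply: (xideal_sub _ Ua) => y Uy yx; apply: Ux; rewrite -yx.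
apply/(dist_eq0 (xidealP A U)); apply: xideal_norm => // x /aU ->.
by rewrite nm0.
Qed.

Lemma ev_norm a (r : R) : 0 <= r -> (forall x, nm (ev A x a) <= r) -> nm a <= r.
Proof.
move=> r0 ar; pose U0 : opens X := Opens (@open0 X).
have h : dist (xideal A U0) a <= r by apply: xideal_norm.
apply: (le_trans _ h); apply: lb_le_inf.
  by case: (dist_has_inf (xidealP A U0) a).
move=> _ [j Uj <-]; suff -> : j = 0 by rewrite addr0.
(* The empty open set is the empty join, so preservation of joins makes its ideal zero. *)
have S0 : U0 = opens_bigcup (set0 : set (opens X)).
  by apply: opens_ext => /=; rewrite bigcup_set0.
have Z : closed_ideal [set 0 : A].
  split; first exact: zero_subspace.
  - by move=> b c /= ->; rewrite cmul0r.
  - by move=> b c /= ->; rewrite cmul0l.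
  - by move=> b /= ->; rewrite cstar0.
by move: Uj; rewrite S0 xideal_bigcup bigcup_set0; apply: ideal_gen_sub Z _ _.
Qed.

(** The ideal at the complement of [x] is the directed join of the ideals of open sets that miss a
    neighbourhood of [x]. The correction that realizes the norm at [x] can therefore be taken to
    vanish near [x], and it serves all nearby points. *)
Lemma ev_usc a x (r : R) : nm (ev A x a) < r -> nbhs x [set y | nm (ev A y a) < r].
Proof.
rewrite ev_nm => /(dist_lt (xidealP _ _))[j xj aj].
pose S := [set U : opens X | exists2 N, nbhs x N & oset U `&` N = set0].
have [||||U [b [[N xN UN] Ub jb]]] := xideal_directed (S := S) (r := r - nm (a + j)) _ _ _ xj.
- move=> y /= yx; have [V [N [oV oN Vy Nx VN]]] := lch_separate yx.
  by exists (Opens oV) => //; exists N => //; exact: open_nbhs_nbhs.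
- exists (Opens (@open0 X)); exists setT; first exact: filterT.
  by rewrite set0I.
- move=> U V [N xN UN] [M xM VM]; exists (opensU U V); split => /=.
  + exists (N `&` M); first exact: filterI.
    rewrite setIUl setIA UN set0I set0U setIC -setIA (setIC M) VM.
    exact: setI0.
  + exact: subsetUl.
  + exact: subsetUr.
- by rewrite subr_gt0.
apply: filterS xN => y Ny /=; rewrite ev_nm.
have yb : xideal A (opensC1 y) b.
  apply: (xideal_sub _ Ub) => z Uz /= zy; have Nz : N z by rewrite zy.
  by have : (oset U `&` N) z by []; rewrite UN.
apply: le_lt_trans (dist_le (xidealP _ _) a yb) _.
have := nmD (a + j) (b - j); rewrite (nmC b).
by rewrite addrACA [j - j]subrr addr0 => ?; lra.
Qed.

(** The whole algebra is the directed join of the ideals of open sets contained in a compact set. *)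
Lemma ev_van a (r : R) : 0 < r ->
  exists2 K : set X, compact K & forall x, ~ K x -> nm (ev A x a) <= r.
Proof.
move=> r0; pose S := [set U : opens X | exists2 K, compact K & oset U `<=` K].
have Ta : xideal A (opensT X) a by rewrite xidealT.
have [||||U [b [[K cK UK] Ub ab]]] := xideal_directed (S := S) (r := r) _ _ _ Ta => //.
- move=> x _; have [K [xK cK _]] := lch_nbhs_compact x.
  exists (Opens (@open_interior _ K)) => //.
  by exists K => //; exact: interior_subset.
- by exists (Opens (@open0 X)), set0 => //; exact: compact0.
- move=> U V [K cK UK] [L cL VL]; exists (opensU U V); split => /=.
  + by exists (K `|` L); [exact: compactU|exact: setUSS].
  + exact: subsetUl.
  + exact: subsetUr.
exists K => // x nKx; have -> : ev A x a = ev A x (a - b).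
  rewrite (star_homB (ev_hom x)); have /xideal_evP -> := Ub; first by rewrite subr0.
  by move=> /UK.
by rewrite (le_trans (star_hom_le (ev_hom x) _)) // ltW.
Qed.

Lemma ev_field : is_field (ev A).
Proof. by split; [exact: ev_hom|exact: ev_norm|exact: ev_usc|exact: ev_van]. Qed.

Lemma ev_ext a b : (forall x, ev A x a = ev A x b) -> a = b.
Proof. exact: (fld_ext ev_field). Qed.

End XAlgebra.

Arguments ev_hom {R X A} x.

(** * Multiplication by continuous functions *)

Section FunctionAction.
Variables (R : realType) (X : lch) (A : xcstar R X).
Implicit Types (x : X) (a b : A).

(** [k] is cut into layers of height 1, and each layer acts through an approximate unit [f] of the
    ideal of [0 < k]. Where [k >= 1] the layer is right up to [d]. Where [k < 1] it is wrong by at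
    most [3 * nm a], but all higher layers vanish there, so this error occurs once; dividing by the
    number of layers will make it small. *)
Lemma mulby_step a (d : R) n (k : X -> R) : 0 < d -> continuous k ->
  (forall x, 0 <= k x <= n%:R) -> exists b, (forall x, k x = 0 -> ev A x b = 0) /\
    forall x, nm (ev A x b - (k x)%:C *: ev A x a) <= 3 * nm a + n%:R * d.
Proof.
move=> d0; have a0 := nm_ge0 a; elim: n k => [|n IH] k kc k0.
  exists 0; split=> x; first by rewrite (star_hom0 (ev_hom x)).
  have -> : k x = 0 by have := k0 x; rewrite mulr0n; lra.
  by rewrite (star_hom0 (ev_hom x)) scale0r subr0 nm0; lra.
pose k' x := Num.max 0 (k x - 1).
have k'E x : k' x = if 1 <= k x then k x - 1 else 0.
  by rewrite /k'; case: leP => h; case: leP => h'; lra.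
have [||b' [b'0 b'k]] := IH k'.
- apply/real_continuousP => x e e0; have /real_continuousP /(_ x e e0) := kc.
  apply: filterS => y /= ; rewrite !k'E !ltr_norml => /andP[h1 h2]; apply/andP.
  by case: (leP 1 (k y)) => h3; case: (leP 1 (k x)) => h4; lra.
- move=> x; rewrite k'E; have := k0 x; rewrite -natr1; have : 0 <= n%:R :> R by [].
  by case: (leP 1 (k x)) => h; lra.
have oU : open [set x | 0 < k x].
  by apply: (@open_comp _ _ k [set t | 0 < t]); [move=> x _; exact: kc|exact: open_gt].
have oF : open [set x | k x < 1].
  by apply: (@open_comp _ _ k [set t | t < 1]); [move=> x _; exact: kc|exact: open_lt].
have Ta : xideal A (opensT X) a by rewrite xidealT.
have d2 := divr_gt0 d0 (ltr0Sn R 1).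
(* [a] is split along the cover by [0 < k] and [k < 1]: the second part vanishes where [k >= 1], and
   [f] will nearly fix the first. *)
have [x _|b [c [bU cF abc]]] := xideal_binary (U := Opens oU) (V := Opens oF) _ Ta d2.
  by rewrite /=; case: (ltP 0 (k x)) => h; [left|right]; lra.
have [f [fU fb fc]] := approx_unit (xidealP A (Opens oU)) bU d2.
have f0 x : k x = 0 -> ev A x f = 0.
  by move=> kx; have /xideal_evP -> := fU; rewrite //= kx ltxx.
exists (f ** a + b'); split=> x.
  move=> kx; rewrite (star_homD (ev_hom x)) (star_homM (ev_hom x)) f0 // cmul0l add0r.
  by apply: b'0; rewrite k'E kx; case: (leP 1 0) => //; lra.
have := b'k x; rewrite k'E (star_homD (ev_hom x)) -natr1.
have nd : 0 <= n%:R * d by rewrite mulr_ge0 // ltW.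
case: (leP 1 (k x)) => k1 b'kx.
  have cx : ev A x c = 0 by have /xideal_evP -> := cF; rewrite //= ltNge k1.
  have afx : nm (ev A x (f ** a) - ev A x a) <= d.
    have -> : ev A x (f ** a) - ev A x a = ev A x ((f ** b - b) -
        ((a - (b + c)) - f ** (a - (b + c)))) .
      rewrite -[LHS](star_homB (ev_hom x)); apply/eqP; rewrite -subr_eq0.
      rewrite -(star_homB (ev_hom x)) (_ : _ - _ = f ** c - c).
        by rewrite (star_homB (ev_hom x)) (star_homM (ev_hom x)) cx cmul0r subr0.
      by rewrite !(cmulBr, cmulDr); lmod_with R[i].
    apply: (le_trans (star_hom_le (ev_hom x) _)).
    have := nmB (f ** b - b) ((a - (b + c)) - f ** (a - (b + c))).
    by have := fc (a - (b + c)); rewrite (nmC (f ** b) b); lra.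
  have -> : ev A x (f ** a) + ev A x b' - (k x)%:C *: ev A x a =
      (ev A x b' - (k x - 1)%:C *: ev A x a) + (ev A x (f ** a) - ev A x a).
    by rewrite rmorphB rmorph1; lmod_with R[i].
  have := nmD (ev A x b' - (k x - 1)%:C *: ev A x a) (ev A x (f ** a) - ev A x a).
  lra.
rewrite b'0 ?addr0; last by rewrite k'E; case: (leP 1 (k x)) => //; lra.
have := nmB (ev A x (f ** a)) ((k x)%:C *: ev A x a).
have /andP[kx0 _] := k0 x; rewrite nmZr //.
have := star_hom_le (ev_hom x) (f ** a); have := star_hom_le (ev_hom x) a.
have := fc a; have := nm_le_add (f ** a) a; rewrite (nmC (f ** a) a).
have := nm_ge0 (ev A x a); nra.
Qed.

Definition mulby_good (k : X -> R[i]) := forall a, exists b, mulby (ev A) k a b.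

Lemma mulby_goodD k l : mulby_good k -> mulby_good l -> mulby_good (fun x => k x + l x).
Proof.
move=> kg lg a; have [b ab] := kg a; have [c ac] := lg a; exists (b + c) => x.
by rewrite (star_homD (ev_hom x)) ab ac scalerDl.
Qed.

Lemma mulby_goodZ z k : mulby_good k -> mulby_good (fun x => z * k x).
Proof.
move=> kg a; have [b ab] := kg a; exists (z *: b) => x.
by rewrite (star_homZ (ev_hom x)) ab scalerA.
Qed.

Lemma mulby_good1 : mulby_good (fun=> 1).
Proof. by move=> a; exists a => x; rewrite scale1r. Qed.

Lemma mulby_closed (k : X -> R[i]) a :
  (forall r : R, 0 < r -> exists b, forall x, nm (ev A x b - k x *: ev A x a) <= r) ->
  exists b, mulby (ev A) k a b.
Proof.
move=> app; have p2 n : 0 < 2^-1 ^+ n :> R by rewrite exprn_gt0 // invr_gt0.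
have [u uP] := choice (fun n => app _ (p2 n)).
have [|b ub] := @cauchy_seq_cvg _ A u.
  move=> e e0; have e3 : 0 < e / 3 by rewrite divr_gt0.
  have [N NP] := half_pow_small e3; exists N => m n Nm Nn.
  apply: (@le_lt_trans _ _ (e / 3 + e / 3)); last by lra.
  apply: ev_norm => [|x]; first by lra.
  have := uP m x; have := uP n x; have := NP _ Nm; have := NP _ Nn.
  have := nm_tri (ev A x (u m)) (k x *: ev A x a) (ev A x (u n)).
  by rewrite (nmC (k x *: _) (ev A x (u n))) (star_homB (ev_hom x)); lra.
exists b => x; apply/eqP; rewrite -subr_eq0; apply/eqP/nm_small => e e0.
have e2 := divr_gt0 e0 (ltr0Sn R 1).
have [N NP] := half_pow_small e2; have [M MP] := ub _ e2.
have := uP (maxn N M) x; have := NP _ (leq_maxl N M); have := MP _ (leq_maxr N M).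
set n := maxn N M; have := nm_tri (ev A x b) (ev A x (u n)) (k x *: ev A x a).
rewrite -(star_homB (ev_hom x)); have := star_hom_le (ev_hom x) (b - u n).
by rewrite (nmC b); lra.
Qed.

Lemma mulby_good01 (k : X -> R) : continuous k -> (forall x, 0 <= k x <= 1) ->
  mulby_good (fun x => (k x)%:C).
Proof.
move=> kc k01 a; apply: mulby_closed => r r0; have a0 := nm_ge0 a.
(* [N] layers for [N * k] at precision [1 / N] give the error [3 * nm a + 1], which division by [N]
   brings below [r]. *)
pose N := (Num.bound ((3 * nm a + 1) / r)).+1.
have D0 : 0 <= (3 * nm a + 1) / r by rewrite divr_ge0 // ?ltW //; lra.
have N0 : 0 < N%:R :> R by rewrite ltr0n.
have Nr : 3 * nm a + 1 <= N%:R * r.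
  rewrite -ler_pdivrMr // ltW // (lt_trans (archi_boundP D0)) //.
  by rewrite /N ltr_nat.
have Ni : 0 < N%:R^-1 :> R by rewrite invr_gt0.
have [||b [_ bk]] := @mulby_step a N%:R^-1 N (fun x => N%:R * k x) Ni.
- by move=> x; apply: cvgM; [exact: cvg_cst|exact: kc].
- by move=> x; have /andP[k0 k1] := k01 x; rewrite mulr_ge0 ?ler0n //= ler_piMr ?ler0n.
exists (N%:R^-1%:C *: b) => x; rewrite (star_homZ (ev_hom x)).
have -> : N%:R^-1%:C *: ev A x b - (k x)%:C *: ev A x a =
    N%:R^-1%:C *: (ev A x b - (N%:R * k x)%:C *: ev A x a).
  rewrite scalerBr scalerA -rmorphM mulrA mulVf ?mul1r // gt_eqF //.
rewrite nmZr ?(ltW Ni) // ler_pdivrMl //; have := bk x; rewrite mulfV ?gt_eqF //.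
lra.
Qed.

(** An affine change of values brings the range of [k] into the unit interval; constants act by
    scalars. *)
Lemma mulby_good_real (k : X -> R) (M : R) : continuous k -> (forall x, `|k x| <= M) ->
  mulby_good (fun x => (k x)%:C).
Proof.
move=> kc kM.
pose N := `|M| + 1; have N0 : 0 < N by rewrite /N; have := normr_ge0 M; lra.
have kN x : `|k x| <= N by rewrite (le_trans (kM x)) // /N; have := ler_norm M; lra.
have h : mulby_good (fun x => ((k x + N) / (2 * N))%:C).
  apply: mulby_good01.
    by move=> x; apply: cvgM; [apply: cvgD; [exact: kc|exact: cvg_cst]|exact: cvg_cst].
  move=> x; have := kN x; rewrite ler_norml => /andP[h1 h2].
  have N2 : 0 < 2 * N by lra.
  by rewrite divr_ge0 ?ler_pdivrMr ?mul1r; lra.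
have := mulby_goodD (mulby_goodZ (2 * N)%:C h) (mulby_goodZ (- N)%:C mulby_good1).
rewrite (_ : (fun x => _) = (fun x => (k x)%:C)) //; apply/funext => x.
by rewrite mulr1 -rmorphM -rmorphD; congr (_%:C); field; lra.
Qed.

Lemma mulby_exists (k : X -> R[i]^o) (M : R) : continuous k ->
  (forall x, cabs (k x) <= M) -> forall a, exists b, mulby (ev A) k a b.
Proof.
move=> /continuousP kc kM.
have ReB (u v : R[i]) : complex.Re (u - v) = complex.Re u - complex.Re v by case: u v => ? ? [].
have ImB (u v : R[i]) : complex.Im (u - v) = complex.Im u - complex.Im v by case: u v => ? ? [].
have h1 : mulby_good (fun x => (complex.Re (k x))%:C).
  apply: (@mulby_good_real _ M) => [|x]; last by rewrite (le_trans (cabs_ge_Re _)).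
  apply/real_continuousP => x e /(kc x e); apply: filterS => y /=.
  by apply: le_lt_trans; rewrite -ReB cabs_ge_Re.
have h2 : mulby_good (fun x => (complex.Im (k x))%:C).
  apply: (@mulby_good_real _ M) => [|x]; last by rewrite (le_trans (cabs_ge_Im _)).
  apply/real_continuousP => x e /(kc x e); apply: filterS => y /=.
  by apply: le_lt_trans; rewrite -ImB cabs_ge_Im.
have := mulby_goodD h1 (mulby_goodZ 'i%C h2).
rewrite (_ : (fun x => _) = k :> (X -> R[i])) //; apply/funext => x.
by rewrite [RHS]complexE.
Qed.

(** The product of [a] by [k], unique by [ev_ext]; [xget] returns 0 when there is none. It exists
    for every [k] in [C0], the case on which structure maps are tested. *)
Definition xact (k : X -> R[i]^o) a : A := xget (0 : A) [set b | mulby (ev A) k a b].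

Lemma xactE k : C0 k -> forall a x, ev A x (xact k a) = k x *: ev A x a.
Proof.
move=> k0 a; have [M M0 kM] := C0_bounded k0; have [kc _] := k0.
have [b ab] := mulby_exists kc kM a.
exact: (@xgetPex _ 0 [set b | mulby (ev A) k a b] (ex_intro _ b ab)).
Qed.

Lemma xact_linear k : C0 k -> linear (xact k).
Proof.
move=> k0 z a b; apply: ev_ext => x.
rewrite (star_homD (ev_hom x)) (star_homZ (ev_hom x)) !xactE //.
by rewrite (star_homD (ev_hom x)) (star_homZ (ev_hom x)) scalerDr !scalerA mulrC.
Qed.

Lemma xact_bound k : C0 k -> exists2 M : R, 0 <= M & forall a, nm (xact k a) <= M * nm a.
Proof.
move=> k0; have [M M0 kM] := C0_bounded k0; exists M => // a.
apply: ev_norm => [|x]; first by rewrite mulr_ge0 ?nm_ge0.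
rewrite xactE // nmZ ler_pM ?cabs_ge0 ?nm_ge0 //; exact: star_hom_le (ev_hom x) _.
Qed.

Definition bumps : set (X -> R) := [set phi | exists x U, bump x U phi].

Lemma bumps01 phi : bumps phi -> forall z, 0 <= phi z <= 1.
Proof. by move=> [x [U /bump_01]]. Qed.

Lemma bumps_loc (z : X) U : nbhs z U -> exists2 phi, bumps phi &
  nbhs z [set y | phi y = 1] /\ forall y, ~ U y -> phi y = 0.
Proof.
move=> /(bump_exists R)[phi b]; exists phi; first by exists z, U.
by split; [exact: bump_near b|exact: bump_out b].
Qed.

Lemma bumps_C0 phi : bumps phi -> C0 (rc phi).
Proof. by move=> [x [U /bump_C0]]. Qed.

Lemma xideal_span U : xideal A U = closed_span [set b | exists k a, C0_on U k /\ b = xact k a].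
Proof.
set S := closed_span _; have SS : closed_subspace S by exact: closed_span_subspace.
have S0 := subspace0 SS.
apply/seteqP; split=> [e Ue|]; last first.
  apply: closed_span_sub; first exact/ideal_subspace/xidealP.
  move=> _ [k [a [[k0 kU] ->]]]; apply/xideal_evP => x Ux.
  by rewrite xactE // kU // scale0r.
apply: (fld_density (ev_field A) (S := S) _ bumps01 bumps_loc) => //.
- move=> s phi Ss bphi; have k0 := bumps_C0 bphi.
  exists (xact (rc phi) s); last by move=> z; rewrite xactE.
  have [M M0 kM] := xact_bound k0.
  apply: (closed_span_map (xact_linear k0) kM SS _ Ss) => _ [k [a [[kk kU] ->]]].
  apply: sub_closed_span; exists k, (xact (rc phi) a); split => //.
  by apply: ev_ext => x; rewrite !xactE // !scalerA mulrC.
- move=> z r r0; have [Uz|nUz] := pselect (oset U z); last first.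
    exists 0 => //; rewrite subr0; have /xideal_evP -> := Ue => //.
    by rewrite nm0.
  have [phi b] := bump_exists R (open_nbhs_nbhs (conj (osetP U) Uz)).
  exists (xact (rc phi) e).
    by apply: sub_closed_span; exists (rc phi), e; split => //; exact: bump_C0_on b.
  rewrite (star_homB (ev_hom z)) (xactE (bump_C0 b)) /rc.
  by rewrite (nbhs_singleton (bump_near b)) scale1r subrr nm0.
Qed.

(** The frame map thus produces the action of the functions vanishing at infinity; [structure_xact]
    shows that it is the only one. *)
Lemma xact_structure : is_structure_map xact.
Proof.
have hom := @ev_hom R X A.
split.
- move=> c k l a k0 l0; have kl0 : C0 (fun x => c *: k x + l x).
    have [M M0 kM] := C0_bounded k0.
    apply/C0P; move/C0P: (k0) => [kc kv]; move/C0P: (l0) => [lc lv]; split.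
      by move=> x; apply: cvgD; [apply: cvgZr; exact: kc|exact: lc].
    move=> e e0; have e2 := divr_gt0 e0 (ltr0Sn R 1).
    have c1 : 0 < cabs c + 1 by have := cabs_ge0 c; lra.
    have [|K cK Kk] := kv (e / 2 / (cabs c + 1)); first by rewrite divr_gt0.
    have [L cL Ll] := lv _ e2; exists (K `|` L); first exact: compactU.
    move=> x KLx; have Kx : ~ K x by move=> ?; apply: KLx; left.
    have Lx : ~ L x by move=> ?; apply: KLx; right.
    have h1 := Ll x Lx; have := Kk x Kx; rewrite ler_pdivlMr // => h2.
    have := cabsD (c *: k x) (l x); rewrite [cabs (c *: k x)]cabsM.
    by have := cabs_ge0 c; have := cabs_ge0 (k x); nra.
  apply: ev_ext => x; rewrite (star_homD (hom x)) (star_homZ (hom x)) !xactE //.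
  by rewrite scalerDl -scalerA.
- exact: xact_linear.
- move=> k l a b k0 l0; have kl0 := C0M k0 l0.
  apply: ev_ext => x; rewrite (star_homM (hom x)) !xactE // (star_homM (hom x)).
  by rewrite cmulZl cmulZr scalerA.
- move=> k a k0; have kk0 : C0 (fun x => conjc (k x)).
    apply/C0P; move/C0P: (k0) => [kc kv]; split.
      apply/continuousP => x e e0; have /continuousP /(_ x e e0) := kc.
      by apply: filterS => y /=; rewrite -rmorphB cabs_conj.
    by move=> e /kv[K cK Kk]; exists K => // x /Kk; rewrite cabs_conj.
  apply: ev_ext => x.
  by rewrite (star_hom_star (hom x)) !xactE // (star_hom_star (hom x)) cstarZ.
- move=> k a b k0; apply: ev_ext => x.
  by rewrite (star_homM (hom x)) !xactE // (star_homM (hom x)) cmulZr.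
- move=> k a b k0; apply: ev_ext => x.
  by rewrite (star_homM (hom x)) !xactE // (star_homM (hom x)) cmulZl.
- rewrite -(xidealT A) xideal_span; congr closed_span; apply/seteqP.
  split=> _ [k [a [k0 ->]]]; exists k, a; split => //; last by case: k0.
  by split => // x; case.
- exact: xideal_span.
Qed.

End FunctionAction.

Lemma bump_cabs (R : realType) (X : lch) (phi : X -> R) : (forall z, 0 <= phi z <= 1) ->
  forall z, cabs (phi z)%:C <= 1.
Proof. by move=> p z; have /andP[p0 p1] := p z; rewrite cabs_real ger0_norm. Qed.

(** * Algebras over a space from fields *)

Section OfField.
Variables (R : realType) (X : lch) (E : cstarType R) (F : X -> cstarType R).
Variable q : forall z, E -> F z.
Hypothesis qf : is_field q.
Hypothesis qbump : forall phi e, bumps phi -> exists e', mulby q (fun z => (phi z)%:C) e e'.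

Let hom := fld_hom qf.

(** For [f] in [J] with [f ** e] close to [e], the product [f ** e'] lies in [J] and is close to
    [e'], because [phi] is bounded by 1. *)
Lemma mulby_ideal (J : set E) phi e e' : closed_ideal J -> (forall z, 0 <= phi z <= 1) ->
  (forall e, exists e', mulby q (fun z => (phi z)%:C) e e') ->
  J e -> mulby q (fun z => (phi z)%:C) e e' -> J e'.
Proof.
move=> Ji p01 mulp Je ee'; have /closedP := subspace_closed (ideal_subspace Ji).
apply => r r0; have [f [Jf ef fc]] := approx_unit Ji Je r0.
exists (f ** e'); first exact: (idealMr Ji).
apply: le_lt_trans ef; apply: (fld_norm qf) => [|z]; first exact: nm_ge0.
rewrite (star_homB (hom z)) (star_homM (hom z)) ee' cmulZr -scalerBr nmZ.
rewrite -(star_homM (hom z)) -(star_homB (hom z)).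
apply: (@le_trans _ _ (1 * nm (q z (e - f ** e)))).
  by rewrite ler_wpM2r ?nm_ge0 // bump_cabs.
by rewrite mul1r star_hom_le.
Qed.

Let ideal (U : opens X) : set E := [set e | forall z, ~ oset U z -> q z e = 0].

Lemma field_ideal_closed U : closed_ideal (ideal U).
Proof.
split; first split.
- apply/closedP => e eU z Uz; apply: nm_small => r /eU[e' e'U ee'].
  rewrite -(subr0 (q z e)) -(e'U z Uz) -(star_homB (hom z)).
  by rewrite (le_trans (star_hom_le (hom z) _)) // ltW.
- by move=> z _; rewrite (star_hom0 (hom z)).
- by move=> a b aU bU z Uz; rewrite (star_homD (hom z)) aU // bU // addr0.
- by move=> k a aU z Uz; rewrite (star_homZ (hom z)) aU // scaler0.
- by move=> a b bU z Uz; rewrite (star_homM (hom z)) bU // cmul0r.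
- by move=> a b aU z Uz; rewrite (star_homM (hom z)) aU // cmul0l.
- by move=> a aU z Uz; rewrite (star_hom_star (hom z)) aU // cstar0.
Qed.

Lemma field_density (J : set E) e : closed_ideal J ->
  (forall z (r : R), 0 < r -> exists2 s, J s & nm (q z (e - s)) < r) -> J e.
Proof.
move=> Ji; apply: (fld_density qf (ideal_subspace Ji) (@bumps01 R X) (@bumps_loc R X)).
move=> s phi Js bphi; have [s' ss'] := qbump s bphi; exists s' => //.
by apply: mulby_ideal Js ss' => // [|e']; [exact: bumps01|exact: qbump].
Qed.

Lemma field_idealT : ideal (opensT X) = setT.
Proof. by apply/seteqP; split => // e _ z; case. Qed.

Lemma field_idealI U V : ideal (opensI U V) = ideal U `&` ideal V.
Proof.
apply/seteqP; split=> [e eUV|e [eU eV] z UVz].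
  by split=> z h; apply: eUV => -[].
have [Uz|/eU//] := pselect (oset U z); apply: eV => Vz; exact: UVz.
Qed.

Lemma field_ideal_bigcup (S : set (opens X)) :
  ideal (opens_bigcup S) = ideal_gen (\bigcup_(U in S) ideal U).
Proof.
apply/seteqP; split=> [e eS|]; last first.
  apply: ideal_gen_sub; first exact: field_ideal_closed.
  by move=> e [U SU eU] z Sz; apply: eU => Uz; apply: Sz; exists U.
apply: field_density; first exact: ideal_gen_ideal.
move=> z r r0; have [[U SU Uz]|Sz] := pselect (oset (opens_bigcup S) z); last first.
  exists 0; first exact: (subspace0 (ideal_subspace (ideal_gen_ideal _))).
  by rewrite subr0 eS // nm0.
have [phi b] := bump_exists R (open_nbhs_nbhs (conj (osetP U) Uz)).
have [|e' ee'] := qbump (phi := phi) e; first by exists z, (oset U).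
exists e'.
  apply: sub_ideal_gen; exists U => // y Uy; rewrite ee' (bump_out b) //.
  exact: scale0r.
rewrite (star_homB (hom z)) ee' (nbhs_singleton (bump_near b)) scale1r subrr.
by rewrite nm0.
Qed.

Definition of_field : xcstar R X := @Xcstar R X E ideal field_ideal_closed
  field_idealT field_idealI field_ideal_bigcup.

Lemma of_fieldE U e : xideal of_field U e <-> forall z, ~ oset U z -> q z e = 0.
Proof. by []. Qed.

End OfField.

(** * Morphisms built on fibres *)

Section Presentations.
Variable R : realType.

(** Concrete descriptions of the fibres agree with the chosen quotients only up to isomorphism. A
    family with these properties can stand in for [ev] in norms, ideals and equalities. *)
Record presents (X : lch) (A : xcstar R X) (F : X -> cstarType R)
    (q : forall x, A -> F x) : Prop := Presents {
  pres_hom : forall x, star_hom (q x) ;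
  pres_surj : forall x w, exists a, q x a = w ;
  pres_ker : forall x a, q x a = 0 <-> xideal A (opensC1 x) a }.

Lemma ev_presents (X : lch) (A : xcstar R X) : presents (ev A).
Proof. by split; [exact: ev_hom|exact: ev_surj|exact: ev_eq0]. Qed.

Lemma fibre_desc (X : lch) (A : xcstar R X) x (Q : cstarType R) (h : A -> Q) :
  star_hom h -> (forall a, xideal A (opensC1 x) a -> h a = 0) ->
  exists g : fibre A x -> Q, star_hom g /\ forall a, g (ev A x a) = h a.
Proof.
move=> hh h0; have [s sP] := choice (@ev_surj R X A x).
have he a b : ev A x a = ev A x b -> h a = h b.
  move=> ab; apply/eqP; rewrite -subr_eq0 -(star_homB hh); apply/eqP/h0/ev_eq0.
  by rewrite (star_homB (ev_hom x)) ab subrr.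
have eh := ev_hom (A := A) x.
exists (h \o s); split=> [|a] /=; last exact: he.
split=> [k u v|u v|u] /=.
- rewrite -(star_homZ hh) -(star_homD hh); apply: he.
  by rewrite (star_homD eh) (star_homZ eh) !sP.
- by rewrite -(star_homM hh); apply: he; rewrite (star_homM eh) !sP.
- by rewrite -(star_hom_star hh); apply: he; rewrite (star_hom_star eh) !sP.
Qed.

Section Presented.
Variables (X : lch) (A : xcstar R X) (F : X -> cstarType R) (q : forall x, A -> F x).
Hypothesis qp : presents q.

Lemma pres_nm x a : nm (q x a) = nm (ev A x a).
Proof.
have [g [gh ge]] := fibre_desc (pres_hom qp x) (fun a => proj2 (pres_ker qp x a)).
rewrite -ge; apply: (star_iso_nm gh).
have eh := ev_hom (A := A) x.
have gi u v : g u = g v -> u = v.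
  have [a' <-] := ev_surj u; have [b' <-] := ev_surj v; rewrite !ge => ab.
  apply/eqP; rewrite -subr_eq0 -(star_homB eh); apply/eqP/ev_eq0/(pres_ker qp).
  by rewrite (star_homB (pres_hom qp x)) ab subrr.
have gs w : exists u, g u = w.
  by have [b <-] := pres_surj qp w; exists (ev A x b).
have [s sP] := choice gs; exists s => // u; apply: gi; exact: sP.
Qed.

Lemma pres_field : is_field q.
Proof.
split; first exact: pres_hom qp.
- by move=> a r r0 ar; apply: ev_norm => // x; rewrite -pres_nm.
- move=> a x r; rewrite pres_nm => /ev_usc; apply: filterS => y /=.
  by rewrite pres_nm.
- by move=> a r /(ev_van a)[K cK Ka]; exists K => // x /Ka; rewrite pres_nm.
Qed.

Lemma pres_ext a b : (forall x, q x a = q x b) -> a = b.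
Proof. exact: (fld_ext pres_field). Qed.

Lemma pres_eq x a b : q x a = q x b <-> ev A x a = ev A x b.
Proof.
have h := pres_hom qp x; have eh := ev_hom (A := A) x.
split=> ab; apply/eqP; rewrite -subr_eq0.
  by rewrite -(star_homB eh); apply/eqP/ev_eq0/(pres_ker qp); rewrite (star_homB h) ab subrr.
by rewrite -(star_homB h); apply/eqP/(pres_ker qp)/ev_eq0; rewrite (star_homB eh) ab subrr.
Qed.

Lemma pres_mulby (k : X -> R[i]) a b : mulby q k a b <-> mulby (ev A) k a b.
Proof.
split=> h x.
  by rewrite -(star_homZ (ev_hom x)); apply/pres_eq; rewrite h (star_homZ (pres_hom qp x)).
by rewrite -(star_homZ (pres_hom qp x)); apply/pres_eq; rewrite h (star_homZ (ev_hom x)).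
Qed.

Lemma pres_xact k a x : C0 k -> q x (xact k a) = k x *: q x a.
Proof. by move=> k0; apply: (proj2 (pres_mulby k a (xact k a))) => y; rewrite xactE. Qed.

Lemma pres_ideal U a : xideal A U a <-> forall x, ~ oset U x -> q x a = 0.
Proof.
rewrite xideal_evP; split=> h x /h ax.
  by apply/(pres_ker qp)/ev_eq0.
by apply/ev_eq0/(pres_ker qp).
Qed.

End Presented.

(** The elements of [A] whose section under [psi] is realized in [B] form a closed subspace stable
    under bumps. By [fld_density] it is all of [A] as soon as it approximates every value at every
    point. *)
Lemma xhom_build (X : lch) (A B : xcstar R X) (G : X -> cstarType R)
    (r : forall x, B -> G x) (psi : forall x, A -> G x) :
  presents r -> (forall x, star_hom (psi x)) ->
  (forall x a, xideal A (opensC1 x) a -> psi x a = 0) ->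
  (forall x a (e : R), 0 < e -> exists a' b', nm (ev A x (a - a')) < e /\
     forall x', psi x' a' = r x' b') ->
  exists Phi : xhom A B, forall x a, r x (Phi a) = psi x a.
Proof.
move=> rp ph pk gen; have rh := pres_hom rp; have rf := pres_field rp.
pose S := [set a : A | exists b, forall x, psi x a = r x b].
have SS : closed_subspace S.
  split.
  - apply/closedP => a aS.
    have p2 n : 0 < 2^-1 ^+ n :> R by rewrite exprn_gt0 // invr_gt0.
    have ex n : exists ab : A * B, (forall x, psi x ab.1 = r x ab.2) /\
        nm (a - ab.1) < 2^-1 ^+ n.
      by have [a' [b' ab'] aa'] := aS _ (p2 n); exists (a', b').
    have [u uP] := choice ex.
    have uu m n : nm ((u m).2 - (u n).2) <= nm ((u m).1 - (u n).1).
      apply: (fld_norm rf) => [|x]; first exact: nm_ge0.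
      rewrite (star_homB (rh x)) -(uP m).1 -(uP n).1 -(star_homB (ph x)).
      exact: star_hom_le.
    have [|b ub] := @cauchy_seq_cvg _ B (fun n => (u n).2).
      move=> e e0; have [N NP] := half_pow_small (divr_gt0 e0 (ltr0Sn R 1)).
      exists N => m n Nm Nn; apply: (le_lt_trans (uu m n)).
      have := nm_tri (u m).1 a (u n).1; rewrite (nmC (u m).1 a).
      by have := (uP m).2; have := (uP n).2; have := NP _ Nm; have := NP _ Nn; lra.
    exists b => x; apply/eqP; rewrite -subr_eq0; apply/eqP/nm_small => e e0.
    have e2 := divr_gt0 e0 (ltr0Sn R 1).
    have [N NP] := half_pow_small e2; have [M MP] := ub _ e2.
    have := NP _ (leq_maxl N M); have := MP _ (leq_maxr N M); set n := maxn N M.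
    have := nm_tri (psi x a) (psi x (u n).1) (r x b).
    rewrite {2}(uP n).1 -(star_homB (ph x)) -(star_homB (rh x)).
    have := star_hom_le (ph x) (a - (u n).1); have := star_hom_le (rh x) ((u n).2 - b).
    by have := (uP n).2; lra.
  - by exists 0 => x; rewrite (star_hom0 (ph x)) (star_hom0 (rh x)).
  - move=> a a' [b ab] [b' ab']; exists (b + b') => x.
    by rewrite (star_homD (ph x)) (star_homD (rh x)) ab ab'.
  - move=> k a [b ab]; exists (k *: b) => x.
    by rewrite (star_homZ (ph x)) (star_homZ (rh x)) ab.
have Sall a : S a.
  apply: (fld_density (ev_field A) SS (@bumps01 R X) (@bumps_loc R X)).
  - move=> s phi [b sb] bphi; exists (xact (rc phi) s); last by move=> z; rewrite (xactE (bumps_C0 bphi)).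
    exists (xact (rc phi) b) => x; rewrite (pres_xact rp) -?sb; last exact: bumps_C0.
    rewrite -(star_homZ (ph x)); apply/eqP; rewrite -subr_eq0 -(star_homB (ph x)).
    apply/eqP/pk/ev_eq0.
    by rewrite (star_homB (ev_hom x)) (star_homZ (ev_hom x)) (xactE (bumps_C0 bphi)) subrr.
  - by move=> z e e0; have [a' [b' [aa' ab']]] := gen z a e e0; exists a' => //; exists b'.
have [Phi PhiP] := choice Sall.
have Phih : star_hom Phi.
  split=> [k a b|a b|a]; apply: (pres_ext rp) => x.
  - by rewrite (star_homD (rh x)) (star_homZ (rh x)) -!PhiP (star_hom_linear (ph x)).
  - by rewrite (star_homM (rh x)) -!PhiP (star_homM (ph x)).
  - by rewrite (star_hom_star (rh x)) -!PhiP (star_hom_star (ph x)).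
have Phii U a : xideal A U a -> xideal B U (Phi a).
  move=> Ua; apply/(pres_ideal rp) => x Ux; rewrite -PhiP; apply: pk.
  by apply: (xideal_sub _ Ua) => y Uy /= yx; apply: Ux; rewrite -yx.
by exists (Xhom Phih Phii) => x a /=; rewrite PhiP.
Qed.

Lemma xhom_ev0 (X : lch) (A B : xcstar R X) (phi : xhom A B) x a :
  ev A x a = 0 -> ev B x (phi a) = 0.
Proof. by move=> /ev_eq0/(xhom_ideal phi)/ev_eq0. Qed.

Lemma xhom_ev_eq (X : lch) (A B : xcstar R X) (phi : xhom A B) x a a' :
  ev A x a = ev A x a' -> ev B x (phi a) = ev B x (phi a').
Proof.
move=> aa; apply/eqP; rewrite -subr_eq0 -(star_homB (ev_hom x)) -(star_homB (xhom_star phi)).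
by apply/eqP/xhom_ev0; rewrite (star_homB (ev_hom x)) aa subrr.
Qed.

Lemma xhom_xact (X : lch) (A B : xcstar R X) (phi : xhom A B) k a :
  C0 k -> phi (xact k a) = xact k (phi a).
Proof.
move=> k0; apply: ev_ext => x; rewrite xactE //.
rewrite -(star_homZ (ev_hom x)) -(star_homZ (xhom_star phi)); apply: xhom_ev_eq.
by rewrite xactE // (star_homZ (ev_hom x)).
Qed.

Lemma xhom_bij_iso (X : lch) (A B : xcstar R X) (phi : xhom A B) :
  (forall b, exists a, phi a = b) ->
  (forall x a, ev B x (phi a) = 0 -> ev A x a = 0) ->
  is_iso (C := xcstar_category R X) phi.
Proof.
move=> surj inj; have [g gK] := choice surj.
have ph := xhom_star phi.
have phi_inj a a' : phi a = phi a' -> a = a'.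
  move=> aa; apply: ev_ext => x; apply/eqP; rewrite -subr_eq0 -(star_homB (ev_hom x)).
  by apply/eqP/inj; rewrite (star_homB ph) aa subrr (star_hom0 (ev_hom x)).
have gh : star_hom g.
  split=> [k a b|a b|a]; apply: phi_inj.
  - by rewrite (star_homD ph) (star_homZ ph) !gK.
  - by rewrite (star_homM ph) !gK.
  - by rewrite (star_hom_star ph) !gK.
have gi U b : xideal B U b -> xideal A U (g b).
  by move=> /xideal_evP Ub; apply/xideal_evP => x /Ub bx; apply: inj; rewrite gK.
exists (Xhom gh gi); split; apply: xhom_ext => a /=; last exact: gK.
by apply: phi_inj; rewrite gK.
Qed.

(** Bijective fibre maps are isometric, hence so is [phi], and its range is closed. The range is
    stable under bumps and contains every value at every point, so [fld_density] makes [phi]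
    surjective. *)
Lemma xhom_fibre_iso (X : lch) (A B : xcstar R X) (phi : xhom A B) :
  (forall x a, ev B x (phi a) = 0 -> ev A x a = 0) ->
  (forall x b, exists a, ev B x (phi a) = ev B x b) ->
  is_iso (C := xcstar_category R X) phi.
Proof.
move=> inj surj; apply: xhom_bij_iso => // b.
have ph := xhom_star phi.
have fib x : exists h : fibre A x -> fibre B x, star_hom h /\
    forall a, h (ev A x a) = ev B x (phi a).
  apply: (@fibre_desc _ _ _ _ (fun a => ev B x (phi a))).
    exact: star_hom_comp ph (ev_hom x).
  by move=> a /ev_eq0; exact: xhom_ev0.
have nmE' x a : nm (ev B x (phi a)) = nm (ev A x a).
  have [h [hh he]] := fib x; rewrite -he; apply: (star_iso_nm hh).
  have hi u v : h u = h v -> u = v.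
    have [a' <-] := ev_surj u; have [b' <-] := ev_surj v; rewrite !he => ab.
    apply/eqP; rewrite -subr_eq0 -(star_homB (ev_hom x)); apply/eqP/inj.
    by rewrite (star_homB ph) (star_homB (ev_hom x)) ab subrr.
  have hs w : exists u, h u = w.
    have [b' <-] := ev_surj w; have [a' ab'] := surj x b'.
    by exists (ev A x a'); rewrite he.
  have [s sP] := choice hs; exists s => // u; apply: hi; exact: sP.
have phin a : nm (phi a) = nm a.
  apply/eqP; rewrite eq_le star_hom_le //=; apply: ev_norm => [|x]; first exact: nm_ge0.
  by rewrite -nmE' star_hom_le //; exact: ev_hom.
pose S := [set b | exists a, b = phi a].
suff : S b by move=> [a ->]; exists a.
apply: (fld_density (ev_field B) (S := S) _ (@bumps01 R X) (@bumps_loc R X)).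
- split; first exact: range_closed.
  + by exists 0; rewrite (star_hom0 ph).
  + by move=> _ _ [a ->] [a' ->]; exists (a + a'); rewrite (star_homD ph).
  + by move=> k _ [a ->]; exists (k *: a); rewrite (star_homZ ph).
- move=> _ f [a ->] bf; exists (phi (xact (rc f) a)); first by exists (xact (rc f) a).
  by move=> z; rewrite xhom_xact ?(xactE (bumps_C0 bf)) //; exact: bumps_C0.
- move=> z r r0; have [a az] := surj z b; exists (phi a); first by exists a.
  by rewrite (star_homB (ev_hom z)) az subrr nm0.
Qed.

End Presentations.

(** * Pullbacks *)

Section Sections.
Variables (R : realType) (X Y : lch) (f : cmap X Y) (A : xcstar R Y).
Local Notation fam := (forall x : X, fibre A (f x)).
Implicit Types s t : fam.
Let eh y := ev_hom (A := A) y.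

Lemma usc_pull (a : A) (x : X) (r : R) : nm (ev A (f x) a) < r ->
  nbhs x [set x' | nm (ev A (f x') a) < r].
Proof. by move=> /ev_usc h; exact: (cmap_continuous (c := f) h). Qed.

(** Sections that are locally close to pulled back elements of [A] and vanish at infinity.
    Continuity is demanded of every [a] with the right value at [x], which is the form convenient
    for use; [gsec_cont_of] establishes it from one approximate choice. *)
Record gsec (s : fam) : Prop := Gsec {
  gsec_cont : forall (x : X) a, ev A (f x) a = s x -> forall e : R, 0 < e ->
    nbhs x [set x' | nm (s x' - ev A (f x') a) < e] ;
  gsec_van : forall e : R, 0 < e ->
    exists2 K : set X, compact K & forall x, ~ K x -> nm (s x) <= e }.

(** By upper semicontinuity, two elements of [A] with close values at [f x] have close values at
    [f y] for all [y] near [x]. *)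
Lemma gsec_cont_of (s : fam) : (forall (x : X) (e : R), 0 < e -> exists a,
    nbhs x [set x' | nm (s x' - ev A (f x') a) < e]) ->
  forall (x : X) a, ev A (f x) a = s x -> forall e : R, 0 < e ->
    nbhs x [set x' | nm (s x' - ev A (f x') a) < e].
Proof.
move=> sc x a ax e e0; have e2 := divr_gt0 e0 (ltr0Sn R 1).
have [b bs] := sc x _ e2; have := nbhs_singleton bs; rewrite /= -ax -(star_homB (eh _)).
move=> /usc_pull ab; apply: filterS (filterI bs ab) => y /= [h1 h2].
have := nm_tri (s y) (ev A (f y) b) (ev A (f y) a).
by rewrite (nmC (ev A (f y) b)) -(star_homB (eh (f y)) a b); lra.
Qed.

Lemma gsec_basic (k : X -> R[i]^o) (a : A) : C0 k ->
  gsec (fun x => k x *: ev A (f x) a).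
Proof.
move=> k0; have /C0P[kc kv] := k0; split.
  apply: gsec_cont_of => x e e0; exists (k x *: a).
  have a1 : 0 < nm a + 1 by have := nm_ge0 a; lra.
  have /continuousP /(_ x (e / (nm a + 1))) := kc; rewrite divr_gt0 // => /(_ isT).
  apply: filterS => y /=; rewrite ltr_pdivlMr // (star_homZ (eh _)) -scalerBl nmZ.
  have := star_hom_le (eh (f y)) a; have := cabs_ge0 (k y - k x).
  have := nm_ge0 (ev A (f y) a); nra.
move=> e e0; have a1 : 0 < nm a + 1 by have := nm_ge0 a; lra.
have [|K cK Kk] := kv (e / (nm a + 1)); first by rewrite divr_gt0.
exists K => // x /Kk; rewrite nmZ ler_pdivlMr // => h.
have := star_hom_le (eh (f x)) a; have := cabs_ge0 (k x).
by have := nm_ge0 (ev A (f x) a); nra.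
Qed.

Lemma gsec0 : gsec (fun=> 0).
Proof.
split=> [x a a0 e e0|e e0].
  have := @usc_pull a x e; rewrite a0 nm0 => /(_ e0); apply: filterS => y /=.
  by rewrite sub0r nmN.
by exists set0 => [|x _]; [exact: compact0|rewrite nm0 ltW].
Qed.

Lemma gsec_rep s : gsec s -> forall x, exists a, ev A (f x) a = s x /\
  forall e : R, 0 < e -> nbhs x [set x' | nm (s x' - ev A (f x') a) < e].
Proof.
by move=> sg x; have [a ax] := ev_surj (s x); exists a; split => //; exact: gsec_cont.
Qed.

Lemma gsecD s t : gsec s -> gsec t -> gsec (fun x => s x + t x).
Proof.
move=> sg tg; split.
  apply: gsec_cont_of => x e e0; have e2 := divr_gt0 e0 (ltr0Sn R 1).
  have [a [_ /(_ _ e2) sa]] := gsec_rep sg x; have [b [_ /(_ _ e2) tb]] := gsec_rep tg x.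
  exists (a + b); apply: filterS (filterI sa tb) => y /= [h1 h2].
  rewrite (star_homD (eh _)) opprD addrACA.
  have := nmD (s y - ev A (f y) a) (t y - ev A (f y) b); lra.
move=> e e0; have e2 := divr_gt0 e0 (ltr0Sn R 1).
have [K cK Ks] := gsec_van sg e2; have [L cL Lt] := gsec_van tg e2.
exists (K `|` L) => [|x KL]; first exact: compactU.
have := nmD (s x) (t x); have := Ks x _; have := Lt x _.
have nK : ~ K x by move=> ?; apply: KL; left.
have nL : ~ L x by move=> ?; apply: KL; right.
by move=> /(_ nL) ? /(_ nK) ?; lra.
Qed.

Lemma gsecZ (c : R[i]) s : gsec s -> gsec (fun x => c *: s x).
Proof.
move=> sg; have c1 : 0 < cabs c + 1 by have := cabs_ge0 c; lra.
split.
  apply: gsec_cont_of => x e e0; have e2 := divr_gt0 e0 c1.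
  have [a [_ /(_ _ e2) sa]] := gsec_rep sg x; exists (c *: a).
  apply: filterS sa => y /=; rewrite ltr_pdivlMr // (star_homZ (eh _)) -scalerBr nmZ.
  by have := cabs_ge0 c; have := nm_ge0 (s y - ev A (f y) a); nra.
move=> e e0; have [K cK Ks] := gsec_van sg (divr_gt0 e0 c1); exists K => // x /Ks.
rewrite ler_pdivlMr // nmZ.
by have := cabs_ge0 c; have := nm_ge0 (s x); nra.
Qed.

Lemma gsec_star s : gsec s -> gsec (fun x => cstar (s x)).
Proof.
move=> sg; split.
  apply: gsec_cont_of => x e e0.
  have [a [_ /(_ _ e0) sa]] := gsec_rep sg x; exists (cstar a).
  by apply: filterS sa => y /=; rewrite (star_hom_star (eh _)) -cstarB nm_star.
by move=> e /(gsec_van sg)[K cK Ks]; exists K => // x /Ks; rewrite nm_star.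
Qed.

Lemma gsec_bounded s : gsec s -> exists2 M : R, 0 <= M & forall x, nm (s x) <= M.
Proof.
move=> sg; have [K cK Ks] := gsec_van sg ltr01.
have [M M0 KM] : exists2 M : R, 0 <= M & forall x, K x -> nm (s x) <= M.
  apply: (compact_ind (P := fun B => exists2 M, 0 <= M & forall x, B x -> nm (s x) <= M) cK).
  - by exists 0.
  - move=> B C [M M0 BM] [N N0 CN]; exists (M + N); first by rewrite addr_ge0.
    by move=> x [/BM|/CN]; lra.
  - by move=> B C BC [M M0 CM]; exists M => // x /BC/CM.
  - move=> x _; have [a [_ /(_ _ ltr01) sa]] := gsec_rep sg x.
    exists [set y | nm (s y - ev A (f y) a) < 1] => //.
    exists (nm a + 1) => [|y /= sy]; first by have := nm_ge0 a; lra.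
    by have := nm_le_add (s y) (ev A (f y) a); have := star_hom_le (eh (f y)) a; lra.
exists (1 + M) => [|x]; first by rewrite addr_ge0.
by have [/KM|/Ks] := pselect (K x); lra.
Qed.

Lemma gsecM s t : gsec s -> gsec t -> gsec (fun x => s x ** t x).
Proof.
move=> sg tg; split.
  apply: gsec_cont_of => x e e0.
  have [a [_ sa]] := gsec_rep sg x; have [b [_ tb]] := gsec_rep tg x.
  exists (a ** b).
  pose C := nm a + nm b + 1; have [a0 b0] := (nm_ge0 a, nm_ge0 b).
  have C0 : 0 < C + 1 by rewrite /C; lra.
  pose d := Num.min 1 (e / (C + 1)).
  have d0 : 0 < d by rewrite lt_min ltr01 divr_gt0.
  have d1 : d <= 1 by rewrite ge_min lexx.
  have de : d * (C + 1) <= e by rewrite -ler_pdivlMr // ge_min lexx orbT.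
  apply: filterS (filterI (sa _ d0) (tb _ d0)) => y /= [h1 h2].
  rewrite (star_homM (eh _)).
  have -> : s y ** t y - ev A (f y) a ** ev A (f y) b =
      (s y - ev A (f y) a) ** t y + ev A (f y) a ** (t y - ev A (f y) b).
    by rewrite cmulBl cmulBr; lmod_with R[i].
  have := nmD ((s y - ev A (f y) a) ** t y) (ev A (f y) a ** (t y - ev A (f y) b)).
  have := nmM (s y - ev A (f y) a) (t y); have := nmM (ev A (f y) a) (t y - ev A (f y) b).
  have := nm_le_add (t y) (ev A (f y) b).
  have := star_hom_le (eh (f y)) a; have := star_hom_le (eh (f y)) b.
  have := nm_ge0 (s y - ev A (f y) a); have := nm_ge0 (t y - ev A (f y) b).
  have := nm_ge0 (t y); have := nm_ge0 (ev A (f y) a); rewrite /C in de; nra.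
move=> e e0; have [M M0 sM] := gsec_bounded sg.
have M1 : 0 < M + 1 by lra.
have [L cL Lt] := gsec_van tg (divr_gt0 e0 M1); exists L => // x /Lt.
rewrite ler_pdivlMr // => h; have := nmM (s x) (t x); have := sM x.
by have := nm_ge0 (s x); have := nm_ge0 (t x); nra.
Qed.

Lemma gsec_closed s : (forall e : R, 0 < e -> exists2 t, gsec t &
  forall x, nm (s x - t x) <= e) -> gsec s.
Proof.
move=> app; split.
  apply: gsec_cont_of => x e e0; have e2 := divr_gt0 e0 (ltr0Sn R 1).
  have e4 := divr_gt0 e2 (ltr0Sn R 1).
  have [t tg st] := app _ e4; have [a [_ /(_ _ e4) ta]] := gsec_rep tg x.
  exists a; apply: filterS ta => y /= h; have := nm_tri (s y) (t y) (ev A (f y) a).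
  by have := st y; lra.
move=> e e0; have e2 := divr_gt0 e0 (ltr0Sn R 1).
have [t tg st] := app _ e2; have [K cK Kt] := gsec_van tg e2; exists K => // x /Kt.
by have := st x; have := nm_le_add (s x) (t x); lra.
Qed.

Lemma gsec_subalgebra : family_subalgebra gsec.
Proof.
split.
- move=> s /gsec_bounded[M M0 sM]; exists M%:C => x; rewrite norm_leE; exact: sM.
- exact: gsec0.
- exact: gsecD.
- exact: gsecZ.
- exact: gsecM.
- exact: gsec_star.
- move=> s app; apply: gsec_closed => e e0.
  have [|t tg st] := app e%:C; first by rewrite ltcR.
  by exists t => // x; rewrite -norm_leE; exact: st.
Qed.

Lemma gsec_basics : basic_sections (f := f) (A := A) `<=` gsec.
Proof.
move=> s [k [a [k0 sE]]]; rewrite (_ : s = fun x => k x *: ev A (f x) a).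
  exact: gsec_basic.
exact: functional_extensionality_dep.
Qed.

Definition sect := {s : fam | gsec s}.

Lemma sect_complete (u : nat -> sect) :
  (forall e : R, 0 < e -> exists N, forall m n, (N <= m)%N -> (N <= n)%N ->
     forall x, nm (sval (u m) x - sval (u n) x) <= e) ->
  exists l : sect, forall e : R, 0 < e -> exists N, forall n, (N <= n)%N ->
     forall x, nm (sval (u n) x - sval l x) <= e.
Proof.
move=> cu.
have lim x : exists l, lim_seq (fun n => sval (u n) x) l.
  apply: cauchy_seq_cvg => e e0; have e2 := divr_gt0 e0 (ltr0Sn R 1).
  have [N NP] := cu _ e2; exists N => m n Nm Nn; have := NP m n Nm Nn x; lra.
pose l x := sval (cid (lim x)).
have lP x : lim_seq (fun n => sval (u n) x) (l x) by rewrite /l; case: cid.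
have ul e : 0 < e -> exists N, forall n, (N <= n)%N -> forall x, nm (sval (u n) x - l x) <= e.
  move=> /cu[N NP]; exists N => n Nn x; rewrite nmC.
  have := lim_seqD (lP x) (lim_seq_cst (- sval (u n) x)).
  by move=> /lim_seq_le; apply; exists N => m Nm; exact: NP.
have lg : gsec l.
  apply: gsec_closed => e /ul[N /(_ N (leqnn N)) NP]; exists (sval (u N)).
    exact: svalP.
  by move=> x; rewrite nmC.
by exists (exist _ _ lg).
Qed.

Definition sect_evalgebra : evalgebra sect (fun x => fibre A (f x)).
Proof.
refine (@EvAlgebra R sect X (fun x => fibre A (f x)) (fun x (s : sect) => sval s x)
  (exist _ _ gsec0)
  (fun s t : sect => exist _ _ (gsecD (svalP s) (svalP t)))
  (fun c (s : sect) => exist _ _ (gsecZ c (svalP s)))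
  (fun s t : sect => exist _ _ (gsecM (svalP s) (svalP t)))
  (fun s : sect => exist _ _ (gsec_star (svalP s))) _ _ _ _ _ _ sect_complete) => //.
by move=> s; have [M _ sM] := gsec_bounded (svalP s); exists M.
Defined.

Definition sect_alg : cstarType R := ev_cstar sect_evalgebra.
Definition sect_ev (x : X) : sect_alg -> fibre A (f x) := ev_at (T := sect_evalgebra) x.
Definition sect_class (s : fam) (sg : gsec s) : sect_alg :=
  ev_class sect_evalgebra (exist _ s sg).

Lemma sect_evE s (sg : gsec s) x : sect_ev x (sect_class sg) = s x.
Proof. by rewrite /sect_ev /sect_class ev_at_class. Qed.

Lemma sect_ev_gsec (p : sect_alg) : gsec (sect_ev^~ p).
Proof.
have [[s sg] ->] := ev_classK p.
rewrite (_ : (fun x => _) = s) //; apply: functional_extensionality_dep => x.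
exact: sect_evE.
Qed.

Lemma gsec_field (E : cstarType R) (q : forall x : X, E -> fibre A (f x)) :
  (forall x, star_hom (q x)) ->
  (forall e (r : R), 0 <= r -> (forall x, nm (q x e) <= r) -> nm e <= r) ->
  (forall e, gsec (q^~ e)) -> is_field q.
Proof.
move=> qh qn qg; split => // [e z r zr|e r r0]; last exact: gsec_van.
have [a [az /(_ ((r - nm (q z e)) / 2)) az']] := gsec_rep (qg e) z.
have d0 : 0 < (r - nm (q z e)) / 2 by rewrite divr_gt0 // subr_gt0.
have /usc_pull ua : nm (ev A (f z) a) < nm (q z e) + (r - nm (q z e)) / 2 by rewrite az; lra.
apply: filterS (filterI (az' d0) ua) => y /= [h1 h2].
by have := nm_le_add (q y e) (ev A (f y) a); lra.
Qed.

Lemma sect_field : is_field sect_ev.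
Proof.
apply: gsec_field; [exact: ev_at_hom| |exact: sect_ev_gsec].
by move=> e r r0 er; apply/(@ev_nm_le _ _ _ _ sect_evalgebra).
Qed.

Lemma gsec_bump (s : fam) phi : gsec s -> bumps phi -> gsec (fun x => (phi x)%:C *: s x).
Proof.
move=> sg bphi; have p01 := bumps01 bphi; have /C0P[/continuousP pc _] := bumps_C0 bphi.
split.
  apply: gsec_cont_of => x e e0; have [a [_ sa]] := gsec_rep sg x.
  exists ((phi x)%:C *: a); have a1 : 0 < nm a + 1 by have := nm_ge0 a; lra.
  have e2 := divr_gt0 e0 (ltr0Sn R 1); have d0 := divr_gt0 e2 a1.
  apply: filterS (filterI (sa _ e2) (pc x _ d0)) => y /= [h1].
  rewrite /rc ltr_pdivlMr // (star_homZ (eh _)) => h2.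
  have -> : (phi y)%:C *: s y - (phi x)%:C *: ev A (f y) a =
    (phi y)%:C *: (s y - ev A (f y) a) + ((phi y)%:C - (phi x)%:C) *: ev A (f y) a.
    by lmod_with R[i].
  have := nmD ((phi y)%:C *: (s y - ev A (f y) a)) (((phi y)%:C - (phi x)%:C) *: ev A (f y) a).
  rewrite !nmZ; have := bump_cabs p01 y; have := cabs_ge0 ((phi y)%:C - (phi x)%:C).
  have := star_hom_le (eh (f y)) a; have := nm_ge0 (ev A (f y) a).
  have := nm_ge0 (s y - ev A (f y) a); have := cabs_ge0 (phi y)%:C.
  move: (cabs ((phi y)%:C - _)) (cabs (phi y)%:C) (nm (s y - _)) (nm (ev A (f y) a)) h1 h2.
  move=> c1 c2 n1 n2 h1 h2 ? ? ? ? ? ? ?; nra.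
move=> e /(gsec_van sg)[K cK Ks]; exists K => // x /Ks; rewrite nmZ.
have := bump_cabs p01 x; have := nm_ge0 (s x); have := cabs_ge0 (phi x)%:C; nra.
Qed.

Lemma sect_bump phi e : bumps phi -> exists e', mulby sect_ev (fun z => (phi z)%:C) e e'.
Proof.
move=> bphi; exists (sect_class (gsec_bump (sect_ev_gsec e) bphi)) => x.
by rewrite sect_evE.
Qed.

Definition pull_alg : xcstar R X := of_field sect_field sect_bump.

(** With a bump equal to 1 at [z], a basic section takes any prescribed value at [z]. By
    [fld_density] the basic sections then span a dense subspace of the continuous ones, and every
    closed family algebra that contains them contains the rest. *)
Lemma gsec_minimal (S : set fam) : family_subalgebra S ->
  basic_sections (f := f) (A := A) `<=` S -> gsec `<=` S.
Proof.
move=> SS bS s sg.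
pose G := [set e : sect_alg | exists k a, C0 k /\ forall x, sect_ev x e = k x *: ev A (f x) a].
have GG := closed_span_subspace G.
have sh := fld_hom sect_field.
have : closed_span G (sect_class sg).
  apply: (fld_density sect_field GG (@bumps01 R X) (@bumps_loc R X)).
  - have mul_ex phi (bp : bumps phi) := choice (fun e => sect_bump e bp).
    move=> e phi Ge bp; have [m mP] := mul_ex phi bp; exists (m e) => //.
    have ml : linear m.
      move=> c a b; apply: (fld_ext sect_field) => x.
      rewrite (star_hom_linear (sh x)) !mP (star_hom_linear (sh x)) scalerDr.
      by rewrite !scalerA mulrC.
    have mb a : nm (m a) <= 1 * nm a.
      rewrite mul1r; apply: (fld_norm sect_field) => [|x]; first exact: nm_ge0.
      rewrite mP nmZ -[leRHS]mul1r ler_pM ?nm_ge0 ?cabs_ge0 ?star_hom_le //.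
      by rewrite bump_cabs //; exact: bumps01.
    move: e Ge; apply: (closed_span_map ml mb GG).
    move=> e [k [a [k0 ek]]] /=; apply: sub_closed_span.
    exists (fun x => rc phi x * k x), a; split; first exact: C0M (bumps_C0 bp) k0.
    by move=> x; rewrite mP ek scalerA.
  - move=> z r r0; have [a [az _]] := gsec_rep sg z.
    have [phi b] := bump_exists R (@filterT _ (nbhs z) _).
    exists (sect_class (gsec_basic a (bump_C0 b))).
      apply: sub_closed_span; exists (rc phi), a; split; first exact: bump_C0 b.
      by move=> x; rewrite sect_evE.
    rewrite (star_homB (sh z)) !sect_evE /rc (nbhs_singleton (bump_near b)) scale1r.
    by rewrite az subrr nm0.
have famE (t u : fam) : (forall x, t x = u x) -> t = u by exact: functional_extensionality_dep.
suff SG : closed_span G `<=` [set e | S (sect_ev^~ e)].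
  by move=> /SG; congr S; apply: famE => x; rewrite sect_evE.
apply: closed_span_sub; last first.
  by move=> e [k [a [k0 ek]]]; apply: bS; exists k, a.
split.
- apply/closedP => e eT; apply: (family_closed SS) => eps.
  rewrite ltcE /= => /andP[/eqP ei e0]; have [e' e'T ee'] := eT _ e0.
  exists (sect_ev^~ e') => // x; rewrite norm_leP ei eqxx /= -(star_homB (sh x)).
  by rewrite (le_trans (star_hom_le (sh x) _)) // ltW.
- rewrite /= (_ : (fun x => _) = fun=> 0); first exact: (family0 SS).
  by apply: famE => x; rewrite (star_hom0 (sh x)).
- move=> a b /= Sa Sb; rewrite (_ : (fun x => _) = fun x => sect_ev x a + sect_ev x b).
    exact: (familyD SS).
  by apply: famE => x; rewrite (star_homD (sh x)).
- move=> c a /= Sa; rewrite (_ : (fun x => _) = fun x => c *: sect_ev x a).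
    exact: (familyZ SS).
  by apply: famE => x; rewrite (star_homZ (sh x)).
Qed.

Lemma gsec_bigcap : [set s | gsec s] =
  \bigcap_(S in [set S | family_subalgebra S /\ basic_sections (f := f) (A := A) `<=` S]) S.
Proof.
apply/seteqP; split=> [s sg S [SS bS]|s]; first exact: gsec_minimal.
by apply; split; [exact: gsec_subalgebra|exact: gsec_basics].
Qed.

Lemma pull_algP : is_pullback (P := pull_alg) sect_ev.
Proof.
have sh := fld_hom sect_field; split => //.
- move=> p r; rewrite lecE /= => /andP[/eqP ri r0]; rewrite norm_leP ri eqxx /=.
  split=> [pr x|pr]; first by rewrite norm_leP ri eqxx /= (le_trans (star_hom_le (sh x) _)).
  by apply: (fld_norm sect_field) => // x; have := pr x; rewrite norm_leP ri eqxx.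
- rewrite -gsec_bigcap; apply/seteqP; split=> [s [p ps]|s sg].
    rewrite /= (_ : s = (sect_ev^~ p)); first exact: sect_ev_gsec.
    by apply: functional_extensionality_dep => x; rewrite ps.
  by exists (sect_class sg) => x; rewrite sect_evE.
- move=> U; apply/seteqP; split=> [e eU|]; last first.
    apply: ideal_gen_sub; first exact: xidealP.
    by move=> e [k [p [[_ kU] ek]]]; apply/of_fieldE => z Uz; rewrite ek kU // scale0r.
  apply: (field_density sect_field sect_bump (ideal_gen_ideal _)) => z r r0.
  have [Uz|Uz] := pselect (oset U z); last first.
    exists 0; first exact: (subspace0 (ideal_subspace (ideal_gen_ideal _))).
    by rewrite subr0 eU // nm0.
  have [phi b] := bump_exists R (open_nbhs_nbhs (conj (osetP U) Uz)).
  have [|e' ee'] := @sect_bump phi e; first by exists z, (oset U).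
  exists e'.
    apply: sub_ideal_gen; exists (rc phi), e; split => //; exact: bump_C0_on b.
  by rewrite (star_homB (sh z)) ee' (nbhs_singleton (bump_near b)) scale1r subrr nm0.
Qed.

End Sections.

(** * Properties shared by all pullbacks *)

Section Pullbacks.
Variables (R : realType) (X Y : lch) (f : cmap X Y) (A : xcstar R Y) (P : xcstar R X).
Variable e : forall x : X, P -> fibre A (f x).
Hypothesis eP : is_pullback e.

Let eh := pullback_hom eP.

Lemma pb_sections : [set s : forall x, fibre A (f x) | exists p, forall x, e x p = s x] =
  [set s | gsec s].
Proof. by rewrite gsec_bigcap; exact: (pullback_sections eP). Qed.

Lemma pb_gsec p : gsec (e^~ p).
Proof.
have : [set s : forall x, fibre A (f x) | exists p, forall x, e x p = s x] (e^~ p) by exists p.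
by rewrite pb_sections.
Qed.

Lemma pb_section s : gsec s -> exists p, forall x, e x p = s x.
Proof.
move=> sg; have : [set s : forall x, fibre A (f x) | gsec s] s by [].
by rewrite -pb_sections.
Qed.

Lemma pb_field : is_field e.
Proof.
apply: gsec_field => //; last exact: pb_gsec.
move=> p r r0 pr; rewrite -norm_leE; apply/(pullback_norm eP); first by rewrite lecR.
by move=> x; rewrite norm_leE.
Qed.

Lemma pb_bump phi p : bumps phi -> exists p', mulby e (fun z => (phi z)%:C) p p'.
Proof.
by move=> bphi; have [p' pp'] := pb_section (gsec_bump (pb_gsec p) bphi); exists p'.
Qed.

Lemma pb_ideal U p : xideal P U p <-> forall x, ~ oset U x -> e x p = 0.
Proof.
rewrite (pullback_ideal eP); split=> [Up x Ux|pU].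
  have := Up [set p | e x p = 0]; apply; split; last first.
    by move=> q [k [p' [[_ kU] qk]]]; rewrite /= qk kU // scale0r.
  split; first split.
  - apply/closedP => a aS; apply: nm_small => r /aS[b b0 ab].
    rewrite -(subr0 (e x a)) -b0 -(star_homB (eh x)).
    by rewrite (le_trans (star_hom_le (eh x) _)) // ltW.
  - by rewrite /= (star_hom0 (eh x)).
  - by move=> a b /= a0 b0; rewrite (star_homD (eh x)) a0 b0 addr0.
  - by move=> k a /= a0; rewrite (star_homZ (eh x)) a0 scaler0.
  - by move=> a b /= b0; rewrite (star_homM (eh x)) b0 cmul0r.
  - by move=> a b /= a0; rewrite (star_homM (eh x)) a0 cmul0l.
  - by move=> a /= a0; rewrite (star_hom_star (eh x)) a0 cstar0.
apply: (field_density pb_field pb_bump (ideal_gen_ideal _)) => z r r0.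
have [Uz|Uz] := pselect (oset U z); last first.
  exists 0; first exact: (subspace0 (ideal_subspace (ideal_gen_ideal _))).
  by rewrite subr0 pU // nm0.
have [phi b] := bump_exists R (open_nbhs_nbhs (conj (osetP U) Uz)).
have [|p' pp'] := @pb_bump phi p; first by exists z, (oset U).
exists p'.
  by apply: sub_ideal_gen; exists (rc phi), p; split => //; exact: bump_C0_on b.
by rewrite (star_homB (eh z)) pp' (nbhs_singleton (bump_near b)) scale1r subrr nm0.
Qed.

Lemma pb_basic (k : X -> R[i]^o) (a : A) : C0 k -> exists p, forall x, e x p = k x *: ev A (f x) a.
Proof. by move=> k0; exact: pb_section (gsec_basic f a k0). Qed.

(** A basic section with a bump equal to 1 at [x] takes any value of the fibre at [f x]. So [e]
    describes the fibres of the pullback and can replace [ev]. *)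
Lemma pb_presents : presents e.
Proof.
split => // [x w|x p].
  have [a <-] := ev_surj w; have [phi b] := bump_exists R (@filterT _ (nbhs x) _).
  have [p pE] := pb_basic a (bump_C0 b); exists p.
  by rewrite pE /rc (nbhs_singleton (bump_near b)) scale1r.
rewrite pb_ideal; split=> [p0 x' /contrapT ->//|]; apply; rewrite /= => xx; exact: xx.
Qed.

Lemma pb_ext p p' : (forall x, e x p = e x p') -> p = p'.
Proof. exact: (fld_ext pb_field). Qed.

Lemma pb_rep p x : exists a, e x p = ev A (f x) a.
Proof. by have [a <-] := ev_surj (e x p); exists a. Qed.

End Pullbacks.

(** * External products *)

Section ExternalFunctions.
Variables (R : realType) (X Y : lch).

Lemma C0X (k : X -> R[i]^o) (l : Y -> R[i]^o) : C0 k -> C0 l ->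
  C0 (X := lch_prod X Y) (fun z => k z.1 * l z.2).
Proof.
move=> k0 l0; have [M M0 kM] := C0_bounded k0; have [N N0 lN] := C0_bounded l0.
move/C0P: k0 => [kc kv]; move/C0P: l0 => [lc lv]; apply/C0P; split.
  move=> z; apply: cvgM.
    by apply: (continuous_comp (f := fst) (g := k)); [exact: cvg_fst|exact: kc].
  by apply: (continuous_comp (f := snd) (g := l)); [exact: cvg_snd|exact: lc].
move=> e e0; have M1 : 0 < M + 1 by lra.
have N1 : 0 < N + 1 by lra.
have [K cK Kk] := kv _ (divr_gt0 e0 N1); have [L cL Ll] := lv _ (divr_gt0 e0 M1).
exists (K `*` L) => [|[x y] /= nKL]; first exact: compact_setX.
rewrite cabsM; have [Kx|/Kk] := pselect (K x).
  have [Ly|/Ll] := pselect (L y); first by case: nKL.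
  rewrite ler_pdivlMr // => h; have := kM x; have := cabs_ge0 (k x); have := cabs_ge0 (l y).
  nra.
rewrite ler_pdivlMr // => h; have := lN y; have := cabs_ge0 (k x); have := cabs_ge0 (l y).
nra.
Qed.

Lemma opensX_subproof (U : opens X) (V : opens Y) :
  open ([set z | oset U z.1 /\ oset V z.2] : set (lch_prod X Y)).
Proof.
apply: (openI (A := fst @^-1` oset U) (B := snd @^-1` oset V)).
  by apply: open_comp (osetP U) => z _; exact: cvg_fst.
by apply: open_comp (osetP V) => z _; exact: cvg_snd.
Qed.

Definition opensX (U : opens X) (V : opens Y) : opens (lch_prod X Y) :=
  Opens (@opensX_subproof U V).

(** Products of bumps of the two factors are used because they multiply elementary tensors factor by
    factor. *)
Definition box_bumps : set (lch_prod X Y -> R) :=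
  [set phi | exists f g, [/\ bumps f, bumps g & phi = fun z => f z.1 * g z.2]].

Lemma box_bumps01 phi : box_bumps phi -> forall z, 0 <= phi z <= 1.
Proof.
move=> [f [g [bf bg ->]]] z; have := bumps01 bf z.1; have := bumps01 bg z.2.
by move=> /andP[? ?] /andP[? ?]; apply/andP; split; nra.
Qed.

Lemma box_bumps_loc (z : lch_prod X Y) U : nbhs z U -> exists2 phi, box_bumps phi &
  nbhs z [set y | phi y = 1] /\ forall y, ~ U y -> phi y = 0.
Proof.
case: z => x y [[P Q] /= [xP yQ] PQ].
have [f bf [f1 fP]] := bumps_loc R xP; have [g bg [g1 gQ]] := bumps_loc R yQ.
exists (fun z => f z.1 * g z.2); first by exists f, g.
split=> [|[x' y'] /= nU].
  exists ([set x | f x = 1], [set y | g y = 1]) => // -[x' y'] /= [-> ->].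
  by rewrite mulr1.
have [Px|/fP->] := pselect (P x'); last by rewrite mul0r.
have [Qy|/gQ->] := pselect (Q y'); last by rewrite mulr0.
by case: nU; exact: PQ.
Qed.

End ExternalFunctions.

Section StructureMaps.
Variables (R : realType) (X : lch) (A : xcstar R X).

(** The difference [d] of [m k a] and [k x *: a] vanishes at [x]: times [m l b] it is the image
    under [m] of a function vanishing at [x], and the elements [m l b] span a dense subspace, so
    [d ** cstar d] vanishes at [x] as well. Structure maps are therefore unique. *)
Lemma structure_xact (m : (X -> R[i]^o) -> A -> A) k a :
  is_structure_map m -> C0 k -> m k a = xact k a.
Proof.
move=> mP k0; apply: ev_ext => x; rewrite xactE //.
have eh := ev_hom (A := A) x.
set d := m k a - k x *: a; suff : ev A x d = 0.
  by rewrite /d (star_homB eh) (star_homZ eh) => /eqP; rewrite subr_eq0 => /eqP.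
have dJ c : ev A x (d ** c) = 0.
  have : closed_span [set b | exists k a, C0 k /\ b = m k a] c by rewrite (structure_surj mP).
  apply: (closed_span_map (f := fun c => ev A x (d ** c)) (M := nm d) _ _ (zero_subspace _)).
  - by move=> z b b'; rewrite cmulDr cmulZr (star_hom_linear eh).
  - by move=> b; rewrite (le_trans (star_hom_le eh _)) ?nmM.
  move=> _ [l [b [l0 ->]]] /=.
  have -> : d ** m l b = m (fun y => - k x * l y + k y * l y) (a ** b).
    have kl0 : C0 (fun y => k y * l y : R[i]^o) by exact: C0M.
    rewrite (structure_linear_l mP (- k x) (a ** b) l0 kl0) (structureM mP) //.
    rewrite (structure_bilinear_l mP) // /d cmulBl cmulZl.
    by lmod_with R[i].
  apply/ev_eq0; rewrite (structure_ideal mP); apply: sub_closed_span.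
  exists (fun y => - k x * l y + k y * l y), (a ** b); split => //; split.
    have kl0 : C0 (fun y => k y * l y : R[i]^o) by exact: C0M.
    have [c1 v1] := l0; have [c2 v2] := kl0; apply/C0P; split.
      move=> y; apply: cvgD; last exact: c2.
      by apply: cvgM; [exact: cvg_cst|exact: c1].
    move/C0P: (l0) => [_ lv]; move/C0P: (kl0) => [_ klv] e e0.
    have k1 : 0 < cabs (k x) + 1 by have := cabs_ge0 (k x); lra.
    have e2 := divr_gt0 e0 (ltr0Sn R 1); have e3 := divr_gt0 e2 k1.
    have [K cK Kl] := lv _ e3; have [L cL Ll] := klv _ e2.
    exists (K `|` L) => [|y KL]; first exact: compactU.
    have nK : ~ K y by move=> ?; apply: KL; left.
    have nL : ~ L y by move=> ?; apply: KL; right.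
    have := cabsD (- k x * l y) (k y * l y); rewrite cabsM cabsN.
    have := Ll _ nL; have := Kl _ nK; rewrite ler_pdivlMr //.
    by have := cabs_ge0 (k x); have := cabs_ge0 (l y); nra.
  by move=> y /= /contrapT ->; rewrite mulNr addNr.
have := dJ (cstar d); rewrite (star_homM eh) (star_hom_star eh) => h.
by apply: nm_eq0; apply/eqP; rewrite -sqrf_eq0 -nm_mul_star h nm0.
Qed.

End StructureMaps.

Lemma span_at (R : realType) (T E F : cstarType R) (q : T -> F) (q' : E -> F) (G : set T) (I : Type) (tau : I -> E) :
  star_hom q -> star_hom q' ->
  (forall i, exists2 g, closed_span G g & q g = q' (tau i)) ->
  forall l, exists2 g, closed_span G g & q g = q' (comb tau l).
Proof.
move=> qh qh' gen; have SG := closed_span_subspace G; elim=> [|[c i] l [g Gg gE]].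
  exists 0; first exact: (subspace0 SG).
  by rewrite /comb big_nil (star_hom0 qh) (star_hom0 qh').
have [g' Gg' gE'] := gen i; exists (c *: g' + g).
  by apply: (subspaceD SG) => //; exact: (subspaceZ SG).
by rewrite /comb big_cons (star_hom_linear qh) gE' gE (star_hom_linear qh').
Qed.

Section ExtTensor.
Variables (R : realType) (X Y : lch) (A : xcstar R X) (B : xcstar R Y).
Variables (E : xcstar R (lch_prod X Y)) (t : A -> B -> E).

(** The structure maps in [is_ext_product] amount to this compatibility with values;
    [ext_product_tensor] and [ext_tensor_product] pass between the two forms. *)
Record ext_tensor : Prop := ExtTensor {
  ext_max : is_max_tensor t ;
  ext_evl : forall (x : X) (y : Y) a b, ev A x a = 0 -> ev E (x, y) (t a b) = 0 ;
  ext_evr : forall (x : X) (y : Y) a b, ev B y b = 0 -> ev E (x, y) (t a b) = 0 }.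

Lemma ext_product_tensor : is_ext_product t -> ext_tensor.
Proof.
move=> [tm [m [n [M [mP nP MP tMM]]]]]; have th := max_tensor_hom tm.
have key k l a b x y : C0 k -> C0 l ->
    ev E (x, y) (t (xact k a) (xact l b)) = (k x * l y) *: ev E (x, y) (t a b).
  move=> k0 l0; rewrite -(structure_xact _ mP k0) -(structure_xact _ nP l0) -tMM //.
  by rewrite (structure_xact _ MP (C0X k0 l0)) xactE //; exact: C0X.
have spanB (b : B) : closed_span [set b | exists l b', C0_on (opensT Y) l /\ b = xact l b'] b.
  by rewrite -(xideal_span B) xidealT.
have spanA (a : A) : closed_span [set a | exists k a', C0_on (opensT X) k /\ a = xact k a'] a.
  by rewrite -(xideal_span A) xidealT.
split => // x y a b /ev_eq0; rewrite xideal_span => h; have sh := bistar_post th (ev_hom (A := E) (x, y)).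
- apply: (closed_span_map (bistar_linear_l sh b) (bistar_linear_bound_l b sh) (zero_subspace _) _ h).
  move=> _ [k [a' [[k0 kx] ->]]] /=.
  apply: (closed_span_map (bistar_linear_r sh _) (bistar_le sh _) (zero_subspace _) _ (spanB b)).
  by move=> _ [l [b' [[l0 _] ->]]] /=; rewrite key // kx ?mul0r ?scale0r //=; apply.
- apply: (closed_span_map (bistar_linear_r sh a) (bistar_le sh a) (zero_subspace _) _ h).
  move=> _ [l [b' [[l0 ly] ->]]] /=.
  apply: (closed_span_map (bistar_linear_l sh _) (bistar_linear_bound_l _ sh) (zero_subspace _) _ (spanA a)).
  by move=> _ [k [a' [[k0 _] ->]]] /=; rewrite key // ly ?mulr0 ?scale0r //=; apply.
Qed.

Hypothesis tP : ext_tensor.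
Let th := max_tensor_hom (ext_max tP).

Lemma ext_ev_eq (x : X) (y : Y) a a' b b' : ev A x a = ev A x a' -> ev B y b = ev B y b' ->
  ev E (x, y) (t a b) = ev E (x, y) (t a' b').
Proof.
move=> aa bb; have eh := ev_hom (A := E) (x, y).
apply/eqP; rewrite -subr_eq0 -(star_homB eh).
have -> : t a b - t a' b' = t (a - a') b + t a' (b - b').
  by rewrite (bistarBl th) (bistarBr th); lmod_with R[i].
rewrite (star_homD eh) (ext_evl tP) ?(ext_evr tP) ?addr0 //.
  by rewrite (star_homB (ev_hom y)) bb subrr.
by rewrite (star_homB (ev_hom x)) aa subrr.
Qed.

Lemma ext_xact k l a b : C0 k -> C0 l ->
  t (xact k a) (xact l b) = xact (fun z : lch_prod X Y => k z.1 * l z.2) (t a b).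
Proof.
move=> k0 l0; apply: ev_ext => -[x y]; rewrite xactE; last exact: C0X.
have -> : (k x * l y) *: ev E (x, y) (t a b) = ev E (x, y) (t (k x *: a) (l y *: b)).
  by rewrite (bistarZl th) (bistarZr th) !(star_homZ (ev_hom (A := E) (x, y))) scalerA.
by apply: ext_ev_eq; rewrite xactE // (star_homZ (ev_hom _)).
Qed.

Lemma ext_tensor_product : is_ext_product t.
Proof.
split; first exact: ext_max.
exists (@xact R X A), (@xact R Y B), (@xact R _ E); split; try exact: xact_structure.
by move=> k l a b k0 l0; rewrite ext_xact.
Qed.

Lemma box_bumps_mulby phi : box_bumps phi -> exists2 f : E -> E, linear f &
  [/\ exists2 M : R, 0 <= M & forall e, nm (f e) <= M * nm e,
      forall e, mulby (ev E) (fun z => (phi z)%:C) e (f e) &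
      exists f1 f2, [/\ bumps f1, bumps f2 & forall a b, f (t a b) = t (xact (rc f1) a) (xact (rc f2) b)]].
Proof.
move=> [g [h [bg bh ->]]]; have g0 := bumps_C0 bg; have h0 := bumps_C0 bh.
have gh0 := C0X g0 h0; exists (xact (fun z : lch_prod X Y => rc g z.1 * rc h z.2)); first exact: xact_linear.
split; first exact: xact_bound.
  by move=> e z; rewrite xactE // /rc rmorphM.
by exists g, h; split => // a b; rewrite ext_xact.
Qed.

(** The elements vanishing at [(x, y)] are limits of sums of tensors with one factor vanishing
    there. By [fld_density] it suffices to match values at the other points, where one coordinate
    differs and a bump in that coordinate makes a factor vanish at [x] or [y] without changing the
    value. *)
Lemma ext_kernel (Q : cstarType R) (f : E -> Q) (M : R) (x : X) (y : Y) : linear f ->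
  (forall e, nm (f e) <= M * nm e) ->
  (forall a b, ev A x a = 0 \/ ev B y b = 0 -> f (t a b) = 0) ->
  forall e, ev E (x, y) e = 0 -> f e = 0.
Proof.
move=> fl fM f0 e e0.
pose G := [set q | exists a b, (ev A x a = 0 \/ ev B y b = 0) /\ q = t a b].
have SG := closed_span_subspace G.
suff : closed_span G e.
  by apply: (closed_span_map fl fM (zero_subspace Q)) => _ [a [b [ab ->]]]; exact: f0.
apply: (fld_density (ev_field E) SG (@box_bumps01 R X Y) (@box_bumps_loc R X Y)).
  move=> s phi Gs /box_bumps_mulby[g gl [[N _ gN] gE [f1 [f2 [b1 b2 gt]]]]].
  exists (g s) => //; apply: (closed_span_map gl gN SG) Gs.
  move=> _ [a [b [ab ->]]]; rewrite gt; apply: sub_closed_span.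
  exists (xact (rc f1) a), (xact (rc f2) b); split => //.
  by case: ab => [a0|b0]; [left|right]; rewrite xactE ?a0 ?b0 ?scaler0 //; exact: bumps_C0.
move=> [x' y'] r r0; have eh := ev_hom (A := E) (x', y').
have [[-> ->]|xy] := pselect ((x', y') = (x, y)).
  by exists 0; [exact: (subspace0 SG)|rewrite subr0 e0 nm0].
have elem a b : exists2 s, closed_span G s & ev E (x', y') s = ev E (x', y') (t a b).
  have [xx|xx] := pselect (x' = x).
    have yy : y' <> y by move=> yy; apply: xy; rewrite xx yy.
    have [g bg [g1 g0]] := bumps_loc R (open_nbhs_nbhs (conj (osetP (opensC1 y)) yy)).
    exists (t a (xact (rc g) b)).
      apply: sub_closed_span; exists a, (xact (rc g) b); split => //; right.
      by rewrite (xactE (bumps_C0 bg)) /rc g0 ?scale0r //=; apply.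
    apply: ext_ev_eq => //; rewrite xactE; last exact: bumps_C0.
    by rewrite /rc (nbhs_singleton g1) scale1r.
  have [g bg [g1 g0]] := bumps_loc R (open_nbhs_nbhs (conj (osetP (opensC1 x)) xx)).
  exists (t (xact (rc g) a) b).
    apply: sub_closed_span; exists (xact (rc g) a), b; split => //; left.
    by rewrite (xactE (bumps_C0 bg)) /rc g0 ?scale0r //=; apply.
  apply: ext_ev_eq => //; rewrite xactE; last exact: bumps_C0.
  by rewrite /rc (nbhs_singleton g1) scale1r.
have [l el] : exists l, nm (e - comb (fun g => t g.1 g.2) l) < r.
  by apply: closed_span_approx r0 _; rewrite (tensor_span (ext_max tP)).
have [s Gs sl] := span_at eh eh (fun g : A * B => elem g.1 g.2) l.
exists s => //; rewrite (star_homB eh) sl -(star_homB eh).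
exact: le_lt_trans (star_hom_le eh _) el.
Qed.

(** Exactness of the maximal tensor product: a bilinear map on the fibres lifts to [A] and [B],
    extends to [E], and descends to the fibre of [E] by [ext_kernel]. As a star homomorphism on that
    fibre it is contractive. *)
Lemma ext_fibre (x : X) (y : Y) : exists t' : fibre A x -> fibre B y -> fibre E (x, y),
  is_max_tensor t' /\ forall a b, t' (ev A x a) (ev B y b) = ev E (x, y) (t a b).
Proof.
have [repA repAK] := choice (@ev_surj _ _ A x); have [repB repBK] := choice (@ev_surj _ _ B y).
have ah := ev_hom (A := A) x; have bh := ev_hom (A := B) y; have eh := ev_hom (A := E) (x, y).
pose t' u v := ev E (x, y) (t (repA u) (repB v)).
have tE a b : t' (ev A x a) (ev B y b) = ev E (x, y) (t a b).
  by apply: ext_ev_eq; rewrite ?repAK ?repBK.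
have t'h : bistar_hom t'.
  split.
  - move=> v k u u'; rewrite -(repAK u) -(repAK u') -(repBK v) -(star_homZ ah) -(star_homD ah).
    by rewrite !tE (bistarDl th) (bistarZl th) (star_homD eh) (star_homZ eh).
  - move=> u k v v'; rewrite -(repAK u) -(repBK v) -(repBK v') -(star_homZ bh) -(star_homD bh).
    by rewrite !tE (bistarDr th) (bistarZr th) (star_homD eh) (star_homZ eh).
  - move=> u u' v v'; rewrite -(repAK u) -(repAK u') -(repBK v) -(repBK v').
    by rewrite -(star_homM ah) -(star_homM bh) !tE (bistarM th) (star_homM eh).
  - move=> u v; rewrite -(repAK u) -(repBK v) -(star_hom_star ah) -(star_hom_star bh).
    by rewrite !tE (bistar_star th) (star_hom_star eh).
exists t'; split=> //; split => //.
  apply/seteqP; split => // q _; have [e <-] := ev_surj q.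
  have : closed_span [set q | exists g : A * B, q = t g.1 g.2] e by rewrite (tensor_span (ext_max tP)).
  apply: (closed_span_map (star_hom_linear eh) (star_hom_bound eh) (closed_span_subspace _)).
  move=> _ [g ->]; apply: sub_closed_span; exists (ev A x g.1), (ev B y g.2); by rewrite tE.
move=> Q' s' sh' l.
have sE := bistar_comp sh' ah bh.
have [f [fh fE]] := max_tensor_univ (ext_max tP) sE.
have [g [gh gE]] : exists g : fibre E (x, y) -> Q', star_hom g /\ forall e, g (ev E (x, y) e) = f e.
  apply: fibre_desc => // e /ev_eq0.
  apply: (ext_kernel (star_hom_linear fh) (star_hom_bound fh)) => a b [] h; rewrite fE h.
    exact: (bistar0l sh').
  exact: (bistar0r sh').
suff -> : \sum_(ab <- l) s' ab.1 ab.2 = g (\sum_(ab <- l) t' ab.1 ab.2).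
  by rewrite !nmE lecR; exact: star_hom_le.
rewrite (big_morph g (star_homD gh) (star_hom0 gh)); apply: eq_bigr => -[u v] _ /=.
by rewrite -(repAK u) -(repBK v) tE gE fE.
Qed.

End ExtTensor.

(** * The ideals of the external product *)

Section BoxAlgebra.
Variables (R : realType) (X Y : lch) (A : xcstar R X) (B : xcstar R Y).
Variables (T : cstarType R) (t : A -> B -> T).
Hypothesis tm : is_max_tensor t.
Let th := max_tensor_hom tm.
Implicit Types (U : opens X) (V : opens Y) (W : opens (lch_prod X Y)).

Definition box_gen W : set T := [set q | exists U V a b,
  [/\ oset (opensX U V) `<=` oset W, xideal A U a, xideal B V b & q = t a b]].

Definition box_ideal W : set T := closed_span (box_gen W).

Lemma box_ideal_sub W W' : oset W `<=` oset W' -> box_ideal W `<=` box_ideal W'.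
Proof.
move=> WW; apply: closed_span_sub; first exact: closed_span_subspace.
move=> q [U [V [a [b [UV Ua Vb ->]]]]]; apply: sub_closed_span.
by exists U, V, a, b; split => // z /UV/WW.
Qed.

(** Taking the whole space for one of the open sets, this yields the ideal laws; with an approximate
    unit it yields the law for intersections. *)
Lemma box_ideal_mul W W' e e' : box_ideal W e -> box_ideal W' e' ->
  box_ideal (opensI W W') (e ** e').
Proof.
move=> We We'; have SS := closed_span_subspace (box_gen (opensI W W')).
move: e We; apply: (closed_span_map (mull_linear e') (mull_bound e') SS).
move=> _ [U [V [a [b [UV Ua Vb ->]]]]].
move: e' We'; apply: (closed_span_map (mulr_linear (t a b)) (nmM (t a b)) SS).
move=> _ [U' [V' [a' [b' [UV' Ua' Vb' ->]]]]].
rewrite -(bistarM th); apply: sub_closed_span.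
exists (opensI U U'), (opensI V V'), (a ** a'), (b ** b'); split => //.
- by move=> z /= [[? ?] [? ?]]; split; [apply: UV|apply: UV'].
- by rewrite xidealI; split; [exact: (idealMr (xidealP A U))|exact: (idealMl (xidealP A U'))].
- by rewrite xidealI; split; [exact: (idealMr (xidealP B V))|exact: (idealMl (xidealP B V'))].
Qed.

Lemma box_idealT : box_ideal (opensT _) = setT.
Proof.
rewrite -(max_tensor_dense tm); congr closed_span; apply/seteqP.
split=> [_ [U [V [a [b [_ _ _ ->]]]]]|_ [a [b ->]]]; first by exists a, b.
by exists (opensT X), (opensT Y), a, b; rewrite !xidealT; split.
Qed.

Lemma box_ideal_closed W : closed_ideal (box_ideal W).
Proof.
have SS := closed_span_subspace (box_gen W).
have WT : oset (opensI W (opensT _)) `<=` oset W by move=> z [].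
have TW : oset (opensI (opensT _) W) `<=` oset W by move=> z [].
split => // [a b Wb|a b Wa|a].
- by apply: (box_ideal_sub TW); apply: box_ideal_mul => //; rewrite box_idealT.
- by apply: (box_ideal_sub WT); apply: box_ideal_mul => //; rewrite box_idealT.
- apply: (closed_span_sub (star_subspace SS)).
  move=> _ [U [V [c [d [UV Uc Vd ->]]]]]; rewrite /= -(bistar_star th).
  apply: sub_closed_span; exists U, V, (cstar c), (cstar d); split => //.
    exact: (ideal_star (xidealP A U)).
  exact: (ideal_star (xidealP B V)).
Qed.

Lemma box_idealI W W' : box_ideal (opensI W W') = box_ideal W `&` box_ideal W'.
Proof.
apply/seteqP; split=> [e We|e [We We']].
  by split; apply: box_ideal_sub We => z [].
have /closedP := subspace_closed (closed_span_subspace (box_gen (opensI W W'))); apply => r r0.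
have [f [Wf ef _]] := approx_unit (box_ideal_closed W) We r0.
by exists (f ** e) => //; exact: box_ideal_mul.
Qed.

(** For [a] in [K] with approximate unit [u], the tensor of [u ** a] with [b ** b'] factors as
    [t u b ** t a b'], so the slice absorbs products. Slices allow joins to be taken in one variable
    while the other is fixed. *)
Lemma slice_ideal (J : set T) (K : set A) : closed_ideal J -> closed_ideal K ->
  closed_ideal [set b | forall a, K a -> J (t a b)].
Proof.
move=> Ji Ki; have Js := ideal_subspace Ji.
have M b b' : (forall a, K a -> J (t a b)) \/ (forall a, K a -> J (t a b')) ->
    forall a, K a -> J (t a (b ** b')).
  move=> h a Ka; have /closedP := subspace_closed Js; apply => r r0.
  have b1 : 0 < nm (b ** b') + 1 by have := nm_ge0 (b ** b'); lra.
  have [u [Ku ua _]] := approx_unit Ki Ka (divr_gt0 r0 b1).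
  exists (t u b ** t a b').
    by case: h => h; [apply: (idealMr Ji)|apply: (idealMl Ji)]; exact: h.
  rewrite -(bistarM th) -(bistarBl th).
  have := bistar_le th (a - u ** a) (b ** b'); move: ua; rewrite ltr_pdivlMr // => ua.
  by have := nm_ge0 (a - u ** a); nra.
split; first split.
- apply/closedP => b bS a Ka; have /closedP := subspace_closed Js; apply => r r0.
  have a1 : 0 < nm a + 1 by have := nm_ge0 a; lra.
  have [c cS] := bS _ (divr_gt0 r0 a1); rewrite ltr_pdivlMr // => bc.
  exists (t a c); first exact: cS.
  rewrite -(bistarBr th); have := bistar_le th a (b - c); have := nm_ge0 (b - c); nra.
- by move=> a _; rewrite (bistar0r th); exact: (subspace0 Js).
- by move=> b c /= h h' a Ka; rewrite (bistarDr th); apply: (subspaceD Js); [exact: h|exact: h'].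
- by move=> k b /= h a Ka; rewrite (bistarZr th); apply: (subspaceZ Js); exact: h.
- by move=> b b' h; apply: M; right.
- by move=> b b' h; apply: M; left.
- move=> b /= h a Ka; rewrite -(cstarK a) (bistar_star th).
  by apply: (ideal_star Ji); apply: h; exact: (ideal_star Ki).
Qed.

End BoxAlgebra.

Section BoxJoins.
Variables (R : realType) (X Y : lch) (A : xcstar R X) (B : xcstar R Y).
Variables (T : cstarType R) (t : A -> B -> T).
Hypothesis tm : is_max_tensor t.
Let th := max_tensor_hom tm.
Variable J : set T.
Hypothesis Ji : closed_ideal J.

Definition box_in (U : opens X) (V : opens Y) :=
  forall a b, xideal A U a -> xideal B V b -> J (t a b).

Lemma box_in_sub (U U' : opens X) (V V' : opens Y) :
  oset U' `<=` oset U -> oset V' `<=` oset V -> box_in U V -> box_in U' V'.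
Proof. by move=> UU VV h a b /(xideal_sub UU) ? /(xideal_sub VV) ?; exact: h. Qed.

Lemma box_in_cover_l (U : opens X) (V : opens Y) (S : set (opens X)) :
  oset U `<=` \bigcup_(U in S) oset U -> (forall U, S U -> box_in U V) -> box_in U V.
Proof.
move=> US h a b Ua Vb.
have Ki := slice_ideal (max_tensor_flip tm) Ji (xidealP B V).
have := @xideal_cover _ _ _ U S _ Ki US; apply => // U' SU' a' Ua' b' Vb'; exact: (h U').
Qed.

Lemma box_in_cover_r (U : opens X) (V : opens Y) (S : set (opens Y)) :
  oset V `<=` \bigcup_(V in S) oset V -> (forall V, S V -> box_in U V) -> box_in U V.
Proof.
move=> VS h a b Ua Vb.
have Ki := slice_ideal tm Ji (xidealP A U).
have := @xideal_cover _ _ _ V S _ Ki VS; apply => // V' SV' b' Vb' a' Ua'; exact: (h V').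
Qed.

(* The tube lemma, for ideals. *)
Lemma box_in_local (U : opens X) (V : opens Y) :
  (forall x y, oset U x -> oset V y -> exists U' V',
     [/\ oset U' x, oset V' y & box_in U' V']) -> box_in U V.
Proof.
move=> loc.
have tube x (K : set Y) : oset U x -> compact K -> K `<=` oset V ->
    exists U' V', [/\ oset U' x, K `<=` oset V' & box_in U' V'].
  move=> Ux cK KV; apply: (compact_ind (P := fun Z => exists U' V',
    [/\ oset U' x, Z `<=` oset V' & box_in U' V']) cK).
  - exists (opensT X), (Opens open0); split => // a b _ Vb.
    suff -> : b = 0 by rewrite (bistar0r th); exact: (subspace0 (ideal_subspace Ji)).
    apply: ev_ext => y; rewrite (star_hom0 (ev_hom y)).
    by have /xideal_evP := Vb; apply => -[].
  - move=> Z Z' [U1 [V1 [U1x ZV1 h1]]] [U2 [V2 [U2x ZV2 h2]]].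
    exists (opensI U1 U2), (opensU V1 V2); split => //.
      by move=> y [/ZV1|/ZV2] ?; [left|right].
    apply: (@box_in_cover_r _ _ [set V' | V' = V1 \/ V' = V2]).
      by move=> y [?|?]; [exists V1 => //; left|exists V2 => //; right].
    by move=> V' [->|->]; [apply: box_in_sub h1|apply: box_in_sub h2] => // z [].
  - by move=> Z Z' ZZ [U' [V' [Ux' ZV' h]]]; exists U', V'; split => // y /ZZ/ZV'.
  - move=> y Ky; have [U' [V' [U'x V'y h]]] := loc x y Ux (KV _ Ky).
    by exists (oset V'); [exact: open_nbhs_nbhs (conj (osetP V') V'y)|exists U', V'; split].
apply: (@box_in_cover_r _ _ [set V' | box_in U V']) => // y Vy.
have [phi [_ p01 p1 [K cK [KV pK]]]] := bump_exists R (open_nbhs_nbhs (conj (osetP V) Vy)).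
(* The interior of the set where [phi] is 1 is a neighbourhood of [y] inside the compact [K], to
   which the tube argument applies. *)
exists (Opens (@open_interior _ [set y | phi y = 1])) => //=.
apply: (@box_in_cover_l _ _ [set U' | box_in U' (Opens (@open_interior _ [set y | phi y = 1]))]) => // x Ux.
have [U' [V' [U'x KV' h]]] := tube x K Ux cK KV.
exists U' => //; apply: box_in_sub h => // y' /interior_subset /= py.
by apply: KV'; have [//|/pK] := pselect (K y'); rewrite py => /eqP; rewrite oner_eq0.
Qed.

End BoxJoins.

Section Box.
Variables (R : realType) (X Y : lch) (A : xcstar R X) (B : xcstar R Y).
Let tm := max_tensorP A B.

Lemma box_ideal_bigcup (S : set (opens (lch_prod X Y))) :
  box_ideal (@mtens R A B) (opens_bigcup S) =
  ideal_gen (\bigcup_(U in S) box_ideal (@mtens R A B) U).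
Proof.
set J := ideal_gen _; have Ji : closed_ideal J by exact: ideal_gen_ideal.
have JS W : S W -> box_ideal (@mtens R A B) W `<=` J.
  by move=> SW e We; apply: sub_ideal_gen; exists W.
apply/seteqP; split; last first.
  apply: ideal_gen_sub; first exact: box_ideal_closed.
  by move=> e [W SW]; apply: box_ideal_sub => z Wz; exists W.
apply: (closed_span_sub (ideal_subspace Ji)) => _ [U [V [a [b [UV Ua Vb ->]]]]].
move: a b Ua Vb; apply: (box_in_local tm Ji) => x y Ux Vy.
have [|W SW Wxy] := UV (x, y); first by split.
have [[P Q] /= [xP yQ] PQ] : nbhs ((x, y) : lch_prod X Y) (oset W).
  by apply: open_nbhs_nbhs; split => //; exact: osetP.
exists (Opens (@open_interior _ P)), (Opens (@open_interior _ Q)); split => // a b Pa Qb.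
apply: (JS W SW); apply: sub_closed_span.
exists (Opens (@open_interior _ P)), (Opens (@open_interior _ Q)), a, b; split => // z [/= zP zQ].
by apply: PQ; split; exact: interior_subset.
Qed.

Definition box_alg : xcstar R (lch_prod X Y) := @Xcstar R _ (max_tensor A B)
  (box_ideal (@mtens R A B)) (box_ideal_closed tm) (box_idealT tm) (box_idealI tm)
  box_ideal_bigcup.

Definition box_tens : A -> B -> box_alg := @mtens R A B.

Lemma box_algP : ext_tensor box_tens.
Proof.
split => // x y a b /ev_eq0 h; apply/ev_eq0; apply: sub_closed_span.
  exists (opensC1 x), (opensT Y), a, b; split => //; last by rewrite xidealT.
  by move=> z [/= zx _] zE; apply: zx; rewrite zE.
exists (opensT X), (opensC1 y), a, b; split => //; last by rewrite xidealT.
by move=> z [_ /= zy] zE; apply: zy; rewrite zE.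
Qed.

End Box.

(** * Coherence isomorphisms *)

Section Tools.
Variable R : realType.

Lemma xhom_of_star (X : lch) (A B : xcstar R X) (f : A -> B) : star_hom f ->
  (forall x a, ev A x a = 0 -> ev B x (f a) = 0) -> exists phi : xhom A B, phi =1 f.
Proof.
move=> fh f0; have fi U a : xideal A U a -> xideal B U (f a).
  by move=> /xideal_evP Ua; apply/xideal_evP => x /Ua/f0.
by exists (Xhom fh fi).
Qed.

Lemma xhom_fib (X : lch) (A B : xcstar R X) (phi : xhom A B) x :
  exists h : fibre A x -> fibre B x, star_hom h /\ forall a, h (ev A x a) = ev B x (phi a).
Proof.
apply: (@fibre_desc _ _ _ _ _ (fun a => ev B x (phi a))).
  exact: star_hom_comp (xhom_star phi) (ev_hom x).
by move=> a /ev_eq0; exact: xhom_ev0.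
Qed.

(** Being approximated at a point by realized elements passes to closed spans, so [xhom_build] can
    be fed with generators. *)
Lemma xhom_build_span (X : lch) (A B : xcstar R X) (F : X -> cstarType R)
    (r : forall x, B -> F x) (psi : forall x, A -> F x) (G : set A) :
  presents r -> (forall x, star_hom (psi x)) ->
  (forall x a, ev A x a = 0 -> psi x a = 0) -> closed_span G = setT ->
  (forall x g, G g -> exists a b, ev A x a = ev A x g /\ forall y, psi y a = r y b) ->
  exists Phi : xhom A B, forall x a, r x (Phi a) = psi x a.
Proof.
move=> rp ph p0 GT gen; apply: (xhom_build rp ph); first by move=> x a /ev_eq0/p0.
move=> x a e e0; have rh := pres_hom rp; have ah := ev_hom (A := A) x.
pose S := [set a | forall e : R, 0 < e -> exists a' b', nm (ev A x (a - a')) < e /\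
     forall x', psi x' a' = r x' b'].
suff : S a by exact.
have : closed_span G a by rewrite GT.
apply: closed_span_sub => [|g /(gen x)[a' [b' [ga ab]]] d d0]; last first.
  by exists a', b'; rewrite (star_homB ah) ga subrr nm0.
split.
- apply/closedP => c cS d d0; have d2 := divr_gt0 d0 (ltr0Sn R 1).
  have [c' /(_ _ d2)[a' [b' [h ab]]] cc] := cS _ d2; exists a', b'; split => //.
  have := nm_tri (ev A x c) (ev A x c') (ev A x a'); rewrite -!(star_homB ah).
  by have := star_hom_le ah (c - c'); lra.
- move=> d d0; exists 0, 0; rewrite subrr (star_hom0 ah) nm0; split => // y.
  by rewrite (star_hom0 (ph y)) (star_hom0 (rh y)).
- move=> c c' cS cS' d d0; have d2 := divr_gt0 d0 (ltr0Sn R 1).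
  have [a1 [b1 [h1 ab1]]] := cS _ d2; have [a2 [b2 [h2 ab2]]] := cS' _ d2.
  exists (a1 + a2), (b1 + b2); split => [|y].
    rewrite opprD addrACA (star_homD ah).
    have := nmD (ev A x (c - a1)) (ev A x (c' - a2)); lra.
  by rewrite (star_homD (ph y)) (star_homD (rh y)) ab1 ab2.
- move=> k c cS d d0; have k1 : 0 < cabs k + 1 by have := cabs_ge0 k; lra.
  have [a1 [b1 [h1 ab1]]] := cS _ (divr_gt0 d0 k1); exists (k *: a1), (k *: b1); split => [|y].
    move: h1; rewrite ltr_pdivlMr // -scalerBr (star_homZ ah) nmZ => h1.
    by have := cabs_ge0 k; have := nm_ge0 (ev A x (c - a1)); nra.
  by rewrite (star_homZ (ph y)) (star_homZ (rh y)) ab1.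
Qed.

Definition mk_iso (C : category) (x y : C) (f : hom x y) (fi : is_iso f) : iso x y :=
  Iso (svalP (cid fi)).

Section Presented.
Variables (X : lch) (B : xcstar R X) (F : X -> cstarType R) (r : forall x, B -> F x).
Hypothesis rp : presents r.

Lemma pres_eq0 x b : r x b = 0 <-> ev B x b = 0.
Proof. by rewrite (pres_ker rp) ev_eq0. Qed.

Lemma pres_inv x : exists s : F x -> fibre B x, star_hom s /\ forall b, s (r x b) = ev B x b.
Proof.
have rh := pres_hom rp x; have bh := ev_hom (A := B) x.
have [g gK] := choice (@pres_surj _ _ _ _ _ rp x).
have sE b : ev B x (g (r x b)) = ev B x b by apply/(pres_eq rp).
exists (fun w => ev B x (g w)); split => //; split=> [k u v|u v|u].
- by rewrite -(gK u) -(gK v) -(star_homZ rh) -(star_homD rh) !sE (star_homD bh) (star_homZ bh).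
- by rewrite -(gK u) -(gK v) -(star_homM rh) !sE (star_homM bh).
- by rewrite -(gK u) -(star_hom_star rh) !sE (star_hom_star bh).
Qed.

Lemma pres_fib x : exists s : fibre B x -> F x, star_hom s /\ forall b, s (ev B x b) = r x b.
Proof. by apply: fibre_desc; [exact: pres_hom|move=> b /(pres_ker rp)]. Qed.

Lemma xhom_eq_span (A : xcstar R X) (G : set A) (phi psi : xhom A B) :
  closed_span G = setT -> (forall x g, G g -> r x (phi g) = r x (psi g)) -> phi = psi.
Proof.
move=> GT h; apply: xhom_ext; apply: (star_hom_eq_span (xhom_star _) (xhom_star _) GT).
by move=> g Gg; apply: (pres_ext rp) => x; exact: h.
Qed.

Lemma pres_iso (A : xcstar R X) (phi : xhom A B) :
  (forall x a, r x (phi a) = 0 -> ev A x a = 0) -> (forall x w, exists a, r x (phi a) = w) ->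
  is_iso (C := xcstar_category R X) phi.
Proof.
move=> inj surj; apply: xhom_fibre_iso => [x a /pres_eq0/inj//|x b].
by have [a ab] := surj x (r x b); exists a; apply/(pres_eq rp).
Qed.

(** On each fibre both composites are star homomorphisms, so generators of the two sides decide
    whether they are identities. *)
Lemma pres_inverse_iso (A : xcstar R X) (phi : xhom A B) (GA : set A) (GB : forall x, set (F x)) :
  closed_span GA = setT ->
  (forall x, exists h : F x -> fibre A x, star_hom h /\
     forall g, GA g -> h (r x (phi g)) = ev A x g) ->
  (forall x, closed_span (GB x) = setT) ->
  (forall x w, GB x w -> exists a, r x (phi a) = w) ->
  is_iso (C := xcstar_category R X) phi.
Proof.
move=> GAT hex GBT surj; have rh := pres_hom rp; have ah := ev_hom (A := A).
have hE x : exists h : F x -> fibre A x, star_hom h /\ forall a, h (r x (phi a)) = ev A x a.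
  have [h [hh hg]] := hex x; exists h; split => //.
  apply: (star_hom_eq_span _ (ah x) GAT) => //.
  exact: star_hom_comp (star_hom_comp (xhom_star phi) (rh x)) hh.
apply: pres_iso => [x a ra|x w].
  by have [h [hh hg]] := hE x; rewrite -hg ra (star_hom0 hh).
have [h [hh hg]] := hE x; have [p [ph pE]] := xhom_fib phi x; have [s [sh sE]] := pres_fib x.
have [a ha] := ev_surj (h w); exists a; rewrite -sE -pE ha.
apply: (star_hom_eq_span (g := id) (star_hom_comp hh (star_hom_comp ph sh)) (star_hom_id _) (GBT x)).
by move=> v /surj[b <-] /=; rewrite hg pE sE.
Qed.

End Presented.

Lemma C0_mul (X : lch) (k l : X -> R[i]^o) (M : R) : C0 k -> continuous l ->
  (forall x, cabs (l x) <= M) -> C0 (fun x => k x * l x : R[i]^o).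
Proof.
move=> /C0P[kc kv] lc lM; apply/C0P; split.
  by move=> x; apply: cvgM; [exact: kc|exact: lc].
move=> e e0; have M1 : 0 < `|M| + 1 by have := normr_ge0 M; lra.
have [K cK Kk] := kv _ (divr_gt0 e0 M1); exists K => // x /Kk; rewrite ler_pdivlMr // cabsM.
have := lM x; have := ler_norm M; have := cabs_ge0 (k x); have := cabs_ge0 (l x); nra.
Qed.

Section PullbackBuild.
Variables (X Y : lch) (f : cmap X Y) (A : xcstar R Y) (P : xcstar R X).
Variable e : forall x : X, P -> fibre A (f x).
Hypothesis eP : is_pullback e.

(** Every value of the pullback at [x] is that of a basic section with coefficient 1 at [x], so it
    suffices to realize the images of such sections in [B]. *)
Lemma pb_build (B : xcstar R X) (F : X -> cstarType R) (r : forall x, B -> F x)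
    (psi : forall x : X, fibre A (f x) -> F x) :
  presents r -> (forall x, star_hom (psi x)) ->
  (forall (x : X) a, exists k b, [/\ C0 k, k x = 1 &
     forall y, r y b = k y *: psi y (ev A (f y) a)]) ->
  exists Phi : xhom P B, forall x p, r x (Phi p) = psi x (e x p).
Proof.
move=> rp ph gen; have eh := pres_hom (pb_presents eP).
apply: (@xhom_build_span _ _ _ _ r (fun x p => psi x (e x p)) setT rp).
- by move=> x; exact: star_hom_comp (eh x) (ph x).
- by move=> x p /(pres_eq0 (pb_presents eP)) ->; rewrite (star_hom0 (ph x)).
- by apply/seteqP; split => // a _; exact: sub_closed_span.
- move=> x p _; have [a pa] := pb_rep e p x; have [k [b [k0 kx kb]]] := gen x a.
  have [q qE] := pb_basic eP a k0; exists q, b; split.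
    by apply/(pres_eq (pb_presents eP)); rewrite qE kx scale1r.
  by move=> y; rewrite qE (star_homZ (ph y)) kb.
Qed.

End PullbackBuild.

Lemma dchoice (X : Type) (T : X -> Type) (Q : forall x, T x -> Prop) :
  (forall x, exists y, Q x y) -> exists g : forall x, T x, forall x, Q x (g x).
Proof. by move=> h; exists (fun x => sval (cid (h x))) => x; exact: svalP. Qed.

Lemma C0_at (X : lch) (x : X) : exists k : X -> R[i]^o, C0 k /\ k x = 1.
Proof.
have [k bk [k1 _]] := bumps_loc R (@filterT _ (nbhs x) _).
by exists (rc k); split; [exact: bumps_C0|rewrite /rc (nbhs_singleton k1)].
Qed.

Lemma presents_comp (X : lch) (A : xcstar R X) (F G : X -> cstarType R)
    (q : forall x, A -> F x) (s : forall x, F x -> G x) : presents q ->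
  (forall x, star_hom (s x)) -> (forall x w, s x w = 0 -> w = 0) ->
  (forall x v, exists w, s x w = v) -> presents (fun x a => s x (q x a)).
Proof.
move=> qp sh s0 ss; split=> [x|x v|x a].
- exact: star_hom_comp (pres_hom qp x) (sh x).
- by have [w <-] := ss x v; have [a <-] := pres_surj qp w; exists a.
- rewrite -(pres_ker qp); split=> [/s0//|->]; exact: star_hom0.
Qed.

Section PullbackMaps.
Variables (X Y : lch) (f : cmap X Y).

Lemma pullm_exists (A B : xcstar R Y) (P Q : xcstar R X) (e : forall x, P -> fibre A (f x))
    (e' : forall x, Q -> fibre B (f x)) (phi : xhom A B) : is_pullback e -> is_pullback e' ->
  exists Phi : xhom P Q, forall p x a, e x p = ev A (f x) a -> e' x (Phi p) = ev B (f x) (phi a).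
Proof.
move=> eP eP'; have [h hP] := dchoice (fun x : X => xhom_fib phi (f x)).
have [||x a|Phi PhiE] := @pb_build _ _ f A P e eP Q _ e' h.
- exact: pb_presents.
- by move=> x; case: (hP x).
- have [k [k0 kx]] := C0_at x; have [b bE] := pb_basic eP' (phi a) k0.
  by exists k, b; split => // y; rewrite bE; case: (hP y) => _ ->.
- by exists Phi => p x a pa; rewrite PhiE pa; case: (hP x) => _ ->.
Qed.

Lemma pullcomp_exists (Z : lch) (g : cmap Y Z) (A : xcstar R Z) (P S : xcstar R X) (Q : xcstar R Y)
    (e : forall x, P -> fibre A (g (f x))) (e1 : forall y, Q -> fibre A (g y))
    (e2 : forall x, S -> fibre Q (f x)) :
  is_pullback (f := cmap_comp f g) e -> is_pullback e1 -> is_pullback e2 ->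
  exists Phi : xhom P S, is_iso (C := xcstar_category R X) Phi /\
    forall p x q, e2 x (Phi p) = ev Q (f x) q -> e x p = e1 (f x) q.
Proof.
move=> eP eP1 eP2; have p1 := pb_presents eP1.
have [s sP] := dchoice (pres_fib p1); have [s' sP'] := dchoice (pres_inv p1).
(* An element of [S] is evaluated in two steps: its value at [x] lies in the fibre of [Q] at [f x],
   which [s] identifies with the fibre of [A] at [g (f x)]. *)
have rp : presents (fun x p => s (f x) (e2 x p)).
  apply: (presents_comp (s := fun x => s (f x)) (pb_presents eP2)) => [x|x w|x v].
  - by case: (sP (f x)).
  - have [q <-] := ev_surj w; case: (sP (f x)) => _ -> q0.
    by case: (sP' (f x)) => h <-; rewrite q0 (star_hom0 h).
  - have [q <-] := pres_surj p1 v; exists (ev Q (f x) q); by case: (sP (f x)).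
have [|x a|Phi PhiE] := @pb_build _ _ (cmap_comp f g) A P e eP S _ _ (fun x => id) rp.
- by move=> x; exact: star_hom_id.
- have [k [k0 kx]] := C0_at x; have [l [l0 ly]] := C0_at (f x).
  have [q qE] := pb_basic eP1 a l0; have [b bE] := pb_basic eP2 q k0.
  (* [l] composed with [f] is bounded but need not vanish at infinity; the factor [k] ensures it. *)
  exists (fun x => k x * l (f x)), b; split.
  + have [M M0 lM] := C0_bounded l0; apply: (C0_mul (M := M) k0) => // y.
    by apply: (continuous_comp (f := f) (g := l)); [exact: cmap_continuous|have [lc _] := l0; exact: lc].
  + by rewrite kx ly mulr1.
  + move=> y; rewrite bE; case: (sP (f y)) => h hE; rewrite (star_homZ h) hE qE.
    by rewrite scalerA.
- exists Phi; split => [|p x q pq]; last first.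
    by rewrite -PhiE pq; case: (sP (f x)) => _ ->.
  apply: (pres_iso rp) => [x p|x w]; first by rewrite PhiE => /(pres_eq0 (pb_presents eP)).
  by have [p <-] := pres_surj (pb_presents eP) w; exists p; rewrite PhiE.
Qed.

End PullbackMaps.

Lemma pullid_exists (X : lch) (A P : xcstar R X) (e : forall x, P -> fibre A x) :
  is_pullback (f := cmap_id X) e -> exists Phi : xhom P A,
  is_iso (C := xcstar_category R X) Phi /\ forall p x, e x p = ev A x (Phi p).
Proof.
move=> eP; have [||x a|Phi PhiE] := @pb_build _ _ (cmap_id X) A P e eP A _ (ev A) (fun x => id).
- exact: ev_presents.
- by move=> x; exact: star_hom_id.
- have [k [k0 kx]] := C0_at x; exists k, (xact k a); split => // y.
  by rewrite xactE.
- exists Phi; split => [|p x]; last by rewrite PhiE.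
  apply: (pres_iso (ev_presents A)) => [x p|x w].
    by rewrite PhiE => /(pres_eq0 (pb_presents eP)).
  by have [p <-] := pres_surj (pb_presents eP) w; exists p; rewrite PhiE.
Qed.

(** The common form of the coherence isomorphisms into a pullback. The fibre maps [s] are glued
    after generators have been multiplied by functions equal to 1 at the given point, and the
    inverse fibre maps are controlled on generators. *)
Lemma fibrewise_iso (W Z : lch) (h : cmap W Z) (D : xcstar R Z) (P E : xcstar R W)
    (e : forall w, P -> fibre D (h w)) (G : set E) (s : forall w, fibre E w -> fibre D (h w)) :
  is_pullback e -> closed_span G = setT -> (forall w, star_hom (s w)) ->
  (forall w g, G g -> exists g' k d, [/\ C0 k, ev E w g' = ev E w g &
     forall w', s w' (ev E w' g') = k w' *: ev D (h w') d]) ->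
  (forall w, exists r : fibre D (h w) -> fibre E w, [/\ star_hom r,
     forall g, G g -> r (s w (ev E w g)) = ev E w g &
     exists2 H, closed_span H = setT & forall v, H v -> s w (r v) = v]) ->
  exists Phi : xhom E P, is_iso (C := xcstar_category R W) Phi /\
    forall w a, e w (Phi a) = s w (ev E w a).
Proof.
move=> eP GT sh gen inv; have rp := pb_presents eP.
have [|w a a0|w g /(gen w)[g' [k [d [k0 gg kE]]]]|Phi PhiE] :=
  xhom_build_span (r := e) (psi := fun w a => s w (ev E w a)) rp _ _ GT.
- by move=> w; exact: star_hom_comp (ev_hom w) (sh w).
- by rewrite a0 (star_hom0 (sh w)).
- by have [p pE] := pb_basic eP d k0; exists g', p; split => // w'; rewrite kE pE.
exists Phi; split => //.
apply: (pres_inverse_iso rp GT (GB := fun=> setT)) => [w||w v _].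
- have [r [rh rg _]] := inv w; exists r; split => // g Gg.
  by rewrite PhiE rg.
- by move=> w; apply/seteqP; split => // v _; exact: sub_closed_span.
- have [r [rh rg [H HT Hv]]] := inv w; have [a ar] := ev_surj (r v); exists a.
  rewrite PhiE ar; have sr := star_hom_comp rh (sh w).
  exact: (star_hom_eq_span (f := fun v => s w (r v)) (g := id) sr (star_hom_id _) HT Hv v).
Qed.

Lemma span_image (A B : cstarType R) (f : A -> B) (G : set A) (H : set B) : star_hom f ->
  (forall b, exists a, f a = b) -> closed_span G = setT -> (forall g, G g -> H (f g)) ->
  closed_span H = setT.
Proof.
move=> fh fs GT GH; apply/seteqP; split => // b _; have [a <-] := fs b.
have : closed_span G a by rewrite GT.
apply: (closed_span_map (star_hom_linear fh) (star_hom_bound fh) (closed_span_subspace _)).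
by move=> g /GH; exact: sub_closed_span.
Qed.

Section ExtDesc.
Variables (X Y : lch) (A : xcstar R X) (B : xcstar R Y) (E : xcstar R (lch_prod X Y)).
Variable t : A -> B -> E.
Hypothesis tP : ext_tensor t.
Let th := max_tensor_hom (ext_max tP).

Definition elementary : set E := [set q | exists g : A * B, q = t g.1 g.2].

Lemma elementary_span : closed_span elementary = setT.
Proof. exact: tensor_span (ext_max tP). Qed.

Lemma ext_desc (x : X) (y : Y) (Q : cstarType R) (tau : A -> B -> Q) : bistar_hom tau ->
  (forall a b, ev A x a = 0 \/ ev B y b = 0 -> tau a b = 0) ->
  exists s : fibre E (x, y) -> Q, star_hom s /\ forall a b, s (ev E (x, y) (t a b)) = tau a b.
Proof.
move=> tauh tau0; have [f [fh fE]] := max_tensor_univ (ext_max tP) tauh.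
have [|s [sh sE]] := @fibre_desc _ _ E (x, y) _ f fh.
  move=> e /ev_eq0; apply: (ext_kernel tP (star_hom_linear fh) (star_hom_bound fh)) => a b.
  by move=> /tau0; rewrite fE.
by exists s; split => // a b; rewrite sE fE.
Qed.

Lemma ext_ev_bistar (x : X) (y : Y) : bistar_hom (fun a b => ev E (x, y) (t a b)).
Proof. exact: bistar_post th (ev_hom _). Qed.

Lemma ext_ev0 (x : X) (y : Y) a b : ev A x a = 0 \/ ev B y b = 0 -> ev E (x, y) (t a b) = 0.
Proof. by case=> h; [exact: (ext_evl tP)|exact: (ext_evr tP)]. Qed.

Lemma elementary_fibre (z : lch_prod X Y) :
  closed_span [set w | exists a b, w = ev E z (t a b)] = setT.
Proof.
apply: (span_image (ev_hom z) (@ev_surj _ _ E z) elementary_span).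
by move=> _ [g ->]; exists g.1, g.2.
Qed.

End ExtDesc.

Section BoxPullback.
Variables (X X' Y Y' : lch) (f : cmap X X') (g : cmap Y Y').
Variables (A : xcstar R X') (B : xcstar R Y') (P : xcstar R X) (Q : xcstar R Y).
Variables (e1 : forall x, P -> fibre A (f x)) (e2 : forall y, Q -> fibre B (g y)).
Variables (E : xcstar R (lch_prod X Y)) (t : P -> Q -> E).
Variables (E' : xcstar R (lch_prod X' Y')) (t' : A -> B -> E').
Variables (S : xcstar R (lch_prod X Y)).
Let h : cmap (lch_prod X Y) (lch_prod X' Y') := @prodm LCH X X' Y Y' f g.
Variable e3 : forall w, S -> fibre E' (h w).
Hypotheses (eP1 : is_pullback e1) (eP2 : is_pullback e2) (eP3 : is_pullback e3).
Hypotheses (tP : ext_tensor t) (tP' : ext_tensor t').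

(** By [ext_fibre] both sides have, at [(x, y)], the maximal tensor product of the fibres of [A] at
    [f x] and of [B] at [g y]. *)
Lemma boxpb_exists : exists Phi : xhom E S, is_iso (C := xcstar_category R (lch_prod X Y)) Phi /\
  forall p q (x : X) (y : Y) a b, e1 x p = ev A (f x) a -> e2 y q = ev B (g y) b ->
    e3 (x, y) (Phi (t p q)) = ev E' (f x, g y) (t' a b).
Proof.
have p1 := pb_presents eP1; have p2 := pb_presents eP2.
have fib (w : lch_prod X Y) : exists s : fibre E w -> fibre E' (h w), star_hom s /\
    forall p q a b, e1 w.1 p = ev A (f w.1) a -> e2 w.2 q = ev B (g w.2) b ->
    s (ev E w (t p q)) = ev E' (h w) (t' a b).
  case: w => x y; have [t1 [t1P t1E]] := ext_fibre tP' (f x) (g y).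
  have t1h := max_tensor_hom t1P.
  have [|p q pq|s [sh sE]] := ext_desc tP (x := x) (y := y) (tau := fun p q => t1 (e1 x p) (e2 y q)).
  - exact: bistar_comp t1h (pres_hom p1 x) (pres_hom p2 y).
  - by case: pq => [/(pres_eq0 p1)|/(pres_eq0 p2)] ->; rewrite ?(bistar0l t1h) ?(bistar0r t1h).
  - by exists s; split => // p q a b /= pa qb; rewrite sE pa qb t1E.
have [s sP] := dchoice fib.
have [|w|w _ [[p q] ->]|w|Phi [Phii PhiE]] := fibrewise_iso (G := elementary t) (s := s) eP3.
- exact: elementary_span.
- by case: (sP w).
- have [a pa] := pb_rep e1 p w.1; have [b qb] := pb_rep e2 q w.2.
  have [k [k0 kx]] := C0_at w.1; have [l [l0 ly]] := C0_at w.2.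
  have [p' pE] := pb_basic eP1 a k0; have [q' qE] := pb_basic eP2 b l0.
  exists (t p' q'), (fun w => k w.1 * l w.2), (t' a b); split; first exact: C0X.
    rewrite (surjective_pairing w); apply: (ext_ev_eq tP).
      by apply/(pres_eq p1); rewrite pE kx scale1r.
    by apply/(pres_eq p2); rewrite qE ly scale1r.
  move=> w'; have [_ sE] := sP w'.
  rewrite (sE _ _ (k w'.1 *: a) (l w'.2 *: b)) ?pE ?qE ?(star_homZ (ev_hom _)) //.
  have th' := max_tensor_hom (ext_max tP').
  by rewrite (bistarZl th') (bistarZr th') !(star_homZ (ev_hom _)) scalerA.
- case: w => x y; have [sh sE] := sP (x, y); rewrite /= in sE.
  have [t2 [t2P t2E]] := ext_fibre tP x y; have t2h := max_tensor_hom t2P.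
  have [r1 [r1h r1E]] := pres_inv p1 x; have [r2 [r2h r2E]] := pres_inv p2 y.
  have [||r [rh rE]] := ext_desc tP' (x := f x) (y := g y)
      (tau := fun a b => t2 (r1 (ev A (f x) a)) (r2 (ev B (g y) b))).
  + exact: bistar_comp t2h (star_hom_comp (ev_hom _) r1h) (star_hom_comp (ev_hom _) r2h).
  + move=> a b [] ->; rewrite ?(star_hom0 r1h) ?(star_hom0 r2h) ?(bistar0l t2h) ?(bistar0r t2h) //.
  exists r; split => // [_ [[p q] ->]|].
    have [a pa] := pb_rep e1 p x; have [b qb] := pb_rep e2 q y.
    by rewrite /= (sE _ _ _ _ pa qb) rE -pa -qb r1E r2E t2E.
  exists [set w | exists a b, w = ev E' (f x, g y) (t' a b)]; first exact: elementary_fibre.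
  move=> _ [a [b ->]]; rewrite rE.
  have [p pa] := pres_surj p1 (ev A (f x) a); have [q qb] := pres_surj p2 (ev B (g y) b).
  by rewrite -pa -qb r1E r2E t2E; exact: sE.
exists Phi; split => // p q x y a b pa qb; rewrite PhiE.
by case: (sP (x, y)) => _; exact.
Qed.

End BoxPullback.

Section UnitLaws.
Variables (X : lch) (A : xcstar R X) (I : xcstar R lch_one) (u : R[i]^o -> I).
Hypothesis uP : is_scalars u.

Lemma C0_one : C0 (fun _ : lch_one => 1 : R[i]^o).
Proof.
split; first by move=> x; exact: cvg_cst.
move=> eps e0; exists setT => [|x []//].
have -> : [set: lch_one] = [set tt] by apply/seteqP; split=> -[].
exact: compact_set1.
Qed.

Lemma scalars_inv : exists v : I -> R[i], [/\ forall z, v (u z) = z, forall c, u (v c) = c,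
  linear (v : I -> R[i]^o), forall c c', v (c ** c') = v c * v c' & forall c, v (cstar c) = conjc (v c)].
Proof.
case: uP => ul [v vu uv] uM us _; have ui := can_inj vu.
by exists v; split => // [k c c'|c c'|c]; apply: ui; rewrite ?ul ?uM ?us ?uv.
Qed.

Lemma scalars_bistar (Q : cstarType R) (f : A -> Q) (v : I -> R[i]) :
  star_hom f -> linear (v : I -> R[i]^o) -> (forall c c', v (c ** c') = v c * v c') ->
  (forall c, v (cstar c) = conjc (v c)) -> bistar_hom (fun c a => f (v c *: a)).
Proof.
move=> fh vl vM vs; split=> [a k c c'|c k a a'|c c' a a'|c a].
- by rewrite vl scalerDl -scalerA (star_homD fh) (star_homZ fh).
- by rewrite !(star_homZ fh) (star_homD fh) (star_homZ fh) scalerDr !scalerA mulrC.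
- by rewrite vM -(star_homM fh) cmulZl cmulZr scalerA.
- by rewrite vs -(star_hom_star fh) cstarZ.
Qed.

(** Both unit laws at once: [h] is the projection to [X] from either side, and [t] is flipped for
    the right unit. Composition with [h] preserves [C0] because the other factor is a point. *)
Lemma unit_exists (W : lch) (h : cmap W X) (E : xcstar R W) (t : I -> A -> E)
    (P : xcstar R W) (e : forall w, P -> fibre A (h w)) :
  is_max_tensor t -> is_pullback e ->
  (forall l : X -> R[i]^o, C0 l -> C0 (fun w => l (h w))) ->
  (forall w c a, ev A (h w) a = 0 -> ev E w (t c a) = 0) ->
  (forall w (Q : cstarType R) (tau : I -> A -> Q), bistar_hom tau ->
     (forall c a, c = 0 \/ ev A (h w) a = 0 -> tau c a = 0) ->
     exists s : fibre E w -> Q, star_hom s /\ forall c a, s (ev E w (t c a)) = tau c a) ->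
  exists Phi : xhom E P, is_iso (C := xcstar_category R W) Phi /\
    forall z a w, e w (Phi (t (u z) a)) = ev A (h w) (z *: a).
Proof.
move=> tm eP h0 ker desc; have [v [vu uv vl vM vs]] := scalars_inv.
have [ul _ uM us _] := uP; have th := max_tensor_hom tm.
have u0 : u 0 = 0 by have := ul (-1) 0 0; rewrite scaler0 addr0 scaleN1r addNr.
have v0 : v 0 = 0 by rewrite -u0 vu.
have fib w : exists s : fibre E w -> fibre A (h w), star_hom s /\
    forall c a, s (ev E w (t c a)) = ev A (h w) (v c *: a).
  have ah := ev_hom (A := A) (h w); apply: desc; first exact: scalars_bistar.
  by move=> c a [->|a0]; rewrite (star_homZ ah) ?v0 ?scale0r // a0 scaler0.
have [s sP] := dchoice fib.
pose G := [set q | exists g : I * A, q = t g.1 g.2].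
have [|w|w _ [[c a] ->]|w|Phi [Phii PhiE]] := fibrewise_iso (G := G) (s := s) eP.
- exact: tensor_span.
- by case: (sP w).
- have [l [l0 ly]] := C0_at (h w).
  exists (t c (xact l a)), (fun w => l (h w)), (v c *: a); split; first exact: h0.
  + have eh := ev_hom (A := E) w; apply/eqP; rewrite -subr_eq0 -(star_homB eh) -(bistarBr th).
    by rewrite ker // (star_homB (ev_hom _)) xactE // ly scale1r subrr.
  + move=> w'; case: (sP w') => _ ->; rewrite !(star_homZ (ev_hom _)) xactE //.
    by rewrite !scalerA mulrC.
- have eh := ev_hom (A := E) w.
  (* [u 1] is a self-adjoint idempotent, so tensoring with it is a star homomorphism on [A]; it
     provides the inverse on fibres. *)
  have u1 : u 1 = u 1 ** u 1 by rewrite -uM mulr1.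
  have u1s : cstar (u 1) = u 1 by rewrite -us conjc1.
  have [||r [rh rE]] := @fibre_desc _ _ A (h w) _ (fun a => ev E w (t (u 1) a)).
  + split=> [k a a'|a a'|a].
    * by rewrite (bistar_linear_r th) (star_hom_linear eh).
    * by rewrite -(star_homM eh) -(bistarM th) -u1.
    * by rewrite -(star_hom_star eh) -(bistar_star th) u1s.
  + by move=> a /ev_eq0; exact: ker.
  have uZ z a : t (u z) a = t (u 1) (z *: a).
    rewrite (bistarZr th) -(bistarZl th); congr (t _ a).
    by have := ul z 1 0; rewrite addr0 u0 addr0 (_ : z%:A = z) //; exact: mulr1.
  exists r; split => // [_ [[c a] ->]|].
    by case: (sP w) => _ -> /=; rewrite rE -(uZ (v c)) uv.
  exists setT; first by apply/seteqP; split => // v' _; exact: sub_closed_span.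
  move=> v' _; have [a <-] := ev_surj v'; rewrite rE; case: (sP w) => _ ->.
  by rewrite vu scale1r.
by exists Phi; split => // z a w; rewrite PhiE; case: (sP w) => _ ->; rewrite vu.
Qed.

Lemma ev_one_eq0 (o : lch_one) (c : I) : ev I o c = 0 -> c = 0.
Proof. by move=> c0; apply: ev_ext => -[]; rewrite (star_hom0 (ev_hom _)); case: o c0. Qed.

Lemma lunit_exists (E : xcstar R (lch_prod lch_one X)) (t : I -> A -> E)
    (P : xcstar R (lch_prod lch_one X)) (e : forall w, P -> fibre A (lch_pr2 lch_one X w)) :
  ext_tensor t -> is_pullback e ->
  exists Phi : xhom E P, is_iso (C := xcstar_category R (lch_prod lch_one X)) Phi /\
    forall z a w, e w (Phi (t (u z) a)) = ev A w.2 (z *: a).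
Proof.
move=> tP eP; apply: (unit_exists (h := lch_pr2 lch_one X) (ext_max tP) eP).
- move=> l l0; have := C0X C0_one l0; congr C0.
  by apply: funext => w; rewrite mul1r.
- by case=> o x c a; exact: (ext_evr tP).
- case=> o x Q tau tauh tau0; apply: (ext_desc tP tauh) => c a h; apply: tau0.
  by case: h => [/ev_one_eq0|]; [left|right].
Qed.

Lemma runit_exists (E : xcstar R (lch_prod X lch_one)) (t : A -> I -> E)
    (P : xcstar R (lch_prod X lch_one)) (e : forall w, P -> fibre A (lch_pr1 X lch_one w)) :
  ext_tensor t -> is_pullback e ->
  exists Phi : xhom E P, is_iso (C := xcstar_category R (lch_prod X lch_one)) Phi /\
    forall z a w, e w (Phi (t a (u z))) = ev A w.1 (z *: a).
Proof.
move=> tP eP.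
apply: (unit_exists (h := lch_pr1 X lch_one) (max_tensor_flip (ext_max tP)) eP).
- move=> l l0; have := C0X l0 C0_one; congr C0.
  by apply: funext => w; rewrite mulr1.
- by case=> x o c a; exact: (ext_evl tP).
- case=> x o Q tau tauh tau0.
  have [|s [sh sE]] := ext_desc tP (x := x) (y := o) (bistar_flip tauh).
    by move=> a c h; apply: tau0; case: h => [|/ev_one_eq0]; [right|left].
  by exists s; split.
Qed.

End UnitLaws.

Lemma braid_exists (X Y : lch) (A : xcstar R X) (B : xcstar R Y) (E : xcstar R (lch_prod X Y))
    (t : A -> B -> E) (E' : xcstar R (lch_prod Y X)) (t' : B -> A -> E')
    (P : xcstar R (lch_prod X Y)) (e : forall w, P -> fibre E' ((@swapm LCH X Y : cmap _ _) w)) :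
  ext_tensor t -> ext_tensor t' -> is_pullback e ->
  exists Phi : xhom E P, is_iso (C := xcstar_category R (lch_prod X Y)) Phi /\
    forall a b w, e w (Phi (t a b)) = ev E' (w.2, w.1) (t' b a).
Proof.
move=> tP tP' eP; have th := max_tensor_hom (ext_max tP); have th' := max_tensor_hom (ext_max tP').
have fib (w : lch_prod X Y) : exists s : fibre E w -> fibre E' (w.2, w.1), star_hom s /\
    forall a b, s (ev E w (t a b)) = ev E' (w.2, w.1) (t' b a).
  case: w => x y; apply: (ext_desc tP (tau := fun a b => ev E' (y, x) (t' b a))).
    exact: bistar_flip (ext_ev_bistar tP' _ _).
  by move=> a b /or_comm; exact: (ext_ev0 tP').
have fib' (w : lch_prod X Y) : exists s : fibre E' (w.2, w.1) -> fibre E w, star_hom s /\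
    forall a b, s (ev E' (w.2, w.1) (t' b a)) = ev E w (t a b).
  case: w => x y; have [||s [sh sE]] := ext_desc tP' (x := y) (y := x) (tau := fun b a => ev E (x, y) (t a b)).
  - exact: bistar_flip (ext_ev_bistar tP _ _).
  - by move=> b a /or_comm; exact: (ext_ev0 tP).
  - by exists s; split.
have [s sP] := dchoice fib; have [r rP] := dchoice fib'.
have [|w|w _ [[a b] ->]|w|Phi [Phii PhiE]] := fibrewise_iso (h := @swapm LCH X Y : cmap _ _) (G := elementary t) (s := s) eP.
- exact: elementary_span.
- by case: (sP w).
- have [k [k0 kx]] := C0_at w.1; have [l [l0 ly]] := C0_at w.2.
  exists (t (xact k a) (xact l b)), (fun w => k w.1 * l w.2), (t' b a); split.
  + exact: C0X.
  + rewrite (surjective_pairing w); apply: (ext_ev_eq tP); rewrite xactE // ?kx ?ly ?scale1r //.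
  + move=> w'; case: (sP w') => _ ->; rewrite (ext_xact tP') // xactE; last exact: C0X.
    by rewrite mulrC.
- exists (r w); case: (sP w) => sh sE; case: (rP w) => rh rE; split => //.
    by move=> _ [[a b] ->]; rewrite sE rE.
  exists [set v | exists b a, v = ev E' (w.2, w.1) (t' b a)]; first exact: (elementary_fibre tP').
  by move=> _ [b [a ->]]; rewrite rE sE.
by exists Phi; split => // a b w; rewrite PhiE; case: (sP w) => _ ->.
Qed.

Section Associator.
Variables (X Y Z : lch) (A : xcstar R X) (B : xcstar R Y) (C : xcstar R Z).
Variables (E1 : xcstar R (lch_prod X Y)) (t1 : A -> B -> E1).
Variables (E2 : xcstar R (lch_prod (lch_prod X Y) Z)) (t2 : E1 -> C -> E2).
Variables (F1 : xcstar R (lch_prod Y Z)) (u1 : B -> C -> F1).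
Variables (F2 : xcstar R (lch_prod X (lch_prod Y Z))) (u2 : A -> F1 -> F2).
Hypotheses (t1P : ext_tensor t1) (t2P : ext_tensor t2) (u1P : ext_tensor u1) (u2P : ext_tensor u2).
Let t1h := max_tensor_hom (ext_max t1P).
Let t2h := max_tensor_hom (ext_max t2P).
Let u1h := max_tensor_hom (ext_max u1P).
Let u2h := max_tensor_hom (ext_max u2P).

Lemma triple_span : closed_span [set q | exists a b c, q = t2 (t1 a b) c] = setT.
Proof.
apply: (tensor_span_l (ext_max t2P) (elementary_span t1P)) => _ c [[a b] ->].
by exists a, b, c.
Qed.

Lemma triple_span_r : closed_span [set q | exists a b c, q = u2 a (u1 b c)] = setT.
Proof.
apply: (tensor_span_r (ext_max u2P) (elementary_span u1P)) => a _ [[b c] ->].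
by exists a, b, c.
Qed.

(** [triple_tensor] extends the trilinear map with values in the fibre. That the extension kills the
    elements vanishing at the point is checked by [ext_kernel], for the outer tensor product and
    then for the inner one. *)
Lemma triple_fib (x : X) (y : Y) (z : Z) :
  exists s : fibre E2 ((x, y), z) -> fibre F2 (x, (y, z)), star_hom s /\
    forall a b c, s (ev E2 ((x, y), z) (t2 (t1 a b) c)) = ev F2 (x, (y, z)) (u2 a (u1 b c)).
Proof.
have fh := ev_hom (A := F2) (x, (y, z)).
have [||||||f [f_h fE]] := triple_tensor (ext_max t1P) (ext_max t2P)
  (tau := fun a b c => ev F2 (x, (y, z)) (u2 a (u1 b c))).
- by move=> b c k a a'; rewrite (bistar_linear_l u2h) (star_hom_linear fh).
- by move=> a c k b b'; rewrite (bistar_linear_l u1h) (bistar_linear_r u2h) (star_hom_linear fh).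
- by move=> a b k c c'; rewrite (bistar_linear_r u1h) (bistar_linear_r u2h) (star_hom_linear fh).
- by move=> a a' b b' c c'; rewrite (bistarM u1h) (bistarM u2h) (star_homM fh).
- by move=> a b c; rewrite (bistar_star u1h) (bistar_star u2h) (star_hom_star fh).
- apply: (span_image fh (@ev_surj _ _ F2 _) triple_span_r) => _ [a [b [c ->]]].
  by exists (a, b, c).
have [|s [sh sE]] := @fibre_desc _ _ E2 ((x, y), z) _ f f_h; last first.
  by exists s; split => // a b c; rewrite sE fE.
move=> q /ev_eq0; apply: (ext_kernel t2P (star_hom_linear f_h) (star_hom_bound f_h)) => p c [p0|c0].
  move: p p0; apply: (ext_kernel t1P (M := nm c)).
  - by move=> k p p'; rewrite (bistar_linear_l t2h) (star_hom_linear f_h).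
  - by move=> p; apply: (le_trans (star_hom_le f_h _)); exact: bistar_linear_bound_l.
  - move=> a b ab; rewrite fE; apply: (ext_ev0 u2P).
    by case: ab => [|b0]; [left|right; apply: (ext_ev0 u1P); left].
have : closed_span (elementary t1) p by rewrite (elementary_span t1P).
apply: (closed_span_map (f := fun p => f (t2 p c)) (M := nm c) _ _ (zero_subspace _)).
- by move=> k p1 p2; rewrite (bistar_linear_l t2h) (star_hom_linear f_h).
- by move=> p1; apply: (le_trans (star_hom_le f_h _)); exact: bistar_linear_bound_l.
- move=> _ [[a b] ->]; rewrite /= fE; apply: (ext_ev0 u2P); right.
  by apply: (ext_ev0 u1P); right.
Qed.

(** Reversing the order of the three factors turns the right bracketing into the left one, so
    [triple_tensor] serves again. *)
Lemma triple_fib_r (x : X) (y : Y) (z : Z) :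
  exists s : fibre F2 (x, (y, z)) -> fibre E2 ((x, y), z), star_hom s /\
    forall a b c, s (ev F2 (x, (y, z)) (u2 a (u1 b c))) = ev E2 ((x, y), z) (t2 (t1 a b) c).
Proof.
have fh := ev_hom (A := E2) ((x, y), z).
have [||||||f [f_h fE]] := triple_tensor (max_tensor_flip (ext_max u1P)) (max_tensor_flip (ext_max u2P))
  (tau := fun c b a => ev E2 ((x, y), z) (t2 (t1 a b) c)).
- by move=> b a k c c'; rewrite (bistar_linear_r t2h) (star_hom_linear fh).
- by move=> c a k b b'; rewrite (bistar_linear_r t1h) (bistar_linear_l t2h) (star_hom_linear fh).
- by move=> c b k a a'; rewrite (bistar_linear_l t1h) (bistar_linear_l t2h) (star_hom_linear fh).
- by move=> c c' b b' a a'; rewrite (bistarM t1h) (bistarM t2h) (star_homM fh).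
- by move=> c b a; rewrite (bistar_star t1h) (bistar_star t2h) (star_hom_star fh).
- apply: (span_image fh (@ev_surj _ _ E2 _) triple_span) => _ [a [b [c ->]]].
  by exists (c, b, a).
have [|s [sh sE]] := @fibre_desc _ _ F2 (x, (y, z)) _ f f_h; last first.
  by exists s; split => // a b c; rewrite sE fE.
move=> q /ev_eq0; apply: (ext_kernel u2P (star_hom_linear f_h) (star_hom_bound f_h)) => a p [a0|p0].
  have : closed_span (elementary u1) p by rewrite (elementary_span u1P).
  apply: (closed_span_map (f := fun p => f (u2 a p)) (M := nm a) _ _ (zero_subspace _)).
  - by move=> k p1 p2; rewrite (bistar_linear_r u2h) (star_hom_linear f_h).
  - by move=> p1; apply: (le_trans (star_hom_le f_h _)); exact: bistar_le.
  - move=> _ [[b c] ->]; rewrite /= fE; apply: (ext_ev0 t2P); left.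
    by apply: (ext_ev0 t1P); left.
move: p p0; apply: (ext_kernel u1P (M := nm a)).
- by move=> k p p'; rewrite (bistar_linear_r u2h) (star_hom_linear f_h).
- by move=> p; apply: (le_trans (star_hom_le f_h _)); exact: bistar_le.
- move=> b c bc; rewrite fE; apply: (ext_ev0 t2P).
  by case: bc => [b0|]; [left; apply: (ext_ev0 t1P); right|right].
Qed.

Lemma assoc_exists (P : xcstar R (lch_prod (lch_prod X Y) Z))
    (e : forall w, P -> fibre F2 ((@prodmA LCH X Y Z : cmap _ _) w)) : is_pullback e ->
  exists Phi : xhom E2 P, is_iso (C := xcstar_category R (lch_prod (lch_prod X Y) Z)) Phi /\
    forall a b c w, e w (Phi (t2 (t1 a b) c)) = ev F2 (w.1.1, (w.1.2, w.2)) (u2 a (u1 b c)).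
Proof.
move=> eP.
have fib (w : lch_prod (lch_prod X Y) Z) :
    exists s : fibre E2 w -> fibre F2 (w.1.1, (w.1.2, w.2)), star_hom s /\
    forall a b c, s (ev E2 w (t2 (t1 a b) c)) = ev F2 (w.1.1, (w.1.2, w.2)) (u2 a (u1 b c)).
  by case: w => -[x y] z; exact: triple_fib.
have [s sP] := dchoice fib.
have [|w|w _ [a [b [c ->]]]|w|Phi [Phii PhiE]] := fibrewise_iso (h := @prodmA LCH X Y Z : cmap _ _)
    (G := [set q | exists a b c, q = t2 (t1 a b) c]) (s := s) eP.
- exact: triple_span.
- by case: (sP w).
- have [k [k0 kx]] := C0_at w.1.1; have [l [l0 ly]] := C0_at w.1.2.
  have [m [m0 mz]] := C0_at w.2.
  exists (t2 (t1 (xact k a) (xact l b)) (xact m c)).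
  exists (fun w => k w.1.1 * l w.1.2 * m w.2), (u2 a (u1 b c)); split.
  + exact: (C0X (C0X k0 l0) m0).
  + rewrite (surjective_pairing w) (surjective_pairing w.1).
    apply: (ext_ev_eq t2P); last by rewrite xactE // mz scale1r.
    by apply: (ext_ev_eq t1P); rewrite xactE // ?kx ?ly scale1r.
  + move=> w'; case: (sP w') => _ ->; rewrite (ext_xact u1P) //.
    have lm0 := C0X l0 m0; rewrite (ext_xact u2P _ _ k0 lm0) (xactE (C0X k0 lm0)).
    by rewrite mulrA.
- case: w => -[x y] z; have [r [rh rE]] := triple_fib_r x y z; exists r.
  case: (sP ((x, y), z)) => sh sE; split => //.
    by move=> _ [a [b [c ->]]]; rewrite sE rE.
  exists [set v | exists a b c, v = ev F2 (x, (y, z)) (u2 a (u1 b c))].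
    apply: (span_image (ev_hom _) (@ev_surj _ _ F2 _) triple_span_r).
    by move=> _ [a [b [c ->]]]; exists a, b, c.
  by move=> _ [a [b [c ->]]]; rewrite rE sE.
by exists Phi; split => // a b c w; rewrite PhiE; case: (sP w) => _ ->.
Qed.

End Associator.

End Tools.

(** * The lax symmetric monoidal functor *)

Local Open Scope cat_scope.

Section Reps.
Variables (R : realType) (D : pseudofunctor (C := LCH) (@xcstar_category R)).

Definition ap (X : lch) (A B : xcstar R X) (u : @hom (xcstar_category R X) A B) : A -> B :=
  xfun u.

Lemma apKV (X : lch) (A B : xcstar R X) (i : iso (C := xcstar_category R X) A B) b :
  ap i (ap (iinv i) b) = b.
Proof. by have [_ h] := isoP i; have := congr1 (fun u => ap u b) h. Qed.

Definition pbp (X Y : lch) (f : cmap X Y) (A : xcstar R Y) : xcstar R X := @pb _ _ D X Y f A.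

Variable e : forall (X Y : lch) (f : cmap X Y) (A : xcstar R Y) (x : X), pbp f A -> fibre A (f x).

(** Values in iterated pullbacks lie in nested fibres; following representatives [a] of the values
    replaces computation there. *)
Definition rep (X Y : lch) (f : cmap X Y) (A : xcstar R Y) (x : X) (p : pbp f A) (a : A) :=
  e x p = ev A (f x) a.

Hypothesis hpb : forall (X Y : lch) (f : cmap X Y) (A : xcstar R Y), is_pullback (@e X Y f A).
Hypothesis hfmap : forall (X Y : lch) (f : cmap X Y) (A B : xcstar R Y) (phi : xhom A B) x p a,
  rep (f := f) x p a -> rep (f := f) x (ap (fmap (@pb _ _ D X Y f) phi) p) (phi a).
Hypothesis hpbid : forall (X : lch) (A : xcstar R X) (p : pbp (cmap_id X) A) x,
  e x p = ev A x (ap (@pbid _ _ D X A) p).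
Hypothesis hpbcomp : forall (X Y Z : lch) (f : cmap X Y) (g : cmap Y Z) (A : xcstar R Z)
    (p : pbp (cmap_comp f g) A) x (q : pbp g A),
  rep x (ap (@pbcomp _ _ D X Y Z f g A) p) q -> e x p = e (f x) q.

Section Maps.
Variables (X Y : lch) (f : cmap X Y) (A : xcstar R Y).

Lemma rep_ex x (p : pbp f A) : exists a, rep x p a.
Proof. exact: pb_rep. Qed.

Lemma rep_pbeq (g : cmap X Y) (E : f = g) x (p : pbp f A) a :
  rep x p a -> rep (f := g) x (ap (@pbeq LCH (xcstar_category R) (@pb _ _ D) X Y f g E A) p) a.
Proof. by case: _ / E. Qed.

Lemma rep_pbcomp (Z : lch) (h : cmap Z X) x (p : pbp (cmap_comp h f) A) (q : pbp f A) a :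
  rep x p a -> rep x (ap (@pbcomp _ _ D Z X Y h f A) p) q -> rep (h x) q a.
Proof. by rewrite /rep => pa /hpbcomp <-. Qed.

Lemma rep_pbcomp_inv (Z : lch) (h : cmap Z X) x (w : pbp h (pbp f A)) (q : pbp f A) a :
  rep x w q -> rep (h x) q a ->
  rep (f := cmap_comp h f) x (ap (iinv (@pbcomp _ _ D Z X Y h f A)) w) a.
Proof.
move=> wq; rewrite /rep => <-; apply: hpbcomp.
by rewrite (apKV (@pbcomp _ _ D Z X Y h f A)).
Qed.

End Maps.

Definition oap (X Y : lch) (f : cmap X Y) (A : xcstar R X) (B : xcstar R Y)
  (u : @over LCH (xcstar_category R) D X Y f A B) : A -> pbp f B := ap u.

Lemma rep_oid (X : lch) (A : xcstar R X) x a :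
  rep x (oap (@oid LCH (xcstar_category R) D X A) a) a.
Proof. by rewrite /rep hpbid (apKV (@pbid _ _ D X A)). Qed.

Lemma rep_ocomp (X Y Z : lch) (f : cmap X Y) (g : cmap Y Z) (A : xcstar R X) (B : xcstar R Y)
    (E : xcstar R Z) (u : @over LCH (xcstar_category R) D X Y f A B)
    (v : @over LCH (xcstar_category R) D Y Z g B E) x a b c :
  rep x (oap u a) b -> rep (f x) (oap v b) c ->
  rep x (oap (@ocomp LCH (xcstar_category R) D X Y Z f g A B E u v) a) c.
Proof. by move=> /(hfmap v) h /(rep_pbcomp_inv h). Qed.

(** Transport along an equality of maps does not change representatives. A common representative at
    each point, for each generator, therefore proves equality over maps that agree pointwise. *)
Lemma osameI (X Y : lch) (f g : cmap X Y) (A : xcstar R X) (B : xcstar R Y) (G : set A)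
    (u : @over LCH (xcstar_category R) D X Y f A B)
    (v : @over LCH (xcstar_category R) D X Y g A B) :
  (forall x, f x = g x) -> closed_span G = setT ->
  (forall x a, G a -> exists2 b, rep x (oap u a) b & rep x (oap v a) b) ->
  @osame LCH (xcstar_category R) D X Y f g A B u v.
Proof.
move=> fg GT h; have E : f = g by exact: cmap_ext.
exists E; apply: (xhom_eq_span (pb_presents (@hpb _ _ g B)) GT) => x a Ga.
by have [b ub vb] := h x a Ga; rewrite [RHS]vb; exact: rep_pbeq.
Qed.

Section Ext.
Variable P : extProduct D.
Definition bx (X Y : lch) (A : xcstar R X) (B : xcstar R Y) : xcstar R (lch_prod X Y) :=
  @box _ _ _ P X Y A B.
Variable t : forall (X Y : lch) (A : xcstar R X) (B : xcstar R Y), A -> B -> bx A B.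
Hypothesis hbox : forall (X Y : lch) (A : xcstar R X) (B : xcstar R Y), ext_tensor (@t X Y A B).
Hypothesis hbmap : forall (X Y : lch) (A A' : xcstar R X) (B B' : xcstar R Y)
    (phi : xhom A A') (psi : xhom B B') a b,
  ap (@bmap _ _ _ P X Y A A' B B' phi psi) (t a b) = t (phi a) (psi b).
Hypothesis hboxpb : forall (X X' Y Y' : lch) (f : cmap X X') (g : cmap Y Y')
    (A : xcstar R X') (B : xcstar R Y') (p : pbp f A) (q : pbp g B) x y a b,
  rep x p a -> rep y q b ->
  rep (f := @prodm LCH X X' Y Y' f g) (A := bx A B) (x, y) (ap (@boxpb _ _ _ P X X' Y Y' f g A B) (t p q)) (t a b).

Lemma rep_obox (X X' Y Y' : lch) (f : cmap X X') (g : cmap Y Y') (A : xcstar R X) (A' : xcstar R X')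
    (B : xcstar R Y) (B' : xcstar R Y') (u : @over LCH (xcstar_category R) D X X' f A A')
    (v : @over LCH (xcstar_category R) D Y Y' g B B') x y a b a' b' :
  rep x (oap u a) a' -> rep y (oap v b) b' ->
  rep (f := @prodm LCH X X' Y Y' f g) (A := bx A' B') (x, y)
    (oap (@obox LCH (xcstar_category R) D P X X' Y Y' f g A A' B B' u v) (t a b)) (t a' b').
Proof.
move=> ua vb; have := hboxpb ua vb.
by have <- := @hbmap X Y A (pbp f A') B (pbp g B') u v a b.
Qed.

End Ext.
End Reps.

(** * Construction of the functor *)

Section Construction.
Variable R : realType.
Local Notation XC := (@xcstar_category R).

Definition pe (X Y : lch) (f : cmap X Y) (A : xcstar R Y) (x : X) : pull_alg f A -> fibre A (f x) :=
  sect_ev x.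
Arguments pe {X Y} f A x _.

Lemma peP (X Y : lch) (f : cmap X Y) (A : xcstar R Y) : is_pullback (pe f A).
Proof. exact: pull_algP. Qed.

Definition pullm (X Y : lch) (f : cmap X Y) (A B : xcstar R Y) (phi : xhom A B) :
    xhom (pull_alg f A) (pull_alg f B) := sval (cid (pullm_exists phi (peP f A) (peP f B))).

Lemma pullmE (X Y : lch) (f : cmap X Y) (A B : xcstar R Y) (phi : xhom A B) p x a :
  pe f A x p = ev A (f x) a -> pe f B x (pullm f phi p) = ev B (f x) (phi a).
Proof. by rewrite /pullm; case: cid => Phi /= h; exact: h. Qed.

Lemma pullm1 (X Y : lch) (f : cmap X Y) (A : xcstar R Y) :
  pullm f (xhom_id A) = xhom_id (pull_alg f A).
Proof.
apply: xhom_ext => p; apply: (pb_ext (peP f A)) => x; have [b pb_] := pb_rep (pe f A) p x.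
by rewrite (pullmE (xhom_id A) pb_) pb_.
Qed.

Lemma pullmD (X Y : lch) (f : cmap X Y) (A B E : xcstar R Y) (phi : xhom A B) (psi : xhom B E) :
  pullm f (xhom_comp phi psi) = xhom_comp (pullm f phi) (pullm f psi).
Proof.
apply: xhom_ext => p; apply: (pb_ext (peP f E)) => x; have [b pb_] := pb_rep (pe f A) p x.
by rewrite (pullmE (xhom_comp phi psi) pb_) (pullmE psi (pullmE phi pb_)).
Qed.

Definition pull_functor (X Y : LCH) (f : hom X Y) : functor (XC Y) (XC X) :=
  @Functor (XC Y) (XC X) (@pull_alg R X Y f) (@pullm X Y f) (@pullm1 X Y f) (@pullmD X Y f).

Definition pull_id (X : LCH) (A : XC X) : iso (pull_functor (idm X) A) A :=
  mk_iso (proj1 (svalP (cid (pullid_exists (peP (cmap_id X) A))))).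

Lemma pull_idE (X : lch) (A : xcstar R X) (p : pull_alg (cmap_id X) A) x :
  pe (cmap_id X) A x p = ev A x (ap (@pull_id X A) p).
Proof. exact: (proj2 (svalP (cid (pullid_exists (peP (cmap_id X) A))))). Qed.

Definition pull_comp (X Y Z : LCH) (f : hom X Y) (g : hom Y Z) (A : XC Z) :
    iso (pull_functor (f ;; g) A) (pull_functor f (pull_functor g A)) :=
  mk_iso (proj1 (svalP (cid (pullcomp_exists (peP (cmap_comp f g) A) (peP g A) (peP f (pull_alg g A)))))).

Lemma pull_compE (X Y Z : lch) (f : cmap X Y) (g : cmap Y Z) (A : xcstar R Z)
    (p : pull_alg (cmap_comp f g) A) x (q : pull_alg g A) :
  pe f (pull_alg g A) x (ap (@pull_comp X Y Z f g A) p) = ev (pull_alg g A) (f x) q ->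
  pe (cmap_comp f g) A x p = pe g A (f x) q.
Proof.
exact: (proj2 (svalP (cid (pullcomp_exists (peP (cmap_comp f g) A) (peP g A) (peP f (pull_alg g A)))))).
Qed.

Lemma pe_pbeq (X Y : lch) (f g : cmap X Y) (E : f = g) (A : xcstar R Y) x (p : pull_alg f A) a :
  pe f A x p = ev A (f x) a ->
  pe g A x (ap (@pbeq LCH XC pull_functor X Y f g E A) p) = ev A (g x) a.
Proof. by case: _ / E. Qed.

Lemma pe_ext2 (X Y Z : lch) (f : cmap X Y) (g : cmap Y Z) (A : xcstar R Z)
    (p q : pull_alg f (pull_alg g A)) :
  (forall x b c, pe f _ x p = ev (pull_alg g A) (f x) b -> pe f _ x q = ev (pull_alg g A) (f x) c ->
     pe g A (f x) b = pe g A (f x) c) -> p = q.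
Proof.
move=> h; apply: (pb_ext (peP f (pull_alg g A))) => x.
have [b pb_] := pb_rep (pe f (pull_alg g A)) p x; have [c qc] := pb_rep (pe f (pull_alg g A)) q x.
by rewrite pb_ qc; apply/(pres_eq (pb_presents (peP g A))); exact: h pb_ qc.
Qed.

Lemma pull_id_nat (X : LCH) (A B : XC X) (u : hom A B) :
  fmap (pull_functor (idm X)) u ;; pull_id B = pull_id A ;; u.
Proof.
apply: xhom_ext => p; apply: ev_ext => x /=.
rewrite -[LHS]pull_idE; have [a pa] := pb_rep (pe (cmap_id X) A) p x.
rewrite (pullmE u pa); apply: xhom_ev_eq; rewrite -[RHS]pull_idE.
by rewrite pa.
Qed.

Lemma pull_comp_nat (X Y Z : LCH) (f : hom X Y) (g : hom Y Z) (A B : XC Z) (u : hom A B) :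
  fmap (pull_functor (f ;; g)) u ;; pull_comp f g B =
  pull_comp f g A ;; fmap (pull_functor f) (fmap (pull_functor g) u).
Proof.
apply: xhom_ext => p; apply: pe_ext2 => x b c /= pb_ qc.
have [a pa] := pb_rep (pe (cmap_comp f g) A) p x.
rewrite -(pull_compE pb_) (pullmE u pa).
have [q pq] := pb_rep (pe f (pull_alg g A)) (ap (@pull_comp X Y Z f g A) p) x.
have qa := pull_compE pq; rewrite pa in qa.
have := pullmE (pullm g u) pq; rewrite qc => /(pres_eq (pb_presents (peP g B))) ->.
exact: (esym (@pullmE _ _ g _ _ u _ _ _ (esym qa))).
Qed.

Lemma pull_comp1m (X Y : LCH) (f : hom X Y) (A : XC Y) :
  pull_comp (idm X) f A ;; pull_id (pull_functor f A) = pbeq pull_functor (comp1m f) A.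
Proof.
apply: xhom_ext => p; apply: (pb_ext (peP f A)) => x /=.
have [a pa] := pb_rep (pe (cmap_comp (cmap_id X) f) A) p x.
rewrite [RHS](pe_pbeq (comp1m (c := LCH) f) pa).
have [q pq] := pb_rep (pe (cmap_id X) (pull_alg f A)) (ap (@pull_comp X X Y (idm X) f A) p) x.
have qa := pull_compE pq; rewrite [LHS]pa in qa; rewrite qa.
by apply/(pres_eq (pb_presents (peP f A))); rewrite -[LHS]pull_idE pq.
Qed.

Lemma pull_compm1 (X Y : LCH) (f : hom X Y) (A : XC Y) :
  pull_comp f (idm Y) A ;; fmap (pull_functor f) (pull_id A) = pbeq pull_functor (compm1 f) A.
Proof.
apply: xhom_ext => p; apply: (pb_ext (peP f A)) => x /=.
have [a pa] := pb_rep (pe (cmap_comp f (cmap_id Y)) A) p x.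
rewrite [RHS](pe_pbeq (compm1 (c := LCH) f) pa).
have [q pq] := pb_rep (pe f (pull_alg (cmap_id Y) A)) (ap (@pull_comp X Y Y f (idm Y) A) p) x.
have qa := pull_compE pq; rewrite [LHS]pa in qa.
by rewrite (pullmE (ihom (@pull_id Y A) : xhom _ _) pq) -[LHS]pull_idE.
Qed.

(** A representative [a] of the value of [p] at [x] is followed along both paths, with one
    intermediate representative for each pullback on the way. *)
Lemma pull_compA (X Y Z W : LCH) (f : hom X Y) (g : hom Y Z) (h : hom Z W) (A : XC W) :
  pull_comp (f ;; g) h A ;; pull_comp f g (pull_functor h A) =
  pbeq pull_functor (compA f g h) A ;; pull_comp f (g ;; h) A
    ;; fmap (pull_functor f) (pull_comp g h A).
Proof.
apply: xhom_ext => p; apply: pe_ext2 => x b c /= pb_ qc.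
have [a pa] := pb_rep (pe (cmap_comp (cmap_comp f g) h) A) p x.
set w := ap (@pull_comp X Z W (f ;; g) h A) p in pb_.
have [q wq] := pb_rep (pe (cmap_comp f g) (pull_alg h A)) w x.
have qa := pull_compE wq; rewrite [LHS]pa in qa.
have qb := pull_compE pb_; rewrite [LHS]wq in qb.
set p' := ap (@pbeq LCH XC pull_functor X W _ _ (compA (c := LCH) f g h) A) p in qc.
have pa' : pe (cmap_comp f (cmap_comp g h)) A x p' = ev A (h (g (f x))) a by exact: (pe_pbeq _ pa).
set v := ap (@pull_comp X Y W f (g ;; h) A) p' in qc.
have [s vs] := pb_rep (pe f (pull_alg (cmap_comp g h) A)) v x.
have sa := pull_compE vs; rewrite [LHS]pa' in sa.
have := pullmE (ihom (@pull_comp Y Z W g h A) : xhom _ _) vs; rewrite [LHS]qc.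
move=> /(pres_eq (pb_presents (peP g (pull_alg h A)))) ->.
have [q' sq'] := pb_rep (pe g (pull_alg h A)) (ap (@pull_comp Y Z W g h A) s) (f x).
have qa' := pull_compE sq'; rewrite [RHS]sq' -[LHS]qb; apply/(pres_eq (pb_presents (peP h A))).
by rewrite -[LHS]qa -[RHS]qa' sa.
Qed.

Definition pull_pseudofunctor : pseudofunctor XC :=
  @Pseudofunctor LCH XC pull_functor pull_id pull_comp pull_id_nat pull_comp_nat
    pull_comp1m pull_compm1 pull_compA.

Section BoxMap.
Variables (X Y : lch) (A A' : xcstar R X) (B B' : xcstar R Y).
Variables (phi : xhom A A') (psi : xhom B B').

(** The induced map of tensor products respects values by [ext_kernel], since it carries a tensor
    with a vanishing factor to another such tensor. *)
Lemma boxm_exists : exists Phi : xhom (box_alg A B) (box_alg A' B'),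
  forall a b, Phi (box_tens a b) = box_tens (phi a) (psi b).
Proof.
have tP := box_algP A B; have tP' := box_algP A' B'; have th' := max_tensor_hom (ext_max tP').
have [f [fh fE]] := max_tensor_univ (ext_max tP) (bistar_comp th' (xhom_star phi) (xhom_star psi)).
have [[x y] q q0|Phi PhiE] := @xhom_of_star _ _ (box_alg A B) (box_alg A' B') f fh.
  have h := star_hom_comp fh (ev_hom (A := box_alg A' B') (x, y)).
  apply: (ext_kernel tP (star_hom_linear h) (star_hom_bound h)) q0 => a b ab /=.
  by rewrite fE; apply: (ext_ev0 tP'); case: ab => /xhom_ev0 ->; [left|right].
by exists Phi => a b; rewrite PhiE fE.
Qed.

Definition boxm := sval (cid boxm_exists).

Lemma boxmE a b : boxm (box_tens a b) = box_tens (phi a) (psi b).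
Proof. exact: (svalP (cid boxm_exists)). Qed.

End BoxMap.

Lemma boxm1 (X Y : lch) (A : xcstar R X) (B : xcstar R Y) :
  boxm (xhom_id A) (xhom_id B) = xhom_id (box_alg A B).
Proof.
apply: (xhom_eq_span (ev_presents _) (elementary_span (box_algP A B))) => x _ [[a b] ->].
by rewrite boxmE.
Qed.

Lemma boxmD (X Y : lch) (A A' A'' : xcstar R X) (B B' B'' : xcstar R Y)
    (u : xhom A A') (u' : xhom A' A'') (v : xhom B B') (v' : xhom B' B'') :
  boxm (xhom_comp u u') (xhom_comp v v') = xhom_comp (boxm u v) (boxm u' v').
Proof.
apply: (xhom_eq_span (ev_presents _) (elementary_span (box_algP A B))) => x _ [[a b] ->].
by rewrite boxmE /= !boxmE.
Qed.

Section BoxPull.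
Variables (X X' Y Y' : lch) (f : cmap X X') (g : cmap Y Y') (A : xcstar R X') (B : xcstar R Y').
Let h : cmap (lch_prod X Y) (lch_prod X' Y') := @prodm LCH X X' Y Y' f g.

Let ex := boxpb_exists (peP f A) (peP g B) (peP h (box_alg A B))
  (box_algP (pull_alg f A) (pull_alg g B)) (box_algP A B).

Definition box_pull : iso (C := XC (lch_prod X Y)) (box_alg (pull_alg f A) (pull_alg g B))
  (pull_alg h (box_alg A B)) := mk_iso (proj1 (svalP (cid ex))).

Lemma box_pullE p q x y a b : pe f A x p = ev A (f x) a -> pe g B y q = ev B (g y) b ->
  pe h (box_alg A B) (x, y) (ap box_pull (box_tens p q)) = ev (box_alg A B) (f x, g y) (box_tens a b).
Proof. exact: (proj2 (svalP (cid ex))). Qed.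

End BoxPull.

Lemma box_pull_nat (X X' Y Y' : lch) (f : cmap X X') (g : cmap Y Y') (A A' : xcstar R X')
    (B B' : xcstar R Y') (u : xhom A A') (v : xhom B B') :
  xhom_comp (boxm (pullm f u) (pullm g v)) (ihom (box_pull f g A' B') : xhom _ _) =
  xhom_comp (ihom (box_pull f g A B) : xhom _ _) (pullm (@prodm LCH X X' Y Y' f g) (boxm u v)).
Proof.
apply: (xhom_eq_span (pb_presents (peP _ _)) (elementary_span (box_algP _ _))) => -[x y] _ [[p q] ->].
have [a pa] := pb_rep (pe f A) p x; have [b qb] := pb_rep (pe g B) q y.
rewrite [RHS](pullmE (boxm u v) (box_pullE pa qb)) boxmE /= boxmE.
exact: box_pullE (pullmE u pa) (pullmE v qb).
Qed.

Definition box_product : extProduct (C := LCH) pull_pseudofunctor :=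
  @ExtProduct LCH XC pull_pseudofunctor (@box_alg R) boxm boxm1 boxmD box_pull box_pull_nat.

Section UnitObject.

Lemma point_field (E : cstarType R) : is_field (X := lch_one) (fun _ => @id E).
Proof.
split=> // [e r r0 /(_ tt)//|e z r er|e r r0].
  by apply: filterE => -[].
exists setT => [|z []//].
have -> : [set: lch_one] = [set tt] by apply/seteqP; split=> -[].
exact: compact_set1.
Qed.

Lemma point_bump (E : cstarType R) (phi : lch_one -> R) (e : E) : bumps phi ->
  exists e', mulby (X := lch_one) (fun _ => @id E) (fun z => (phi z)%:C) e e'.
Proof. by move=> _; exists ((phi tt)%:C *: e) => -[]. Qed.

(** Besides the unit object, this is applied to the single fibres [B(y)] in the projection
    formula. *)
Definition point_alg (E : cstarType R) : xcstar R lch_one :=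
  of_field (point_field E) (@point_bump E).

Definition unit_alg : xcstar R lch_one := point_alg (scalars R).

Definition unit_map : R[i]^o -> unit_alg := @to_scalars R.

Lemma unit_mapP : is_scalars unit_map.
Proof. exact: to_scalarsP. Qed.

End UnitObject.

Section Constraints.
Implicit Types (X Y Z : lch).

Section LUnit.
Variables (X : lch) (A : xcstar R X).
Let ex := lunit_exists unit_mapP (box_algP unit_alg A) (peP (lch_pr2 lch_one X) A).
Definition box_lunit : iso (C := XC _) (box_alg unit_alg A) (pull_alg (lch_pr2 lch_one X) A) :=
  mk_iso (proj1 (svalP (cid ex))).
Lemma box_lunitE z a w : pe (lch_pr2 lch_one X) A w (ap box_lunit (box_tens (unit_map z) a)) =
  ev A w.2 (z *: a).
Proof. exact: (proj2 (svalP (cid ex))). Qed.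
End LUnit.

Section RUnit.
Variables (X : lch) (A : xcstar R X).
Let ex := runit_exists unit_mapP (box_algP A unit_alg) (peP (lch_pr1 X lch_one) A).
Definition box_runit : iso (C := XC _) (box_alg A unit_alg) (pull_alg (lch_pr1 X lch_one) A) :=
  mk_iso (proj1 (svalP (cid ex))).
Lemma box_runitE z a w : pe (lch_pr1 X lch_one) A w (ap box_runit (box_tens a (unit_map z))) =
  ev A w.1 (z *: a).
Proof. exact: (proj2 (svalP (cid ex))). Qed.
End RUnit.

Section Assoc.
Variables (X Y Z : lch) (A : xcstar R X) (B : xcstar R Y) (C : xcstar R Z).
Let h : cmap (lch_prod (lch_prod X Y) Z) (lch_prod X (lch_prod Y Z)) := @prodmA LCH X Y Z.
Let ex := assoc_exists (box_algP A B) (box_algP (box_alg A B) C) (box_algP B C)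
  (box_algP A (box_alg B C)) (peP h (box_alg A (box_alg B C))).
Definition box_assoc : iso (C := XC _) (box_alg (box_alg A B) C)
  (pull_alg h (box_alg A (box_alg B C))) := mk_iso (proj1 (svalP (cid ex))).
Lemma box_assocE a b c w : pe h (box_alg A (box_alg B C)) w
    (ap box_assoc (box_tens (box_tens a b : box_alg A B) c)) =
  ev (box_alg A (box_alg B C)) (w.1.1, (w.1.2, w.2)) (box_tens a (box_tens b c : box_alg B C)).
Proof. exact: (proj2 (svalP (cid ex))). Qed.
End Assoc.

Section Braid.
Variables (X Y : lch) (A : xcstar R X) (B : xcstar R Y).
Let h : cmap (lch_prod X Y) (lch_prod Y X) := @swapm LCH X Y.
Let ex := braid_exists (box_algP A B) (box_algP B A) (peP h (box_alg B A)).
Definition box_braid : iso (C := XC _) (box_alg A B) (pull_alg h (box_alg B A)) :=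
  mk_iso (proj1 (svalP (cid ex))).
Lemma box_braidE a b w : pe h (box_alg B A) w (ap box_braid (box_tens a b)) =
  ev (box_alg B A) (w.2, w.1) (box_tens b a).
Proof. exact: (proj2 (svalP (cid ex))). Qed.
End Braid.

End Constraints.

Local Notation D := pull_pseudofunctor.
Local Notation P := box_product.

Lemma prep_oid (X : lch) (A : xcstar R X) x a :
  rep (D := D) (@pe) x (oap (@oid LCH XC D X A) a) a.
Proof. by apply: rep_oid; exact: pull_idE. Qed.

Lemma prep_ocomp (X Y Z : lch) (f : cmap X Y) (g : cmap Y Z) (A : xcstar R X) (B : xcstar R Y)
    (E : xcstar R Z) (u : @over LCH XC D X Y f A B) (v : @over LCH XC D Y Z g B E) x a b c :
  rep (D := D) (@pe) x (oap u a) b -> rep (D := D) (@pe) (f x) (oap v b) c ->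
  rep (D := D) (@pe) x (oap (@ocomp LCH XC D X Y Z f g A B E u v) a) c.
Proof.
apply: (@rep_ocomp R D (@pe)) => [X' Y' *|X' Y' Z' *]; first exact: (@pullmE X' Y').
exact: pull_compE.
Qed.

Lemma prep_obox (X X' Y Y' : lch) (f : cmap X X') (g : cmap Y Y') (A : xcstar R X)
    (A' : xcstar R X') (B : xcstar R Y) (B' : xcstar R Y') (u : @over LCH XC D X X' f A A')
    (v : @over LCH XC D Y Y' g B B') x y a b a' b' :
  rep (D := D) (@pe) x (oap u a) a' -> rep (D := D) (@pe) y (oap v b) b' ->
  rep (D := D) (@pe) (f := @prodm LCH X X' Y Y' f g) (A := box_alg A' B') (x, y)
    (oap (@obox LCH XC D P X X' Y Y' f g A A' B B' u v) (box_tens a b : box_alg A B))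
    (box_tens a' b').
Proof.
apply: (rep_obox (P := P) (t := @box_tens R)) => *; first exact: boxmE.
exact: box_pullE.
Qed.

Lemma posame (X Y : lch) (f g : cmap X Y) (A : xcstar R X) (B : xcstar R Y) (G : set A)
    (u : @over LCH XC D X Y f A B) (v : @over LCH XC D X Y g A B) :
  closed_span G = setT -> (forall x, f x = g x) -> 
  (forall x a, G a -> exists2 b, rep (D := D) (@pe) x (oap u a) b & rep (D := D) (@pe) x (oap v a) b) ->
  @osame LCH XC D X Y f g A B u v.
Proof. by move=> GT fg h; exact: (@osameI R D (@pe) (@peP) X Y f g A B G u v fg GT h). Qed.

Lemma lax_obox1 (X Y : LCH) (A : XC X) (B : XC Y) :
  osame (obox P (oid D A) (oid D B)) (oid D (box P A B)).
Proof.
apply: (posame (elementary_span (box_algP _ _))) => [[]//|[x y] _ [[a b] ->]].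
exists (box_tens a b); first by apply: prep_obox; exact: prep_oid.
exact: prep_oid.
Qed.

Lemma over_rep (X Y : lch) (f : cmap X Y) (A : xcstar R X) (B : xcstar R Y)
    (u : @over LCH XC D X Y f A B) x a : exists b, rep (D := D) (@pe) x (oap u a) b.
Proof. exact: rep_ex. Qed.

Lemma lax_oboxD (X X' X'' Y Y' Y'' : LCH)
      (f : hom X X') (f' : hom X' X'') (g : hom Y Y') (g' : hom Y' Y'')
      (A : XC X) (A' : XC X') (A'' : XC X'') (B : XC Y) (B' : XC Y') (B'' : XC Y'')
      (u : over D f A A') (u' : over D f' A' A'')
      (v : over D g B B') (v' : over D g' B' B'') :
    osame (obox P (ocomp u u') (ocomp v v')) (ocomp (obox P u v) (obox P u' v')).
Proof.
apply: (posame (elementary_span (box_algP _ _))) => [[]//|[x y] _ [[a b] ->]].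
have [a' ua] := over_rep u x a; have [b' vb] := over_rep v y b.
have [a'' ua'] := over_rep u' (f x) a'; have [b'' vb'] := over_rep v' (g y) b'.
exists (box_tens a'' b'').
  by apply: prep_obox; apply: prep_ocomp; eassumption.
by apply: prep_ocomp; apply: prep_obox; eassumption.
Qed.

Lemma over_repZ (X Y : lch) (f : cmap X Y) (A : xcstar R X) (B : xcstar R Y)
    (u : @over LCH XC D X Y f A B) x a b z : rep (D := D) (@pe) x (oap u a) b ->
  rep (D := D) (@pe) x (oap u (z *: a)) (z *: b).
Proof.
have eh := pres_hom (pb_presents (peP f B)) x.
rewrite /rep /oap /ap (star_homZ (xhom_star _)) (star_homZ eh) => ->.
by rewrite (star_homZ (ev_hom _)).
Qed.

Definition lassoc (X Y Z : LCH) (A : XC X) (B : XC Y) (E : XC Z) :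
  iso (box P (box P A B) E) (pb D (prodmA X Y Z) (box P A (box P B E))) := box_assoc A B E.

Definition lbraid (X Y : LCH) (A : XC X) (B : XC Y) :
  iso (box P A B) (pb D (swapm X Y) (box P B A)) := box_braid A B.

Definition llunit (X : LCH) (A : XC X) : iso (box P unit_alg A) (pb D (pr2 one X) A) := box_lunit A.

Definition lrunit (X : LCH) (A : XC X) : iso (box P A unit_alg) (pb D (pr1 X one) A) := box_runit A.

Lemma prep_lunit (X : lch) (A : xcstar R X) z a (o : lch_one) (x : X) :
  rep (D := D) (@pe) ((o, x) : lch_prod lch_one X)
    (oap (D := D) (ihom (llunit A)) (box_tens (unit_map z) a)) (z *: a).
Proof. exact: (@box_lunitE X A z a (o, x)). Qed.

Lemma prep_runit (X : lch) (A : xcstar R X) z a (o : lch_one) (x : X) :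
  rep (D := D) (@pe) ((x, o) : lch_prod X lch_one)
    (oap (D := D) (ihom (lrunit A)) (box_tens a (unit_map z))) (z *: a).
Proof. exact: (@box_runitE X A z a (x, o)). Qed.

Lemma prep_assoc (X Y Z : lch) (A : xcstar R X) (B : xcstar R Y) (C : xcstar R Z) a b c x y z :
  rep (D := D) (@pe) (((x, y), z) : lch_prod (lch_prod X Y) Z)
    (oap (D := D) (ihom (lassoc A B C)) (box_tens (box_tens a b : box_alg A B) c))
    (box_tens a (box_tens b c : box_alg B C)).
Proof. exact: (@box_assocE X Y Z A B C a b c (x, y, z)). Qed.

Lemma prep_braid (X Y : lch) (A : xcstar R X) (B : xcstar R Y) a b x y :
  rep (D := D) (@pe) ((x, y) : lch_prod X Y) (oap (D := D) (ihom (lbraid A B)) (box_tens a b)) (box_tens b a).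
Proof. exact: (@box_braidE X Y A B a b (x, y)). Qed.

Lemma unit_surj (c : unit_alg) : exists z, c = unit_map z.
Proof. by have [_ [v _ uv] _ _ _] := unit_mapP; exists (v c); rewrite uv. Qed.

Lemma lax_lunit_nat (X X' : LCH) (f : hom X X') (A : XC X) (A' : XC X') (u : over D f A A') :
    osame (ocomp (obox P (oid D unit_alg) u) (ihom (box_lunit A') : over D (pr2 one X') (box P unit_alg A') A'))
          (ocomp (ihom (box_lunit A) : over D (pr2 one X) (box P unit_alg A) A) u).
Proof.
apply: (posame (elementary_span (box_algP _ _))) => [[]//|[p x] _ [[c a] ->]].
have [z ->] := unit_surj c; have [b ub] := over_rep u x a; exists (z *: b).
  by apply: prep_ocomp; [apply: prep_obox; [exact: prep_oid|exact: ub]|exact: prep_lunit].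
by apply: prep_ocomp; [exact: prep_lunit|exact: over_repZ].
Qed.

Lemma lax_runit_nat (X X' : LCH) (f : hom X X') (A : XC X) (A' : XC X') (u : over D f A A') :
    osame (ocomp (obox P u (oid D unit_alg)) (ihom (box_runit A') : over D (pr1 X' one) (box P A' unit_alg) A'))
          (ocomp (ihom (box_runit A) : over D (pr1 X one) (box P A unit_alg) A) u).
Proof.
apply: (posame (elementary_span (box_algP _ _))) => [[]//|[x o] _ [[a c] ->]].
have [z ->] := unit_surj c; have [b ub] := over_rep u x a; exists (z *: b).
  by apply: prep_ocomp; [apply: prep_obox ub _; exact: prep_oid|exact: prep_runit].
by apply: prep_ocomp; [exact: prep_runit|exact: over_repZ].
Qed.

Lemma lax_assoc_nat (X X' Y Y' Z Z' : LCH) (f : hom X X') (g : hom Y Y') (h : hom Z Z')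
      (A : XC X) (A' : XC X') (B : XC Y) (B' : XC Y') (E : XC Z) (E' : XC Z')
      (u : over D f A A') (v : over D g B B') (w : over D h E E') :
    osame (ocomp (obox P (obox P u v) w) (ihom (lassoc A' B' E')))
          (ocomp (ihom (lassoc A B E)) (obox P u (obox P v w))).
Proof.
apply: (posame (triple_span (box_algP A B) (box_algP _ E))) => [[[]]//|[[x y] z] _ [a [b [c ->]]]].
have [a' ua] := over_rep u x a; have [b' vb] := over_rep v y b; have [c' wc] := over_rep w z c.
exists (box_tens a' (box_tens b' c' : box_alg B' E')).
  by apply: prep_ocomp; [apply: prep_obox wc; exact: prep_obox ua vb|exact: prep_assoc].
by apply: prep_ocomp; [exact: prep_assoc|apply: prep_obox ua _; exact: prep_obox].
Qed.

Lemma lax_braid_nat (X X' Y Y' : LCH) (f : hom X X') (g : hom Y Y')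
      (A : XC X) (A' : XC X') (B : XC Y) (B' : XC Y') (u : over D f A A') (v : over D g B B') :
    osame (ocomp (obox P u v) (ihom (lbraid A' B'))) (ocomp (ihom (lbraid A B)) (obox P v u)).
Proof.
apply: (posame (elementary_span (box_algP _ _))) => [[]//|[x y] _ [[a b] ->]].
have [a' ua] := over_rep u x a; have [b' vb] := over_rep v y b; exists (box_tens b' a').
  by apply: prep_ocomp; [exact: prep_obox ua vb|exact: prep_braid].
by apply: prep_ocomp; [exact: prep_braid|exact: prep_obox vb ua].
Qed.

Lemma lax_triangle (X Y : LCH) (A : XC X) (B : XC Y) :
    osame (ocomp (ihom (lassoc A (unit_alg : XC one) B)) (obox P (oid D A) (ihom (llunit B))))
          (obox P (ihom (lrunit A)) (oid D B)).
Proof.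
apply: (posame (triple_span (box_algP A unit_alg) (box_algP _ B)))
  => [[[]]//|[[x o] y] _ [a [c [b ->]]]].
have [z ->] := unit_surj c; exists (box_tens (z *: a) b); last first.
  by apply: prep_obox; [exact: prep_runit|exact: prep_oid].
(* The scalar of the unit factor is moved from [a] to [b], where the left unit law puts it. *)
rewrite (bistarZl (max_tensor_hom (ext_max (box_algP A B)))).
rewrite -(bistarZr (max_tensor_hom (ext_max (box_algP A B)))).
apply: prep_ocomp; first exact: prep_assoc.
by apply: prep_obox; [exact: prep_oid|exact: prep_lunit].
Qed.

Lemma lax_braidK (X Y : LCH) (A : XC X) (B : XC Y) :
    osame (ocomp (ihom (lbraid A B)) (ihom (lbraid B A))) (oid D (box P A B)).
Proof.
apply: (posame (elementary_span (box_algP _ _))) => [[]//|[x y] _ [[a b] ->]].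
exists (box_tens a b); last exact: prep_oid.
by apply: prep_ocomp; exact: prep_braid.
Qed.

Lemma lax_hexagon (X Y Z : LCH) (A : XC X) (B : XC Y) (E : XC Z) :
    osame (ocomp (ocomp (ihom (lassoc A B E)) (ihom (lbraid A (box P B E)))) (ihom (lassoc B E A)))
          (ocomp (ocomp (obox P (ihom (lbraid A B)) (oid D E)) (ihom (lassoc B A E)))
                 (obox P (oid D B) (ihom (lbraid A E)))).
Proof.
apply: (posame (triple_span (box_algP A B) (box_algP _ E))) => [[[]]//|[[x y] z] _ [a [b [c ->]]]].
exists (box_tens b (box_tens c a : box_alg E A)).
  apply: prep_ocomp; last exact: prep_assoc.
  by apply: prep_ocomp; [exact: prep_assoc|exact: prep_braid].
apply: prep_ocomp; last by apply: prep_obox; [exact: prep_oid|exact: prep_braid].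
apply: prep_ocomp; last exact: prep_assoc.
by apply: prep_obox; [exact: prep_braid|exact: prep_oid].
Qed.

Lemma lax_pentagon (X Y Z W : LCH) (A : XC X) (B : XC Y) (E : XC Z) (G : XC W) :
    osame (ocomp (ihom (lassoc (box P A B) E G)) (ihom (lassoc A B (box P E G))))
          (ocomp (ocomp (obox P (ihom (lassoc A B E)) (oid D G)) (ihom (lassoc A (box P B E) G)))
                 (obox P (oid D A) (ihom (lassoc B E G)))).
Proof.
have tP := box_algP (box_alg (box_alg A B) E) G.
have sp : closed_span [set q | exists a b c d, q = box_tens (box_tens (box_tens a b : box_alg A B) c
    : box_alg (box_alg A B) E) d] = [set: box_alg (box_alg (box_alg A B) E) G].
  apply: (tensor_span_l (ext_max tP) (triple_span (box_algP A B) (box_algP _ E))).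
  by move=> _ d [a [b [c ->]]]; exists a, b, c, d.
apply: (posame sp) => [[[[]]]//|[[[x y] z] w] _ [a [b [c [d ->]]]]].
exists (box_tens a (box_tens b (box_tens c d : box_alg E G) : box_alg B (box_alg E G))).
  by apply: prep_ocomp; exact: prep_assoc.
apply: prep_ocomp; last by apply: prep_obox; [exact: prep_oid|exact: prep_assoc].
apply: prep_ocomp; last exact: prep_assoc.
by apply: prep_obox; [exact: prep_assoc|exact: prep_oid].
Qed.

Definition cstar_functor : laxSymMonFunctor XC :=
  @LaxSymMonFunctor LCH XC D P lax_obox1 lax_oboxD (unit_alg : XC one) llunit lrunit lassoc lbraid
    lax_lunit_nat lax_runit_nat lax_assoc_nat lax_braid_nat lax_triangle lax_pentagon
    lax_hexagon lax_braidK.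

Lemma cstar_functorP : is_cstar_functor cstar_functor.
Proof.
exists (@pe), (@box_tens R), unit_map; split.
- exact: peP.
- by move=> X Y f A B phi p x a; exact: pullmE.
- by move=> X A p x; exact: pull_idE.
- by move=> X Y Z f g A p x q; exact: pull_compE.
- by move=> X Y A B; exact: ext_tensor_product (box_algP A B).
- by move=> X Y A A' B B' phi psi a b; exact: boxmE.
- by move=> X X' Y Y' f g A B p q x y a b; exact: box_pullE.
- exact: unit_mapP.
- by move=> X A z a w; exact: box_lunitE.
- by move=> X A z a w; exact: box_runitE.
- by move=> X Y Z A B E a b c w; exact: box_assocE.
- by move=> X Y A B a b w; exact: box_braidE.
Qed.

End Construction.

(** * Adjoints and universal arrows *)

Section Isomorphisms.
Variable C : category.
Implicit Types x y z : C.

Lemma ihom_is_iso x y (f : iso x y) : is_iso (ihom f).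
Proof. by exists (iinv f); exact: isoP. Qed.

Lemma is_iso_comp x y z (f : hom x y) (g : hom y z) : is_iso f -> is_iso g -> is_iso (f ;; g).
Proof. by move=> fi gi; exact: (ihom_is_iso (iso_comp (mk_iso fi) (mk_iso gi))). Qed.

Lemma is_iso_cancel_l x y z (f : hom x y) (g : hom y z) : is_iso f -> is_iso (f ;; g) -> is_iso g.
Proof.
move=> [f' [ff' f'f]] [h [fgh hfg]]; exists (h ;; f); split; last by rewrite compA.
by rewrite -[LHS]comp1m -f'f !compA -(compA f g) -(compA (f ;; g)) fgh comp1m.
Qed.

Lemma is_iso_cancel_r x y z (f : hom x y) (g : hom y z) : is_iso g -> is_iso (f ;; g) -> is_iso f.
Proof.
move=> [g' [gg' g'g]] [h [fgh hfg]]; exists (g ;; h); split; first by rewrite -compA.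
by rewrite -[LHS]compm1 -gg' !compA -(compA f) -(compA h) hfg comp1m.
Qed.

Lemma is_iso_fmap (D : category) (G : functor C D) x y (f : hom x y) : is_iso f -> is_iso (fmap G f).
Proof. by move=> [g [fg gf]]; exists (fmap G g); split; rewrite -fmapD ?fg ?gf fmap1. Qed.

End Isomorphisms.

Section LeftUniversal.
Variables (C D : category) (G : functor D C).

Definition left_universal (c : C) (d : D) (n : hom c (G d)) :=
  forall d' (u : hom c (G d')), exists! v : hom d d', n ;; fmap G v = u.

Lemma left_universal_inj c d (n : hom c (G d)) d' (v v' : hom d d') : left_universal n ->
  n ;; fmap G v = n ;; fmap G v' -> v = v'.
Proof.
by move=> nu vv; have [w [_ wu]] := nu _ (n ;; fmap G v'); rewrite -(wu v) // -(wu v').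
Qed.

Lemma left_adjoint_exists (L : C -> D) (n : forall c, hom c (G (L c))) :
  (forall c, left_universal (n c)) -> inhabited (left_adjoint G).
Proof.
move=> nu; pose tr c d (u : hom c (G d)) : hom (L c) d := sval (cid (nu c d u)).
have trE c d u : n c ;; fmap G (tr c d u) = u by rewrite /tr; case: cid => v [].
have inj c d (v v' : hom (L c) d) : n c ;; fmap G v = n c ;; fmap G v' -> v = v'.
  exact: left_universal_inj.
pose Lm c c' (f : hom c c') := tr c (L c') (f ;; n c').
have L1 c : Lm c c (idm c) = idm (L c).
  by apply: inj; rewrite trE comp1m fmap1 compm1.
have LD c c' c'' (f : hom c c') (g : hom c' c'') : Lm _ _ (f ;; g) = Lm _ _ f ;; Lm _ _ g.
  by apply: inj; rewrite trE fmapD -compA trE !compA trE.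
pose LF := @Functor C D L Lm L1 LD.
constructor; exists LF.
refine (@Adjunction C D LF G n (fun d => tr _ _ (idm (G d))) _ _ _ _).
- by move=> c c' f /=; rewrite trE.
- move=> d d' f /=; apply: inj.
  by rewrite !fmapD -!compA !trE comp1m compA trE compm1.
- by move=> c /=; apply: inj; rewrite fmapD -compA trE compA trE compm1 fmap1 compm1.
- by move=> d /=; rewrite trE.
Qed.

Variable L : left_adjoint G.
Let n := aunit (ladjP L).

Lemma ltransposeE c d (u : hom c (G d)) : n c ;; fmap G (ltranspose L u) = u.
Proof.
by rewrite /ltranspose fmapD -compA -(aunit_nat (ladjP L)) compA (triangleR (ladjP L)) compm1.
Qed.

Lemma aunit_universal c : left_universal (n c).
Proof.
move=> d u; exists (ltranspose L u); split; first exact: ltransposeE.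
move=> v <-; rewrite /ltranspose fmapD compA -(acounit_nat (ladjP L)) -compA.
by rewrite (triangleL (ladjP L)) comp1m.
Qed.

(** The unit of an arbitrary left adjoint differs from a concrete universal arrow by an isomorphism,
    so what holds for the concrete one transfers to every left adjoint. *)
Lemma left_universal_compare c d (m : hom c (G d)) : left_universal m ->
  exists phi : hom (L c) d, is_iso phi /\ n c ;; fmap G phi = m.
Proof.
move=> mu; exists (ltranspose L m); split; last exact: ltransposeE.
have [psi [psiE _]] := mu _ (n c); exists psi; split.
  apply: (left_universal_inj (@aunit_universal c)).
  by rewrite fmapD -compA ltransposeE psiE fmap1 compm1.
apply: (left_universal_inj mu).
by rewrite fmapD -compA psiE ltransposeE fmap1 compm1.
Qed.

End LeftUniversal.

Section RightUniversal.
Variables (C D : category) (L : functor C D).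

Definition right_universal (d : D) (c : C) (m : hom (L c) d) :=
  forall c' (v : hom (L c') d), exists! w : hom c' c, fmap L w ;; m = v.

Lemma right_universal_inj d c (m : hom (L c) d) c' (w w' : hom c' c) : right_universal m ->
  fmap L w ;; m = fmap L w' ;; m -> w = w'.
Proof.
by move=> mu ww; have [w0 [_ wu]] := mu _ (fmap L w' ;; m); rewrite -(wu w) // -(wu w').
Qed.

Lemma right_adjoint_exists (G : D -> C) (m : forall d, hom (L (G d)) d) :
  (forall d, right_universal (m d)) -> inhabited (right_adjoint L).
Proof.
move=> mu; pose tr c d (v : hom (L c) d) : hom c (G d) := sval (cid (mu d c v)).
have trE c d v : fmap L (tr c d v) ;; m d = v by rewrite /tr; case: cid => w [].
have inj d c (w w' : hom c (G d)) : fmap L w ;; m d = fmap L w' ;; m d -> w = w'.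
  exact: right_universal_inj.
pose Gm d d' (f : hom d d') := tr (G d) d' (m d ;; f).
have G1 d : Gm d d (idm d) = idm (G d).
  by apply: inj; rewrite trE compm1 fmap1 comp1m.
have GD d d' d'' (f : hom d d') (g : hom d' d'') : Gm _ _ (f ;; g) = Gm _ _ f ;; Gm _ _ g.
  by apply: inj; rewrite trE fmapD compA trE -!compA trE.
pose GF := @Functor D C G Gm G1 GD.
constructor; exists GF.
refine (@Adjunction C D L GF (fun c => tr _ _ (idm (L c))) m _ _ _ _).
- move=> c c' f /=; apply: inj.
  by rewrite !fmapD !compA !trE compm1 -compA trE comp1m.
- by move=> d d' f /=; rewrite trE.
- by move=> c /=; rewrite trE.
- by move=> d /=; apply: inj; rewrite fmapD compA trE -compA trE comp1m fmap1 comp1m.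
Qed.

Variable G : right_adjoint L.
Let m := acounit (radjP G).

Lemma rtransposeE c d (v : hom (L c) d) : fmap L (rtranspose G v) ;; m d = v.
Proof.
by rewrite /rtranspose fmapD compA -(acounit_nat (radjP G)) -compA (triangleL (radjP G)) comp1m.
Qed.

Lemma acounit_universal d : right_universal (m d).
Proof.
move=> c v; exists (rtranspose G v); split; first exact: rtransposeE.
move=> w <-; rewrite /rtranspose fmapD -compA -(aunit_nat (radjP G)) compA.
by rewrite (triangleR (radjP G)) compm1.
Qed.

Lemma right_universal_compare d c (k : hom (L c) d) : right_universal k ->
  exists phi : hom (G d) c, is_iso phi /\ fmap L phi ;; k = m d.
Proof.
move=> ku; have [phi [phiE _]] := ku _ (m d); exists phi; split => //.
exists (rtranspose G k); split.
  apply: (right_universal_inj (@acounit_universal d)).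
  by rewrite fmapD compA rtransposeE phiE fmap1 comp1m.
apply: (right_universal_inj ku).
by rewrite fmapD compA phiE rtransposeE fmap1 comp1m.
Qed.

End RightUniversal.

Section Squares.
Variables (C : cartCategory) (F : C -> category) (D : laxSymMonFunctor F).
Local Notation "f ^*" := (pb D f) : cat_scope.

Lemma pbeq_nat (X Y : C) (f g : hom X Y) (e : f = g) (A B : F Y) (u : hom A B) :
  fmap (f^*) u ;; pbeq (@pb _ _ D) e B = pbeq (@pb _ _ D) e A ;; fmap (g^*) u.
Proof. by case: _ / e; rewrite /= compm1 comp1m. Qed.

Lemma inv_nat (X : C) (A A' B B' : F X) (i : iso A A') (j : iso B B') (u : hom A B) (v : hom A' B') :
  u ;; j = i ;; v -> iinv i ;; u = v ;; iinv j.
Proof.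
move=> uv; have [ii' i'i] := isoP i; have [jj' j'j] := isoP j.
by rewrite -[LHS]compm1 -jj' -!compA (compA (iinv i)) uv -compA i'i comp1m.
Qed.

Lemma square_nat (W X Z Y : C) (f : hom W X) (g : hom W Z) (p : hom X Y) (q : hom Z Y)
    (e : f ;; p = g ;; q) (A B : F Y) (u : hom A B) :
  fmap (f^*) (fmap (p^*) u) ;; square D e B = square D e A ;; fmap (g^*) (fmap (q^*) u).
Proof.
rewrite /= -compA -(inv_nat (pbcomp_nat D f p u)) !compA; congr (_ ;; _).
by rewrite -compA pbeq_nat compA (pbcomp_nat D g q u).
Qed.

Lemma bmap_iso (X Y : C) (A A' : F X) (B B' : F Y) (u : hom A A') (v : hom B B') :
  is_iso u -> is_iso v -> is_iso (bmap D u v).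
Proof.
move=> [u' [uu u'u]] [v' [vv v'v]]; exists (bmap D u' v').
by split; rewrite -bmapD ?uu ?vv ?u'u ?v'v bmap1.
Qed.

(** The mixed map is transposed in both adjunctions. Restricted along [j], preceded by the unit of
    [j] and followed by the base change map of [p], it becomes the image under [Rq] of the unit of
    [i]. Once the other factors are isomorphisms, so is the restriction. *)
Lemma mixed_unit (W X Z Y : C) (i : hom W X) (q : hom W Z) (p : hom X Y) (j : hom Z Y)
    (E : i ;; p = q ;; j) (Li : left_adjoint (i^*)) (Lj : left_adjoint (j^*))
    (Rp : right_adjoint (p^*)) (Rq : right_adjoint (q^*)) (A : F W)
    (m : hom (p^* (Lj (Rq A))) (Li (q^* (Rq A)))) :
  bc_shriek E Li Lj (Rq A) ;; m = idm _ ->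
  aunit (ladjP Lj) (Rq A) ;; fmap (j^*) (mixed Rp m) ;; bc_push E Rp Rq (Li A) =
  fmap Rq (aunit (ladjP Li) A).
Proof.
move=> bm; apply: (right_universal_inj (@acounit_universal _ _ _ Rq _)).
have h1 : fmap (q^*) (bc_push E Rp Rq (Li A)) ;; acounit (radjP Rq) (i^* (Li A)) =
    square D (esym E) (Rp (Li A)) ;; fmap (i^*) (acounit (radjP Rp) (Li A)) := rtransposeE Rq _.
have h2 : fmap (p^*) (mixed Rp m) ;; acounit (radjP Rp) (Li A) =
    m ;; fmap Li (acounit (radjP Rq) A) := rtransposeE Rp _.
have h3 : aunit (ladjP Li) (q^* (Rq A)) ;; fmap (i^*) (bc_shriek E Li Lj (Rq A)) =
    fmap (q^*) (aunit (ladjP Lj) (Rq A)) ;; square D (esym E) (Lj (Rq A)) := ltransposeE Li _.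
rewrite -(acounit_nat (radjP Rq)) 2!fmapD compA h1 compA.
rewrite -(compA (fmap (q^*) (fmap (j^*) (mixed Rp m)))) square_nat (compA (ihom (square D _ _))).
rewrite -fmapD h2 -compA -h3 compA -fmapD -compA bm comp1m.
by rewrite (aunit_nat (ladjP Li)).
Qed.

End Squares.

(** * Open inclusions and proper maps *)

Section Push.
Variables (R : realType) (X Y : lch) (f : cmap X Y) (A : xcstar R X).

Lemma preim_subproof (V : opens Y) : open (f @^-1` oset V).
Proof. by apply: open_comp (osetP V) => x _; exact: cmap_continuous. Qed.

Definition preim (V : opens Y) : opens X := Opens (@preim_subproof V).

Lemma push_idealT : xideal A (preim (opensT Y)) = setT.
Proof. by rewrite -(xidealT A); congr (xideal A _); exact: opens_ext. Qed.

Lemma push_idealI U V : xideal A (preim (opensI U V)) = xideal A (preim U) `&` xideal A (preim V).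
Proof. by rewrite -xidealI; congr (xideal A _); exact: opens_ext. Qed.

Lemma push_ideal_bigcup (S : set (opens Y)) : xideal A (preim (opens_bigcup S)) =
  ideal_gen (\bigcup_(V in S) xideal A (preim V)).
Proof.
have -> : preim (opens_bigcup S) = opens_bigcup (preim @` S).
  apply: opens_ext; apply/seteqP; split=> [x [V SV Vx]|x [_ [V SV <-] Vx]].
    by exists (preim V) => //; exists V.
  by exists V.
rewrite xideal_bigcup; congr ideal_gen; apply/seteqP; split=> [a [_ [V SV <-] Va]|a [V SV Va]].
  by exists V.
by exists (preim V) => //; exists V.
Qed.

Definition push_alg : xcstar R Y := @Xcstar R Y A (fun V => xideal A (preim V))
  (fun V => xidealP A (preim V)) push_idealT push_idealI push_ideal_bigcup.

Lemma push_evP y (a : push_alg) : ev push_alg y a = 0 <-> forall x, f x = y -> ev A x a = 0.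
Proof.
rewrite ev_eq0; split=> [/(@xideal_evP R X A)h x fx|h].
  by apply: h => /=; apply; rewrite fx.
by apply/(@xideal_evP R X A) => x /= /contrapT/h.
Qed.

(** The ideal that defines this fibre is the ideal of an open set of [X], so [xideal_norm] over [X]
    applies. *)
Lemma push_ev_norm y (a : push_alg) (r : R) : 0 <= r ->
  (forall x, f x = y -> nm (ev A x a) <= r) -> nm (ev push_alg y a) <= r.
Proof.
move=> r0 h; rewrite ev_nm; apply: (@xideal_norm R X A (preim (opensC1 y))) => // x /= /contrapT.
exact: h.
Qed.

End Push.

Section OpenInclusion.
Variables (R : realType) (X Y : lch) (i : cmap X Y).
Hypotheses (inj : injective i) (iopen : forall U : set X, open U -> open (i @` U)).

Lemma open_image_nbhs x (U : set X) : nbhs x U -> nbhs (i x) (i @` U).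
Proof.
rewrite nbhsE => -[V [oV Vx] VU].
suff h : nbhs (i x) (i @` V) by apply: filterS h => _ [z Vz <-]; exists z => //; exact: VU.
by apply: open_nbhs_nbhs; split; [exact: iopen|exists x].
Qed.

Lemma compact_image_cmap (K : set X) : compact K -> compact (i @` K).
Proof. by move=> cK; apply: continuous_compact cK; apply: continuous_subspaceT; exact: cmap_continuous. Qed.

Variables (B : xcstar R Y) (P : xcstar R X) (e : forall x, P -> fibre B (i x)).
Hypothesis eP : is_pullback e.

(** Continuity at points off the image comes from vanishing at infinity on [X]: outside the compact
    image of some [K] the extension is small. *)
Lemma extend_by_zero (w : P) : exists b : B, (forall x, ev B (i x) b = e x w) /\
  forall y, (forall x, i x <> y) -> ev B y b = 0.
Proof.
have [s [si s0]] : exists s : forall y, fibre B y, (forall x, s (i x) = e x w) /\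
    forall y, (forall x, i x <> y) -> s y = 0.
  (* The value must live in the fibre at [y], hence the transport along [i x = y]; injectivity and
     proof irrelevance make it independent of [x]. *)
  have ex y : exists v : fibre B y, (forall x (E : i x = y), v = eq_rect _ (fibre B) (e x w) _ E) /\
      ((forall x, i x <> y) -> v = 0).
    have [[x E]|ny] := pselect (exists x, i x = y); last first.
      by exists 0; split => // x E; case: ny; exists x.
    case: y / E; exists (e x w); split => [x' E|/(_ x)//].
    by have xx : x' = x := inj E; subst x'; rewrite (Prop_irrelevance E erefl).
  have [s sP] := dchoice ex; exists s; split=> [x|y ny].
    by have [h _] := sP (i x); rewrite (h x erefl).
  by have [_ ->] := sP y.
have small (r : R) : 0 < r -> exists2 K : set X, compact K & forall y, ~ (i @` K) y -> nm (s y) <= r.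
  move=> r0; have [K cK Kw] := gsec_van (pb_gsec eP w) r0; exists K => // y nKy.
  have [[x E]|ny] := pselect (exists x, i x = y).
    by rewrite -E si; apply: Kw => Kx; apply: nKy; exists x.
  by rewrite s0 ?nm0 ?(ltW r0) // => x E; apply: ny; exists x.
have sg : gsec (f := cmap_id Y) (A := B) s.
  split; last first.
    by move=> r /small[K cK Ks]; exists (i @` K) => //; exact: compact_image_cmap.
  apply: gsec_cont_of => y r r0; have [[x E]|ny] := pselect (exists x, i x = y).
    case: y / E; have [b bw] := pb_rep e w x; exists b.
    have := gsec_cont (pb_gsec eP w) (esym bw) r0 => /open_image_nbhs.
    by apply: filterS => _ [x' h <-] /=; rewrite si.
  have r2 := divr_gt0 r0 (ltr0Sn R 1); have [K cK Ks] := small _ r2.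
  exists 0; have nK : nbhs y (~` (i @` K)).
    apply: open_nbhs_nbhs; split; last by move=> [x _ E]; apply: ny; exists x.
    by rewrite openC; apply: lch_compact_closed; exact: compact_image_cmap.
  apply: filterS nK => z /Ks /= h; rewrite (star_hom0 (ev_hom _)) subr0; lra.
(* Over the identity map, the continuous sections vanishing at infinity are the elements of [B]
   itself. *)
have [p pE] := pb_section (pull_algP (cmap_id Y) B) sg.
have [Phi [_ PhiE]] := pullid_exists (pull_algP (cmap_id Y) B); exists (Phi p).
by split=> [x|y ny]; rewrite -PhiE pE ?si ?s0.
Qed.

Lemma push_open_ev x (A : xcstar R X) (a : push_alg i A) :
  ev (push_alg i A) (i x) a = 0 <-> ev A x a = 0.
Proof.
by rewrite push_evP; split=> [h|a0 x' /inj->//]; exact: h.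
Qed.

Lemma push_open_ev0 y (A : xcstar R X) (a : push_alg i A) :
  (forall x, i x <> y) -> ev (push_alg i A) y a = 0.
Proof. by move=> ny; apply/push_evP => x /ny. Qed.

Lemma push_unit_exists (A : xcstar R X) (Q : xcstar R X) (q : forall x, Q -> fibre (push_alg i A) (i x)) :
  is_pullback q ->
  exists n : xhom A Q, forall x a, q x (n a) = ev (push_alg i A) (i x) a.
Proof.
move=> qP; apply: (xhom_build (psi := fun x a => ev (push_alg i A) (i x) a) (pb_presents qP)).
- by move=> x; exact: (ev_hom (A := push_alg i A)).
- by move=> x a /ev_eq0/push_open_ev.
- move=> x a r r0; have [|p pE] := pb_section (s := fun x => ev (push_alg i A) (i x) a) qP.
    split=> [|r' r'0].
      by apply: gsec_cont_of => x' r' r'0; exists a; apply: filterE => x'' /=; rewrite subrr nm0.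
    have [K cK Ka] := ev_van a r'0; exists K => // x' nK.
    by apply: push_ev_norm => [|x'' /inj->]; [exact: ltW|exact: Ka].
  by exists a, p; split; [rewrite subrr (star_hom0 (ev_hom _)) nm0|move=> x'; rewrite pE].
Qed.

Lemma push_unit_factor (A : xcstar R X) (v : A -> P) : star_hom v ->
  (forall x a, ev A x a = 0 -> e x (v a) = 0) ->
  exists w : xhom (push_alg i A) B, forall x a, ev B (i x) (w a) = e x (v a).
Proof.
move=> vh v0; have [z zP] := choice (fun a => extend_by_zero (v a)).
have eh := pullback_hom eP; have bh := ev_hom (A := B).
have zh : star_hom z.
  split=> [k a b|a b|a]; apply: ev_ext => y;
    have [[x <-]|ny] := pselect (exists x, i x = y).
  - rewrite (star_homD (bh _)) (star_homZ (bh _)) !(proj1 (zP _)).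
    by rewrite (star_homD vh) (star_homZ vh) (star_homD (eh x)) (star_homZ (eh x)).
  - rewrite (star_homD (bh _)) (star_homZ (bh _)) !(proj2 (zP _)) ?scaler0 ?addr0 //;
      by move=> x E; apply: ny; exists x.
  - by rewrite (star_homM (bh _)) !(proj1 (zP _)) (star_homM vh) (star_homM (eh x)).
  - rewrite (star_homM (bh _)) !(proj2 (zP _)) ?cmul0l //;
      by move=> x E; apply: ny; exists x.
  - by rewrite (star_hom_star (bh _)) !(proj1 (zP _)) (star_hom_star vh) (star_hom_star (eh x)).
  - rewrite (star_hom_star (bh _)) !(proj2 (zP _)) ?cstar0 //;
      by move=> x E; apply: ny; exists x.
have [y a a0|w wE] := @xhom_of_star _ _ (push_alg i A) B z zh.
  have [[x E]|ny] := pselect (exists x, i x = y).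
    by case: y / E a0 => /push_open_ev /v0; rewrite (proj1 (zP _)).
  by rewrite (proj2 (zP _)) // => x E; apply: ny; exists x.
by exists w => x a; rewrite wE (proj1 (zP _)).
Qed.

End OpenInclusion.

(** * The axioms for every functor with the standard structure *)

Section Standard.
Variables (R : realType) (D : laxSymMonFunctor (C := LCH) (@xcstar_category R)).
Variable e : forall (X Y : lch) (f : cmap X Y) (A : xcstar R Y) (x : X),
  pbx D f A -> fibre A (f x).
Variable t : forall (X Y : lch) (A : xcstar R X) (B : xcstar R Y), A -> B -> boxx D A B.
Variable u : R[i]^o -> onex D.
Hypothesis S : cstar_structure e t u.
Local Notation XC := (@xcstar_category R).
Local Notation PB f A := (@pb _ _ D _ _ f A : xcstar R _).

Lemma std_is_pullback (X Y : lch) (f : cmap X Y) (A : xcstar R Y) : is_pullback (@e X Y f A).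
Proof. exact: (std_pb S). Qed.

Lemma std_presents (X Y : lch) (f : cmap X Y) (A : xcstar R Y) : presents (@e X Y f A).
Proof. exact: pb_presents (std_is_pullback f A). Qed.

Lemma srep_fmap (X Y : lch) (f : cmap X Y) (A B : xcstar R Y) (phi : xhom A B) x p a :
  rep (D := D) e (f := f) x p a ->
  rep (D := D) e (f := f) x (ap (fmap (@pb _ _ D X Y f) phi) p) (phi a).
Proof. exact: (std_fmap S). Qed.

Lemma srep_pbcomp_eq (X Y Z : lch) (f : cmap X Y) (g : cmap Y Z) (A : xcstar R Z)
    (p : pbx D (cmap_comp f g) A) x (q : pbx D g A) :
  rep (D := D) e x (ap (@pbcomp _ _ D X Y Z f g A) p) q -> e x p = e (f x) q.
Proof. exact: (std_pbcomp S). Qed.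

Lemma srep_ex (X Y : lch) (f : cmap X Y) (A : xcstar R Y) x (p : pbx D f A) :
  exists a, rep (D := D) e x p a.
Proof. exact: pb_rep. Qed.

Lemma srep_surj (X Y : lch) (f : cmap X Y) (A : xcstar R Y) (x : X) (a : A) :
  exists p : pbx D f A, rep (D := D) e x p a.
Proof. exact: (pres_surj (std_presents f A)). Qed.

Lemma std_ext_tensor (X Y : lch) (A : xcstar R X) (B : xcstar R Y) : ext_tensor (@t X Y A B).
Proof. exact: ext_product_tensor (std_box S A B). Qed.

Section OpenPart.
Variables (X Y : lch) (i : cmap X Y).
Hypotheses (inj : injective i) (iopen : forall U : set X, open U -> open (i @` U)).
Local Notation G := (@pb _ _ D X Y i).

(** Over the image, the fibres of the pushforward are those of [A], so the unit is an isomorphism;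
    its universality is extension by zero. *)
Lemma std_unit (A : xcstar R X) : exists n : @hom (XC X) A (G (push_alg i A)),
  is_iso n /\ left_universal n.
Proof.
have qP := std_is_pullback i (push_alg i A).
have [n nE] := push_unit_exists inj qP.
exists (n : @hom (XC X) A (G (push_alg i A))); split.
  apply: (pres_iso (std_presents i (push_alg i A))) => [x a|x w].
    by rewrite nE => /(push_open_ev inj).
  by have [a <-] := ev_surj w; exists a; rewrite nE.
move=> B v; have [||w wE] := push_unit_factor inj iopen (std_is_pullback i B) (v := ap v).
- exact: xhom_star.
- by move=> x a a0; apply/(pres_eq0 (std_presents i B)); exact: (xhom_ev0 (v : xhom _ _)).
have key (w' : xhom (push_alg i A) B) x a :
    e x (ap ((n : @hom (XC X) A (G (push_alg i A))) ;; fmap G (w' : @hom (XC Y) (push_alg i A) B)) a) = ev B (i x) (w' a).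
  exact: (srep_fmap w' (nE x a)).
exists w; split.
  by apply: xhom_ext => a; apply: (pb_ext (std_is_pullback i B)) => x; rewrite [LHS]key wE.
move=> w' w'v; apply: xhom_ext => a; apply: ev_ext => y.
have [[x <-]|ny] := pselect (exists x, i x = y); first by rewrite wE -key w'v.
have y0 : ev (push_alg i A) y a = 0 by apply: push_open_ev0 => // x E; apply: ny; exists x.
by rewrite !xhom_ev0.
Qed.

Lemma left_adjoint_open : inhabited (left_adjoint G).
Proof.
have [n nP] := dchoice std_unit.
exact: (@left_adjoint_exists (XC X) (XC Y) G (@push_alg R X Y i) n (fun A => proj2 (nP A))).
Qed.

Variable L : left_adjoint G.

Lemma open_unit_iso (A : XC X) : is_iso (aunit (ladjP L) A).
Proof.
have [n [ni nu]] := std_unit A; have [phi [phii phiE]] := left_universal_compare L nu.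
by apply: (@is_iso_cancel_r _ _ _ _ _ (fmap G phi)); [exact: is_iso_fmap|rewrite phiE].
Qed.

Lemma xiso_ev0 (Z : lch) (A B : xcstar R Z) (phi : xhom A B) z a :
  is_iso (C := XC Z) phi -> ev B z (phi a) = 0 -> ev A z a = 0.
Proof.
move=> [psi [h _]] /(xhom_ev0 (psi : xhom _ _)).
by have /= -> := congr1 (fun v : xhom A A => v a) h.
Qed.

Lemma open_fibre0 (A : XC X) y (a : (L A : xcstar R Y)) : (forall x, i x <> y) -> ev (L A) y a = 0.
Proof.
move=> ny; have [n [ni nu]] := std_unit A; have [phi [phii phiE]] := left_universal_compare L nu.
by apply: (xiso_ev0 phii); exact: push_open_ev0.
Qed.

(** An algebra whose fibres vanish off the image is controlled by its restriction to [X]. The two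
    equivalences for open inclusions and the mixed one are reduced to this test. *)
Lemma open_iso (A B : xcstar R Y) (h : xhom A B) : is_iso (fmap G (h : @hom (XC Y) A B)) ->
  (forall y (a : A), (forall x, i x <> y) -> ev A y a = 0) ->
  (forall y (b : B), (forall x, i x <> y) -> ev B y b = 0) -> is_iso (C := XC Y) h.
Proof.
move=> hi A0 B0; apply: xhom_fibre_iso => y.
  move=> a; have [[x <-]|ny] := pselect (exists x, i x = y); last first.
    by move=> _; apply: A0 => x E; apply: ny; exists x.
  move=> ha; have [p pa] := srep_surj i x a; have := srep_fmap h pa; rewrite /rep ha.
  move=> /(pres_eq0 (std_presents i B)) /(xiso_ev0 hi) /(pres_eq0 (std_presents i A)).
  by rewrite pa.
move=> b; have [[x <-]|ny] := pselect (exists x, i x = y); last first.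
  exists 0; rewrite (star_hom0 (xhom_star h)) (star_hom0 (ev_hom _)) B0 // => x E.
  by apply: ny; exists x.
have [q qb] := srep_surj i x b; have [k [_ kh]] := hi.
have [a pa] := srep_ex x (ap k q); exists a; have := srep_fmap h pa; rewrite /rep => <-.
have kq : ap (fmap G (h : @hom (XC Y) A B)) (ap k q) = q := congr1 (fun v => ap v q) kh.
by rewrite kq qb.
Qed.

End OpenPart.

Lemma pullback_fibre0 (X Y : lch) (f : cmap X Y) (B : xcstar R Y) x (p : pbx D f B) :
  (forall b, ev B (f x) b = 0) -> ev (pbx D f B) x p = 0.
Proof.
move=> B0; apply/(pres_eq0 (std_presents f B)); have [b pb_] := srep_ex x p.
by rewrite pb_.
Qed.

Lemma box_fibre0 (X Y : lch) (A : xcstar R X) (B : xcstar R Y) (z : lch_prod X Y)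
    (q : boxx D A B) : (forall a, ev A z.1 a = 0) -> ev (boxx D A B) z q = 0.
Proof.
move=> A0; have tP := std_ext_tensor A B.
have : closed_span [set w | exists a b, w = ev (boxx D A B) z (t a b)] (ev _ z q).
  by rewrite (elementary_fibre tP).
apply: (closed_span_sub (zero_subspace _)) => _ [a [b ->]].
by case: z A0 {q} => x y A0; apply: (ext_evl tP).
Qed.

(** Points are maps from the one-point space, so a cartesian square is a fibre product of sets. *)
Lemma cartesian_point (W X Z Y : lch) (f : cmap W X) (q : cmap W Z) (p : cmap X Y) (g : cmap Z Y) :
  @cartesian LCH W X Z Y f q p g -> forall x z, p x = g z -> exists w, f w = x /\ q w = z.
Proof.
move=> [_ sq] x z pg; have cst (V : lch) (v : V) : continuous (fun _ : lch_one => v).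
  by move=> c; exact: cvg_cst.
have [|w [[wf wq] _]] := sq lch_one (Cmap (cst X x)) (Cmap (cst Z z)).
  by apply: cmap_ext => c /=.
exists ((w : cmap lch_one W) tt).
have /= -> := congr1 (fun v : cmap lch_one X => v tt) wf.
by have /= -> := congr1 (fun v : cmap lch_one Z => v tt) wq.
Qed.

Lemma cartesian_inj (W X Z Y : lch) (f : cmap W X) (q : cmap W Z) (p : cmap X Y) (g : cmap Z Y) :
  @cartesian LCH W X Z Y f q p g -> forall w w', f w = f w' -> q w = q w' -> w = w'.
Proof.
move=> [fp sq] w w' ff qq; have cst (v : W) : continuous (fun _ : lch_one => v).
  by move=> c; exact: cvg_cst.
pose k v : @hom LCH lch_one W := Cmap (cst v).
have [|h [_ hu]] := sq lch_one (k w ;; f) (k w ;; q); first by rewrite !compA fp.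
have hw : h = k w by apply: hu.
have hw' : h = k w' by apply: hu; split; apply: cmap_ext => c /=.
by have := congr1 (fun v : cmap lch_one W => v tt) (etrans (esym hw) hw').
Qed.

Lemma std_condition_I : condition_I D open_inclusion.
Proof.
split=> [U X i [inj iopen]|U X V Y i g f j sq [inj iopen] [jinj jopen] Li Lj B|U X i [inj iopen] Li A B].
- exact: left_adjoint_open.
- apply: (open_iso (i := i)).
  (* Composed with the unit of [i], the restriction of the transposed map becomes the map before
     transposition, a composite of isomorphisms. *)
  + apply: (is_iso_cancel_l (open_unit_iso inj iopen Li _)).
    rewrite ltransposeE; apply: is_iso_comp; last exact: ihom_is_iso.
    by apply: is_iso_fmap; exact: open_unit_iso.
  + by move=> x a; exact: (open_fibre0 inj iopen).
  + move=> x b nx; apply: pullback_fibre0 => c; apply: (open_fibre0 jinj jopen) => v jv.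
    by have [w [iw _]] := cartesian_point sq (esym jv); exact: (nx w).
- apply: (open_iso (i := i)).
  + apply: (is_iso_cancel_l (open_unit_iso inj iopen Li _)).
    rewrite ltransposeE; apply: is_iso_comp; last exact: ihom_is_iso.
    apply: is_iso_fmap; apply: bmap_iso; first exact: open_unit_iso.
    by exists (idm _); exact: inverse_of_id.
  + by move=> x a; exact: (open_fibre0 inj iopen).
  + move=> x b nx; apply: pullback_fibre0 => c; apply: box_fibre0 => a.
    exact: (open_fibre0 inj iopen).
Qed.

Lemma srep_square (W X Z Y : lch) (f : cmap W X) (g : cmap W Z) (p : cmap X Y) (q : cmap Z Y)
    (E : @comp LCH W X Y f p = @comp LCH W Z Y g q) (A : xcstar R Y) x
    (s : pbx D f (pbx D p A)) (b : pbx D p A) (a : A) :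
  rep (D := D) e x s b -> rep (D := D) e (f x) b a ->
  exists2 c : pbx D q A, rep (D := D) e (f := g) x (ap (ihom (@square LCH XC D W X Z Y f g p q E A)) s) c &
    rep (D := D) e (g x) c a.
Proof.
move=> sb ba; have h1 := rep_pbcomp_inv (D := D) (@srep_pbcomp_eq) sb ba.
have h2 := rep_pbeq E h1.
have [c h3] := srep_ex x (ap (@pbcomp _ _ D W Z Y g q A) (ap (pbeq (@pb _ _ D) E A)
  (ap (iinv (@pbcomp _ _ D W X Y f p A)) s))).
by exists c => //; exact: (rep_pbcomp (D := D) (@srep_pbcomp_eq) h2 h3).
Qed.

Lemma xiso_surj (Z : lch) (A B : xcstar R Z) (phi : xhom A B) b :
  is_iso (C := XC Z) phi -> exists a, phi a = b.
Proof.
move=> [psi [_ h]]; exists ((psi : xhom B A) b).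
exact: (congr1 (fun v : xhom B B => v b) h).
Qed.

Lemma xiso_nm (Z : lch) (A B : xcstar R Z) (phi : xhom A B) z a :
  is_iso (C := XC Z) phi -> nm (ev A z a) <= nm (ev B z (phi a)).
Proof.
move=> [psi [h _]]; have [k [kh kE]] := xhom_fib (psi : xhom B A) z.
have pa : (psi : xhom B A) (phi a) = a := congr1 (fun v : xhom A A => v a) h.
by rewrite -{1}pa -kE; exact: star_hom_le.
Qed.

(** * Pushforward along proper maps *)

Section ProperPart.
Variables (X Y : lch) (p : cmap X Y).
Hypothesis pproper : forall K : set Y, compact K -> compact (p @^-1` K).
Local Notation L := (@pb _ _ D X Y p).

(** Properness makes [x |-> b (p x)] vanish at infinity, so this section belongs to the pullback. It
    is the unit of the adjunction. *)
Lemma pull_const (B : xcstar R Y) : exists c : B -> pbx D p B,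
  star_hom c /\ forall x b, e x (c b) = ev B (p x) b.
Proof.
have bP := std_is_pullback p B; have eh := pullback_hom bP; have bh := ev_hom (A := B).
have ex b : exists w, forall x, e x w = ev B (p x) b.
  apply: (pb_section bP (s := fun x => ev B (p x) b)); split=> [|r r0].
    by apply: gsec_cont_of => x r r0; exists b; apply: filterE => y /=; rewrite subrr nm0.
  have [K cK Kb] := ev_van b r0; exists (p @^-1` K); first exact: pproper.
  by move=> x; exact: Kb.
have [c cE] := choice ex; exists c; split => //; split=> [k a b|a b|a];
  apply: (pb_ext bP) => x; rewrite cE.
- by rewrite (star_homD (eh x)) (star_homZ (eh x)) !cE (star_homD (bh _)) (star_homZ (bh _)).
- by rewrite (star_homM (eh x)) !cE (star_homM (bh _)).
- by rewrite (star_hom_star (eh x)) !cE (star_hom_star (bh _)).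
Qed.

(** An element [a] that represents a value in the fibre at [p x] also has a value at [x], which
    depends only on its class there; this defines the counit. A map [v] on the pullback transposes
    to [b |-> v (c b)], with [c] from [pull_const]. *)
Lemma std_counit (A : xcstar R X) : exists m : @hom (XC X) (L (push_alg p A)) A,
  right_universal m /\ forall x w (a : push_alg p A), rep (D := D) e x w a ->
    ev A x (ap m w) = ev A x a.
Proof.
pose PA := push_alg p A; have bP := std_is_pullback p PA.
have fib x : exists s : fibre PA (p x) -> fibre A x, star_hom s /\
    forall a, s (ev PA (p x) a) = ev A x a.
  apply: (@fibre_desc _ _ PA (p x) _ (fun a => ev A x a)); first exact: (ev_hom (A := A)).
  by move=> a /ev_eq0/push_evP; exact.
have [s sP] := dchoice fib.
have [|x a|m mE] := pb_build (r := ev A) bP (psi := s) (ev_presents A).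
- by move=> x; case: (sP x).
- have [k [k0 kx]] := C0_at R x; exists k, (xact k (a : A)); split => // y.
  by rewrite xactE //; case: (sP y) => _ ->.
have mP x w (a : PA) : rep (D := D) e x w a -> ev A x (m w) = ev A x a.
  by move=> wa; rewrite mE wa; case: (sP x) => _ ->.
exists (m : @hom (XC X) (L PA) A); split => // B v; have [c [ch cE]] := pull_const B.
have wh : star_hom (fun b => ap v (c b) : PA) := star_hom_comp ch (xhom_star v).
have wi V b : xideal B V b -> xideal PA V (ap v (c b)).
  move=> Vb; apply: (xhom_ideal (v : xhom _ _) (U := preim p V)).
  apply/(pb_ideal (std_is_pullback p B)) => x Vx; rewrite cE.
  by have /xideal_evP := Vb; apply.
have key (w : xhom B PA) x b : ev A x (ap (fmap L (w : @hom (XC Y) B PA)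
    ;; (m : @hom (XC X) (L PA) A)) (c b)) = ev A x (w b).
  by apply: mP; apply: srep_fmap; exact: cE.
exists (Xhom wh wi : @hom (XC Y) B PA); split.
  apply: xhom_ext => w0; apply: ev_ext => x; have [b w0b] := srep_ex x w0.
  have -> : ev A x (ap v w0) = ev A x (ap v (c b)).
    apply: (xhom_ev_eq (v : xhom _ _)); apply/(pres_eq (std_presents p B)).
    by rewrite w0b cE.
  by apply: mP; exact: (srep_fmap (Xhom wh wi) w0b).
move=> w wv; apply: xhom_ext => b; apply: (ev_ext (A := A)) => x.
by rewrite -(key w x b) wv.
Qed.

Lemma right_adjoint_proper : inhabited (right_adjoint L).
Proof.
have [m mP] := dchoice std_counit.
exact: (@right_adjoint_exists (XC Y) (XC X) L (@push_alg R X Y p) m (fun A => proj1 (mP A))).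
Qed.

Variable G : right_adjoint L.

Lemma proper_compare (A : XC X) : exists b : xhom (G A : xcstar R Y) (push_alg p A),
  is_iso (C := XC Y) b /\ forall x w a, rep (D := D) e x w a ->
    ev A x (ap (acounit (radjP G) A) w) = ev A x (b a).
Proof.
have [m [mu mE]] := std_counit A; have [phi [phii <-]] := right_universal_compare G mu.
by exists phi; split => // x w a /(srep_fmap (phi : xhom _ _)) /mE.
Qed.

(** Once [b] identifies the target with the pushforward of [E], the norm condition at [r = 0] is
    injectivity on the fibre at [y]. *)
Lemma push_iso (T : xcstar R Y) (E : XC X) (h : xhom T (G E)) (b : xhom (G E : xcstar R Y) (push_alg p E)) :
  is_iso (C := XC Y) b ->
  (forall y s (r : R), 0 <= r -> (forall x, p x = y -> nm (ev E x (b (h s))) <= r) ->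
     nm (ev T y s) <= r) ->
  (forall c : E, exists s, b (h s) = c) -> is_iso (C := XC Y) h.
Proof.
move=> bi inj surj.
apply: (@is_iso_cancel_r (XC Y) _ _ _ (h : @hom (XC Y) T (G E)) (b : @hom (XC Y) (G E) (push_alg p E))) => //.
apply: (@xhom_bij_iso _ _ T (push_alg p E) (xhom_comp h b)) => // y s /push_evP h0.
by apply: nm_le0; apply: inj => // x px; rewrite h0 // nm0.
Qed.

End ProperPart.

(** An isometric range is closed, so it suffices that it contains a set [G] whose closed span
    approximates all values and is stable under enough localizing functions. *)
Lemma field_surj (W : lch) (T E : cstarType R) (F : W -> cstarType R) (q : forall w, E -> F w)
    (h : T -> E) (Phi : set (W -> R)) (G : set E) :
  is_field q -> star_hom h -> (forall s, nm s <= nm (h s)) ->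
  (forall phi, Phi phi -> forall z, 0 <= phi z <= 1) ->
  (forall (z : W) (U : set W), nbhs z U -> exists2 phi, Phi phi &
     nbhs z [set y | phi y = 1] /\ forall y, ~ U y -> phi y = 0) ->
  (forall phi, Phi phi -> exists f : E -> E, [/\ linear f, exists M : R, forall c, nm (f c) <= M * nm c,
     forall c, mulby q (fun z => (phi z)%:C) c (f c) & forall g, G g -> closed_span G (f g)]) ->
  (forall g, G g -> exists s, h s = g) ->
  (forall c z (r : R), 0 < r -> exists2 g, closed_span G g & nm (q z (c - g)) < r) ->
  forall c, exists s, h s = c.
Proof.
move=> qf hh hn p01 ploc stab Gh dense c.
have hnm s : nm (h s) = nm s by apply/eqP; rewrite eq_le hn (star_hom_le hh).
have ran : closed_subspace [set y | exists x, y = h x] by exact: range_subspace.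
have SG := closed_span_subspace G.
suff : [set y | exists x, y = h x] c by move=> [s ->]; exists s.
apply: (closed_span_sub ran (G := G)); first by move=> g /Gh[s <-]; exists s.
apply: (fld_density qf SG p01 ploc) => [s phi Gs /stab[f [fl [M fM] fE fG]]|]; last exact: dense.
by exists (f s) => //; exact: (closed_span_map fl fM SG fG).
Qed.

(** * Proper base change *)

Section ProperBaseChange.
Variables (W X Z Y : lch) (f : cmap W X) (q : cmap W Z) (p : cmap X Y) (g : cmap Z Y).
Hypothesis sq : @cartesian LCH W X Z Y f q p g.
Hypothesis pproper : forall K : set Y, compact K -> compact (p @^-1` K).
Hypothesis qproper : forall K : set Z, compact K -> compact (q @^-1` K).
Variables (Rp : right_adjoint (@pb _ _ D X Y p)) (Rq : right_adjoint (@pb _ _ D W Z q)).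
Variable A : XC X.
Let h : xhom (pbx D g (Rp A)) (Rq (@pb _ _ D W X f A)) := bc_push (proj1 sq) Rp Rq A.

(** The topology of [W] is induced by [f] and [q]. Properness of [q] makes the part of the preimage
    of [K] outside [U'] compact, and each of its points is separated from [w] by [f] or by [q]. *)
Lemma cartesian_nbhs (w : W) (U : set W) : nbhs w U -> exists N1 N2,
  [/\ nbhs (f w) N1, nbhs (q w) N2 & forall w', N1 (f w') -> N2 (q w') -> U w'].
Proof.
rewrite nbhsE => -[U' [oU' U'w] U'U]; have [K [Kq cK _]] := lch_nbhs_compact (q w).
have cC : compact (q @^-1` K `&` ~` U').
  apply: compact_closedI; first exact: qproper.
  by apply: open_closedC.
have [N1 [N2 [Ow Vw OV]]] : exists N1 N2, [/\ nbhs (f w) N1, nbhs (q w) N2 &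
    forall w', (q @^-1` K `&` ~` U') w' -> N1 (f w') -> N2 (q w') -> False].
  apply: (compact_ind (P := fun C => exists N1 N2, [/\ nbhs (f w) N1, nbhs (q w) N2 &
    forall w', C w' -> N1 (f w') -> N2 (q w') -> False]) cC).
  - by exists setT, setT; split => //; exact: filterT.
  - move=> C C' [N1 [N2 [Ow Vw h1]]] [N1' [N2' [Ow' Vw' h2]]]; exists (N1 `&` N1'), (N2 `&` N2').
    split; [exact: filterI|exact: filterI|].
    by move=> w' [Cw|Cw] [? ?] [? ?]; [exact: (h1 w')|exact: (h2 w')].
  - move=> C C' CC [N1 [N2 [Ow Vw h1]]]; exists N1, N2; split => // w' /CC; exact: h1.
  - move=> c [_ Uc]; have cw : c <> w by move=> cw; apply: Uc; rewrite cw.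
    have [fcw|fcw] := pselect (f c = f w); last first.
      have [M1 [M2 [c1 c2 M1c M2w M12]]] := lch_separate fcw.
      exists (f @^-1` M1).
        by apply: (cmap_continuous (c := f)); exact: open_nbhs_nbhs.
      exists M2, setT; split; [exact: open_nbhs_nbhs|exact: filterT|].
      by move=> w' /= w1 w2 _; have : (M1 `&` M2) (f w') by []; rewrite M12.
    have qcw : q c <> q w by move=> qcw; apply: cw; exact: (cartesian_inj sq).
    have [V1 [V2 [c1 c2 V1c V2w V12]]] := lch_separate qcw.
    exists (q @^-1` V1).
      by apply: (cmap_continuous (c := q)); exact: open_nbhs_nbhs.
    exists setT, V2; split; [exact: filterT|exact: open_nbhs_nbhs|].
    by move=> w' /= w1 _ w2; have : (V1 `&` V2) (q w') by []; rewrite V12.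
exists N1, (N2 `&` K); split; [by []|exact: filterI|] => w' Ow' [Vw' Kw'].
by apply: U'U; apply: contrapT => nU; exact: (OV w').
Qed.

(** Through [bp] and [bq] the base change map becomes explicit: a section represented at [q w] by
    [b] goes to one whose value at [w] is that of [b] at [f w]. *)
Lemma bc_push_value (bp : xhom (Rp A) (push_alg p A)) (bq : xhom (Rq (@pb _ _ D W X f A)) (push_alg q (pbx D f A))) :
  (forall x w a, rep (D := D) e x w a -> ev A x (ap (acounit (radjP Rp) A) w) = ev A x (bp a)) ->
  (forall x w a, rep (D := D) e x w a ->
     ev (pbx D f A) x (ap (acounit (radjP Rq) (@pb _ _ D W X f A)) w) = ev (pbx D f A) x (bq a)) ->
  forall w s b, rep (D := D) e (q w) s b -> e w (bq (h s)) = ev A (f w) (bp b).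
Proof.
move=> bpE bqE w s b sb; have [s' s's] := srep_surj q w s.
have := rtransposeE Rq (@square LCH XC D W Z X Y q f g p (esym (proj1 sq)) (Rp A)
  ;; fmap (@pb _ _ D W X f) (acounit (radjP Rp) A)).
move=> /(congr1 (fun v => ap v s')); set l := ap _ _; set r := ap _ _ => lr.
have lE : ev (pbx D f A) w l = ev (pbx D f A) w (bq (h s)).
  by apply: bqE; exact: (srep_fmap h s's).
have [c sc cb] := srep_square (esym (proj1 sq)) s's sb.
have rE : e w r = ev A (f w) (bp b).
  by rewrite -(bpE _ _ _ cb); exact: (srep_fmap (acounit (radjP Rp) A : xhom _ _) sc).
by rewrite -rE; apply/(pres_eq (std_presents f A)); rewrite -lE lr.
Qed.

Lemma bc_push_iso : is_iso (C := XC Z) h.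
Proof.
have [bp [bpi bpE]] := proper_compare pproper Rp A.
have [bq [bqi bqE]] := proper_compare qproper Rq (@pb _ _ D W X f A).
have val := bc_push_value bpE bqE; have fP := std_is_pullback f A.
(* Every point of the fibre of [p] over [g y] comes from the fibre of [q] over [y], so a bound over
   the latter controls the norm at [g y]. *)
have inj y s (r : R) : 0 <= r -> (forall w, q w = y -> nm (ev (pbx D f A) w (bq (h s))) <= r) ->
    nm (ev (pbx D g (Rp A)) y s) <= r.
  move=> r0 sr; rewrite -(pres_nm (std_presents g (Rp A))); have [b sb] := srep_ex y s.
  rewrite sb; apply: (le_trans (xiso_nm _ _ bpi)); apply: push_ev_norm => // x px.
  have [w [fw qw]] := cartesian_point sq px; case: x / fw px => _; case: y / qw sb sr => sb sr.
  by rewrite -(val _ _ _ sb) (pres_nm (std_presents f A)); exact: sr.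
apply: (push_iso bqi inj).
have bh : star_hom (fun s => bq (h s) : pbx D f A) := star_hom_comp (xhom_star h) (xhom_star bq).
pose G := [set c : pbx D f A | exists k a, C0 k /\ forall w, e w c = k (q w) *: ev A (f w) a].
have Gran c : G c -> exists s, bq (h s) = c.
  move=> [k [a [k0 cE]]]; have [b bpa] := xiso_surj (a : push_alg p A) bpi.
  have [s sE] := pb_basic (std_is_pullback g (Rp A)) b k0.
  exists s; apply: (pb_ext fP) => w; rewrite cE.
  rewrite (val w s (k (q w) *: b)).
    by rewrite (star_homZ (xhom_star bp)) bpa (star_homZ (ev_hom _)).
  by rewrite /rep sE (star_homZ (ev_hom _)).
(* By [cartesian_nbhs] these products localize at every point of [W], and multiplication by them
   preserves the form of the elements of [G]. *)
pose Phi := [set phi : W -> R | exists k l, [/\ bumps k, bumps l & phi = fun w => k (q w) * l (f w)]].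
apply: (field_surj (q := @e W X f A) (Phi := Phi) (G := G)) => //.
- exact: pb_field fP.
- move=> s; apply: ev_norm => [|z]; first exact: nm_ge0.
  by apply: inj => [|w qw]; [exact: nm_ge0|exact: star_hom_le (ev_hom _) _].
- move=> phi [k [l [bk bl ->]]] w; have /andP[? ?] := bumps01 bk (q w).
  by have /andP[? ?] := bumps01 bl (f w); apply/andP; split; nra.
- move=> w U /cartesian_nbhs[N1' [V [Ow Vw OVU]]].
  have [k bk [k1 k0]] := bumps_loc R Vw; have [l bl [l1 l0]] := bumps_loc R Ow.
  exists (fun w => k (q w) * l (f w)); first by exists k, l.
  split.
    have kq : nbhs w (q @^-1` [set y | k y = 1]) by exact: (cmap_continuous (c := q)) k1.
    have lf : nbhs w (f @^-1` [set y | l y = 1]) by exact: (cmap_continuous (c := f)) l1.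
    by apply: filterS (filterI kq lf) => w' /= [-> ->]; rewrite mulr1.
  move=> w' nU; have [Ow'|/l0->] := pselect (N1' (f w')); last by rewrite mulr0.
  have [Vw'|/k0->] := pselect (V (q w')); last by rewrite mul0r.
  by case: nU; exact: OVU.
- move=> phi [k [l [bk bl ->]]]; have k0 := bumps_C0 bk; have l0 := bumps_C0 bl.
  (* Properness of [q] makes [k] composed with [q] vanish at infinity, while [l] composed with [f]
     is merely bounded. *)
  have kq0 : C0 (fun w => rc k (q w)).
    have [kc kv] := k0; split.
      by move=> w; apply: (continuous_comp (f := q) (g := rc k)); [exact: cmap_continuous|exact: kc].
    by move=> r /kv[K cK Kk]; exists (q @^-1` K); [exact: qproper|move=> w; exact: Kk].
  have kl0 : C0 (fun w => rc k (q w) * rc l (f w) : R[i]^o).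
    have [M M0 lM] := C0_bounded l0; apply: (C0_mul (M := M) kq0) => //.
    have [lc _] := l0.
    by move=> w; apply: (continuous_comp (f := f) (g := rc l)); [exact: cmap_continuous|exact: lc].
  exists (@xact R W (pbx D f A) (fun w => rc k (q w) * rc l (f w))); split.
  + exact: xact_linear.
  + by have [M _ aM] := xact_bound (pbx D f A) kl0; exists M.
  + by move=> c w; rewrite (pres_xact (std_presents f A)) // /rc rmorphM.
  + move=> c [m [a [m0 cE]]]; apply: sub_closed_span.
    exists (fun z => rc k z * m z), (xact (rc l) a); split; first exact: C0M.
    move=> w; rewrite (pres_xact (std_presents f A)) // cE xactE // !scalerA; congr (_ *: _).
    by rewrite mulrAC.
- move=> c w r r0; have [a ca] := srep_ex w c; have [k [k0 kw]] := C0_at R (q w).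
  have [b bpa] := xiso_surj (a : push_alg p A) bpi.
  have [s sE] := pb_basic (std_is_pullback g (Rp A)) b k0.
  have vE w' : e w' (bq (h s)) = k (q w') *: ev A (f w') a.
    rewrite (val w' s (k (q w') *: b)).
      by rewrite (star_homZ (xhom_star bp)) bpa (star_homZ (ev_hom _)).
    by rewrite /rep sE (star_homZ (ev_hom _)).
  exists (bq (h s)); first by apply: sub_closed_span; exists k, a.
  by rewrite (star_homB (pullback_hom fP w)) vE kw scale1r ca subrr nm0.
Qed.

End ProperBaseChange.

(** * The projection formula for proper maps *)

Section ProperProjection.
Variables (X Y : lch) (p : cmap X Y).
Hypothesis pproper : forall K : set Y, compact K -> compact (p @^-1` K).
Variable Rp : right_adjoint (@pb _ _ D X Y p).
Variables (A : XC X) (B : XC Y).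
Let PB : XC X := @pb _ _ D X Y p B.
Let T : XC X := @tens LCH XC D X A PB.
Let T0 : XC Y := @tens LCH XC D Y (Rp A) B.
Let dg (Z : lch) : cmap Z (lch_prod Z Z) := @diagm LCH Z.
Let h : xhom T0 (Rp T) := @proj_push LCH XC D X Y p Rp A B.
Variables (bp : xhom (Rp A) (push_alg p A)) (bq : xhom (Rp T) (push_alg p T)).
Hypotheses (bpi : is_iso (C := XC Y) bp) (bqi : is_iso (C := XC Y) bq).
Hypothesis bpE : forall x w a, rep (D := D) e x w a ->
  ev A x (ap (acounit (radjP Rp) A) w) = ev A x (bp a).
Hypothesis bqE : forall x w a, rep (D := D) e x w a ->
  ev T x (ap (acounit (radjP Rp) T) w) = ev T x (bq a).
Let tP1 := std_ext_tensor (Rp A : xcstar R Y) B.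
Let tP2 := std_ext_tensor A PB.

(** On fibres the projection map is the tensor product of two maps: evaluation at [x] of elements of
    the pushforward, and the identification of the fibre of [B] at [p x] with that of its pullback
    at [x]. *)
Lemma proj_fib (x : X) : exists s : fibre (boxx D (Rp A) B) (p x, p x) -> fibre (boxx D A PB) (x, x),
  star_hom s /\ forall b c (d : pbx D p B), rep (D := D) e x d c ->
    s (ev (boxx D (Rp A) B) (p x, p x) (t b c)) = ev (boxx D A PB) (x, x) (@t X X A PB (bp b) d).
Proof.
have [t' [t'P t'E]] := ext_fibre tP2 x x; have t'h := max_tensor_hom t'P.
have [k [kh kE]] := pres_inv (std_presents p B) x.
have [||s [sh sE]] := ext_desc tP1 (x := p x) (y := p x)
    (tau := fun b c => t' (ev A x (bp b)) (k (ev B (p x) c))).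
- apply: bistar_comp t'h _ (star_hom_comp (ev_hom _) kh).
  exact: (star_hom_comp (xhom_star bp) (ev_hom (A := A) x)).
- move=> b c [/(xhom_ev0 bp)/push_evP/(_ x erefl) ->|->]; first exact: bistar0l.
  by rewrite (star_hom0 kh) (bistar0r t'h).
exists s; split => // b c d dc; rewrite sE.
by have := kE d; rewrite dc => ->; exact: t'E.
Qed.

Section Values.
Variable s : forall x : X, fibre (boxx D (Rp A) B) (p x, p x) -> fibre (boxx D A PB) (x, x).
Arguments s : clear implicits.
Hypothesis sh : forall x, star_hom (s x).
Hypothesis sE : forall x b c (d : pbx D p B), rep (D := D) e x d c ->
    s x (ev (boxx D (Rp A) B) (p x, p x) (t b c)) = ev (boxx D A PB) (x, x) (@t X X A PB (bp b) d).

Lemma proj_push_value (x : X) (w : T0) (Q : boxx D (Rp A) B) :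
  rep (D := D) e (f := dg Y) (p x) w Q -> 
  e (f := dg X) x (bq (h w)) = s x (ev (boxx D (Rp A) B) (p x, p x) Q).
Proof.
move=> wQ; have [w' w'w] := srep_surj p x w.
have := rtransposeE Rp (@pbtens LCH XC D X Y p (Rp A) B
  ;; @tmap LCH XC D X _ _ _ _ (acounit (radjP Rp) A) (idm PB)).
move=> /(congr1 (fun v => ap v w')); set l := ap _ _; set r := ap _ _ => lr.
have lE : ev T x l = ev T x (bq (h w)).
  by apply: bqE; exact: (srep_fmap h w'w).
have [c sc cQ] := @srep_square _ _ _ _ p (dg X) (dg Y) (@prodm LCH X Y X Y p p : cmap _ _)
   (diagm_nat (C := LCH) p) (boxx D (Rp A) B) x w' w Q w'w wQ.
pose bx := @boxpb _ _ _ D X Y X Y p p (Rp A) B.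
have h1 := srep_fmap (iinv bx : xhom _ _) sc.
have h2 := srep_fmap (@bmap _ _ _ D X X _ _ _ _ (acounit (radjP Rp) A) (idm PB) : xhom _ _) h1.
(* Both sides are star homomorphisms in the argument [v] of [key], so they are compared on
   elementary tensors, where all structure maps are known. *)
have rE : e (f := dg X) x r = s x (e (f := @prodm LCH X Y X Y p p : cmap _ _) (x, x) c).
  pose m := @bmap _ _ _ D X X _ _ _ _ (acounit (radjP Rp) A) (idm PB).
  suff key v : ev (boxx D A PB) (x, x) (ap m v) =
      s x (e (f := @prodm LCH X Y X Y p p : cmap _ _) (x, x) (ap bx v)).
    by rewrite [LHS]h2 -[in RHS](apKV bx c); exact: key.
  have tP3 := std_ext_tensor (@pb _ _ D X Y p (Rp A) : xcstar R X) PB.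
  have bmh := star_hom_comp (xhom_star (m : xhom _ _))
    (ev_hom (A := boxx D A PB) (x, x)).
  have eh := pullback_hom (std_is_pullback (@prodm LCH X Y X Y p p : cmap _ _) (boxx D (Rp A) B)).
  have bxh := star_hom_comp (star_hom_comp (xhom_star (ihom bx : xhom _ _)) (eh (x, x))) (sh x).
  apply: (star_hom_eq_span bmh bxh (elementary_span tP3)) => _ [[v1 v2] ->] /=.
  have [b v1b] := srep_ex x v1; have [d v2d] := srep_ex x v2.
  have := std_boxpb S v1b v2d; rewrite -/bx => ->; rewrite (sE _ v2d).
  have := std_bmap S (acounit (radjP Rp) A : xhom _ _) (xhom_id PB) v1 v2 => ->.
  by apply: (ext_ev_eq tP2) => //; exact: bpE.
rewrite -cQ -rE; apply/(pres_eq (std_presents (dg X) (boxx D A PB))).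
by rewrite -lE lr.
Qed.

(** The fibre of [A] tensored with the single algebra [B(p x)] receives a star homomorphism [k] from
    the target of [s x], and [k] carries the one combination to the other. *)
Lemma proj_comb_le (x : X) (o : lch_one) (l : seq (R[i] * (Rp A * B))) :
  nm (ev (box_alg A (point_alg (fibre B (p x)))) (x, o)
    (comb (fun g : Rp A * B => box_tens (bp g.1 : A) (ev B (p x) g.2 : point_alg (fibre B (p x)))) l))
  <= nm (s x (ev (boxx D (Rp A) B) (p x, p x) (comb (fun g => @t Y Y (Rp A) B g.1 g.2) l))).
Proof.
set N := point_alg (fibre B (p x)); have tE := box_algP A N.
have eh := pullback_hom (std_is_pullback p B) x; have tEh := max_tensor_hom (ext_max tE).
have [||k [kh kE]] := ext_desc tP2 (x := x) (y := x)
    (tau := fun a d => ev (box_alg A N) (x, o) (box_tens a (e x d : N))).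
- exact: bistar_comp (ext_ev_bistar tE x o) (star_hom_id _) eh.
- move=> a d [a0|/(pres_eq0 (std_presents p B)) ->]; first exact: (ext_evl tE).
  by rewrite (bistar0r tEh) (star_hom0 (ev_hom _)).
set a := comb _ l; set Q := comb _ l.
have -> : ev (box_alg A N) (x, o) a = k (s x (ev (boxx D (Rp A) B) (p x, p x) Q)).
  have ksh := star_hom_comp (star_hom_comp (ev_hom (A := boxx D (Rp A) B) (p x, p x)) (sh x)) kh.
  rewrite (lin_comb (star_hom_linear (ev_hom _))) [RHS](lin_comb (star_hom_linear ksh)).
  apply: eq_bigr => -[z [b d]] _ /=.
  by have [d' dd] := srep_surj p x d; rewrite (sE _ dd) kE dd.
exact: star_hom_le.
Qed.

(* The C*-algebra [A (x) B(y)] over X detects the norm of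
   [(p_* A)(y) (x) B(y)] on the fibre of p over y. *)
Lemma proj_comb_norm (y : Y) (l : seq (R[i] * (Rp A * B))) (r : R) : 0 <= r ->
  let Q := comb (fun g => @t Y Y (Rp A) B g.1 g.2) l in
  (forall x, p x = y -> nm (s x (ev (boxx D (Rp A) B) (p x, p x) Q)) <= r) ->
  nm (ev (boxx D (Rp A) B) (y, y) Q) <= r.
Proof.
move=> r0 Q Qr; pose N := point_alg (fibre B y).
pose E := box_alg A N; have tE := box_algP A N; have tEh := max_tensor_hom (ext_max tE).
have [c [cb bc]] := bpi.
have cbK b : (c : xhom (push_alg p A) (Rp A)) (bp b) = b := congr1 (fun v => ap v b) cb.
have [ty [tyP tyE]] := ext_fibre tP1 y y; have tyh := max_tensor_hom tyP.
have ch : star_hom (fun a : A => ev (Rp A) y ((c : xhom (push_alg p A) (Rp A)) a)) :=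
  star_hom_comp (xhom_star (c : xhom _ _)) (ev_hom y).
have [La [Lah LaE]] := max_tensor_univ (ext_max tE) (bistar_comp tyh ch (star_hom_id (fibre B y))).
(* [La] kills the ideal of the part of [X] away from the fibre over [y]. Its values are thus bounded
   by a distance to that ideal, which [xideal_norm] bounds by norms over the points of the fibre. *)
pose W := opensX (preim p (opensC1 y)) (opensT lch_one).
have LaW a : xideal E W a -> La a = 0.
  apply: (closed_span_map (star_hom_linear Lah) (star_hom_bound Lah) (zero_subspace _)).
  move=> _ [U [V [b [n [UV Ub Vn ->]]]]].
  suff : La (box_tens b n) = 0 by []; rewrite LaE.
  have [Vt|Vt] := pselect (oset V tt); last first.
    have -> : n = 0 by apply: (Vn tt).
    exact: (bistar0r tyh).
  have /(xhom_ideal (c : xhom _ _)) : xideal (push_alg p A) (opensC1 y) b.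
    by apply: (xideal_sub (A := A) _ Ub) => x Ux; have [] := UV (x, tt) (conj Ux Vt).
  by move=> /ev_eq0 ->; exact: (bistar0l tyh).
have LaN a : nm (La a) <= dist (xideal E W) a.
  apply/ler_addgt0Pr => d d0.
  have [|j Wj aj] := @dist_lt _ _ _ (xidealP E W) a (dist (xideal E W) a + d); first by rewrite ltrDl.
  rewrite -[La a]addr0 -(LaW j Wj) -(star_homD Lah).
  by apply: (le_trans (star_hom_le Lah _)); exact: ltW.
pose a := comb (fun g : Rp A * B => box_tens (bp g.1 : A) (ev B y g.2 : N) : E) l.
have eh z := ev_hom (A := boxx D (Rp A) B) z.
have -> : ev (boxx D (Rp A) B) (y, y) Q = La a.
  rewrite (lin_comb (star_hom_linear (eh _))) (lin_comb (star_hom_linear Lah)).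
  by apply: eq_bigr => -[z [b d]] _ /=; rewrite LaE /= cbK tyE.
apply: (le_trans (LaN a)); apply: xideal_norm => // -[x pt] nW.
have px : p x = y by apply: contrapT => px; apply: nW; split.
apply: (le_trans _ (Qr x px)).
(* [y] occurs in the type of the algebra [B(y)], so the statement is generalized before [p x = y] is
   substituted. *)
suff key y' : p x = y' -> nm (ev (box_alg A (point_alg (fibre B y'))) (x, pt)
    (comb (fun g : Rp A * B => box_tens (bp g.1 : A) (ev B y' g.2 : point_alg (fibre B y'))) l))
  <= nm (s x (ev (boxx D (Rp A) B) (p x, p x) Q)) by exact: key.
by case: y' /; exact: proj_comb_le.
Qed.

Lemma proj_norm (y : Y) (Q : boxx D (Rp A) B) (r : R) : 0 <= r ->
  (forall x, p x = y -> nm (s x (ev (boxx D (Rp A) B) (p x, p x) Q)) <= r) ->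
  nm (ev (boxx D (Rp A) B) (y, y) Q) <= r.
Proof.
move=> r0 Qr; apply/ler_addgt0Pr => d d0; have d2 := divr_gt0 d0 (ltr0Sn R 1).
have eh z := ev_hom (A := boxx D (Rp A) B) z.
have [l Ql] : exists l, nm (Q - comb (fun g => @t Y Y (Rp A) B g.1 g.2) l) < d / 2.
  by apply: closed_span_approx d2 _; rewrite (tensor_span (ext_max tP1)).
have Q'r := @proj_comb_norm y l (r + d / 2); move: Ql Q'r; set Q' := comb _ _ => Ql Q'r.
have : nm (ev (boxx D (Rp A) B) (y, y) Q') <= r + d / 2.
  apply: Q'r => [|x px]; first by lra.
  have {1}-> : Q' = Q - (Q - Q') by rewrite subKr.
  rewrite (star_homB (eh _)) (star_homB (sh x)) (le_trans (nmB _ _)) // lerD ?Qr //.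
  by rewrite (le_trans (star_hom_le (sh x) _)) // (le_trans (star_hom_le (eh _) _)) // ltW.
move=> Qd; rewrite -(subrK Q' Q) (star_homD (eh _)) (le_trans (nmD _ _)) //.
have := star_hom_le (eh (y, y)) (Q - Q').
move: Qd Ql; move: (nm _) (nm _) (nm _) => n1 n2 n3; lra.
Qed.

Lemma proj_push_iso : is_iso (C := XC Y) h.
Proof.
have dP Z := std_is_pullback (dg Z).
have inj y w (r : R) : 0 <= r -> (forall x, p x = y -> nm (ev T x (bq (h w))) <= r) ->
    nm (ev T0 y w) <= r.
  move=> r0 wr; rewrite -(pres_nm (std_presents (dg Y) (boxx D (Rp A) B))).
  have [Q wQ] := srep_ex y w; rewrite wQ; apply: proj_norm => // x px.
  rewrite -(proj_push_value (w := w)); last by rewrite px.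
  by rewrite (pres_nm (std_presents (dg X) (boxx D A PB))); exact: wr.
apply: (push_iso bqi inj).
have bh : star_hom (fun w => bq (h w) : T) := star_hom_comp (xhom_star h) (xhom_star bq).
have t1h := max_tensor_hom (ext_max tP1); have t2h := max_tensor_hom (ext_max tP2).
have val (k : Y -> R[i]^o) (a : A) (c : B) : C0 k -> exists w, forall x (d : pbx D p B),
    rep (D := D) e x d c -> 
    e (f := dg X) x (bq (h w)) = k (p x) *: ev (boxx D A PB) (x, x) (@t X X A PB a d).
  move=> k0; have [b ba] := xiso_surj (a : push_alg p A) bpi.
  have [w wE] := pb_basic (dP Y (boxx D (Rp A) B)) (@t Y Y (Rp A) B b c) k0.
  exists w => x d dc; rewrite (proj_push_value (Q := k (p x) *: @t Y Y (Rp A) B b c)).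
    by rewrite (star_homZ (ev_hom _)) (star_homZ (sh x)) (sE _ dc) ba.
  by rewrite /rep wE (star_homZ (ev_hom _)).
(* Elements with value [k (p x)] times the tensor of [a] with the pullback of [c]: they lie in the
   range, and at each point their values have dense span. *)
pose G := [set v : T | exists k a c, C0 k /\ forall x (d : pbx D p B), rep (D := D) e x d c ->
  e (f := dg X) x v = k (p x) *: ev (boxx D A PB) (x, x) (@t X X A PB a d)].
have := @field_surj X T0 T _ (@e X _ (dg X) (boxx D A PB)) (fun w => bq (h w)) (@bumps R X) G.
apply => //.
- exact: pb_field (dP X _).
- move=> w; apply: ev_norm => [|y]; first exact: nm_ge0.
  by apply: inj => [|x _]; [exact: nm_ge0|exact: star_hom_le (ev_hom _) _].
- exact: bumps01.
- exact: bumps_loc.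
- move=> phi bphi; have phi0 := bumps_C0 bphi; exists (@xact R X T (rc phi)); split.
  + exact: xact_linear.
  + by have [M _ MT] := xact_bound T phi0; exists M.
  + by move=> v x; rewrite (pres_xact (std_presents (dg X) _)).
  + move=> v [k [a [c [k0 vE]]]]; apply: sub_closed_span; exists k, (xact (rc phi) a), c.
    split => // x d dc; rewrite (pres_xact (std_presents (dg X) _)) // (vE x d dc) !scalerA.
    rewrite mulrC -scalerA; congr (_ *: _).
    rewrite -(star_homZ (ev_hom _)) -(bistarZl t2h); apply: (ext_ev_eq tP2) => //.
    by rewrite xactE // (star_homZ (ev_hom _)).
- move=> v [k [a [c [k0 vE]]]]; have [w wE] := val k a c k0; exists w.
  apply: (pb_ext (dP X _)) => x; have [d dc] := srep_surj p x c.
  by rewrite (wE x d dc) (vE x d dc).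
- move=> v x r r0; have [Q vQ] := srep_ex x v.
  have [l Ql] : exists l, nm (Q - comb (fun g => @t X X A PB g.1 g.2) l) < r.
    by apply: closed_span_approx r0 _; rewrite (tensor_span (ext_max tP2)).
  have eh := pullback_hom (dP X (boxx D A PB)) x.
  have [|g Gg gE] := span_at (q := e (f := dg X) x) (q' := ev (boxx D A PB) (x, x)) (G := G)
      (tau := fun g => @t X X A PB g.1 g.2) eh (ev_hom _) _ l.
    move=> [a d] /=; have [c dc] := srep_ex x d; have [k [k0 kx]] := C0_at R (p x).
    have [w wE] := val k a c k0; exists (bq (h w)).
      by apply: sub_closed_span; exists k, a, c.
    by rewrite (wE x d dc) kx scale1r.
  exists g => //; rewrite (star_homB eh) gE vQ -(star_homB (ev_hom _)).
  exact: le_lt_trans (star_hom_le (ev_hom _) _) Ql.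
Qed.

End Values.

End ProperProjection.

Lemma std_condition_P : condition_P D proper_map.
Proof.
split=> [X Y p pp|W X Z Y f q p g sq pp qp Rp Rq A|X Y p pp Rp A B].
- exact: right_adjoint_proper.
- exact: bc_push_iso.
- have [bp [bpi bpE]] := proper_compare pp Rp A.
  have [bq [bqi bqE]] := proper_compare pp Rp (tens D A (@pb _ _ D X Y p B)).
  have [s sP] := dchoice (proj_fib B bp).
  apply: (proj_push_iso bpi bqi bpE bqE (s := s)) => x; first by case: (sP x).
  by case: (sP x).
Qed.

Lemma std_mixed : mixed_beck_chevalley D open_inclusion proper_map.
Proof.
move=> W X Z Y i q p j sq [inj iopen] [jinj jopen] pp qp Li Lj Rp Rq A m [bm _].
apply: (open_iso (i := j)).
- apply: (is_iso_cancel_l (open_unit_iso jinj jopen Lj _)).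
  (* Base change for the same square is an isomorphism because [p] and [q] are proper, so
     [mixed_unit] leaves [Rq] of the unit of [i], an isomorphism for open [i]. *)
  apply: (@is_iso_cancel_r _ _ _ _ _ (bc_push (proj1 sq) Rp Rq (Li A))).
    exact: bc_push_iso.
  by rewrite mixed_unit //; apply: is_iso_fmap; exact: open_unit_iso.
- by move=> y a; exact: (open_fibre0 jinj jopen).
(* Off the image of [j] the target vanishes as well: a point of [X] over [y] cannot come from [W],
   since the square commutes. *)
- move=> y b ny; have [bp [bpi bpE]] := proper_compare pp Rp (Li A).
  apply: (xiso_ev0 bpi); apply/push_evP => x px; apply: (open_fibre0 inj iopen) => w iw.
  apply: (ny ((q : cmap W Z) w)); rewrite -px -iw.
  exact: (congr1 (fun v : cmap W Y => v w) (esym (proj1 sq))).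
Qed.

Lemma std_three_functor_formalism : three_functor_formalism D open_inclusion proper_map.
Proof. by split; [exact: std_condition_I|exact: std_condition_P|exact: std_mixed]. Qed.

End Standard.

Theorem theorem1p6 (R : realType) :
  (exists D : @laxSymMonFunctor LCH (@xcstar_category R), is_cstar_functor D)
  /\
  (forall D : @laxSymMonFunctor LCH (@xcstar_category R),
     is_cstar_functor D ->
     three_functor_formalism D open_inclusion proper_map).
Proof.
split=> [|D [e [t [u S]]]]; first by exists (cstar_functor R); exact: cstar_functorP.
exact: (std_three_functor_formalism S).
Qed.
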